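(* Let $(\mathcal{H},\Phi,\sigma+\eta)$, $\mathcal{H}\rightrightarrows N$, be a lagrangian morphism into a 2-shifted symplectic Lie group $(K,\Omega+\Theta)$, and identify $A_{\mathcal{H}}$ with a Dirac structure in $E=\mathbb{T}_\eta N\times\mathfrak{k}$ via $(\mathtt{a}_{\mathcal{H}},\lambda_\sigma,\mathrm{Lie}(\Phi))$. Then each choice of isotropic complement $\mathbf{C}$ for $A_{\mathcal{H}}$ in $E$ induces (through $\mathrm{Graph}(\pi^\sharp)=R\circ(\mathbf{C}\times\mathbf{C})$, with $R$ the relation defined in the context) a quasi-Poisson structure on $\mathcal{H}\rightrightarrows N$ that integrates the Lie quasi-bialgebroid determined by the quasi-Manin triple $(E,A_{\mathcal{H}},\mathbf{C})$.
   Context: Everything is real and $C^\infty$. For a Lie groupoid $\mathcal{H}\rightrightarrows N$: source $\mathtt{s}$, target $\mathtt{t}$, multiplication $\mathtt{m}$ (defined when $\mathtt{s}(g)=\mathtt{t}(h)$), unit $\epsilon$, inversion $\mathtt{i}$; $A_{\mathcal{H}}=\ker(T\mathtt{s})|_N$, anchor $\mathtt{a}_{\mathcal{H}}=T\mathtt{t}$, bracket by right-invariant vector fields (same for Lie groups). $(\cdot)^r,(\cdot)^l$ are right/left-invariant extensions, and $\mathtt{i}:A_{\mathcal{H}}\to\ker(T\mathtt{t})|_N$ is induced by inversion (extended to exterior powers). $\lambda_\sigma(u)=(i_u\sigma)|_{TN}$. 2-shifted symplectic Lie group: a Lie group $K$ with $\Omega\in\Omega^2(K\times K)$, whose pullbacks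 along $k\mapsto(1,k)$ and $k\mapsto(k,1)$ vanish, and $\Theta\in\Omega^3(K)$, such that $\delta\Omega=0$, $\delta\Theta=\mathrm{pr}_1^*\Theta+\mathrm{pr}_2^*\Theta-\mathtt{m}^*\Theta=-d\Omega$, $d\Theta=0$, where $\delta\Omega=(k_2,k_3)^*\Omega-(k_1k_2,k_3)^*\Omega+(k_1,k_2k_3)^*\Omega-(k_1,k_2)^*\Omega$, and such that $\langle u,v\rangle=-\Omega_{(1,1)}((u,0),(0,v))+\Omega_{(1,1)}((0,u),(v,0))$ is nondegenerate on $\mathfrak{k}$, making it a quadratic Lie algebra. Lagrangian morphism $(\mathcal{H},\Phi,\sigma+\eta)$: a Lie groupoid morphism $\Phi:\mathcal{H}\to K$, $\sigma\in\Omega^2(\mathcal{H})$ with $\epsilon^*\sigma=0$, closed $\eta\in\Omega^3(N)$, with $\mathrm{pr}_1^*\sigma+\mathrm{pr}_2^*\sigma-\mathtt{m}^*\sigma=\Phi^*\Omega$, $\mathtt{s}^*\eta-\mathtt{t}^*\eta-d\sigma=\Phi^*\Theta$, $\dim\mathcal{H}-2\dim N=\frac12\dim K$, $\ker(\sigma)_h\cap\ker(T\Phi)_h\cap\ker(T\mathtt{s})_h\cap\ker(T\mathtt{t})_h=\{0\}$ for all $h$. It is known that then $(\mathtt{a}_{\mathcal{H}},\lambda_\sigma,\mathrm{Lie}(\Phi))$ embeds $A_{\mathcal{H}}$ as a Dirac structure (lagrangian involutive subbundle) in $E$. $E=\mathbb{T}_\eta N\times\mathfrak{k}$ is the Courant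 algebroid $TN\oplus T^*N\oplus(N\times\mathfrak{k})$ with anchor the projection to $TN$, pairing $i_{X_2}\alpha_1+i_{X_1}\alpha_2+\langle w_1,w_2\rangle$ and bracket $[\![X_1+\alpha_1+w_1,X_2+\alpha_2+w_2]\!]=[X_1,X_2]+(\mathcal{L}_{X_1}\alpha_2-i_{X_2}d\alpha_1+i_{X_2}i_{X_1}\eta+\langle dw_1,w_2\rangle)+(\mathcal{L}_{X_1}w_2-\mathcal{L}_{X_2}w_1+[w_1,w_2])$. Definition of $R$. For $X+\alpha\in T_kK\oplus T_k^*K$ and $u\in\mathfrak{k}$ set $\mathtt{s}_\Omega(X+\alpha)(u)=\alpha(u^l)+\Omega|_{(k,1)}((X,0),(0,u))$, $\mathtt{t}_\Omega(X+\alpha)(u)=\alpha(u^r)+\Omega|_{(1,k)}((0,X),(u,0))$, viewed in $\mathfrak{k}$ via $\mathfrak{k}^*\cong\mathfrak{k}$. Over $h\in\mathcal{H}$, $R$ consists of all $((U,\beta),(e_1,e_2))$ with $(U,\beta)\in T_h\mathcal{H}\oplus T_h^*\mathcal{H}$, $e_1=(T\mathtt{t}(U),\alpha_1,\mathtt{t}_\Omega(T\Phi(U)+\zeta))\in E_{\mathtt{t}(h)}$, $e_2=(T\mathtt{s}(U),\alpha_2,\mathtt{s}_\Omega(T\Phi(U)+\zeta))\in E_{\mathtt{s}(h)}$, $\beta=\mathtt{t}^*\alpha_1-\mathtt{s}^*\alpha_2+\Phi^*\zeta-i_U\sigma$, for $\alpha_1\in T^*_{\mathtt{t}(h)}N$,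 $\alpha_2\in T^*_{\mathtt{s}(h)}N$, $\zeta\in T^*_{\Phi(h)}K$. $R\circ(\mathbf{C}\times\mathbf{C})$ is the set of $(X,\beta)\in T\mathcal{H}\oplus T^*\mathcal{H}$ for which there is $e\in\mathbf{C}\times\mathbf{C}$ with $((X,\beta),e)\in R$. Isotropic complement: a subbundle $\mathbf{C}$ with $E=A_{\mathcal{H}}\oplus\mathbf{C}$ and $\langle\mathbf{C},\mathbf{C}\rangle=0$. With $\mathbf{C}\cong A^*$ ($A=A_{\mathcal{H}}$) by the pairing, the quasi-Manin triple $(E,A,\mathbf{C})$ determines the Lie quasi-bialgebroid $(A,d_*,\chi)$: $d_*f(\xi)=\mathcal{L}_{\mathtt{a}(\xi)}f$, $d_*u(\xi_1,\xi_2)=\mathcal{L}_{\mathtt{a}(\xi_1)}(\xi_2(u))-\mathcal{L}_{\mathtt{a}(\xi_2)}(\xi_1(u))-\langle[\![\xi_1,\xi_2]\!],u\rangle$, $\chi(\xi_1,\xi_2,\xi_3)=\langle[\![\xi_1,\xi_2]\!],\xi_3\rangle$. A quasi-Poisson groupoid structure on $\mathcal{H}$ is a pair $(\pi,\chi)$ with $\pi$ a multiplicative bivector field on $\mathcal{H}$ and $\chi\in\Gamma(\wedge^3A)$, satisfying $\frac12[\pi,\pi]=\chi^r+\mathtt{i}(\chi)^l$ and $[\pi,\chi^r]=0$. It integrates $(A,d_*,\chi)$ if $\mathcal{L}_{u^r}\pi=-(d_*u)^r$ and $i_{\mathtt{t}^*df}\pi=-(d_*f)^r$ for $u\in\Gamma(A)$,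 $f\in C^\infty(N)$. *)

(* Defs.v *)
From HB Require Import structures.
From mathcomp Require Import all_boot all_order all_algebra.
From mathcomp Require Import all_classical all_reals all_analysis.
Set Implicit Arguments.
Unset Strict Implicit.
Unset Printing Implicit Defensive.
Import Order.TTheory GRing.Theory Num.Theory.
Import numFieldNormedType.Exports.
Local Open Scope classical_set_scope.
Local Open Scope ring_scope.

(* Fibres of bundles are represented as linear
   subsets of a fixed ambient vector space, so that vectors based at provably
   equal but not convertible points live in the same type.  Linear functionals
   on a subset are extended by 0 outside of it, so that Leibniz equality of
   functionals is equality on the subset. *)

Section LinearAlgebra.
Variables (R : realType) (V : lmodType R).

Definition fnl : lmodType R := (V -> R^o)%type.

Definition subspace (S : set V) : Prop :=
  S 0 /\ forall (a : R) (u v : V), S u -> S v -> S (a *: u + v).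

Definition linear_on (S : set V) (f : V -> R) : Prop :=
  forall (a : R) (u v : V), S u -> S v -> f (a *: u + v) = a * f u + f v.

Definition alt2 (S : set V) (w : V -> V -> R) : Prop :=
  (forall v, S v -> linear_on S (fun u => w u v)) /\
  (forall u v, S u -> S v -> w u v = - w v u).

Definition alt3 (S : set V) (w : V -> V -> V -> R) : Prop :=
  (forall v t, S v -> S t -> linear_on S (fun u => w u v t)) /\
  (forall u v t, S u -> S v -> S t ->
     w u v t = - w v u t /\ w u v t = - w u t v).

Definition restr (S : set V) (f : V -> R) : fnl :=
  fun v => if `[< S v >] then f v else 0.

Definition dual (S : set V) : set fnl :=
  [set f | linear_on S f /\ forall v, ~ S v -> f v = 0].

End LinearAlgebra.

(* With vector fields acting on functions this is the exterior derivative.  With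
   functions acting by a biderivation {.,.} of the functions, and {.,.} also as
   the bracket, it is [pi, .], for the Schouten bracket that extends the Lie
   bracket as a graded biderivation
   [P, Q /\ R] = [P, Q] /\ R + (-1)^((p-1)q) Q /\ [P, R]; this does not use the
   Jacobi identity for {.,.}. *)
Section Koszul.
Variables (R : realType) (M L : Type).
Variables (act : L -> (M -> R) -> M -> R) (br : L -> L -> L).

Definition koszul1 (w : L -> M -> R) (x y : L) : M -> R := fun p =>
  act x (w y) p - act y (w x) p - w (br x y) p.

Definition koszul2 (w : L -> L -> M -> R) (x y z : L) : M -> R := fun p =>
  act x (w y z) p - act y (w x z) p + act z (w x y) p
  - w (br x y) z p + w (br x z) y p - w (br y z) x p.

Definition koszul3 (w : L -> L -> L -> M -> R) (x y z t : L) : M -> R := fun p =>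
  act x (w y z t) p - act y (w x z t) p + act z (w x y t) p - act t (w x y z) p
  - w (br x y) z t p + w (br x z) y t p - w (br x t) y z p
  - w (br y z) x t p + w (br y t) x z p - w (br z t) x y p.

End Koszul.

Section Charts.
Variable R : realType.

Fixpoint Ck (n k : nat) (U : set 'rV[R]_n) (f : 'rV[R]_n -> R^o) : Prop :=
  (forall x, U x -> {for x, continuous f}) /\
  (if k is k'.+1 then
     forall v : 'rV[R]_n, (forall x, U x -> derivable f x v) /\
       Ck k' U (fun x => 'D_v f x)
   else True).

Definition smooth_on (n : nat) (U : set 'rV[R]_n) (f : 'rV[R]_n -> R) : Prop :=
  forall k, Ck k U f.

Record chart (M : topologicalType) (n : nat) := Chart {
  cdom : set M;
  cfun : M -> 'rV[R]_n;
  cinv : 'rV[R]_n -> M }.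

Definition cimg (M : topologicalType) (n : nat) (c : chart M n) : set 'rV[R]_n :=
  [set cfun c x | x in cdom c].

Definition is_chart (M : topologicalType) (n : nat) (c : chart M n) : Prop :=
  [/\ open (cdom c),
      open (cimg c),
      (forall x, cdom c x -> cinv c (cfun c x) = x),
      (forall x, cdom c x -> {for x, continuous (cfun c)}) &
      (forall z, cimg c z -> {for z, continuous (cinv c)})].

Definition compatible (M : topologicalType) (n : nat) (c d : chart M n) : Prop :=
  forall j : 'I_n,
    smooth_on [set cfun c x | x in cdom c `&` cdom d]
      (fun z => cfun d (cinv c z) 0 j).

(* Data only; the axioms are in [is_mfd], so that products need no proof. *)
Record mfd := Mfd {
  pt :> topologicalType;
  mdim : nat;
  atlas : set (chart pt mdim) }.

Definition is_mfd (M : mfd) : Prop :=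
  [/\ hausdorff_space M,
      @second_countable M,
      (forall c, atlas (m := M) c -> is_chart c),
      (forall c d, atlas (m := M) c -> atlas (m := M) d -> compatible c d) &
      (forall x : M, exists2 c, atlas (m := M) c & cdom c x)].

Definition prod_chart (M N : topologicalType) (m n : nat)
    (c : chart M m) (d : chart N n) : chart (M * N)%type (m + n) :=
  Chart [set x | cdom c x.1 /\ cdom d x.2]
        (fun x => row_mx (cfun c x.1) (cfun d x.2))
        (fun z => (cinv c (lsubmx z), cinv d (rsubmx z))).

Definition prod_mfd (M N : mfd) : mfd :=
  @Mfd (M * N)%type (mdim M + mdim N)
    [set e | exists c d, [/\ atlas (m := M) c, atlas (m := N) d & e = prod_chart c d]].

Definition smooth_fun (M : mfd) (f : M -> R) : Prop :=
  forall c, atlas (m := M) c -> smooth_on (cimg c) (f \o cinv c).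

Definition smooth_map (M N : mfd) (F : M -> N) : Prop :=
  continuous F /\
  forall c d, atlas (m := M) c -> atlas (m := N) d -> forall j,
    smooth_on [set cfun c x | x in cdom c `&` F @^-1` cdom d]
      (fun z => cfun d (F (cinv c z)) 0 j).

End Charts.

Section Calculus.
Variable R : realType.
Implicit Types M N : mfd R.

Definition tvec M : lmodType R := ((M -> R) -> R^o)%type.

(* Tangent vectors are derivations of the algebra of smooth functions at p,
   extended by 0 to non-smooth functions. *)
Definition tangent M (p : M) : set (tvec M) := [set v |
  [/\ (forall (a : R) f g, smooth_fun f -> smooth_fun g ->
         v (fun x => a * f x + g x) = a * v f + v g),
      (forall f g, smooth_fun f -> smooth_fun g ->
         v (fun x => f x * g x) = v f * g p + f p * v g) &
      (forall f, ~ smooth_fun f -> v f = 0)]].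

Definition cotangent M (p : M) : set (fnl (tvec M)) := dual (tangent p).

Definition tmap M N (F : M -> N) (v : tvec M) : tvec N :=
  fun g => if `[< smooth_fun g >] then v (g \o F) else 0.

(* The vector (u, v) at (p, q) in a product. *)
Definition tpair M N (p : M) (q : N) (u : tvec M) (v : tvec N) :
    tvec (prod_mfd M N) :=
  fun f => if `[< @smooth_fun R (prod_mfd M N) f >]
           then u (fun x => f (x, q)) + v (fun y => f (p, y)) else 0.

Definition submersion M N (F : M -> N) : Prop :=
  forall p w, tangent (F p) w -> exists2 v, tangent p v & tmap F v = w.

Definition differential M (p : M) (f : M -> R) : fnl (tvec M) :=
  restr (tangent p) (fun v => v f).

Definition is_vfield M (X : M -> tvec M) : Prop :=
  (forall p, tangent p (X p)) /\
  (forall f, smooth_fun f -> smooth_fun (fun p => X p f)).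

Definition vact M (X : M -> tvec M) (f : M -> R) : M -> R := fun p => X p f.

Definition lie M (X Y : M -> tvec M) : M -> tvec M :=
  fun p f => X p (vact Y f) - Y p (vact X f).

Definition form1 M := M -> fnl (tvec M).
Definition form2 M := M -> tvec M -> tvec M -> R.
Definition form3 M := M -> tvec M -> tvec M -> tvec M -> R.

Definition ev1 M (w : form1 M) (X : M -> tvec M) : M -> R := fun p => w p (X p).
Definition ev2 M (w : form2 M) (X Y : M -> tvec M) : M -> R :=
  fun p => w p (X p) (Y p).
Definition ev3 M (w : form3 M) (X Y Z : M -> tvec M) : M -> R :=
  fun p => w p (X p) (Y p) (Z p).

Definition is_form1 M (w : form1 M) : Prop :=
  (forall p, cotangent p (w p)) /\
  (forall X, is_vfield X -> smooth_fun (ev1 w X)).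
Definition is_form2 M (w : form2 M) : Prop :=
  (forall p, alt2 (tangent p) (w p)) /\
  (forall X Y, is_vfield X -> is_vfield Y -> smooth_fun (ev2 w X Y)).
Definition is_form3 M (w : form3 M) : Prop :=
  (forall p, alt3 (tangent p) (w p)) /\
  (forall X Y Z, is_vfield X -> is_vfield Y -> is_vfield Z ->
     smooth_fun (ev3 w X Y Z)).

Definition pull2 M N (F : M -> N) (w : form2 N) : form2 M :=
  fun p u v => w (F p) (tmap F u) (tmap F v).
Definition pull3 M N (F : M -> N) (w : form3 N) : form3 M :=
  fun p u v t => w (F p) (tmap F u) (tmap F v) (tmap F t).

Definition dform1 M (w : form1 M) := koszul1 (@vact M) (@lie M) (ev1 w).
Definition dform2 M (w : form2 M) := koszul2 (@vact M) (@lie M) (ev2 w).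
Definition dform3 M (w : form3 M) := koszul3 (@vact M) (@lie M) (ev3 w).

Definition closed_form3 M (w : form3 M) : Prop :=
  forall X Y Z T, is_vfield X -> is_vfield Y -> is_vfield Z -> is_vfield T ->
  forall p, dform3 w X Y Z T p = 0.

(* Multivectors at p are alternating multilinear functions of covectors, with
   (X /\ Y)(a, b) = a(X) b(Y) - a(Y) b(X). *)
Definition mvec2 M := M -> fnl (tvec M) -> fnl (tvec M) -> R.
Definition mvec3 M := M -> fnl (tvec M) -> fnl (tvec M) -> fnl (tvec M) -> R.

Definition dev2 M (P : mvec2 M) (f g : M -> R) : M -> R :=
  fun p => P p (differential p f) (differential p g).
Definition dev3 M (P : mvec3 M) (f g h : M -> R) : M -> R :=
  fun p => P p (differential p f) (differential p g) (differential p h).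

Definition is_bivector_field M (P : mvec2 M) : Prop :=
  (forall p, alt2 (cotangent p) (P p)) /\
  (forall f g, smooth_fun f -> smooth_fun g -> smooth_fun (dev2 P f g)).

(* The values of [P, Q] on differentials of smooth functions. *)
Definition schouten22 M (P : mvec2 M) := koszul2 (dev2 P) (dev2 P) (dev2 P).
Definition schouten23 M (P : mvec2 M) (Q : mvec3 M) :=
  koszul3 (dev2 P) (dev2 P) (dev3 Q).

(* The values of L_X P on differentials of smooth functions. *)
Definition lie_bivector M (X : M -> tvec M) (P : mvec2 M) (f g : M -> R) : M -> R :=
  fun p => vact X (dev2 P f g) p - dev2 P (vact X f) g p - dev2 P f (vact X g) p.

End Calculus.

Record lie_group_data (R : realType) := LieGroupData {
  lgM :> mfd R;
  lmul : lgM -> lgM -> lgM;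
  lone : lgM;
  linv : lgM -> lgM }.

Section LieGroup.
Variables (R : realType) (K : lie_group_data R).
Local Notation "x ** y" := (lmul x y) (at level 40, left associativity).
Local Notation e := (lone K).
Local Notation KK := (prod_mfd K K).
Local Notation KKK := (prod_mfd KK K).

Record is_lie_group : Prop := IsLieGroup {
  lg_mfd : is_mfd K;
  lg_mulA : forall x y z : K, x ** (y ** z) = (x ** y) ** z;
  lg_mul1l : forall x : K, e ** x = x;
  lg_mul1r : forall x : K, x ** e = x;
  lg_mulVl : forall x : K, linv x ** x = e;
  lg_mulVr : forall x : K, x ** linv x = e;
  lg_mul_smooth : @smooth_map R KK K (fun x => x.1 ** x.2);
  lg_inv_smooth : @smooth_map R K K (@linv R K) }.

Definition lie_algebra : set (tvec K) := tangent e.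

Definition right_inv (u : tvec K) : K -> tvec K := fun k => tmap (fun x : K => x ** k) u.
Definition left_inv (u : tvec K) : K -> tvec K := fun k => tmap (fun x : K => k ** x) u.

Definition lie_algebra_bracket (u v : tvec K) : tvec K :=
  lie (right_inv u) (right_inv v) e.

Variable Omega : form2 KK.
Variable Theta : form3 K.

Definition kpair (u v : tvec K) : R :=
  - Omega (e, e) (tpair e e u 0) (tpair e e 0 v)
  + Omega (e, e) (tpair e e 0 u) (tpair e e v 0).

Definition delta_Omega : form2 KKK := fun p u v =>
    @pull2 R KKK KK (fun k => (k.1.2, k.2)) Omega p u v
  - @pull2 R KKK KK (fun k => (k.1.1 ** k.1.2, k.2)) Omega p u v
  + @pull2 R KKK KK (fun k => (k.1.1, k.1.2 ** k.2)) Omega p u v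
  - @pull2 R KKK KK (fun k => (k.1.1, k.1.2)) Omega p u v.

Definition delta_Theta : form3 KK := fun p u v t =>
    @pull3 R KK K (fun k => k.1) Theta p u v t
  + @pull3 R KK K (fun k => k.2) Theta p u v t
  - @pull3 R KK K (fun k => k.1 ** k.2) Theta p u v t.

Record shifted_symplectic : Prop := ShiftedSymplectic {
  ss_group : is_lie_group;
  ss_Omega : is_form2 Omega;
  ss_Theta : is_form3 Theta;
  ss_norml : forall (k : K) u v, tangent k u -> tangent k v ->
    @pull2 R K KK (fun x => (e, x)) Omega k u v = 0;
  ss_normr : forall (k : K) u v, tangent k u -> tangent k v ->
    @pull2 R K KK (fun x => (x, e)) Omega k u v = 0;
  ss_delta_Omega : forall (p : KKK) u v, tangent p u -> tangent p v ->
    delta_Omega p u v = 0;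
  ss_delta_Theta : forall X Y Z,
    is_vfield X -> is_vfield Y -> is_vfield Z -> forall p : KK,
    ev3 delta_Theta X Y Z p = - dform2 Omega X Y Z p;
  ss_Theta_closed : closed_form3 Theta;
  ss_nondeg : forall u, lie_algebra u ->
    (forall v, lie_algebra v -> kpair u v = 0) -> u = 0 }.

(* The covectors s_Omega(X + zeta) and t_Omega(X + zeta) on the Lie algebra. *)
Definition s_Omega (k : K) (X : tvec K) (zeta : fnl (tvec K)) (u : tvec K) : R :=
  zeta (left_inv u k) + Omega (k, e) (tpair k e X 0) (tpair k e 0 u).
Definition t_Omega (k : K) (X : tvec K) (zeta : fnl (tvec K)) (u : tvec K) : R :=
  zeta (right_inv u k) + Omega (e, k) (tpair e k 0 X) (tpair e k u 0).

(* w represents phi under the identification given by the pairing. *)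
Definition represents (w : tvec K) (phi : tvec K -> R) : Prop :=
  lie_algebra w /\ forall u, lie_algebra u -> kpair w u = phi u.

End LieGroup.

(* [gmul] is meaningful only on composable arrows; [cpb] is the manifold of
   composable pairs, with its two projections. *)
Record groupoid_data (R : realType) := GroupoidData {
  arr : mfd R;
  obj : mfd R;
  cpb : mfd R;
  src : arr -> obj;
  tgt : arr -> obj;
  unt : obj -> arr;
  ginv : arr -> arr;
  gmul : arr -> arr -> arr;
  cpr1 : cpb -> arr;
  cpr2 : cpb -> arr }.

Section LieGroupoid.
Variables (R : realType) (G : groupoid_data R).
Local Notation H := (arr G).
Local Notation N := (obj G).
Local Notation s := (@src R G).
Local Notation t := (@tgt R G).
Local Notation pr1 := (@cpr1 R G).
Local Notation pr2 := (@cpr2 R G).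

Definition gm (q : cpb G) : H := gmul (pr1 q) (pr2 q).

(* [cpb] is an embedded submanifold of H x H whose points are the composable
   pairs and whose tangent spaces are {(v, w) | Ts(v) = Tt(w)}. *)
Record is_composable_mfd : Prop := IsComposableMfd {
  cm_mfd : is_mfd (cpb G);
  cm_pr1 : smooth_map pr1;
  cm_pr2 : smooth_map pr2;
  cm_inj : forall q q', pr1 q = pr1 q' -> pr2 q = pr2 q' -> q = q';
  cm_image : forall g h : H,
    s g = t h <-> exists2 q, pr1 q = g & pr2 q = h;
  cm_topology : forall U : set (cpb G), open U ->
    exists2 W : set (H * H)%type, open W & U = [set q | W (pr1 q, pr2 q)];
  cm_immersion : forall q x, tangent q x ->
    tmap pr1 x = 0 -> tmap pr2 x = 0 -> x = 0;
  cm_tangent : forall q v w, tangent (pr1 q) v -> tangent (pr2 q) w ->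
    (tmap s v = tmap t w <->
     exists x, [/\ tangent q x, tmap pr1 x = v & tmap pr2 x = w]) }.

Record is_lie_groupoid : Prop := IsLieGroupoid {
  gd_arr : is_mfd H;
  gd_obj : is_mfd N;
  gd_cpb : is_composable_mfd;
  gd_src_smooth : smooth_map s;
  gd_tgt_smooth : smooth_map t;
  gd_unt_smooth : smooth_map (@unt R G);
  gd_inv_smooth : smooth_map (@ginv R G);
  gd_mul_smooth : smooth_map gm;
  gd_src_subm : submersion s;
  gd_tgt_subm : submersion t;
  gd_src_unt : forall x : N, s (unt x) = x;
  gd_tgt_unt : forall x : N, t (unt x) = x;
  gd_src_mul : forall g h : H, s g = t h -> s (gmul g h) = s h;
  gd_tgt_mul : forall g h : H, s g = t h -> t (gmul g h) = t g;
  gd_mulA : forall g h k : H, s g = t h -> s h = t k ->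
    gmul (gmul g h) k = gmul g (gmul h k);
  gd_mul1l : forall g : H, gmul (unt (t g)) g = g;
  gd_mul1r : forall g : H, gmul g (unt (s g)) = g;
  gd_src_inv : forall g : H, s (ginv g) = t g;
  gd_tgt_inv : forall g : H, t (ginv g) = s g;
  gd_mulVl : forall g : H, gmul (ginv g) g = unt (s g);
  gd_mulVr : forall g : H, gmul g (ginv g) = unt (t g) }.

(* Tm(v, w) for (v, w) tangent to the composable pairs at (g, h). *)
Definition tmul (g h : H) (v w : tvec H) : tvec H :=
  xget 0 [set z | exists q x,
    [/\ pr1 q = g, pr2 q = h, tangent q x & [/\ tmap pr1 x = v, tmap pr2 x = w
      & tmap gm x = z]]].

Definition algd (x : N) : set (tvec H) :=
  [set u | tangent (unt x) u /\ tmap s u = 0].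

Definition is_section (u : N -> tvec H) : Prop :=
  (forall x, algd x (u x)) /\
  (forall f, smooth_fun f -> smooth_fun (fun x => u x f)).

Definition right_ext (h : H) (u : tvec H) : tvec H := tmul (unt (t h)) h u 0.
Definition left_ext (h : H) (v : tvec H) : tvec H := tmul h (unt (s h)) 0 v.
Definition right_field (u : N -> tvec H) : H -> tvec H := fun h => right_ext h (u (t h)).

(* Sections of exterior powers of the algebroid, as alternating multilinear
   functions on the fibres of its dual. *)
Definition amv2 := N -> fnl (tvec H) -> fnl (tvec H) -> R.
Definition amv3 := N -> fnl (tvec H) -> fnl (tvec H) -> fnl (tvec H) -> R.

Definition algd_diff (x : N) (f : H -> R) : fnl (tvec H) :=
  restr (algd x) (fun u => u f).

Definition is_section2 (w : amv2) : Prop :=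
  (forall x, alt2 (dual (algd x)) (w x)) /\
  (forall f g, smooth_fun f -> smooth_fun g ->
     smooth_fun (fun x => w x (algd_diff x f) (algd_diff x g))).
Definition is_section3 (w : amv3) : Prop :=
  (forall x, alt3 (dual (algd x)) (w x)) /\
  (forall f g k, smooth_fun f -> smooth_fun g -> smooth_fun k ->
     smooth_fun (fun x => w x (algd_diff x f) (algd_diff x g) (algd_diff x k))).

(* Transposes of u |-> u^r(h), on the fibre over t h, and of u |-> i(u)^l(h),
   on the fibre over s h. *)
Definition right_tr (h : H) (b : fnl (tvec H)) : fnl (tvec H) :=
  restr (algd (t h)) (fun u => b (right_ext h u)).
Definition left_inv_tr (h : H) (b : fnl (tvec H)) : fnl (tvec H) :=
  restr (algd (s h)) (fun u => b (left_ext h (tmap (@ginv R G) u))).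

Definition right2 (w : amv2) : mvec2 H := fun h a b =>
  w (t h) (right_tr h a) (right_tr h b).
Definition right3 (w : amv3) : mvec3 H := fun h a b c =>
  w (t h) (right_tr h a) (right_tr h b) (right_tr h c).
Definition left_inv3 (w : amv3) : mvec3 H := fun h a b c =>
  w (s h) (left_inv_tr h a) (left_inv_tr h b) (left_inv_tr h c).

(* The graph of the multiplication is coisotropic for P + P - P. *)
Definition multiplicative (P : mvec2 H) : Prop :=
  forall (q : cpb G) (a1 a2 b1 b2 c1 c2 : fnl (tvec H)),
  cotangent (pr1 q) a1 -> cotangent (pr2 q) b1 -> cotangent (gm q) c1 ->
  cotangent (pr1 q) a2 -> cotangent (pr2 q) b2 -> cotangent (gm q) c2 ->
  (forall x, tangent q x -> a1 (tmap pr1 x) + b1 (tmap pr2 x) + c1 (tmap gm x) = 0) ->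
  (forall x, tangent q x -> a2 (tmap pr1 x) + b2 (tmap pr2 x) + c2 (tmap gm x) = 0) ->
  P (pr1 q) a1 a2 + P (pr2 q) b1 b2 - P (gm q) c1 c2 = 0.

Record quasi_poisson (P : mvec2 H) (chi : amv3) : Prop := QuasiPoisson {
  qp_bivector : is_bivector_field P;
  qp_multiplicative : multiplicative P;
  qp_chi : is_section3 chi;
  qp_jacobi : forall f g k, smooth_fun f -> smooth_fun g -> smooth_fun k ->
    forall h, 2^-1 * schouten22 P f g k h =
      dev3 (right3 chi) f g k h + dev3 (left_inv3 chi) f g k h;
  qp_chi_closed : forall f g k l,
    smooth_fun f -> smooth_fun g -> smooth_fun k -> smooth_fun l ->
    forall h, schouten23 P (right3 chi) f g k l h = 0 }.

(* [d0] and [d1] are the components of d_* on functions and on sections. *)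
Record integrates (P : mvec2 H)
    (d0 : (N -> R) -> N -> tvec H) (d1 : (N -> tvec H) -> amv2) : Prop := Integrates {
  int_section : forall u, is_section u -> forall f g, smooth_fun f -> smooth_fun g ->
    forall h, lie_bivector (right_field u) P f g h = - dev2 (right2 (d1 u)) f g h;
  int_function : forall f, smooth_fun f -> forall h b, cotangent h b ->
    P h (differential h (f \o t)) b = - b (right_field (d0 f) h) }.

End LieGroupoid.

Section Lagrangian.
Variables (R : realType) (K : lie_group_data R) (Omega : form2 (prod_mfd K K)).
Variables (G : groupoid_data R).
Local Notation H := (arr G).
Local Notation N := (obj G).
Local Notation s := (@src R G).
Local Notation t := (@tgt R G).
Local Notation pr1 := (@cpr1 R G).
Local Notation pr2 := (@cpr2 R G).

Record lagrangian_morphism (Theta : form3 K) (Phi : H -> K) (sigma : form2 H)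
    (eta : form3 N) : Prop := LagrangianMorphism {
  lm_groupoid : is_lie_groupoid G;
  lm_smooth : smooth_map Phi;
  lm_morphism : forall g h : H, s g = t h -> Phi (gmul g h) = lmul (Phi g) (Phi h);
  lm_sigma : is_form2 sigma;
  lm_sigma_unt : forall (x : N) u v, tangent x u -> tangent x v ->
    pull2 (@unt R G) sigma x u v = 0;
  lm_eta : is_form3 eta;
  lm_eta_closed : closed_form3 eta;
  lm_delta_sigma : forall (q : cpb G) u v, tangent q u -> tangent q v ->
    pull2 pr1 sigma q u v + pull2 pr2 sigma q u v - pull2 (@gm R G) sigma q u v =
    @pull2 R (cpb G) (prod_mfd K K) (fun x => (Phi (pr1 x), Phi (pr2 x))) Omega q u v;
  lm_d_sigma : forall X Y Z, is_vfield X -> is_vfield Y -> is_vfield Z -> forall h : H,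
    ev3 (pull3 s eta) X Y Z h - ev3 (pull3 t eta) X Y Z h - dform2 sigma X Y Z h =
    ev3 (pull3 Phi Theta) X Y Z h;
  lm_dim : (2 * mdim H = 4 * mdim N + mdim K)%N;
  lm_nondeg : forall (h : H) v, tangent h v ->
    (forall w, tangent h w -> sigma h v w = 0) ->
    tmap Phi v = 0 -> tmap s v = 0 -> tmap t v = 0 -> v = 0 }.

(* Ambient space of the fibres of TN + T^*N + (N x k). *)
Definition Evec : lmodType R := (tvec N * fnl (tvec N) * tvec K)%type.

Definition Efib (x : N) : set Evec :=
  [set e | [/\ tangent x e.1.1, cotangent x e.1.2 & lie_algebra (K := K) e.2]].

Definition Epair (e1 e2 : Evec) : R :=
  e1.1.2 e2.1.1 + e2.1.2 e1.1.1 + kpair Omega e1.2 e2.2.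

Definition is_Esection (e : N -> Evec) : Prop :=
  [/\ forall x, Efib x (e x),
      is_vfield (fun x => (e x).1.1),
      is_form1 (fun x => (e x).1.2) &
      forall f, smooth_fun f -> smooth_fun (fun x => (e x).2 f)].

Definition lieK (X : N -> tvec N) (w : N -> tvec K) : N -> tvec K :=
  fun x f => X x (fun y => w y f).

Section Courant.
Variables (eta : form3 N) (e1 e2 : N -> Evec).
Let X1 x := (e1 x).1.1.
Let X2 x := (e2 x).1.1.
Let a1 x := (e1 x).1.2.
Let a2 x := (e2 x).1.2.
Let w1 x := (e1 x).2.
Let w2 x := (e2 x).2.

Definition courant_vec : N -> tvec N := lie X1 X2.

(* The one-form component of the bracket, evaluated on a vector field Y; here
   (L_X a)(Y) = X(a(Y)) - a([X, Y]). *)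
Definition courant_form (Y : N -> tvec N) : N -> R := fun x =>
  (vact X1 (ev1 a2 Y) x - a2 x (lie X1 Y x))
  - dform1 a1 X2 Y x
  + eta x (X1 x) (X2 x) (Y x)
  + kpair Omega (lieK Y w1 x) (w2 x).

Definition courant_lie : N -> tvec K := fun x =>
  lieK X1 w2 x - lieK X2 w1 x + lie_algebra_bracket (w1 x) (w2 x).

(* The function < [[e1, e2]], e3 >. *)
Definition courant_pair (e3 : N -> Evec) : N -> R := fun x =>
  courant_form (fun y => (e3 y).1.1) x + (e3 x).1.2 (courant_vec x)
  + kpair Omega (courant_lie x) (e3 x).2.

End Courant.

Variables (Phi : H -> K) (sigma : form2 H) (eta : form3 N).

Definition lambda_sigma (x : N) (u : tvec H) : fnl (tvec N) :=
  restr (tangent x) (fun X => sigma (unt x) u (tmap (@unt R G) X)).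

Definition emb (x : N) (u : tvec H) : Evec :=
  (tmap t u, lambda_sigma x u, tmap Phi u).

Definition is_subbundle (C : N -> set Evec) : Prop :=
  (forall x, C x `<=` Efib x /\ subspace (C x)) /\
  forall x0 : N, exists (r : nat) (c : 'I_r -> N -> Evec) (U : set N),
    [/\ forall i, is_Esection (c i),
        nbhs x0 U &
        forall x, U x ->
          (forall e, C x e <-> exists a : 'I_r -> R, e = \sum_i a i *: c i x) /\
          (forall a : 'I_r -> R, \sum_i a i *: c i x = 0 -> forall i, a i = 0)].

Record isotropic_complement (C : N -> set Evec) : Prop := IsotropicComplement {
  ic_subbundle : is_subbundle C;
  ic_span : forall x e, Efib x e -> exists2 u, algd x u & C x (e - emb x u);
  ic_direct : forall x u, algd x u -> C x (emb x u) -> emb x u = 0;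
  ic_isotropic : forall x c c', C x c -> C x c' -> Epair c c' = 0 }.

(* The functional < xi, . > on the algebroid fibre, for the identification of C
   with the dual of the algebroid. *)
Definition flat (x : N) (xi : Evec) : fnl (tvec H) :=
  restr (algd x) (fun u => Epair xi (emb x u)).

Definition is_Csection (C : N -> set Evec) (xi : N -> Evec) : Prop :=
  is_Esection xi /\ forall x, C x (xi x).

Record quasi_bialgebroid_of (C : N -> set Evec)
    (d0 : (N -> R) -> N -> tvec H) (d1 : (N -> tvec H) -> amv2 G) (chi : amv3 G) :
    Prop := QuasiBialgebroidOf {
  qb_d0_section : forall f, smooth_fun f -> is_section (d0 f);
  qb_d0 : forall f, smooth_fun f -> forall x xi, C x xi ->
    flat x xi (d0 f x) = xi.1.1 f;
  qb_d1_section : forall u, is_section u -> is_section2 (d1 u);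
  qb_d1 : forall u, is_section u -> forall xi1 xi2,
    is_Csection C xi1 -> is_Csection C xi2 -> forall x,
    d1 u x (flat x (xi1 x)) (flat x (xi2 x)) =
      vact (fun y => (xi1 y).1.1) (fun y => flat y (xi2 y) (u y)) x
      - vact (fun y => (xi2 y).1.1) (fun y => flat y (xi1 y) (u y)) x
      - courant_pair eta xi1 xi2 (fun y => emb y (u y)) x;
  qb_chi_section : is_section3 chi;
  qb_chi : forall xi1 xi2 xi3,
    is_Csection C xi1 -> is_Csection C xi2 -> is_Csection C xi3 -> forall x,
    chi x (flat x (xi1 x)) (flat x (xi2 x)) (flat x (xi3 x)) =
      courant_pair eta xi1 xi2 xi3 x }.

Definition relR (h : H) (U : tvec H) (b : fnl (tvec H)) (e1 e2 : Evec) : Prop :=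
  [/\ tangent h U, cotangent h b, Efib (t h) e1, Efib (s h) e2 &
   exists2 zeta, cotangent (Phi h) zeta &
   [/\ e1.1.1 = tmap t U /\ e2.1.1 = tmap s U,
       represents Omega e1.2 (t_Omega Omega (Phi h) (tmap Phi U) zeta),
       represents Omega e2.2 (s_Omega Omega (Phi h) (tmap Phi U) zeta) &
       forall V, tangent h V ->
         b V = e1.1.2 (tmap t V) - e2.1.2 (tmap s V) + zeta (tmap Phi V)
               - sigma h U V]].

Definition relR_comp (C : N -> set Evec) (h : H) (U : tvec H) (b : fnl (tvec H)) : Prop :=
  exists e1 e2, [/\ C (t h) e1, C (s h) e2 & relR h U b e1 e2].

(* Graph(P^#), where a(P^#(b)) = P(b, a). *)
Definition graph_sharp (P : mvec2 H) (h : H) (U : tvec H) (b : fnl (tvec H)) : Prop :=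
  [/\ tangent h U, cotangent h b & forall a, cotangent h a -> a U = P h b a].

End Lagrangian.

(* Main.v *)
Require Import Defs.
From mathcomp Require Import all_boot all_order all_algebra.
From mathcomp Require Import all_classical all_reals all_analysis.
From mathcomp Require Import ring lra zify.
Set Implicit Arguments.
Unset Strict Implicit.
Unset Printing Implicit Defensive.
Import Order.TTheory GRing.Theory Num.Theory.
Import numFieldNormedType.Exports.
Local Open Scope classical_set_scope.
Local Open Scope ring_scope.

(* The forms [muf] and [nuf] built from Omega trivialise TK + T^*K as two copies of k. Hence
   in a point ((U, b), (e1, e2)) of R the components T Phi (U) and zeta are determined by the
   k-components of e1 and e2, and b by (U, e1, e2). R is isotropic and contains
   ((u^r, 0), (u, 0)) and ((i(u)^l, 0), (0, u)), so for e1, e2 in C and b = 0 one gets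
   e1 = e2 = 0, and then U = 0 because sigma is nondegenerate on the common kernel of
   T Phi, Ts and Tt. By [lm_dim] the linear system for U with b given and e1, e2 in C is
   square; Cramer's rule gives a smooth solution, the bivector field.
   For the differential identities let tex be the expression in three pairs (vector
   field, one-form) that gives <[[., .]], .> for the standard Courant bracket. For lifts of
   points of R it equals the Courant pairing at t(h) minus the one at s(h). On Hamiltonian
   lifts tex is half of [pi, pi]; with one lift u^r it is L_{u^r} pi. Finally
   [pi, chi^r] = 0 follows from these formulas and the Jacobi identity of the Courant
   bracket, in which the terms <[[., .]], [[., .]]> are expanded in dual bases of C and A. *)

(** * Smooth functions on open subsets of R^n *)

(** Tangent vectors are derivations of globally smooth functions, so every local object (a
    coordinate frame, a germ, a section through a point) is realised by global ones whose defining
    identities hold only near a point. Hadamard's lemma and bump functions provide such frames;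
    Schwarz's theorem makes right- and left-invariant fields of K commute. The manifold of
    composable pairs is known only through its two projections, and a map into it is never shown
    smooth: derivatives of products are obtained from an estimate. The bivector is selected
    pointwise by choice; its smoothness comes from uniqueness, as the smooth solution of the linear
    system with the same data must be the selected one. The complement has only local frames, so
    [chi] and d_* are defined at x by a frame chosen at x and then shown to be independent of it.
    The expansions in frames separate derivatives of coefficients, which meet only pairings of the
    frame, from structure functions; pairings inside C vanish, and this is why only structure
    functions survive in the final formulas. *)

Section CkBasic.
Variables (R : realType) (n : nat).
Implicit Types (U V : set 'rV[R]_n) (f g : 'rV[R]_n -> R^o).

Lemma Ck_cont k U f x : Ck k U f -> U x -> {for x, continuous f}.
Proof. by case: k => [|k] [cf _] Ux; apply: cf. Qed.

Lemma continuous_near_eq (S T : topologicalType) (f g : S -> T) x :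
  (\forall y \near x, f y = g y) -> {for x, continuous f} -> {for x, continuous g}.
Proof.
move=> fg cf; suff h : g @ x --> g x by exact: h.
rewrite -(nbhs_singleton fg); apply: cvg_trans cf.
by apply: near_eq_cvg; apply: filterS fg.
Qed.

Lemma open_near (T : topologicalType) (W : set T) (P : T -> Prop) x :
  open W -> W x -> (forall y, W y -> P y) -> \forall y \near x, P y.
Proof. by move=> oW Wx WP; apply: filterS WP _; exact: open_nbhs_nbhs. Qed.

(** Openness of U makes the equality hold near each point, so that difference quotients agree as
    well. *)
Lemma Ck_eq k U f g : open U -> (forall x, U x -> f x = g x) ->
  Ck k U f -> Ck k U g.
Proof.
move=> oU; elim: k f g => [|k IH] f g fg /= [cf df]; split => //.
- by move=> x Ux; apply: continuous_near_eq (cf x Ux); exact: open_near oU Ux fg.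
- by move=> x Ux; apply: continuous_near_eq (cf x Ux); exact: open_near oU Ux fg.
move=> v; have [dv cv] := df v; split.
  move=> x Ux; apply: near_eq_derivable (dv x Ux).
  exact: open_near oU Ux fg.
apply: IH cv => x Ux; apply: near_eq_derive.
exact: open_near oU Ux fg.
Qed.

Lemma Ck_sub k U V f : V `<=` U -> Ck k U f -> Ck k V f.
Proof.
move=> VU; elim: k f => [|k IH] f /= [cf df]; split => //.
- by move=> x /VU; apply: cf.
- by move=> x /VU; apply: cf.
by move=> v; have [dv cv] := df v; split; [move=> x /VU; apply: dv | apply: IH].
Qed.

Lemma Ck_S k U f : Ck k.+1 U f -> Ck k U f.
Proof.
elim: k f => [|k IH] f [cf df]; split => //.
by move=> v; have [dv cv] := df v; split => //; apply: IH.
Qed.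

Lemma Ck_local k U f :
  (forall x, U x -> exists V, V x /\ Ck k V f) -> Ck k U f.
Proof.
elim: k f => [|k IH] f loc; split => //.
- by move=> x /loc [V [Vx [cf _]]]; apply: cf.
- by move=> x /loc [V [Vx [cf _]]]; apply: cf.
move=> v; split.
  by move=> x /loc [V [Vx [_ /(_ v) [dv _]]]]; apply: dv.
by apply: IH => x /loc [V [Vx [_ /(_ v) [_ dv]]]]; exists V.
Qed.

Lemma Ck_cst k U (a : R) : Ck k U (fun _ => a).
Proof.
elim: k a => [|k IH] a; (split; first by move=> x _; exact: (@cst_continuous _ _ (a : R^o) x)) => //.
move=> v; split; first by move=> x _; exact: derivable_cst.
have -> : (fun x => 'D_v (fun=> a) x) = (fun _ : 'rV[R]_n => 0 : R^o) by apply/funext => x; rewrite derive_cst.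
exact: IH.
Qed.

Lemma Ck_add k U f g : open U -> Ck k U f -> Ck k U g -> Ck k U (fun x => f x + g x).
Proof.
move=> oU; elim: k f g => [|k IH] f g [cf df] [cg dg]; split => //.
- by move=> x Ux; exact: (continuousD (cf x Ux) (cg x Ux)).
- by move=> x Ux; exact: (continuousD (cf x Ux) (cg x Ux)).
move=> v; have [df1 df2] := df v; have [dg1 dg2] := dg v; split.
  by move=> x Ux; apply: derivableD; [exact: df1 | exact: dg1].
apply: Ck_eq (IH _ _ df2 dg2) => // x Ux.
by rewrite deriveD //; [exact: df1 | exact: dg1].
Qed.

Lemma Ck_mul k U f g : open U -> Ck k U f -> Ck k U g ->
  Ck k U (fun x => f x * g x : R^o).
Proof.
move=> oU; elim: k f g => [|k IH] f g hf hg.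
  by case: hf hg => [cf _] [cg _]; split => // x Ux; exact: (continuousM (cf x Ux) (cg x Ux)).
have [cf df] := hf; have [cg dg] := hg; split.
  by move=> x Ux; exact: (continuousM (cf x Ux) (cg x Ux)).
move=> v; have [df1 df2] := df v; have [dg1 dg2] := dg v; split.
  by move=> x Ux; apply: derivableM; [exact: df1 | exact: dg1].
have h := Ck_add oU (IH _ _ (Ck_S hf) dg2) (IH _ _ df2 (Ck_S hg)).
apply: Ck_eq h => // x Ux.
rewrite [RHS]deriveM; [|exact: df1|exact: dg1].
by rewrite [X in _ = _ + X]mulrC.
Qed.

Lemma Ck_inv k U f : open U -> (forall x, U x -> f x != 0) -> Ck k U f ->
  Ck k U (fun x => (f x)^-1 : R^o).
Proof.
move=> oU f0; elim: k => [|k IH] hf.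
  by case: hf => cf _; split => // x Ux; exact: (continuousV (f0 x Ux) (cf x Ux)).
have [cf df] := hf; split.
  by move=> x Ux; exact: (continuousV (f0 x Ux) (cf x Ux)).
move=> v; have [df1 df2] := df v; split.
  by move=> x Ux; apply: derivableV; [exact: f0 | exact: df1].
have hi := IH (Ck_S hf).
have h := Ck_mul oU (Ck_mul oU (Ck_cst k U (-1)) (Ck_mul oU hi hi)) df2.
apply: Ck_eq h => // x Ux.
rewrite [RHS]deriveV; [|exact: f0|exact: df1].
by rewrite /GRing.scale /= mulN1r -exprVn expr2 mulNr.
Qed.

Lemma Ck_coord k U (i : 'I_n) : Ck k U (fun x : 'rV[R]_n => x 0 i : R^o).
Proof.
have cc x : {for x, continuous (fun x : 'rV[R]_n => x 0 i : R^o)}.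
  by apply: differentiable_continuous; apply: differentiable_coord.
case: k => [|k]; split => // v.
have dv (x : 'rV[R]_n) : is_derive x v (fun x : 'rV[R]_n => x 0 i : R^o) (v 0 i).
  have dx : differentiable (fun x : 'rV[R]_n => x 0 i : R^o) x by apply: differentiable_coord.
  apply: DeriveDef; first by apply: diff_derivable.
  apply: cvg_lim => //.
  apply: (@cvg_trans _ ((fun=> v 0 i : R^o) @ (0 : R)^')); last exact: cvg_cst.
  apply: near_eq_cvg; near=> h; rewrite /= !mxE addrK /GRing.scale /= mulKf //.
  by near: h; exact: nbhs_dnbhs_neq.
split; first by move=> x _; exact: ex_derive.
have -> : (fun x => 'D_v (fun x : 'rV[R]_n => x 0 i : R^o) x) = (fun _ => v 0 i).
  by apply/funext => x; exact: derive_val.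
exact: Ck_cst.
Unshelve. all: by end_near. Qed.

End CkBasic.

(** * Directional derivatives and the mean value theorem along lines *)

Section Line.
Variables (R : realType) (n : nat).
Implicit Types (f g : 'rV[R]_n -> R^o) (x v : 'rV[R]_n).

(** Both difference quotients are the same function of the step. This carries one-variable theorems
    (product rules, mean value, fundamental theorem) over to directional derivatives. *)
Lemma line_derive f x v (t d : R) :
  is_derive (x + t *: v) v f d <-> is_derive t 1 (fun t : R => f (x + t *: v)) d.
Proof.
have E : (fun h : R => h^-1 *: (((fun t : R => f (x + t *: v)) \o shift t) (h *: (1 : R)) - f (x + t *: v)))
       = (fun h : R => h^-1 *: ((f \o shift (x + t *: v)) (h *: v) - f (x + t *: v))).
  apply/funext => h /=; congr (_ *: (f _ - _)).
  by rewrite /GRing.scale /= mulr1 -/(GRing.scale _ _) scalerDl addrCA.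
suff [E1 E2] : derivable (fun t : R => f (x + t *: v)) t 1 = derivable f (x + t *: v) v /\
    'D_1 (fun t : R => f (x + t *: v)) t = 'D_v f (x + t *: v).
  by split=> -[h1 h2]; apply: DeriveDef; rewrite ?E1 ?E2 // -?E1 -?E2.
by split; rewrite /derivable /derive -E.
Qed.

Lemma derive_scale f x v (c : R) : derivable f x v ->
  is_derive x (c *: v) f (c * 'D_v f x).
Proof.
move=> /derivableP h.
have {}h : is_derive (c * 0) 1 (fun t : R => f (x + t *: v)) ('D_v f x).
  by apply/line_derive; rewrite mulr0 scale0r addr0.
have hc : is_derive (0 : R) (1 : R) (fun t : R => c * t) c.
  have := @is_deriveZ _ _ _ (id : R -> R) c 0 1 1 _.
  by move=> /(_ (is_derive_id _ _)); rewrite /GRing.scale /= mulr1.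
have := is_derive1_comp h hc; rewrite /= => hh.
rewrite -[x]addr0 -[X in x + X](scale0r (c *: v)).
apply/line_derive.
have -> : (fun t : R => f (x + t *: (c *: v))) = ((fun t => f (x + t *: v)) \o (fun t => c * t)).
  by apply/funext => t /=; rewrite scalerA mulrC.
by rewrite scale0r addr0 mulrC.
Qed.

Lemma MVT_line f x v :
  (forall t : R, 0 <= t <= 1 -> derivable f (x + t *: v) v) ->
  exists2 t : R, 0 <= t <= 1 & f (x + v) - f x = 'D_v f (x + t *: v).
Proof.
move=> df; pose g (t : R) := f (x + t *: v).
have dg (t : R) : 0 <= t <= 1 -> is_derive t 1 g ('D_v f (x + t *: v)).
  by move=> /df /derivableP h; apply/line_derive.
have [||] := @MVT_segment R g (fun t => 'D_v f (x + t *: v)) 0 1 ler01.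
- by move=> t; rewrite in_itv /= => /andP[t0 t1]; apply: dg; rewrite !ltW.
- apply: derivable_within_continuous => t; rewrite in_itv /= => tI.
  by have [] := dg t tI.
move=> t; rewrite in_itv /= => tI; rewrite /g scale1r scale0r addr0 subr0 mulr1 => e.
by exists t.
Qed.

Definition evec (j : 'I_n) : 'rV[R]_n := delta_mx 0 j.

(** The increment is split along the path that changes one coordinate at a time, with the
    one-variable mean value theorem on each edge. In the max norm every point of the path is within
    [|d|] of y. *)
Lemma MVTn f y (e : R) (d : 'rV[R]_n) :
  (forall z, `|z - y| < e -> forall j, derivable f z (evec j)) -> `|d| < e ->
  exists xi : 'I_n -> 'rV[R]_n, (forall j, `|xi j - y| <= `|d|) /\
    f (y + d) - f y = \sum_j d 0 j * 'D_(evec j) f (xi j).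
Proof.
move=> df de.
pose p (k : nat) : 'rV[R]_n := \row_j (if (j < k)%N then d 0 j else 0).
have pS (k : 'I_n) : p k.+1 = p k + d 0 k *: evec k.
  apply/rowP => j; rewrite !mxE /= ltnS; case: (ltngtP j k) => jk /=.
  - by rewrite (_ : (j == k) = false) ?mulr0 ?addr0 //; apply/eqP => E; rewrite E ltnn in jk.
  - by rewrite (_ : (j == k) = false) ?mulr0 ?addr0 //; apply/eqP => E; rewrite E ltnn in jk.
  - by rewrite (_ : (j == k)) ?mulr1 ?add0r //; [rewrite (val_inj jk) | apply/eqP/val_inj].
have bnd (k : 'I_n) (t : R) : 0 <= t <= 1 -> `|p k + t *: (d 0 k *: evec k)| <= `|d|.
  move=> /andP[t0 t1]; rewrite [X in X <= _]/Num.norm /= mx_normrE.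
  apply/bigmax_leP; split=> //= -[i j] _ /=; rewrite (ord1 i) !mxE /=.
  have dj l : `|d 0 l| <= `|d|.
    by rewrite [X in _ <= X]/Num.norm /= mx_normrE; apply: (le_bigmax _ (fun ij => `|d ij.1 ij.2|) (0, l)).
  case: ltnP => jk.
    rewrite (_ : (j == k) = false) ?mulr0 ?addr0 ?dj //.
    by apply/eqP => E; rewrite E ltnn in jk.
  rewrite add0r normrM; case: eqP => _; last by rewrite mulr0 normr0 mulr0.
  by rewrite mulr1 (ger0_norm t0) (le_trans _ (dj k)) // ler_piMl.
have step (k : 'I_n) : exists xi, `|xi - y| <= `|d| /\
    f (y + p k.+1) - f (y + p k) = d 0 k * 'D_(evec k) f xi.
  have dd (t : R) : 0 <= t <= 1 -> derivable f (y + p k + t *: (d 0 k *: evec k)) (evec k).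
    move=> tI; apply: df; rewrite -(addrA y) addrAC subrr add0r.
    exact: le_lt_trans (bnd k t tI) de.
  have [|t tI E] := @MVT_line f (y + p k) (d 0 k *: evec k).
    by move=> t tI; have [] := derive_scale (d 0 k) (dd t tI).
  exists (y + p k + t *: (d 0 k *: evec k)); split.
    by rewrite -(addrA y) addrAC subrr add0r; exact: bnd.
  rewrite pS addrA E; have [_ ->] := derive_scale (d 0 k) (dd t tI); by [].
have [xi hxi] := choice step.
exists xi; split; first by move=> j; have [] := hxi j.
have -> : y + d = y + p n by congr (_ + _); apply/rowP => j; rewrite mxE ltn_ord.
have {2}-> : y = y + p 0%N by rewrite -[LHS]addr0; congr (_ + _); apply/rowP => j; rewrite !mxE.
rewrite -(@telescope_sumr _ 0 n (fun k => f (y + p k))) // big_mkord.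
by apply: eq_bigr => k _; have [_ ->] := hxi k.
Qed.

End Line.

(** * The chain rule in several variables *)

Section Chain.
Variable R : realType.

Lemma cvg_bigsum (V : normedModType R) (T I : Type) (F : set_system T) (FF : Filter F)
  (r : seq I) (f : I -> T -> V) (l : I -> V) :
  (forall i, f i x @[x --> F] --> l i) ->
  (\sum_(i <- r) f i x) @[x --> F] --> \sum_(i <- r) l i.
Proof.
move=> h; elim: r => [|i r IH].
  by rewrite big_nil; under eq_fun do rewrite big_nil; exact: cvg_cst.
rewrite big_cons; under eq_fun do rewrite big_cons.
exact: cvgD (h i) IH.
Qed.

Lemma cvg_rowP n (T : Type) (F : set_system T) (FF : Filter F)
  (f : T -> 'rV[R]_n) (l : 'rV[R]_n) :
  (forall j, (f x 0 j : R^o) @[x --> F] --> (l 0 j : R^o)) -> f x @[x --> F] --> l.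
Proof.
move=> h; rewrite (row_sum_delta l).
under eq_fun do rewrite (row_sum_delta (f _)).
by apply: cvg_bigsum => j; apply: cvgZr_tmp; exact: h.
Qed.

Lemma continuous_rowP n (T : topologicalType) (f : T -> 'rV[R]_n) x :
  (forall j, {for x, continuous (fun x => f x 0 j : R^o)}) -> {for x, continuous f}.
Proof. by move=> h; apply: cvg_rowP => j; exact: h. Qed.

Variables (m n : nat).
Implicit Types (F : 'rV[R]_m -> 'rV[R]_n) (f : 'rV[R]_n -> R^o).

Lemma open_ballP (p : nat) (V : set 'rV[R]_p) y : open V -> V y ->
  exists2 e : R, 0 < e & forall z, `|z - y| < e -> V z.
Proof.
move=> oV Vy; have /nbhs_ballP [e /= e0 he] : nbhs y V by exact: open_nbhs_nbhs.
by exists e => // z hz; apply: he; rewrite -ball_normE /= distrC.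
Qed.

(** Partial derivatives that are continuous at [F x] take the place of a total derivative: [MVTn]
    writes the increment of f through partial derivatives at nearby points, and continuity gives the
    limit. *)
Lemma is_derive_comp F f x v (V : set 'rV[R]_n) : open V -> V (F x) ->
  (forall j, derivable (fun x => F x 0 j : R^o) x v) ->
  (forall j z, V z -> derivable f z (evec R j)) ->
  (forall j, {for F x, continuous (fun z => 'D_(evec R j) f z)}) ->
  is_derive x v (f \o F) (\sum_j 'D_v (fun x => F x 0 j : R^o) x * 'D_(evec R j) f (F x)).
Proof.
move=> oV VFx dF df cf.
have [e e0 he] := open_ballP oV VFx.
pose d (h : R) := F (h *: v + x) - F x.
have dl : d h @[h --> 0^'] --> (0 : 'rV[R]_n).
  apply: cvg_rowP => j; rewrite mxE.
  have E : {near 0^', (fun h : R => h * (h^-1 *: (((fun x => F x 0 j : R^o) \o shift x) (h *: v) - F x 0 j)))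
     =1 (fun h => d h 0 j : R^o)}.
    near=> h; rewrite /d /= !mxE /GRing.scale /= mulVKf //.
    by near: h; exact: nbhs_dnbhs_neq.
  apply: cvg_trans (near_eq_cvg E) _.
  have h0 : (fun h : R => h) @ (0 : R)^' --> (0 : R) by exact: nbhs_dnbhs.
  by have := cvgM h0 (dF j); rewrite mul0r; apply.
(* For large increments the intermediate points are set to 0 arbitrarily; only h near 0 enters the
   limit. *)
have /choice [xi hxi] : forall h, exists xi : 'I_n -> 'rV[R]_n, `|d h| < e ->
    (forall j, `|xi j - F x| <= `|d h|) /\
    f (F x + d h) - f (F x) = \sum_j d h 0 j * 'D_(evec R j) f (xi j).
  move=> h; case: (pselect (`|d h| < e)) => [hd|]; last by exists (fun=> 0).
  have [z hz j|xi hx] := @MVTn _ _ f (F x) e (d h) _ hd; last by exists xi.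
  by apply: df; apply: he.
have nd : \forall h \near 0^', `|d h| < e.
  by move/cvgr0_norm_lt: dl; apply.
have xil j : xi h j @[h --> 0^'] --> F x.
  apply/cvgrPdist_lt => eps eps0.
  have nd2 : \forall h \near 0^', `|d h| < eps by move/cvgr0_norm_lt: dl; apply.
  near=> h; rewrite distrC; apply: (@le_lt_trans _ _ `|d h|).
    by have [//|] := hxi h; [near: h|move=> + _; apply].
  by near: h.
have lim : (\sum_j (h^-1 * d h 0 j) * 'D_(evec R j) f (xi h j)) @[h --> 0^'] -->
    (\sum_j 'D_v (fun x => F x 0 j : R^o) x * 'D_(evec R j) f (F x) : R^o).
  apply: cvg_bigsum => j; apply: cvgM.
    under eq_fun do rewrite !mxE.
    exact: dF j.
  exact: (cvg_comp _ _ (xil j) (cf j)).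
have E : {near 0^', (fun h : R => \sum_j (h^-1 * d h 0 j) * 'D_(evec R j) f (xi h j))
   =1 (fun h : R => h^-1 *: (((f \o F) \o shift x) (h *: v) - (f \o F) x))}.
  near=> h => /=; have [|_ ] := hxi h; first by near: h.
  rewrite {1}/d (addrC (F x)) subrK => ->; rewrite scaler_sumr.
  by apply: eq_bigr => j _; rewrite /GRing.scale /= mulrA.
have lim2 := cvg_trans (near_eq_cvg E) lim.
apply: DeriveDef; last by apply: cvg_lim => //; exact: lim2.
by apply/cvg_ex; eexists; exact: lim2.
Unshelve. all: by end_near. Qed.

Lemma Ck_sum (p : nat) k (U : set 'rV[R]_p) (I : Type) (r : seq I) (f : I -> 'rV[R]_p -> R^o) :
  open U -> (forall i, Ck k U (f i)) -> Ck k U (fun x => \sum_(i <- r) f i x).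
Proof.
move=> oU h; elim: r => [|i r IH].
  by under eq_fun do rewrite big_nil; exact: Ck_cst.
by under eq_fun do rewrite big_cons; exact: Ck_add.
Qed.

Lemma Ck_comp k (U : set 'rV[R]_m) (V : set 'rV[R]_n) F f : open U -> open V ->
  (forall j, Ck k U (fun x => F x 0 j)) -> (forall x, U x -> V (F x)) ->
  Ck k V f -> Ck k U (f \o F).
Proof.
move=> oU oV; elim: k F f => [|k IH] F f hF FV hf.
  split=> // x Ux; apply: continuous_comp; last by apply: (Ck_cont hf); exact: FV.
  by apply: continuous_rowP => j; exact: Ck_cont (hF j) Ux.
have [cf df] := hf.
split.
  move=> x Ux; apply: continuous_comp; last by apply: (Ck_cont hf); exact: FV.
  by apply: continuous_rowP => j; exact: Ck_cont (hF j) Ux.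
move=> v.
have D x : U x -> is_derive x v (f \o F)
    (\sum_j 'D_v (fun x => F x 0 j : R^o) x * 'D_(evec R j) f (F x)).
  move=> Ux; apply: is_derive_comp oV (FV _ Ux) _ _ _; first 1 last.
  - by move=> j z Vz; have [_ /(_ (evec R j)) [+ _]] := hf; apply.
  - move=> j; have [_ /(_ (evec R j)) [_ h]] := hf.
    by apply: Ck_cont h _; exact: FV.
  by move=> j; have [_ /(_ v) [+ _]] := hF j; apply.
split; first by move=> x /D [].
apply: (Ck_eq (f := fun x => \sum_j 'D_v (fun x => F x 0 j : R^o) x * ('D_(evec R j) f \o F) x)) => //.
  by move=> x /D [_ <-].
apply: Ck_sum => // j; apply: Ck_mul => //.
  by have [_ /(_ v) []] := hF j.
apply: IH => //; first by move=> i; exact: Ck_S.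
by have [_ /(_ (evec R j)) []] := hf.
Qed.

End Chain.

(** * Flat functions and bump functions *)

Section Bump.
Variables (R : realType) (n : nat).
Implicit Types (U : set 'rV[R]_n) (f h q : 'rV[R]_n -> R^o).

Lemma cvg_le_dist (T : Type) (F : set_system T) (FF : Filter F) (f : T -> R^o) (l : R^o)
    (B : T -> R) :
  (forall z, `|f z - l| <= B z) -> B z @[z --> F] --> (0 : R) -> f z @[z --> F] --> l.
Proof.
move=> fB BL; apply/cvgrPdist_lt => e e0.
move/cvgrPdist_lt/(_ e e0) : BL; apply: filterS => z.
rewrite sub0r normrN distrC => h; apply: le_lt_trans (fB z) _.
exact: le_lt_trans (ler_norm _) h.
Qed.

(** With y = 1/q, [expR y] dominates its Taylor term of order m + 2. The factor q^2 that is left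
    over makes both the function and its difference quotient vanish at a zero of q. *)
Lemma flat_bound (m : nat) (q : R) : 0 < q ->
  q^-1 ^+ m * expR (- q^-1) <= (m.+2)`!%:R * q ^+ 2.
Proof.
move=> q0; set y := q^-1; have y0 : 0 < y by rewrite invr_gt0.
rewrite expRN ler_pdivrMr ?expR_gt0 //.
have h1 : y ^+ m.+2 / (m.+2)`!%:R <= expR y.
  by apply: le_trans (expR_ge1Dxn m.+1 (ltW y0)); rewrite lerDr.
have f0 : (0 : R) < (m.+2)`!%:R by rewrite ltr0n fact_gt0.
rewrite ler_pdivrMr // in h1.
have -> : y ^+ m = q ^+ 2 * y ^+ m.+2.
  by rewrite -[m.+2]/(2 + m)%N exprD mulrA -exprMn /y divff ?gt_eqF // expr1n mul1r.
by rewrite (mulrC _%:R) -[leRHS]mulrA ler_pM2l ?exprn_gt0 // mulrC.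
Qed.

Variables (U : set 'rV[R]_n) (q : 'rV[R]_n -> R^o).
Hypotheses (oU : open U) (sq : smooth_on U q).

(** The exponent m and the factor h are parameters so that the family contains its own directional
    derivatives, which the induction of [flatf_smooth] needs. *)
Definition flatf (m : nat) h : 'rV[R]_n -> R^o := fun x =>
  if 0 < q x then h x * ((q x)^-1 ^+ m * expR (- (q x)^-1)) else 0.

Lemma flatf_bound m h x z : q x <= 0 ->
  `|flatf m h z| <= `|h z| * ((m.+2)`!%:R * (q z - q x) ^+ 2).
Proof.
move=> qx; rewrite /flatf; case: ifPn => [qz|_]; last first.
  by rewrite normr0 mulr_ge0 // mulr_ge0 // ?ler0n // sqr_ge0.
rewrite normrM ler_wpM2l // ger0_norm; last first.
  by rewrite mulr_ge0 ?expR_ge0 // exprn_ge0 // invr_ge0 ltW.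
apply: (le_trans (flat_bound m qz)); rewrite ler_wpM2l ?ler0n //.
by rewrite lerXn2r // ?nnegrE ?(ltW qz) ?subr_ge0 ?(le_trans qx (ltW qz)) // lerBrDl gerDr.
Qed.

(** The numerator of the derivative of h q^-m exp(-1/q) over the common denominator q^(m+2). *)
Definition flatf_d m h v : 'rV[R]_n -> R^o := fun x =>
  'D_v h x * q x ^+ 2 - m%:R * h x * q x * 'D_v q x + h x * 'D_v q x.

Lemma flatf_cont0 m h x : U x -> q x <= 0 -> {for x, continuous h} -> {for x, continuous (flatf m h)}.
Proof.
move=> Ux qx ch; have cq : {for x, continuous q} := Ck_cont (sq 0%N) Ux.
have L : (`|h z| * ((m.+2)`!%:R * (q z - q x) ^+ 2)) @[z --> x] --> (0 : R).
  rewrite (_ : 0 = `|h x| * ((m.+2)`!%:R * (q x - q x) ^+ 2) :> R); last first.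
    by rewrite subrr expr2 !mulr0.
  have c1 : `|h z| @[z --> x] --> `|h x| by exact: (cvg_norm ch).
  have c2 : (q z - q x) @[z --> x] --> q x - q x by exact: (cvgB cq (cvg_cst _)).
  exact: (cvgM c1 (cvgM (cvg_cst _) (cvgM c2 c2))).
have z0 : flatf m h x = 0 by rewrite /flatf ltNge qx.
suff h1 : flatf m h @ x --> flatf m h x by exact: h1.
apply: (@cvg_le_dist _ (nbhs x) _ _ _ _ _ L) => z.
by rewrite z0 subr0; exact: flatf_bound.
Qed.

(** Where q > 0 this is the product rule. Where q <= 0 the difference quotient is bounded by a
    multiple of (q(x + t v) - q(x))^2 / t, which tends to 0. *)
Lemma flatf_derive m h x v : U x -> {for x, continuous h} -> derivable h x v ->
  is_derive x v (flatf m h) (flatf m.+2 (flatf_d m h v) x).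
Proof.
move=> Ux ch dh; have cq : {for x, continuous q} := Ck_cont (sq 0%N) Ux.
have dq : derivable q x v by have [_ /(_ v) [+ _]] := sq 1%N; apply.
case: (ltP 0 (q x)) => [qx|qx].
  pose g z : R^o := h z * ((q z)^-1 ^+ m * expR (- (q z)^-1)).
  have ng : \forall z \near x, g z = flatf m h z.
    have : \forall z \near x, 0 < q z by exact: (cvgr_gt (q x) cq).
    by apply: filterS => z qz; rewrite /flatf qz.
  apply: near_eq_is_derive ng _.
  rewrite -[x]addr0 -[X in x + X](scale0r v); apply/line_derive.
  have e0 : x + 0 *: v = x by rewrite scale0r addr0.
  have iq : is_derive (0 : R) (1 : R) (fun t => q (x + t *: v) : R) ('D_v q x).
    by apply/line_derive; rewrite e0; apply/derivableP.
  have ih : is_derive (0 : R) (1 : R) (fun t => h (x + t *: v) : R) ('D_v h x).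
    by apply/line_derive; rewrite e0; apply/derivableP.
  have q0 : q (x + 0 *: v) != 0 by rewrite e0 gt_eqF.
  have iv := @is_deriveV _ _ _ _ _ q0 iq.
  have im := @is_deriveX _ _ _ m _ _ _ iv; 
  have ie := @is_derive1_comp _ (@expR R) _ _ _ _ (is_derive_expR _) (@is_deriveN _ _ _ _ _ _ _ iv).
  have := @is_deriveM _ _ _ _ _ _ _ _ ih (@is_deriveM _ _ _ _ _ _ _ _ im ie).
  move=> hh.
  have E : (fun t : R => g (x + t *: v)) = ((fun t => h (x + t *: v) : R) *
     (((fun t => (q (x + t *: v))^-1) ^+ m) * (expR (R:=R) \o - (fun t => (q (x + t *: v))^-1)))).
    by apply/funext => t; rewrite /g !fctE.
  rewrite E; apply: is_derive_eq.
  rewrite ?fctE.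
  rewrite ?e0 /flatf qx /flatf_d /GRing.scale /= ?e0;
  have qn : q x != 0 by rewrite gt_eqF.
  set w := expR _; set y := q x; set a := h x; set b := 'D_v q x; set c := 'D_v h x.
  rewrite -/y in qn; move: w y a b c qn.
  case: (m) => [|m'] w y a b c qn /=; first by rewrite !expr0 mulr0n; field.
  by rewrite !exprS; set u := (y^-1 ^+ m'); field.
have zE : flatf m h x = 0 by rewrite /flatf ltNge qx.
have -> : flatf m.+2 (flatf_d m h v) x = 0 by rewrite /flatf ltNge qx.
have L : (fun t : R => t^-1 *: ((flatf m h \o shift x) (t *: v) - flatf m h x)) @ 0^' --> (0 : R^o).
  pose B (t : R) := `|h (t *: v + x)| * ((m.+2)`!%:R * (`|t^-1 *: (q (t *: v + x) - q x)| * `|q (t *: v + x) - q x|)).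
  have tx : (fun t : R => t *: v + x) @ 0^' --> x.
    rewrite -[X in _ --> X]add0r -(scale0r v); apply: cvgD; last exact: cvg_cst.
    by apply: cvgZr_tmp; exact: nbhs_dnbhs.
  have LB : B t @[t --> 0^'] --> (0 : R).
    have c1 : `|h (t *: v + x)| @[t --> 0^'] --> `|h x| by exact: (cvg_norm (cvg_comp _ _ tx ch)).
    have c2 : `|t^-1 *: (q (t *: v + x) - q x)| @[t --> 0^'] --> `|'D_v q x| by exact: (cvg_norm dq).
    have c3 : `|q (t *: v + x) - q x| @[t --> 0^'] --> `|q x - q x|.
      exact: (cvg_norm (cvgB (cvg_comp _ _ tx cq) (cvg_cst (q x)))).
    have := cvgM c1 (cvgM (cvg_cst ((m.+2)`!%:R : R^o)) (cvgM c2 c3)).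
    by rewrite subrr normr0 !mulr0; apply.
  apply: (@cvg_le_dist _ _ _ _ _ _ _ LB) => t.
  rewrite zE !subr0 /B /GRing.scale /= normrM.
  have t0 : `|t^-1| >= 0 by [].
  apply: (le_trans (ler_wpM2l t0 (flatf_bound m h _ qx))).
  rewrite -[(q _ - q x) ^+ 2]real_normK ?num_real //.
  by rewrite normrM le_eqVlt; apply/orP; left; apply/eqP; ring.
apply: DeriveDef; first by apply/cvg_ex; eexists; exact: L.
by apply: cvg_lim => //; exact: L.
Unshelve. all: by end_near. Qed.

End Bump.

Section SmoothOn.
Variables (R : realType) (n : nat).
Implicit Types (U V : set 'rV[R]_n) (f g h : 'rV[R]_n -> R^o).

Lemma smooth_on_derive U f v : smooth_on U f -> smooth_on U (fun x => 'D_v f x).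
Proof. by move=> sf k; have [_ /(_ v) []] := sf k.+1. Qed.

Lemma smooth_on_cont U f x : smooth_on U f -> U x -> {for x, continuous f}.
Proof. by move=> sf; apply: Ck_cont (sf 0%N). Qed.

Lemma smooth_on_derivable U f x v : smooth_on U f -> U x -> derivable f x v.
Proof. by move=> sf Ux; have [_ /(_ v) [+ _]] := sf 1%N; apply. Qed.

Lemma smooth_on_add U f g : open U -> smooth_on U f -> smooth_on U g -> smooth_on U (fun x => f x + g x).
Proof. by move=> oU sf sg k; apply: Ck_add. Qed.

Lemma smooth_on_mul U f g : open U -> smooth_on U f -> smooth_on U g -> smooth_on U (fun x => f x * g x : R^o).
Proof. by move=> oU sf sg k; apply: Ck_mul. Qed.

Lemma smooth_on_cst U (a : R) : smooth_on U (fun=> a).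
Proof. by move=> k; apply: Ck_cst. Qed.

Lemma smooth_on_coord U i : smooth_on U (fun x => x 0 i).
Proof. by move=> k; apply: Ck_coord. Qed.

Lemma smooth_on_sum U (I : Type) (r : seq I) (F : I -> 'rV[R]_n -> R^o) :
  open U -> (forall i, smooth_on U (F i)) -> smooth_on U (fun x => \sum_(i <- r) F i x).
Proof. by move=> oU h k; apply: Ck_sum => // i; exact: h. Qed.

Lemma smooth_on_inv U f : open U -> (forall x, U x -> f x != 0) -> smooth_on U f ->
  smooth_on U (fun x => (f x)^-1 : R^o).
Proof. by move=> oU f0 sf k; apply: Ck_inv. Qed.

Lemma smooth_on_sub U V f : V `<=` U -> smooth_on U f -> smooth_on V f.
Proof. by move=> VU sf k; apply: Ck_sub (sf k). Qed.

Lemma smooth_on_eq U f g : open U -> (forall x, U x -> f x = g x) -> smooth_on U f -> smooth_on U g.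
Proof. by move=> oU fg sf k; apply: Ck_eq (sf k). Qed.

Lemma smooth_on_local U f :
  (forall x, U x -> exists V, V x /\ smooth_on V f) -> smooth_on U f.
Proof. by move=> h k; apply: Ck_local => x /h [V [Vx sV]]; exists V; split => //; exact: sV. Qed.

Lemma flatf_smooth U (q : 'rV[R]_n -> R^o) m h : open U -> smooth_on U q -> smooth_on U h ->
  smooth_on U (flatf q m h).
Proof.
move=> oU sq sh k; elim: k m h sh => [|k IH] m h sh.
  split=> // x Ux; case: (ltP 0 (q x)) => qx; last first.
    exact: (@flatf_cont0 _ _ _ _ sq m h x Ux qx (smooth_on_cont sh Ux)).
  have cq : {for x, continuous q} := smooth_on_cont sq Ux.
  have ch : {for x, continuous h} := smooth_on_cont sh Ux.
  have q0 : q x != 0 by rewrite gt_eqF.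
  apply: (@continuous_near_eq _ _ (fun z => h z * ((q z)^-1 ^+ m * expR (- (q z)^-1)) : R^o)).
    have : \forall z \near x, 0 < q z by exact: (cvgr_gt (q x) cq).
    by apply: filterS => z qz; rewrite /flatf qz.
  have ci : {for x, continuous (fun z => (q z)^-1)} by exact: continuousV.
  have cX : {for x, continuous (fun z => (q z)^-1 ^+ m)}.
    exact: (continuous_comp ci (@exprn_continuous R m _)).
  have ce : {for x, continuous (fun z => expR (- (q z)^-1))}.
    exact: (continuous_comp (continuousN ci) (@continuous_expR R _)).
  exact: (continuousM ch (continuousM cX ce)).
split; first by move=> x Ux; exact: Ck_cont (IH m h sh) Ux.
move=> v.
have D x : U x -> is_derive x v (flatf q m h) (flatf q m.+2 (flatf_d q m h v) x).
  move=> Ux; apply: (flatf_derive sq) => //; first exact: smooth_on_cont sh Ux.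
  exact: smooth_on_derivable sh Ux.
split; first by move=> x /D [].
apply: (Ck_eq (f := flatf q m.+2 (flatf_d q m h v))) => //.
  by move=> x /D [_ ->].
apply: IH; rewrite /flatf_d.
have sdq := smooth_on_derive v sq; have sdh := smooth_on_derive v sh.
apply: smooth_on_add => //; last exact: smooth_on_mul.
apply: smooth_on_add => //; first by do 2?[apply: smooth_on_mul => //].
apply: smooth_on_eq (smooth_on_mul oU (smooth_on_cst U (- m%:R)) (smooth_on_mul oU sh (smooth_on_mul oU sq sdq))) => //.
by move=> x Ux; ring.
Qed.

(** The quotient G(q1) / (G(q1) + G(q2)) of flat functions, with q1 positive inside radius e and q2
    positive outside radius e/2. Radii are measured by the sum of squares, which is smooth; it
    dominates the square of the max norm, whence the last clause. *)
Lemma bump_rV (x0 : 'rV[R]_n) (e : R) : 0 < e -> exists b : 'rV[R]_n -> R^o,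
  [/\ smooth_on setT b, \forall z \near x0, b z = 1 & forall z, e <= `|z - x0| -> b z = 0].
Proof.
move=> e0; pose s (z : 'rV[R]_n) : R^o := \sum_i (z 0 i - x0 0 i) * (z 0 i - x0 0 i).
have ss : smooth_on setT s.
  apply: smooth_on_sum => [|i]; first exact: openT.
  have hi : smooth_on setT (fun z : 'rV[R]_n => z 0 i - x0 0 i).
    exact: smooth_on_add openT (smooth_on_coord _ _) (smooth_on_cst _ _).
  exact (smooth_on_mul openT hi hi).
pose q1 z : R^o := e ^+ 2 - s z; pose q2 z : R^o := s z - (e / 2) ^+ 2.
have sq1 : smooth_on setT q1.
  apply: smooth_on_eq openT _ (smooth_on_add openT (smooth_on_cst _ (e ^+ 2)) (smooth_on_mul openT (smooth_on_cst _ (-1)) ss)) => z _.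
  by rewrite /q1 mulN1r.
have sq2 : smooth_on setT q2 by exact: smooth_on_add openT ss (smooth_on_cst _ _).
pose G q := flatf (R:=R) (n:=n) q 0 (fun=> 1).
have sG q : smooth_on setT q -> smooth_on setT (G q).
  by move=> sq; apply: flatf_smooth openT sq (smooth_on_cst _ _).
have Gge q z : 0 <= G q z.
  by rewrite /G /flatf; case: ifP => // _; rewrite mul1r mul1r expR_ge0.
have Ggt q z : 0 < q z -> 0 < G q z.
  by move=> h; rewrite /G /flatf h mul1r mul1r expR_gt0.
have G0 q z : q z <= 0 -> G q z = 0 by move=> h; rewrite /G /flatf ltNge h.
have pos z : G q1 z + G q2 z != 0.
  rewrite gt_eqF //; case: (ltP 0 (q1 z)) => h1; first by rewrite ltr_wpDr // Ggt.
  rewrite ltr_wpDl // Ggt // /q2 subr_gt0.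
  move: h1; rewrite /q1 subr_le0 => /(lt_le_trans _); apply.
  by rewrite expr_div_n ltr_pdivrMr ?exprn_gt0 // ltr_pMr ?exprn_gt0 // expr2; lra.
exists (fun z => G q1 z * (G q1 z + G q2 z)^-1); split.
- apply: smooth_on_mul openT (sG _ sq1) _; apply: smooth_on_inv openT _ _ => //.
  exact: smooth_on_add openT (sG _ sq1) (sG _ sq2).
- have cs : {for x0, continuous s} by exact: smooth_on_cont ss _.
  have s0 : s x0 = 0 by rewrite /s big1 // => i _; rewrite subrr mul0r.
  have : \forall z \near x0, s z < (e / 2) ^+ 2.
    by apply: (cvgr_lt (s x0) cs); rewrite s0 exprn_gt0 // divr_gt0.
  apply: filterS => z sz; have q2z : G q2 z = 0 by rewrite G0 // subr_le0 ltW.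
  by have := pos z; rewrite q2z addr0 => h; rewrite divff.
move=> z ez; rewrite G0 ?mul0r // subr_le0.
have n0 : 0 < `|z - x0| by exact: lt_le_trans ez.
have [i hi] : exists i, `|z - x0| <= `|z 0 i - x0 0 i|.
  apply: contrapT => hn.
  have : `|z - x0| < `|z - x0|.
    rewrite {1}[X in X < _]/Num.norm /= mx_normrE; apply/bigmax_ltP; split=> // -[i j] _ /=.
    by rewrite (ord1 i) !mxE ltNge; apply/negP => h; apply: hn; exists j.
  by rewrite ltxx.
rewrite /s (bigD1 i) //=; apply: le_trans (_ : _ <= (z 0 i - x0 0 i) ^+ 2) _.
  by rewrite -[leRHS]real_normK ?num_real // lerXn2r ?nnegrE ?(ltW e0) // (le_trans ez).
by rewrite expr2 lerDl sumr_ge0 // => j _; rewrite -expr2 sqr_ge0.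
Qed.

End SmoothOn.

(** * Integrals over [0, 1] and differentiation under the integral sign *)

Section Int01.
Variable R : realType.
Implicit Types phi psi : R -> R.

Definition int01 phi : R := \int[@lebesgue_measure R]_(t in `[0, 1]) phi t.

Definition cont01 phi : Prop := {within `[(0 : R), 1], continuous phi}.

Lemma int01_integrable phi : cont01 phi ->
  (@lebesgue_measure R).-integrable `[(0:R), 1] (EFin \o phi).
Proof. by move=> cphi; apply: continuous_compact_integrable => //; exact: segment_compact. Qed.

Lemma m01 : measurable (`[(0:R), 1]%classic : set (measurableTypeR R)).
Proof. exact: measurable_itv. Qed.

Lemma int01_cst c : int01 (fun=> c) = c.
Proof.
have E : @lebesgue_measure R `[0, 1]%classic = 1%:E.
  by rewrite lebesgue_measure_itv /= lte_fin ltr01 -EFinB subr0.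
rewrite /int01 Rintegral_cst; last exact: m01.
have -> : fine (@lebesgue_measure R `[0, 1]%classic) = 1 by rewrite E.
by rewrite mulr1.
Qed.

Lemma int01D phi psi : cont01 phi -> cont01 psi ->
  int01 (fun t => phi t + psi t) = int01 phi + int01 psi.
Proof. by move=> c1 c2; exact: (RintegralD m01 (int01_integrable c1) (int01_integrable c2)). Qed.

Lemma int01Z c phi : cont01 phi -> int01 (fun t => c * phi t) = c * int01 phi.
Proof. by move=> c1; exact: (RintegralZl c m01 (int01_integrable c1)). Qed.

Lemma int01_le phi M : cont01 phi -> (forall t, 0 <= t <= 1 -> `|phi t| <= M) -> `|int01 phi| <= M.
Proof.
move=> c1 hM; apply: le_trans (le_normr_Rintegral m01 (int01_integrable c1)) _.
rewrite -[leRHS]int01_cst; apply: le_Rintegral; first exact: m01.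
- by apply: int01_integrable => x; apply: cvg_norm; exact: c1.
- by apply: int01_integrable => x; exact: cvg_cst.
by move=> t /=; rewrite in_itv /=; exact: hM.
Qed.

Lemma int01_ext phi psi : (forall t, 0 <= t <= 1 -> phi t = psi t) -> int01 phi = int01 psi.
Proof. by move=> h; apply: eq_Rintegral => t; rewrite inE /= in_itv /=; exact: h. Qed.

Lemma int01_sum (I : Type) (r : seq I) (c : I -> R) (phi : I -> R -> R) :
  (forall i, cont01 (phi i)) ->
  cont01 (fun t => \sum_(i <- r) c i * phi i t) /\
  int01 (fun t => \sum_(i <- r) c i * phi i t) = \sum_(i <- r) c i * int01 (phi i).
Proof.
move=> h; elim: r => [|i r [IH1 IH2]].
  rewrite big_nil; under eq_fun do rewrite big_nil; split; last exact: int01_cst.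
  by move=> x; exact: cvg_cst.
have ci : cont01 (fun t => c i * phi i t).
  by move=> x; apply: cvgM; [exact: cvg_cst|exact: (h i)].
rewrite big_cons; under eq_fun do rewrite big_cons; split.
  by move=> x; apply: cvgD; [exact: ci|exact: IH1].
by rewrite int01D // IH2 int01Z.
Qed.

Lemma int01_FTC F phi : (forall t : R, 0 <= t <= 1 -> is_derive t (1:R) (F : R -> R^o) (phi t)) ->
  cont01 phi -> int01 phi = F 1 - F 0.
Proof.
move=> dF cphi.
have cF (t : R) : 0 <= t <= 1 -> {for t, continuous F}.
  move=> /dF [dt _]; apply: differentiable_continuous.
  by apply/derivable1_diffP.
rewrite /int01 /Rintegral (@continuous_FTC2 _ phi F 0 1 ltr01) //.
- split.
  + move=> t; rewrite in_itv /= => /andP[t0 t1].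
    by have [] := dF t; rewrite ?ltW.
  + by apply: cvg_at_right_filter; apply: cF; rewrite lexx ler01.
  + by apply: cvg_at_left_filter; apply: cF; rewrite lexx ler01.
move=> t; rewrite in_itv /= => /andP[t0 t1].
rewrite derive1E; have [|_ ->//] := dF t; by rewrite !ltW.
Qed.

Lemma int01_derive (f df : R -> R -> R) (e M : R) : 0 < e ->
  (forall s, `|s| < e -> cont01 (f s)) ->
  (forall s t, `|s| < e -> 0 <= t <= 1 -> is_derive s (1:R) (fun s => f s t : R^o) (df s t)) ->
  (forall s t, `|s| < e -> 0 <= t <= 1 -> `|df s t| <= M) ->
  is_derive (0 : R) (1:R) (fun s => int01 (f s) : R^o) (int01 (df 0)).
Proof.
move=> e0 cf hdf hM.
have sI (s : R) : `](- e), e[%classic s -> `|s| < e by rewrite /= in_itv /= ltr_norml.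
have tI (t : R) : `[0, 1]%classic t -> 0 <= t <= 1 by rewrite /= in_itv.
have M0 : 0 <= M.
  by apply: le_trans (hM 0 0 _ _); rewrite ?normr0 ?lexx ?ler01.
have a0 : `](- e), e[%classic (0 : R) by rewrite /= in_itv /= oppr_lt0 e0.
have H1 s : `](- e), e[%classic s -> (@lebesgue_measure R).-integrable `[0, 1] (EFin \o f s).
  by move=> /sI hs; apply: int01_integrable; exact: cf.
have H2 (s t : R) : `](- e), e[%classic s -> `[0, 1]%classic t -> derivable (f^~ t : R -> R^o) s 1.
  by move=> /sI hs /tI ht; have [] := hdf s t hs ht.
have H3 : (@lebesgue_measure R).-integrable `[0, 1] (EFin \o (fun=> M)).
  by apply: int01_integrable => x; exact: cvg_cst.
have H4 (s t : R) : `](- e), e[%classic s -> `[0, 1]%classic t -> `|partial1of2 f s t| <= M.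
  move=> /sI hs /tI ht; rewrite partial1of2E; have [_ ->] := hdf s t hs ht.
  exact: hM.
apply: DeriveDef.
  exact: (derivable_under_integral m01 a0 H1 H2 (fun=> M0) H3 H4).
rewrite -derive1E (differentiation_under_integral m01 a0 H1 H2 (fun=> M0) H3 H4).
apply: int01_ext => t ht; rewrite partial1of2E.
by have [|_ ->] := hdf 0 t _ ht; rewrite ?normr0.
Qed.

End Int01.

(** * Hadamard's lemma on a ball *)

Section Hadamard.
Variables (R : realType) (n : nat) (U : set 'rV[R]_n) (x0 : 'rV[R]_n) (r : R).
Hypotheses (oU : open U) (r0 : 0 < r) (rU : forall z, `|z - x0| <= r -> U z).
Implicit Types (f h : 'rV[R]_n -> R^o).

Lemma norm_coord_le (x : 'rV[R]_n) i : `|x 0 i| <= `|x|.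
Proof.
rewrite [leRHS]/Num.norm /= mx_normrE.
exact: (le_bigmax _ (fun ij => `|x ij.1 ij.2|) (0, i)).
Qed.

Lemma ball_bounded h : smooth_on U h ->
  exists2 M : R, 0 <= M & forall z, `|z - x0| <= r -> `|h z| <= M.
Proof.
move=> sh; pose K := [set z : 'rV[R]_n | `|z - x0| <= r].
have cK : compact K.
  apply: bounded_closed_compact.
    exists (r + `|x0|); split; first exact: num_real.
    move=> M hM z /= zr; apply: le_trans (ltW hM).
    by rewrite -[z](subrK x0); apply: le_trans (ler_normD _ _) _; rewrite lerD2r.
  apply: (@preimage_closed _ _ (fun z : 'rV[R]_n => `|z - x0|) [set t : R | t <= r]); last exact: closed_le.
  move=> z _; have h1 : {for z, continuous (fun z : 'rV[R]_n => z - x0)}.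
    exact: (cvgB cvg_id (cvg_cst _)).
  exact: (cvg_norm h1).
have : bounded_set (h @` K).
  apply: compact_bounded; apply: continuous_compact cK.
  apply: continuous_in_subspaceT => z; rewrite inE => Kz.
  exact: smooth_on_cont sh (rU Kz).
move=> [M [_ hM]]; exists (Num.max 0 (M + 1)); first by rewrite le_max lexx.
move=> z zr; rewrite le_max; apply/orP; right.
by apply: hM; [rewrite ltrDl | exists z].
Qed.

Lemma seg_in x (t : R) : `|x - x0| <= r -> 0 <= t <= 1 -> `|x0 + t *: (x - x0) - x0| <= r.
Proof.
move=> xr /andP[t0 t1]; rewrite addrAC subrr add0r normrZ (ger0_norm t0).
by apply: le_trans xr; rewrite ler_piMl.
Qed.

(** The weight t^j is there for the induction: differentiating under the integral sign brings down
    one factor t, so the derivative of [had j h] is [had j.+1] of the derivative of h. *)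
Definition had (j : nat) h : 'rV[R]_n -> R^o := fun x =>
  int01 (fun t => t ^+ j * h (x0 + t *: (x - x0))).

Lemma had_cont01 j h x : smooth_on U h -> `|x - x0| <= r ->
  cont01 (fun t => t ^+ j * h (x0 + t *: (x - x0))).
Proof.
move=> sh xr; apply: continuous_in_subspaceT => t; rewrite inE /= in_itv /= => tI.
have c1 : {for t, continuous (fun t : R => t ^+ j)} by exact: exprn_continuous.
have c2 : {for t, continuous (fun t : R => x0 + t *: (x - x0))}.
  exact: (continuousD (@cst_continuous _ _ x0 t) (@scalel_continuous _ _ (x - x0) t)).
have c3 : {for t, continuous (fun t : R => h (x0 + t *: (x - x0)))}.
  exact: (continuous_comp c2 (smooth_on_cont sh (rU (seg_in xr tI)))).
exact: (continuousM c1 c3).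
Qed.

Lemma had_derive j h x v : smooth_on U h -> `|x - x0| < r ->
  is_derive x v (had j h) (had j.+1 (fun z => 'D_v h z) x).
Proof.
move=> sh xr; rewrite -[X in is_derive X](addr0 x) -[X in x + X](scale0r v).
apply/line_derive.
have sdh := smooth_on_derive v sh.
have [M M0 hM] := ball_bounded sdh.
(* Small enough that x + s v stays in the ball for |s| < e; the summand 1 covers v = 0. *)
pose e := (r - `|x - x0|) / (`|v| + 1).
have v1 : 0 < `|v| + 1 by rewrite ltr_wpDl.
have e0 : 0 < e by rewrite divr_gt0 // subr_gt0.
have sr (s : R) : `|s| < e -> `|x + s *: v - x0| <= r.
  move=> se; rewrite addrAC; apply: le_trans (ler_normD _ _) _.
  rewrite -lerBrDl normrZ; apply: le_trans (_ : e * `|v| <= _).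
    by rewrite ler_wpM2r // ltW.
  rewrite /e mulrAC ler_pdivrMr // ler_wpM2l ?subr_ge0 ?(ltW xr) //.
  by rewrite lerDl ler01.
pose fs (s t : R) := t ^+ j * h (x0 + t *: (x + s *: v - x0)).
pose ds (s t : R) := t ^+ j.+1 * 'D_v h (x0 + t *: (x + s *: v - x0)).
have -> : had j.+1 (fun z => 'D_v h z) x = int01 (ds 0).
  by rewrite /had /ds scale0r addr0.
apply: (@int01_derive R fs ds e M e0).
- by move=> s /sr; exact: had_cont01.
- move=> s t /sr hs tI; rewrite /fs /ds.
  have E (s' : R) : x0 + t *: (x + s' *: v - x0) = (x0 + t *: (x - x0)) + s' *: (t *: v).
    by rewrite (addrAC x) scalerDr !scalerA (mulrC s') addrA.
  have dh : derivable h (x0 + t *: (x + s *: v - x0)) v.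
    by apply: smooth_on_derivable sh _; apply: rU; exact: seg_in.
  have := derive_scale t dh; rewrite E => /line_derive dd.
  have -> : (fun s0 : R => t ^+ j * h (x0 + t *: (x + s0 *: v - x0)) : R^o) =
      (t ^+ j) \*: (fun s0 : R => h (x0 + t *: (x - x0) + s0 *: (t *: v))).
    by apply/funext => s'; rewrite E.
  by apply: is_derive_eq; rewrite exprSr -mulrA /GRing.scale /= .
move=> s t /sr hs tI; rewrite /ds normrM.
have h1 : `|t ^+ j.+1| <= 1.
  by move/andP: tI => [t0 t1]; rewrite ger0_norm ?exprn_ge0 // exprn_ile1.
apply: le_trans (ler_wpM2r (normr_ge0 _) h1) _; rewrite mul1r.
by apply: hM; exact: seg_in.
Qed.

(** A Lipschitz estimate: [MVTn] under the integral, with the partial derivatives bounded on the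
    closed ball by compactness. *)
Lemma had_continuous j h x : smooth_on U h -> `|x - x0| < r -> {for x, continuous (had j h)}.
Proof.
move=> sh xr.
have /choice [M hM] : forall i : 'I_n, exists M : R, 0 <= M /\
    forall z, `|z - x0| <= r -> `|'D_(evec R i) h z| <= M.
  by move=> i; have [M ? ?] := ball_bounded (smooth_on_derive (evec R i) sh); exists M.
pose L := \sum_i M i.
pose e := r - `|x - x0|.
have e0 : 0 < e by rewrite subr_gt0.
have lip y : `|y - x| < e -> `|had j h y - had j h x| <= `|y - x| * L.
  move=> yx.
  have yr : `|y - x0| <= r.
    rewrite -[y](subrK x) -addrA; apply: le_trans (ler_normD _ _) _.
    by rewrite -lerBrDr ltW.
  have cy := @had_cont01 j h y sh yr; have cx := @had_cont01 j h x sh (ltW xr).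
  have -> : had j h y - had j h x = int01 (fun t => t ^+ j * h (x0 + t *: (y - x0))
      + (-1) * (t ^+ j * h (x0 + t *: (x - x0)))).
    rewrite int01D //; first by rewrite int01Z // mulN1r.
    by move=> t; exact: (cvgM (cvg_cst _) (cx t)).
  apply: int01_le.
    move=> t; apply: cvgD; first exact: cy.
    exact: (cvgM (cvg_cst _) (cx t)).
  move=> t tI; rewrite mulN1r -mulrBr normrM.
  have h1 : `|t ^+ j| <= 1.
    by move/andP: tI => [t0 t1]; rewrite ger0_norm ?exprn_ge0 // exprn_ile1.
  apply: le_trans (ler_wpM2r (normr_ge0 _) h1) _; rewrite mul1r.
  have td : `|t *: (y - x)| <= `|y - x|.
    by move/andP: tI => [t0 t1]; rewrite normrZ (ger0_norm t0) ler_piMl.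
  have xt : `|x0 + t *: (x - x0) - x0| <= `|x - x0|.
    by move/andP: tI => [t0 t1]; rewrite addrAC subrr add0r normrZ (ger0_norm t0) ler_piMl.
  have -> : x0 + t *: (y - x0) = x0 + t *: (x - x0) + t *: (y - x).
    by rewrite -addrA -scalerDr; congr (_ + _ *: _); rewrite [RHS]addrC addrA subrK.
  have inr z : `|z - (x0 + t *: (x - x0))| < e -> `|z - x0| <= r.
    move=> hz; rewrite -[z](subrK (x0 + t *: (x - x0))) -addrA.
    apply: le_trans (ler_normD _ _) _; rewrite /e in hz.
    by have := lerD (ltW hz) xt; rewrite subrK.
  have [z hz i|xi [xi1 ->]] := @MVTn _ _ h (x0 + t *: (x - x0)) e (t *: (y - x)) _ (le_lt_trans td yx).
    by apply: smooth_on_derivable sh _; apply: rU; exact: inr hz.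
  apply: le_trans (ler_norm_sum _ _ _) _; rewrite /L mulr_sumr; apply: ler_sum => i _.
  rewrite normrM; apply: ler_pM => //.
    exact: le_trans (norm_coord_le _ _) td.
  have [_] := hM i; apply; apply: inr.
  exact: le_lt_trans (xi1 i) (le_lt_trans td yx).
suff h1 : had j h @ x --> had j h x by exact: h1.
apply/(@cvgrPdist_lt _ R^o _ (nbhs x) (nbhs_filter x)) => eps eps0.
have L0 : 0 <= L by apply: sumr_ge0 => i _; have [] := hM i.
have nx : \forall y \near x, `|y - x| < e.
  apply/nbhs_ballP; exists e => //= y; rewrite -ball_normE /= distrC; exact.
have nx2 : \forall y \near x, `|y - x| < eps / (L + 1).
  apply/nbhs_ballP; exists (eps / (L + 1)) => /=; first by rewrite divr_gt0 // ltr_wpDl.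
  by move=> y; rewrite -ball_normE /= distrC; exact.
near=> y; rewrite distrC; apply: le_lt_trans (lip y _) _; first by near: y.
apply: (@le_lt_trans _ _ (`|y - x| * (L + 1))).
  by rewrite ler_wpM2l // lerDl ler01.
by rewrite -ltr_pdivlMr ?ltr_wpDl //; near: y.
Unshelve. all: by end_near. Qed.

Lemma had_smooth j h : smooth_on U h -> smooth_on [set z | `|z - x0| < r] (had j h).
Proof.
move=> sh k.
have oB : open [set z : 'rV[R]_n | `|z - x0| < r].
  rewrite (_ : [set z | _] = ball x0 r); first exact: ball_open.
  by apply/seteqP; split => z /=; rewrite -ball_normE /= distrC.
elim: k j h sh => [|k IH] j h sh.
  by split=> // x xr; exact: had_continuous.
split; first by move=> x xr; exact: had_continuous.
move=> v; split; first by move=> x xr; have [] := @had_derive j h x v sh xr.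
apply: (Ck_eq (f := had j.+1 (fun z => 'D_v h z))) => //.
  by move=> x xr; have [_ ->] := @had_derive j h x v sh xr.
exact: IH (smooth_on_derive v sh).
Qed.

Lemma derive_lin f x v : smooth_on U f -> U x ->
  'D_v f x = \sum_i v 0 i * 'D_(evec R i) f x.
Proof.
move=> sf Ux.
have dc i (z : 'rV[R]_n) : is_derive z v (fun z : 'rV[R]_n => z 0 i : R^o) (v 0 i).
  have dz : derivable (fun z : 'rV[R]_n => z 0 i : R^o) z v.
    exact: smooth_on_derivable (smooth_on_coord setT i) _.
  rewrite -[z]addr0 -[X in z + X](scale0r v); apply/line_derive.
  have -> : (fun t : R => (z + t *: v) 0 i : R^o) = (fun t : R => t * v 0 i + z 0 i : R^o).
    by apply/funext => t; rewrite !mxE addrC.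
  have d1 : is_derive (0 : R) (1 : R) (fun t : R => (v 0 i) *: (t : R^o)) (v 0 i *: 1).
    exact: is_deriveZ.
  have -> : (fun t : R => t * v 0 i + z 0 i : R^o) = (fun t : R => (v 0 i) *: (t : R^o)) + cst (z 0 i).
    by apply/funext => t; rewrite fctE /GRing.scale /= mulrC.
  by apply: is_derive_eq; rewrite addr0 /GRing.scale /= mulr1.
have [|||_ ->] := @is_derive_comp R n n id f x v U oU Ux.
- by move=> j; have [] := dc j x.
- by move=> j z Uz; exact: smooth_on_derivable sf Uz.
- by move=> j; exact: smooth_on_cont (smooth_on_derive _ sf) Ux.
by apply: eq_bigr => i _; congr (_ * _); have [_ ->] := dc i x.
Qed.

(** The coefficients are integrals of the partial derivatives over the segment from x0 to x. A
    derivation at x0 sees only their values at x0; this is what turns derivations into combinations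
    of partial derivatives. *)
Lemma hadamard f : smooth_on U f ->
  exists g : 'I_n -> 'rV[R]_n -> R^o,
  [/\ forall i, smooth_on [set z | `|z - x0| < r] (g i),
      forall i, g i x0 = 'D_(evec R i) f x0 &
      forall x, `|x - x0| < r -> f x = f x0 + \sum_i (x 0 i - x0 0 i) * g i x].
Proof.
move=> sf; exists (fun i => had 0 (fun z => 'D_(evec R i) f z)); split.
- by move=> i; apply: had_smooth; exact: smooth_on_derive.
- move=> i; rewrite /had -[RHS](int01_cst ('D_(evec R i) f x0)).
  by apply: int01_ext => t _; rewrite expr0 mul1r subrr scaler0 addr0.
move=> x xr.
pose phi i t := t ^+ 0 * 'D_(evec R i) f (x0 + t *: (x - x0)).
have cphi i : cont01 (phi i) by exact: (@had_cont01 0 _ x (smooth_on_derive _ sf) (ltW xr)).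
have [c1 e1] := int01_sum (index_enum 'I_n) (fun i => x 0 i - x0 0 i) cphi.
rewrite /had -/(phi _) -e1.
rewrite (@int01_FTC R (fun t => f (x0 + t *: (x - x0))) _ _ c1).
  by rewrite scale1r scale0r addr0 addrC subrK addrC subrK.
move=> t tI; apply/line_derive.
have Ut : U (x0 + t *: (x - x0)) by apply: rU; exact: seg_in (ltW xr) tI.
apply: DeriveDef; first exact: smooth_on_derivable sf Ut.
rewrite derive_lin //; apply: eq_bigr => i _.
by rewrite /phi expr0 mul1r !mxE.
Qed.

End Hadamard.

(** * Symmetry of second derivatives *)

Section Schwarz.
Variables (R : realType) (n : nat) (U : set 'rV[R]_n).
Hypothesis oU : open U.
Implicit Types f : 'rV[R]_n -> R^o.

Lemma line_derive0 f x v (d : R) :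
  is_derive x v f d <-> is_derive (0 : R) (1 : R) (fun t : R => f (x + t *: v)) d.
Proof. by have := line_derive f x v 0 d; rewrite scale0r addr0. Qed.

Lemma halves_absurd (a b A B : R) :
  `|a - A| < `|a - b| / 2 -> `|b - B| < `|a - b| / 2 -> A = B -> false.
Proof.
move=> h1 h2 E; suff : `|a - b| < `|a - b| by rewrite ltxx.
rewrite -{1}[a](subrK A) -addrA; apply: le_lt_trans (ler_normD _ _) _.
by rewrite {2}E (distrC _ b) [ltRHS](splitr `|a - b|); apply: ltrD.
Qed.

(** The mean value theorem is applied twice, first in direction u to z |-> f(z + e v) - f(z), then
    in direction v. Up to rearrangement the left side is symmetric in u and v. *)
Lemma second_difference f x u v (e : R) : smooth_on U f -> 0 < e ->
  (forall z, `|z - x| <= e * (`|u| + `|v|) -> U z) ->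
  exists xi, `|xi - x| <= e * (`|u| + `|v|) /\
    f (x + e *: u + e *: v) - f (x + e *: u) - (f (x + e *: v) - f x) =
    e * (e * 'D_v (fun z => 'D_u f z) xi).
Proof.
move=> sf e0 eU.
have inU (a b : R) : 0 <= a <= 1 -> 0 <= b <= 1 ->
    `|x + a *: (e *: u) + b *: (e *: v) - x| <= e * (`|u| + `|v|).
  move=> /andP[a0 a1] /andP[b0 b1]; rewrite -(addrA x) addrAC subrr add0r.
  apply: le_trans (ler_normD _ _) _; rewrite mulrDr !normrZ !ger0_norm ?(ltW e0) //.
  by apply: lerD; rewrite ler_piMl // mulr_ge0 // ltW.
have I0 : 0 <= (0 : R) <= 1 by rewrite lexx /= ler01.
have I1 : 0 <= (1 : R) <= 1 by rewrite ler01 /=.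
pose phi z : R^o := f (z + e *: v) - f z.
have dshift (w z : 'rV[R]_n) (d : 'rV[R]_n) : U (z + w) -> is_derive z d (fun z => f (z + w) : R^o) ('D_d f (z + w)).
  move=> Uz; apply/line_derive0.
  have -> : (fun t : R => f (z + t *: d + w) : R^o) = (fun t : R => f (z + w + t *: d)).
    by apply/funext => t; rewrite addrAC.
  apply/line_derive0; apply/derivableP.
  exact: smooth_on_derivable sf Uz.
have dphi (a : R) (d : 'rV[R]_n) : 0 <= a <= 1 ->
    is_derive (x + a *: (e *: u)) d phi ('D_d f (x + a *: (e *: u) + e *: v) - 'D_d f (x + a *: (e *: u))).
  move=> aI.
  have h1 : U (x + a *: (e *: u) + e *: v) by apply: eU; have := inU a 1 aI I1; rewrite scale1r.
  have h2 : U (x + a *: (e *: u)) by apply: eU; have := inU a 0 aI I0; rewrite scale0r addr0.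
  have d1 := dshift (e *: v) _ d h1.
  have d2 : is_derive (x + a *: (e *: u)) d f ('D_d f (x + a *: (e *: u))).
    by apply/derivableP; exact: smooth_on_derivable sf h2.
  exact: is_deriveB.
have [a aI|a aI E] := @MVT_line _ _ phi x (e *: u).
  by have [] := dphi a (e *: u) aI.
move: E; have [_ ->] := dphi a (e *: u) aI.
have DE (z : 'rV[R]_n) : U z -> 'D_(e *: u) f z = e * 'D_u f z.
  by move=> Uz; have [_ ->] := derive_scale e (smooth_on_derivable (v := u) sf Uz).
rewrite !DE; first 1 last.
- by apply: eU; have := inU a 0 aI I0; rewrite scale0r addr0.
- by apply: eU; have := inU a 1 aI I1; rewrite scale1r.
rewrite -mulrBr.
have sdf := smooth_on_derive u sf.
have [b bI|b bI ->] := @MVT_line _ _ (fun z => 'D_u f z) (x + a *: (e *: u)) (e *: v).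
  by apply: smooth_on_derivable sdf _; apply: eU; exact: inU.
have hb : U (x + a *: (e *: u) + b *: (e *: v)) by apply: eU; exact: inU.
have [_ ->] := derive_scale e (smooth_on_derivable (v := v) sdf hb).
move=> E; exists (x + a *: (e *: u) + b *: (e *: v)); split; first exact: inU.
by rewrite -E /phi.
Qed.

(** If the two mixed derivatives differed, then for small e the values at the two intermediate
    points would each be within half of the difference of their limits, although both equal the same
    second difference divided by e^2. *)
Lemma schwarz f x u v : smooth_on U f -> U x ->
  'D_v (fun z => 'D_u f z) x = 'D_u (fun z => 'D_v f z) x.
Proof.
move=> sf Ux; apply/eqP; apply: contraT => neq.
pose a := 'D_v (fun z => 'D_u f z) x; pose b := 'D_u (fun z => 'D_v f z) x.
have d0 : 0 < `|a - b| / 2 by rewrite divr_gt0 // normr_gt0 subr_eq0.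
have [r1 r10 h1] := open_ballP oU Ux.
have ca : {for x, continuous (fun z => 'D_v (fun z => 'D_u f z) z)}.
  exact: smooth_on_cont (smooth_on_derive v (smooth_on_derive u sf)) Ux.
have cb : {for x, continuous (fun z => 'D_u (fun z => 'D_v f z) z)}.
  exact: smooth_on_cont (smooth_on_derive u (smooth_on_derive v sf)) Ux.
have /nbhs_ballP [r2 /= r20 h2] := (iffLR (@cvgrPdist_lt _ R^o _ (nbhs x) (nbhs_filter x) _ _) ca) _ d0.
have /nbhs_ballP [r3 /= r30 h3] := (iffLR (@cvgrPdist_lt _ R^o _ (nbhs x) (nbhs_filter x) _ _) cb) _ d0.
pose r := Num.min r1 (Num.min r2 r3).
have r0 : 0 < r by rewrite !lt_min r10 r20 r30.
have uv : 0 < `|u| + `|v| + 1 by rewrite ltr_wpDl // addr_ge0.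
pose e := r / 2 / (`|u| + `|v| + 1).
have e0 : 0 < e by rewrite !divr_gt0.
have er : e * (`|u| + `|v|) < r.
  apply: (@le_lt_trans _ _ (r / 2)); last by rewrite ltr_pdivrMr // ltr_pMr // ltr1n.
  rewrite /e mulrAC ler_pdivrMr // ler_wpM2l ?divr_ge0 ?ltW //.
  by rewrite ltrDl ltr01.
clearbody e; have eU z : `|z - x| <= e * (`|u| + `|v|) -> U z.
  by move=> hz; apply: h1; apply: le_lt_trans hz (lt_le_trans er _); rewrite ge_min lexx.
have [xi [hxi E1]] := second_difference sf e0 eU.
have [|xi' [hxi' E2]] := @second_difference f x v u e sf e0.
  by rewrite addrC.
have E : 'D_v (fun z => 'D_u f z) xi = 'D_u (fun z => 'D_v f z) xi'.
  apply: (mulfI (lt0r_neq0 e0)); apply: (mulfI (lt0r_neq0 e0)).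
  refine (etrans (esym E1) (etrans _ E2)); clear.
  rewrite (addrAC x) !opprB addrACA [RHS]addrACA; congr (_ + _).
  exact: addrC.
have A1 : `|a - 'D_v (fun z => 'D_u f z) xi| < `|a - b| / 2.
  apply: h2; rewrite -ball_normE /= distrC; apply: le_lt_trans hxi (lt_le_trans er _).
  by rewrite !ge_min lexx orbT.
have A2 : `|b - 'D_u (fun z => 'D_v f z) xi'| < `|a - b| / 2.
  rewrite addrC in hxi'.
  apply: h3; rewrite -ball_normE /= distrC; apply: le_lt_trans (_ : _ <= e * (`|u| + `|v|)) (lt_le_trans er _).
    by move: hxi'; rewrite addrC (addrC `|v|).
  by rewrite !ge_min lexx !orbT.
exact: halves_absurd A1 A2 E.
Qed.

End Schwarz.

(** * Functions, tangent vectors and maps of manifolds *)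

Section SmoothAt.
Variable R : realType.
Implicit Types M N : mfd R.

(** The clauses of [is_mfd] that are carried through products, by [prod_ok]. *)
Definition mfd_ok M : Prop :=
  [/\ hausdorff_space M,
      (forall c, atlas (m := M) c -> is_chart c),
      (forall c d, atlas (m := M) c -> atlas (m := M) d -> compatible c d) &
      (forall x : M, exists2 c, atlas (m := M) c & cdom c x)].

Lemma is_mfd_ok M : is_mfd M -> mfd_ok M.
Proof. by case=> h1 h2 h3 h4 h5; split. Qed.

Lemma open_preim (S T : topologicalType) (U : set S) (V : set T) (g : S -> T) :
  open U -> open V -> (forall z, U z -> {for z, continuous g}) ->
  open [set z | U z /\ V (g z)].
Proof.
move=> oU oV cg; rewrite openE => z [Uz Vz]; apply: filterI.
  by apply: open_nbhs_nbhs; split.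
exact: (cg z Uz (V) (open_nbhs_nbhs (conj oV Vz))).
Qed.

(** Smoothness of a germ, in one chart. It does not depend on the chart ([smooth_at_chart]), and
    [smooth_fun] is this property at all points ([smooth_funP]), so smoothness can be checked on
    neighbourhoods. *)
Definition smooth_at M (p : M) (f : M -> R) : Prop :=
  exists c, [/\ atlas (m := M) c, cdom c p &
    exists V, [/\ open V, V (cfun c p), V `<=` cimg c & smooth_on V (f \o cinv c)]].

Section Fix.
Variable M : mfd R.
Hypothesis okM : mfd_ok M.
Implicit Types (f g : M -> R) (p : M).

Lemma chart_ok c : atlas (m := M) c -> is_chart c.
Proof. by case: okM => _ h _ _; exact: h. Qed.

Lemma cimg_dom c z : atlas (m := M) c -> cimg c z -> cdom c (cinv c z) /\ cfun c (cinv c z) = z.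
Proof. by move=> /chart_ok [_ _ h _ _] [x cx <-]; rewrite h. Qed.

Lemma transition c d : atlas (m := M) c -> atlas (m := M) d ->
  let W := [set z | cimg c z /\ cdom d (cinv c z)] in
  [/\ open W, (forall j, smooth_on W (fun z => cfun d (cinv c z) 0 j)),
      (forall z, W z -> {for z, continuous (fun z => cfun d (cinv c z))}) &
      forall p, cdom c p -> cdom d p -> W (cfun c p)].
Proof.
move=> ac ad W; have [h1 h2 h3 h4 h5] := chart_ok ac; have [g1 g2 g3 g4 g5] := chart_ok ad.
have oW : open W by apply: open_preim.
have EW : W = [set cfun c x | x in cdom c `&` cdom d].
  apply/seteqP; split => z.
    by move=> [cz dz]; have [cz1 cz2] := cimg_dom ac cz; exists (cinv c z).
  by move=> [x [cx dx] <-]; split; [exists x | rewrite h3].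
have sW j : smooth_on W (fun z => cfun d (cinv c z) 0 j).
  by rewrite EW; have [_ _ h _] := okM; exact: h.
split => //.
- by move=> z Wz; apply: continuous_rowP => j; exact: smooth_on_cont (sW j) Wz.
- by move=> p cp dp; split; [exists p | rewrite h3].
Qed.

Lemma smooth_on_comp m n (U : set 'rV[R]_m) (V : set 'rV[R]_n) (F : 'rV[R]_m -> 'rV[R]_n)
    (f : 'rV[R]_n -> R^o) :
  open U -> open V -> (forall j, smooth_on U (fun x => F x 0 j)) -> (forall x, U x -> V (F x)) ->
  smooth_on V f -> smooth_on U (f \o F).
Proof. by move=> oU oV hF FV sf k; apply: Ck_comp (sf k) => // j; exact: hF. Qed.

Lemma smooth_at_chart c p f : atlas (m := M) c -> cdom c p -> smooth_at p f ->
  exists V, [/\ open V, V (cfun c p), V `<=` cimg c & smooth_on V (f \o cinv c)].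
Proof.
move=> ac cp [d [ad dp [V [oV Vp Vd sV]]]].
have [oW sW cW pW] := transition ac ad.
have [_ _ hc _ _] := chart_ok ac; have [_ _ hd _ _] := chart_ok ad.
pose W := [set z | cimg c z /\ cdom d (cinv c z)].
pose W' := [set z | W z /\ V (cfun d (cinv c z))].
have oW' : open W' by apply: open_preim.
exists W'; split => //.
- by split; [exact: pW | rewrite hc].
- by move=> z [[]].
apply: (smooth_on_eq (f := (f \o cinv d) \o (fun z => cfun d (cinv c z)))) => //.
  by move=> z [[_ dz] _] /=; rewrite hd.
apply: smooth_on_comp oW' oV _ _ sV; last by move=> z [].
by move=> j; apply: smooth_on_sub (sW j) => z [].
Qed.

Lemma smooth_funP f : smooth_fun f <-> forall p, smooth_at p f.
Proof.
split=> [sf p|sf c ac].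
  have [_ _ _ /(_ p) [c ac cp]] := okM.
  have [h1 h2 h3 h4 h5] := chart_ok ac.
  exists c; split => //; exists (cimg c); split => //; last exact: sf.
  by exists p.
apply: smooth_on_local => z [p cp <-].
have [V [oV Vp Vc sV]] := smooth_at_chart ac cp (sf p).
by exists V.
Qed.

Lemma smooth_at_near p f g : (\forall x \near p, f x = g x) -> smooth_at p f -> smooth_at p g.
Proof.
move=> fg [c [ac cp [V [oV Vp Vc sV]]]]; have [h1 h2 h3 h4 h5] := chart_ok ac.
have [W [oW Wp hW]] : exists W : set M, [/\ open W, W p & forall x, W x -> f x = g x].
  have : nbhs p [set x | f x = g x] by exact: fg.
  by rewrite nbhsE => -[W [oW Wp] hW]; exists W.
exists c; split => //; exists [set z | V z /\ W (cinv c z)].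
have oV' : open [set z | V z /\ W (cinv c z)].
  by apply: open_preim => // z /Vc; exact: h5.
split=> //.
- by split => //; rewrite h3.
- by move=> z [/Vc].
apply: (smooth_on_eq (f := f \o cinv c)) => //.
  by move=> z [_ Wz] /=; exact: hW.
by apply: smooth_on_sub sV => z [].
Qed.

Lemma smooth_at_fam (I : eqType) (s : seq I) p (f : I -> M -> R) c :
  atlas (m := M) c -> cdom c p -> (forall i, smooth_at p (f i)) ->
  exists V, [/\ open V, V (cfun c p), V `<=` cimg c & forall i, i \in s -> smooth_on V (f i \o cinv c)].
Proof.
move=> ac cp sf; elim: s => [|i s [V [oV Vp Vc sV]]].
  have [h1 h2 h3 h4 h5] := chart_ok ac.
  by exists (cimg c); split => //; exists p.
have [V' [oV' Vp' Vc' sV']] := smooth_at_chart ac cp (sf i).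
exists (V `&` V'); split => //.
- exact: openI.
- by move=> z [/Vc].
move=> j; rewrite inE => /orP[/eqP ->|js].
  by apply: smooth_on_sub sV' => z [].
by apply: smooth_on_sub (sV j js) => z [].
Qed.

Lemma smooth_at_comp n (fc : 'rV[R]_n -> R^o) (G : M -> 'rV[R]_n) (V : set 'rV[R]_n) p :
  open V -> smooth_on V fc -> V (G p) -> (forall j, smooth_at p (fun x => G x 0 j)) ->
  smooth_at p (fun x => fc (G x)).
Proof.
move=> oV sV Vp sg.
have [_ _ _ /(_ p) [c ac cp]] := okM.
have [h1 h2 h3 h4 h5] := chart_ok ac.
have [W [oW Wp Wc sW]] := smooth_at_fam (enum 'I_n) ac cp sg.
have sW' j : smooth_on W (fun z => G (cinv c z) 0 j) by apply: sW; rewrite mem_enum.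
have oW' : open [set z | W z /\ V (G (cinv c z))].
  apply: open_preim => // z Wz; apply: continuous_rowP => j.
  exact: smooth_on_cont (sW' j) Wz.
exists c; split => //; exists [set z | W z /\ V (G (cinv c z))]; split => //.
- by split => //; rewrite h3.
- by move=> z [/Wc].
apply: (smooth_on_comp (F := fun z => G (cinv c z))) oW' oV _ _ sV; last by move=> z [].
by move=> j; apply: smooth_on_sub (sW' j) => z [].
Qed.

Lemma smooth_at_cst p (a : R) : smooth_at p (fun=> a).
Proof.
have [_ _ _ /(_ p) [c ac cp]] := okM; have [h1 h2 h3 h4 h5] := chart_ok ac.
exists c; split => //; exists (cimg c); split => //; first by exists p.
exact: smooth_on_cst.
Qed.

Lemma smooth_at_add p f g : smooth_at p f -> smooth_at p g -> smooth_at p (fun x => f x + g x).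
Proof.
move=> sf sg.
have [_ _ _ /(_ p) [c ac cp]] := okM.
have [|W [oW Wp Wc sW]] := @smooth_at_fam bool [:: true; false] p (fun b => if b then f else g) c ac cp; first by case.
exists c; split => //; exists W; split => //.
by apply: smooth_on_add => //; [apply: (sW true) | apply: (sW false)]; rewrite !inE.
Qed.

Lemma smooth_at_mul p f g : smooth_at p f -> smooth_at p g -> smooth_at p (fun x => f x * g x).
Proof.
move=> sf sg.
have [_ _ _ /(_ p) [c ac cp]] := okM.
have [|W [oW Wp Wc sW]] := @smooth_at_fam bool [:: true; false] p (fun b => if b then f else g) c ac cp; first by case.
exists c; split => //; exists W; split => //.
by apply: smooth_on_mul => //; [apply: (sW true) | apply: (sW false)]; rewrite !inE.
Qed.

Lemma smooth_at_inv p f : f p != 0 -> smooth_at p f -> smooth_at p (fun x => (f x)^-1).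
Proof.
move=> f0 [c [ac cp [V [oV Vp Vc sV]]]]; have [h1 h2 h3 h4 h5] := chart_ok ac.
exists c; split => //; exists [set z | V z /\ [set t : R | t != 0] (f (cinv c z))].
have oN : open [set t : R | t != 0].
  have -> : [set t : R | t != 0] = [set t : R | t < 0] `|` [set t : R | t > 0].
    by apply/seteqP; split=> t /=; rewrite neq_lt => /orP.
  by apply: openU; [exact: open_lt | exact: open_gt].
have oV' : open [set z | V z /\ [set t : R | t != 0] (f (cinv c z))].
  apply: open_preim => // z Vz; exact: smooth_on_cont sV Vz.
split => //.
- by split => //=; rewrite h3.
- by move=> z [/Vc].
apply: smooth_on_inv => //; first by move=> z [].
by apply: smooth_on_sub sV => z [].
Qed.

Lemma smooth_at_coord c p j : atlas (m := M) c -> cdom c p -> smooth_at p (fun x => cfun c x 0 j).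
Proof.
move=> ac cp; have [h1 h2 h3 h4 h5] := chart_ok ac.
exists c; split => //; exists (cimg c); split => //; first by exists p.
apply: smooth_on_eq h2 _ (smooth_on_coord (cimg c) j) => z /(cimg_dom ac) [_ /= ->].
by [].
Qed.

Lemma smooth_at_cont p f : smooth_at p f -> {for p, continuous (f : M -> R^o)}.
Proof.
move=> [c [ac cp [V [oV Vp Vc sV]]]]; have [h1 h2 h3 h4 h5] := chart_ok ac.
apply: (@continuous_near_eq _ _ ((f \o cinv c) \o cfun c)).
  by apply: (open_near h1 cp) => x cx /=; rewrite h3.
exact: (continuous_comp (h4 p cp) (smooth_on_cont sV Vp)).
Qed.

Lemma smooth_cst (a : R) : smooth_fun (fun _ : M => a).
Proof. by apply/smooth_funP => p; exact: smooth_at_cst. Qed.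
Lemma smooth_add f g : smooth_fun f -> smooth_fun g -> smooth_fun (fun x => f x + g x).
Proof. by move=> /smooth_funP sf /smooth_funP sg; apply/smooth_funP => p; exact: smooth_at_add. Qed.
Lemma smooth_mul f g : smooth_fun f -> smooth_fun g -> smooth_fun (fun x => f x * g x).
Proof. by move=> /smooth_funP sf /smooth_funP sg; apply/smooth_funP => p; exact: smooth_at_mul. Qed.
Lemma smooth_opp f : smooth_fun f -> smooth_fun (fun x => - f x).
Proof.
move=> sf; have -> : (fun x => - f x) = (fun x => (-1) * f x) by apply/funext => x; rewrite mulN1r.
exact: smooth_mul (smooth_cst _) sf.
Qed.
Lemma smooth_sub f g : smooth_fun f -> smooth_fun g -> smooth_fun (fun x => f x - g x).
Proof. by move=> sf sg; apply: smooth_add => //; exact: smooth_opp. Qed.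
Lemma smooth_sum (I : Type) (s : seq I) (P : pred I) (F : I -> M -> R) :
  (forall i, smooth_fun (F i)) -> smooth_fun (fun x => \sum_(i <- s | P i) F i x).
Proof.
move=> sF; elim: s => [|i s IH]; first by under eq_fun do rewrite big_nil; exact: smooth_cst.
under eq_fun do rewrite big_cons; case: (P i) => //; exact: smooth_add.
Qed.

End Fix.
End SmoothAt.

(** * Derivations, cutoff functions and local frames *)

Section Tangent.
Variable R : realType.

Lemma derive_coord n (z v : 'rV[R]_n) i :
  is_derive z v (fun z : 'rV[R]_n => z 0 i : R^o) (v 0 i).
Proof.
apply/line_derive0.
have -> : (fun t : R => (z + t *: v) 0 i : R^o) = (fun t : R => (v 0 i) *: (t : R^o)) + cst (z 0 i).
  by apply/funext => t; rewrite fctE !mxE addrC /GRing.scale /= mulrC.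
have d1 : is_derive (0 : R) (1 : R) (fun t : R => (v 0 i) *: (t : R^o)) (v 0 i *: 1).
  exact: is_deriveZ.
by apply: is_derive_eq; rewrite addr0 /GRing.scale /= mulr1.
Qed.

Lemma tvecE (M : mfd R) (a : R) (u v : tvec M) f : (a *: u + v) f = a * u f + v f :> R.
Proof. by []. Qed.

Lemma tvecD (M : mfd R) (u v : tvec M) f : (u + v) f = u f + v f :> R.
Proof. by []. Qed.

Lemma tvecZ (M : mfd R) (a : R) (u : tvec M) f : (a *: u) f = a * u f :> R.
Proof. by []. Qed.

Lemma tvecN (M : mfd R) (u : tvec M) f : (- u) f = - u f :> R.
Proof. by []. Qed.

Lemma tvecB (M : mfd R) (u v : tvec M) f : (u - v) f = u f - v f :> R.
Proof. by []. Qed.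

Section Basic.
Variables (M : mfd R) (p : M).
Hypothesis okM : mfd_ok M.
Implicit Types (f g : M -> R) (v w : tvec M).

Lemma tan_nsmooth v f : tangent p v -> ~ smooth_fun f -> v f = 0.
Proof. by move=> [_ _ h]; exact: h. Qed.

Lemma tan_lin v (a : R) f g : tangent p v -> smooth_fun f -> smooth_fun g ->
  v (fun x => a * f x + g x) = a * v f + v g.
Proof. by move=> [h _ _]; exact: h. Qed.

Lemma tan_mul v f g : tangent p v -> smooth_fun f -> smooth_fun g ->
  v (fun x => f x * g x) = v f * g p + f p * v g.
Proof. by move=> [_ h _]; exact: h. Qed.

Lemma tan_add v f g : tangent p v -> smooth_fun f -> smooth_fun g ->
  v (fun x => f x + g x) = v f + v g.
Proof.
move=> tv sf sg; rewrite -[v f]mul1r -(tan_lin 1 tv sf sg).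
by congr v; apply/funext => x; rewrite mul1r.
Qed.

Lemma tan_cst v (a : R) : tangent p v -> v (fun=> a) = 0.
Proof.
move=> tv.
have s1 : smooth_fun (fun _ : M => 1 : R) by exact: smooth_cst.
have s0 : smooth_fun (fun _ : M => 0 : R) by exact: smooth_cst.
have h0 : v (fun=> 0) = 0.
  have := tan_add tv s0 s0; rewrite (_ : (fun x => 0 + 0) = (fun=> 0)); last by apply/funext => x; rewrite addr0.
  by move/eqP; rewrite -subr_eq0 opprD addrA subrr add0r oppr_eq0 => /eqP.
have h1 : v (fun=> 1) = 0.
  have := tan_mul tv s1 s1; rewrite (_ : (fun x => 1 * 1) = (fun=> 1)); last by apply/funext => x; rewrite mulr1.
  by move/eqP; rewrite mulr1 mul1r -subr_eq0 opprD addrA subrr add0r oppr_eq0 => /eqP.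
have E := tan_lin a tv s1 s0; rewrite h0 h1 in E.
have -> : (fun _ : M => a) = (fun x => a * 1 + 0) by apply/funext => x; rewrite mulr1 addr0.
by rewrite E mulr0 addr0.
Qed.

Lemma tan_scale v (a : R) f : tangent p v -> smooth_fun f -> v (fun x => a * f x) = a * v f.
Proof.
move=> tv sf; have := tan_lin a tv sf (smooth_cst okM 0); rewrite tan_cst // addr0 => <-.
by congr v; apply/funext => x; rewrite addr0.
Qed.

Lemma tan_opp v f : tangent p v -> smooth_fun f -> v (fun x => - f x) = - v f.
Proof. by move=> tv sf; rewrite -mulN1r -tan_scale //; congr v; apply/funext => x; rewrite mulN1r. Qed.

Lemma tan_sub v f g : tangent p v -> smooth_fun f -> smooth_fun g ->
  v (fun x => f x - g x) = v f - v g.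
Proof. by move=> tv sf sg; rewrite tan_add ?tan_opp //; exact: smooth_opp. Qed.

Lemma tan_sum v (I : Type) (s : seq I) (F : I -> M -> R) : tangent p v ->
  (forall i, smooth_fun (F i)) -> v (fun x => \sum_(i <- s) F i x) = \sum_(i <- s) v (F i).
Proof.
move=> tv sF; elim: s => [|i s IH].
  by rewrite big_nil; under eq_fun do rewrite big_nil; exact: tan_cst.
rewrite big_cons -IH -tan_add //; last exact: smooth_sum.
by congr v; apply/funext => x; rewrite big_cons.
Qed.

Lemma tangent_subspace : Defs.subspace (tangent p).
Proof.
split.
  by split => [a f g _ _|f g _ _|f _] //=; rewrite ?(mulr0, mul0r, addr0).
move=> a u v [u1 u2 u3] [v1 v2 v3]; split.
- by move=> b f g sf sg; rewrite !tvecE u1 // v1 //; ring.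
- by move=> f g sf sg; rewrite !tvecE u2 // v2 //; ring.
by move=> f nf; rewrite !tvecE u3 // v3 // mulr0 addr0.
Qed.
End Basic.

Section Local.
Variable M : mfd R.
Hypothesis okM : mfd_ok M.
Implicit Types (f g : M -> R) (p : M).

Lemma smooth_cutoff (rho : M -> R) (K W : set M) f :
  smooth_fun rho -> closed K -> K `<=` W -> (forall x, ~ K x -> rho x = 0) ->
  (forall x, W x -> smooth_at x f) -> smooth_fun (fun x => rho x * f x).
Proof.
move=> srho cK KW rK sf; apply/(smooth_funP okM) => x.
case: (pselect (K x)) => Kx.
  exact: (smooth_at_mul okM ((smooth_funP okM rho).1 srho x) (sf _ (KW _ Kx))).
apply: (@smooth_at_near _ _ okM x (fun=> 0)); last exact: smooth_at_cst.
have oK : open (~` K) by exact: closed_openC.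
by apply: (open_near oK Kx) => y Ky; rewrite rK // mul0r.
Qed.

(** The support K is the image of a closed ball of a chart. It is compact, hence closed because M is
    Hausdorff, so that extension by 0 outside the chart is smooth. *)
Lemma bump_mfd p (W : set M) : open W -> W p -> exists rho : M -> R,
  [/\ smooth_fun rho, \forall x \near p, rho x = 1 &
      exists K, [/\ closed K, K `<=` W & forall x, ~ K x -> rho x = 0]].
Proof.
move=> oW Wp; have [hd _ _ /(_ p) [c ac cp]] := okM.
have [h1 h2 h3 h4 h5] := chart_ok okM ac.
pose z0 := cfun c p.
have oV : open [set z | cimg c z /\ W (cinv c z)] by apply: open_preim.
have [|e e0 he] := @open_ballP R _ _ z0 oV.
  by split; [exists p | rewrite /z0 h3].
have e2 : 0 < e / 2 by rewrite divr_gt0.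
have [b [sb nb b0]] := bump_rV z0 e2.
pose B := [set z : 'rV[R]_(mdim M) | `|z - z0| <= e / 2].
have BV z : B z -> cimg c z /\ W (cinv c z).
  by move=> Bz; apply: he; apply: le_lt_trans Bz _; rewrite ltr_pdivrMr // ltr_pMr // ltr1n.
pose K := [set cinv c z | z in B].
have cB : compact B.
  apply: bounded_closed_compact.
    exists (e / 2 + `|z0|); split; first exact: num_real.
    move=> m hm z /= zr; apply: le_trans (ltW hm).
    by rewrite -[z](subrK z0); apply: le_trans (ler_normD _ _) _; rewrite lerD2r.
  apply: (@preimage_closed _ _ (fun z : 'rV[R]_(mdim M) => `|z - z0|) [set t : R | t <= e / 2]); last exact: closed_le.
  move=> z _; have hc : {for z, continuous (fun z : 'rV[R]_(mdim M) => z - z0)}.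
    exact: (cvgB cvg_id (cvg_cst _)).
  exact: (cvg_norm hc).
have cK : closed K.
  apply: compact_closed => //; apply: continuous_compact cB.
  by apply: continuous_in_subspaceT => z; rewrite inE => /BV [cz _]; exact: h5.
pose rho x := if `[< cdom c x >] then b (cfun c x) : R else 0.
have rK x : ~ K x -> rho x = 0.
  move=> nK; rewrite /rho; case: asboolP => // cx; apply: b0.
  rewrite leNgt; apply/negP => hx; apply: nK; exists (cfun c x); last by rewrite h3.
  exact: ltW.
have Kc x : K x -> cdom c x.
  by move=> [z /BV [cz _] <-]; have [] := cimg_dom okM ac cz.
exists rho; split.
- apply/(smooth_funP okM) => x; case: (pselect (K x)) => Kx; last first.
    apply: (@smooth_at_near _ _ okM x (fun=> 0)); last exact: smooth_at_cst.
    by apply: (open_near (closed_openC cK) Kx) => y Ky; rewrite rK.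
  have cx := Kc _ Kx.
  apply: (@smooth_at_near _ _ okM x (fun y => b (cfun c y))).
    by apply: (open_near h1 cx) => y cy; rewrite /rho asboolT.
  apply: (@smooth_at_comp _ _ okM _ b (cfun c) setT) => //; first exact: openT.
  by move=> j; exact: smooth_at_coord.
- have n1 : \forall x \near p, b (cfun c x) = 1 by exact: (h4 p cp [set z | b z = 1] nb).
  have n2 : \forall x \near p, cdom c x by apply: (open_near h1 cp).
  by near=> x; rewrite /rho asboolT; near: x.
exists K; split => //.
by move=> x [z /BV [_ Wz] <-].
Unshelve. all: by end_near. Qed.

Lemma smooth_at_open p f : smooth_at p f -> exists W, [/\ open W, W p & forall x, W x -> smooth_at x f].
Proof.
move=> [c [ac cp [V [oV Vp Vc sV]]]]; have [h1 h2 h3 h4 h5] := chart_ok okM ac.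
exists [set x | cdom c x /\ V (cfun c x)]; split => //.
  by apply: open_preim.
by move=> x [cx Vx]; exists c; split => //; exists V.
Qed.

Lemma smooth_at_global p f : smooth_at p f ->
  exists g, smooth_fun g /\ \forall x \near p, f x = g x.
Proof.
move=> sf; have [W [oW Wp sW]] := smooth_at_open sf.
have [rho [srho r1 [K [cK KW rK]]]] := bump_mfd oW Wp.
exists (fun x => rho x * f x); split; first exact: smooth_cutoff cK KW rK sW.
by apply: filterS r1 => x ->; rewrite mul1r.
Qed.

(** With a cutoff rho supported where f = g, the Leibniz rule applied to rho (f - g) = 0 gives v (f
    - g) = 0. *)
Lemma tan_local p (v : tvec M) f g : tangent p v -> smooth_fun f -> smooth_fun g ->
  (\forall x \near p, f x = g x) -> v f = v g.
Proof.
move=> tv sf sg; rewrite /prop_near1 nbhsE => -[W [oW Wp] fg].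
have [rho [srho r1 [K [cK KW rK]]]] := bump_mfd oW Wp.
have rp : rho p = 1 by exact: nbhs_singleton r1.
have sfg := smooth_sub okM sf sg.
have := tan_mul tv srho sfg.
rewrite (_ : (fun x => rho x * (f x - g x)) = (fun=> 0)); last first.
  apply/funext => x; case: (pselect (W x)) => Wx; first by rewrite (fg _ Wx) subrr mulr0.
  by rewrite rK ?mul0r // => /KW.
rewrite (tan_cst okM _ tv) rp mul1r (fg _ Wp) subrr mulr0 add0r (tan_sub okM tv sf sg).
by move/esym/eqP; rewrite subr_eq0 => /eqP.
Qed.

(** Coordinates and coordinate fields are multiplied by a cutoff to become global; the identities
    hold on W, where the cutoff is 1. The expansion of a derivation is Hadamard's lemma in the
    chart, made global by a second cutoff. *)
Lemma local_frame c p : atlas (m := M) c -> cdom c p ->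
  exists (q : 'I_(mdim M) -> M -> R) (D : 'I_(mdim M) -> M -> tvec M) (W : set M),
  [/\ [/\ open W, W p & W `<=` cdom c], (forall i, smooth_fun (q i)), (forall i, is_vfield (D i)),
      (forall x, W x -> forall i, q i x = cfun c x 0 i) &
      [/\ (forall x v f, W x -> tangent x v -> smooth_fun f -> v f = \sum_i v (q i) * D i x f),
          (forall x i j, W x -> D i x (q j) = (i == j)%:R) &
          (forall x i f, W x -> smooth_fun f -> D i x f = 'D_(evec R i) (f \o cinv c : _ -> R^o) (cfun c x))]].
Proof.
move=> ac cp; have [h1 h2 h3 h4 h5] := chart_ok okM ac.
have [rho [srho r1 [K [cK KW rK]]]] := bump_mfd h1 cp.
have [W1 [oW1 W1p hW1]] : exists W : set M, [/\ open W, W p & forall x, W x -> rho x = 1].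
  by move: r1; rewrite /prop_near1 nbhsE => -[W [oW Wp] hW]; exists W.
pose W := W1 `&` cdom c.
have oW : open W by exact: openI.
pose q i x := rho x * cfun c x 0 i.
pose D i x : tvec M := fun f => if `[< smooth_fun f >] then
  rho x * 'D_(evec R i) (f \o cinv c : _ -> R^o) (cfun c x) else 0.
have sc f : smooth_fun f -> smooth_on (cimg c) (f \o cinv c) by move=> sf; exact: sf.
have imx x : cdom c x -> cimg c (cfun c x) by move=> cx; exists x.
have sq i : smooth_fun (q i).
  by apply: smooth_cutoff cK KW rK _ => // x cx; exact: smooth_at_coord.
have DE i x f : smooth_fun f -> D i x f = rho x * 'D_(evec R i) (f \o cinv c : _ -> R^o) (cfun c x).
  by move=> sf; rewrite /D asboolT.
have tD i x : tangent x (D i x).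
  case: (pselect (K x)) => Kx; last first.
    have Z f : D i x f = 0 by rewrite /D rK // mul0r; case: ifP.
    by split => *; rewrite !Z ?(mulr0, mul0r, addr0).
  have cx := KW _ Kx.
  have dv f : smooth_fun f -> is_derive (cfun c x) (evec R i) (f \o cinv c : _ -> R^o) ('D_(evec R i) (f \o cinv c : _ -> R^o) (cfun c x)).
    by move=> sf; apply/derivableP; exact: smooth_on_derivable (sc _ sf) (imx _ cx).
  split.
  - move=> a f g sf sg; rewrite !DE //; last by apply: smooth_add => //; apply: smooth_mul => //; exact: smooth_cst.
    have := @is_deriveD _ _ _ _ _ _ _ _ _ (@is_deriveZ _ _ _ _ a _ _ _ (dv f sf)) (dv g sg).
    move=> [_]; rewrite (_ : (a *: (f \o cinv c : _ -> R^o) + (g \o cinv c : _ -> R^o)) = ((fun x => a * f x + g x) \o cinv c : _ -> R^o)) // => ->.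
    by rewrite /GRing.scale /= mulrDr mulrCA.
  - move=> f g sf sg; rewrite !DE //; last exact: smooth_mul.
    have := @is_deriveM _ _ _ _ _ _ _ _ (dv f sf) (dv g sg).
    move=> [_]; rewrite (_ : (f \o cinv c : _ -> R^o) * (g \o cinv c : _ -> R^o) = ((fun x => f x * g x) \o cinv c : _ -> R^o)) // => ->.
    by rewrite /GRing.scale /= h3 //; ring.
  by move=> f nf; rewrite /D asboolF.
have vD i : is_vfield (D i).
  split=> // f sf.
  rewrite (_ : (fun x => D i x f) = (fun x => rho x * 'D_(evec R i) (f \o cinv c : _ -> R^o) (cfun c x))); last by apply/funext => x; rewrite DE.
  apply: smooth_cutoff cK KW rK _ => // x cx.
  apply: (@smooth_at_comp _ _ okM _ (fun z => 'D_(evec R i) (f \o cinv c : _ -> R^o) z) (cfun c) (cimg c)) => //.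
  - exact: smooth_on_derive (sc _ sf).
  - exact: imx.
  - by move=> j; exact: smooth_at_coord.
have Wq x : W x -> forall i, q i x = cfun c x 0 i.
  by move=> [W1x _] i; rewrite /q hW1 // mul1r.
exists q, D, W; split => //; first by split => // x [].
split.
- move=> x v f [W1x cx] tv sf.
  have oV : open [set z | cimg c z /\ W (cinv c z)] by apply: open_preim.
  pose z0 := cfun c x.
  have [|e e0 he] := @open_ballP R _ _ z0 oV.
    by split; [exists x | rewrite /z0 h3].
  have e2 : 0 < e / 2 by rewrite divr_gt0.
  have ballV z : `|z - z0| <= e / 2 -> cimg c z /\ W (cinv c z).
    by move=> hz; apply: he; apply: le_lt_trans hz _; rewrite ltr_pdivrMr // ltr_pMr // ltr1n.
  have [g [sg g0 Eg]] := hadamard h2 (fun z hz => (ballV z hz).1) (sc f sf).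
  pose B := [set z : 'rV[R]_(mdim M) | `|z - z0| < e / 2].
  have oB : open B.
    rewrite (_ : B = ball z0 (e / 2)); first exact: ball_open.
    by apply/seteqP; split => z /=; rewrite -ball_normE /= distrC.
  have oW' : open [set y | cdom c y /\ B (cfun c y)] by apply: open_preim.
  have [|b [sb b1 [K' [cK' KW' bK']]]] := @bump_mfd x _ oW'.
    by split => //; rewrite /B /= subrr normr0.
  have bx : b x = 1 by exact: nbhs_singleton b1.
  pose G i y := b y * g i (cfun c y).
  pose Q i y := b y * (q i y - z0 0 i).
  have sG i : smooth_fun (G i).
    apply: smooth_cutoff cK' KW' bK' _ => // y [cy By].
    apply: (@smooth_at_comp _ _ okM _ (g i) (cfun c) B) => //.
    by move=> j; exact: smooth_at_coord.
  have sqz i : smooth_fun (fun y => q i y - z0 0 i).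
    by apply: smooth_sub => //; exact: smooth_cst.
  have sQ i : smooth_fun (Q i) by apply: smooth_mul.
  have sbb := smooth_mul okM sb sb.
  (* Multiplication by b^2 leaves one factor b for the coordinate increment and one for the Hadamard
     coefficient. At x, b is 1 and [Q i] is 0, so v picks out the values of the coefficients. *)
  have E : (fun y => b y * b y * f y) = (fun y => f x * (b y * b y) + \sum_i Q i y * G i y).
    apply/funext => y; case: (pselect (K' y)) => Ky; last first.
      by rewrite bK' // !mul0r mulr0 big1 ?addr0 // => i _; rewrite /Q bK' // !mul0r.
    have [cy By] := KW' _ Ky; have := Eg _ By; rewrite /= !h3 // => ->.
    rewrite mulrDr mulrC; congr (_ + _); rewrite mulr_sumr; apply: eq_bigr => i _.
    have Wy : W y by have [_] := ballV _ (ltW By); rewrite h3.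
    by rewrite /Q /G (Wq _ Wy); ring.
  have := congr1 v E.
  rewrite (tan_mul tv sbb sf) (tan_lin _ tv sbb); last by apply: smooth_sum => // i; exact: smooth_mul.
  rewrite bx !mulr1 mul1r [v _ * f x]mulrC => /addrI ->.
  rewrite (tan_sum okM _ tv); last by move=> i; exact: smooth_mul.
  apply: eq_bigr => i _; rewrite (tan_mul tv (sQ i) (sG i)).
  have -> : Q i x = 0 by rewrite /Q Wq // subrr mulr0.
  rewrite mul0r addr0 (tan_mul tv sb (sqz i)) bx mul1r Wq // subrr mulr0 add0r.
  rewrite (tan_sub okM tv (sq i) (smooth_cst okM _)) (tan_cst okM _ tv) subr0 DE // hW1 // mul1r.
  by rewrite /G bx mul1r -g0.
- move=> x i j [W1x cx]; rewrite DE // hW1 // mul1r.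
  have -> : (i == j)%:R = 'D_(evec R i) (fun z : 'rV[R]_(mdim M) => z 0 j : R^o) (cfun c x).
    by have [_ ->] := derive_coord (cfun c x) (evec R i) j; rewrite /evec mxE eqxx eq_sym.
  apply: near_eq_derive.
  have oV : open [set z | cimg c z /\ W (cinv c z)] by apply: open_preim.
  apply: (open_near oV); first by split; [exists x | rewrite h3].
  by move=> z [cz Wz] /=; rewrite Wq //; have [_ ->] := cimg_dom okM ac cz.
by move=> x i f [W1x cx] sf; rewrite DE // hW1 // mul1r.
Unshelve. all: by end_near. Qed.

End Local.
End Tangent.

(** * Smooth maps and products of manifolds *)

Section SM.
Variable R : realType.
Implicit Types M N P : mfd R.

Lemma smooth_fun_at M (p : M) f : mfd_ok M -> smooth_fun f -> smooth_at p f.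
Proof. by move=> okM sf; exact: ((smooth_funP okM f).1 sf p). Qed.

(** Smoothness by pulling back functions: closed under composition at once, and the property that
    tangent maps use. *)
Definition sm M N (F : M -> N) : Prop :=
  continuous F /\ forall g, smooth_fun g -> smooth_fun (g \o F).

Lemma smooth_map_sm M N (F : M -> N) : mfd_ok M -> mfd_ok N -> smooth_map F -> sm F.
Proof.
move=> okM okN [cF hF]; split => // g sg; apply/(smooth_funP okM) => p.
have [_ _ _ /(_ p) [c ac cp]] := okM; have [_ _ _ /(_ (F p)) [d ad dp]] := okN.
have [h1 h2 h3 h4 h5] := chart_ok okM ac; have [g1 g2 g3 g4 g5] := chart_ok okN ad.
have oW : open [set x | cdom c x /\ cdom d (F x)] by apply: open_preim => // x _; exact: cF.
have oV : open [set z | cimg c z /\ [set x | cdom c x /\ cdom d (F x)] (cinv c z)] by apply: open_preim.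
apply: (@smooth_at_near _ _ okM p (fun x => (g \o cinv d) (cfun d (F x)))).
  by apply: (open_near oW) => [//|x [_ dx] /=]; rewrite g3.
apply: (@smooth_at_comp _ _ okM _ (g \o cinv d : _ -> R^o) (fun x => cfun d (F x)) (cimg d)) => //.
- exact: sg.
- by exists (F p).
move=> j; exists c; split => //.
exists [set z | cimg c z /\ [set x | cdom c x /\ cdom d (F x)] (cinv c z)]; split => //.
- by split; [exists p | rewrite h3].
- by move=> z [].
have E : [set z | cimg c z /\ [set x | cdom c x /\ cdom d (F x)] (cinv c z)] =
    [set cfun c x | x in cdom c `&` F @^-1` cdom d].
  apply/seteqP; split => z.
    by move=> [cz [c1 d1]]; exists (cinv c z) => //; have [] := cimg_dom okM ac cz.
  by move=> [x [cx dx] <-]; split; [exists x | rewrite h3].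
by rewrite E; exact: hF.
Qed.

Lemma sm_id M : sm (fun x : M => x).
Proof. by split=> // x; exact: cvg_id. Qed.

Lemma sm_comp M N P (F : M -> N) (G : N -> P) : sm F -> sm G -> sm (fun x => G (F x)).
Proof.
move=> [cF sF] [cG sG]; split; first by move=> x; exact: (continuous_comp (cF x) (cG (F x))).
by move=> g /sG /sF.
Qed.

Lemma sm_cst M N (y : N) : mfd_ok M -> sm (fun _ : M => y).
Proof. by move=> okM; split; [move=> x; exact: cvg_cst | move=> g _; exact: smooth_cst]. Qed.

Lemma sm_at M N (F : M -> N) p f : mfd_ok M -> mfd_ok N -> sm F -> smooth_at (F p) f ->
  smooth_at p (fun x => f (F x)).
Proof.
move=> okM okN [cF sF] sf; have [g [sg fg]] := smooth_at_global okN sf.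
apply: (@smooth_at_near _ _ okM p (g \o F)); last exact: (smooth_fun_at p okM (sF _ sg)).
have : nbhs p (F @^-1` [set y | f y = g y]) by exact: (cF p _ fg).
by apply: filterS => x /= ->.
Qed.

Lemma fst_cont (S T : topologicalType) (p : S * T) : {for p, continuous (fun x : S * T => x.1)}.
Proof. exact: cvg_fst. Qed.
Lemma snd_cont (S T : topologicalType) (p : S * T) : {for p, continuous (fun x : S * T => x.2)}.
Proof. exact: cvg_snd. Qed.

Lemma pair_cont (S T U : topologicalType) (f : S -> T) (g : S -> U) p :
  {for p, continuous f} -> {for p, continuous g} -> {for p, continuous (fun x => (f x, g x))}.
Proof. by move=> cf cg; apply: cvg_pair; [exact: cf | exact: cg]. Qed.

Lemma lsub_coord m n (z : 'rV[R]_(m + n)) i : (lsubmx z) 0 i = z 0 (lshift n i).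
Proof. by rewrite mxE. Qed.
Lemma rsub_coord m n (z : 'rV[R]_(m + n)) i : (rsubmx z) 0 i = z 0 (rshift m i).
Proof. by rewrite mxE. Qed.

Lemma lsub_cont m n (z : 'rV[R]_(m + n)) : {for z, continuous (fun z : 'rV[R]_(m + n) => lsubmx z : 'rV[R]_m)}.
Proof.
apply: continuous_rowP => j; apply: (@continuous_near_eq _ _ (fun z : 'rV[R]_(m + n) => z 0 (lshift n j) : R^o)).
  by apply: (open_near openT) => // y _; rewrite lsub_coord.
by apply: (smooth_on_cont (U := setT)) => //; exact: smooth_on_coord.
Qed.

Lemma rsub_cont m n (z : 'rV[R]_(m + n)) : {for z, continuous (fun z : 'rV[R]_(m + n) => rsubmx z : 'rV[R]_n)}.
Proof.
apply: continuous_rowP => j; apply: (@continuous_near_eq _ _ (fun z : 'rV[R]_(m + n) => z 0 (rshift m j) : R^o)).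
  by apply: (open_near openT) => // y _; rewrite rsub_coord.
by apply: (smooth_on_cont (U := setT)) => //; exact: smooth_on_coord.
Qed.

Lemma row_mx_continuous (T : topologicalType) m n (f : T -> 'rV[R]_m) (g : T -> 'rV[R]_n) x :
  {for x, continuous f} -> {for x, continuous g} -> {for x, continuous (fun x => row_mx (f x) (g x))}.
Proof.
move=> cf cg; apply: continuous_rowP => j.
case: (split_ordP j) => i ->.
  apply: (@continuous_near_eq _ _ (fun x => f x 0 i : R^o)); first by apply: nearW => y; rewrite row_mxEl.
  exact: (continuous_comp cf (@coord_continuous _ _ _ 0 i (f x))).
apply: (@continuous_near_eq _ _ (fun x => g x 0 i : R^o)); first by apply: nearW => y; rewrite row_mxEr.
exact: (continuous_comp cg (@coord_continuous _ _ _ 0 i (g x))).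
Qed.

Section Prod.
Variables M N : mfd R.
Hypotheses (okM : mfd_ok M) (okN : mfd_ok N).

Lemma cimg_prod (c : chart R M (mdim M)) (d : chart R N (mdim N)) :
  cimg (prod_chart c d) = [set z | cimg c (lsubmx z) /\ cimg d (rsubmx z)].
Proof.
apply/seteqP; split => z.
  move=> [[x y] [/= cx dy] <-]; rewrite row_mxKl row_mxKr.
  by split; [exists x | exists y].
move=> [[x cx ex] [y dy ey]]; exists (x, y) => //=.
by rewrite ex ey hsubmxK.
Qed.

Lemma prod_chart_ok c d : atlas (m := M) c -> atlas (m := N) d -> is_chart (prod_chart c d).
Proof.
move=> ac ad; have [h1 h2 h3 h4 h5] := chart_ok okM ac; have [g1 g2 g3 g4 g5] := chart_ok okN ad.
split.
- have o1 : open [set x : (M * N)%type | setT x /\ cdom c x.1].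
    by apply: open_preim => //; [exact: openT | move=> z _; exact: cvg_fst].
  have o2 : open [set x : (M * N)%type | setT x /\ cdom d x.2].
    by apply: open_preim => //; [exact: openT | move=> z _; exact: cvg_snd].
  rewrite (_ : cdom _ = [set x : (M * N)%type | setT x /\ cdom c x.1] `&` [set x : (M * N)%type | setT x /\ cdom d x.2]); first exact: openI.
  by apply/seteqP; split => x /=; [move=> [] | move=> [[_ ?] [_ ?]]].
- rewrite cimg_prod.
  have o1 : open [set z : 'rV[R]_(mdim M + mdim N) | setT z /\ cimg c (lsubmx z)].
    exact (@open_preim _ _ setT (cimg c) (fun z : 'rV[R]_(mdim M + mdim N) => lsubmx z) openT h2 (fun z _ => @lsub_cont _ _ z)).
  have o2 : open [set z : 'rV[R]_(mdim M + mdim N) | setT z /\ cimg d (rsubmx z)].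
    exact (@open_preim _ _ setT (cimg d) (fun z : 'rV[R]_(mdim M + mdim N) => rsubmx z) openT g2 (fun z _ => @rsub_cont _ _ z)).
  rewrite (_ : [set z | _] = [set z : 'rV[R]_(mdim M + mdim N) | setT z /\ cimg c (lsubmx z)]
     `&` [set z : 'rV[R]_(mdim M + mdim N) | setT z /\ cimg d (rsubmx z)]); first exact: openI.
  by apply/seteqP; split => x /=; [move=> [] | move=> [[_ ?] [_ ?]]].
- by move=> [x y] [/= cx dy]; rewrite row_mxKl row_mxKr h3 // g3.
- move=> [x y] [/= cx dy]; apply: row_mx_continuous.
    exact: (continuous_comp (@fst_cont _ _ (x, y)) (h4 x cx)).
  exact: (continuous_comp (@snd_cont _ _ (x, y)) (g4 y dy)).
move=> z; rewrite cimg_prod => -[cz dz].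
apply: pair_cont.
  exact: (continuous_comp (@lsub_cont (mdim M) (mdim N) z) (h5 _ cz)).
exact: (continuous_comp (@rsub_cont (mdim M) (mdim N) z) (g5 _ dz)).
Qed.

Lemma prod_ok : mfd_ok (prod_mfd M N).
Proof.
split.
- move=> [x1 y1] [x2 y2] h.
  have [hM _ _ _] := okM; have [hN _ _ _] := okN.
  congr (_, _).
    apply: hM => A B nA nB.
    have [||z [Az Bz]] := h (fst @^-1` A) (fst @^-1` B).
    - exact: (@fst_cont _ _ (x1, y1) A nA).
    - exact: (@fst_cont _ _ (x2, y2) B nB).
    by exists z.1.
  apply: hN => A B nA nB.
  have [||z [Az Bz]] := h (snd @^-1` A) (snd @^-1` B).
  - exact: (@snd_cont _ _ (x1, y1) A nA).
  - exact: (@snd_cont _ _ (x2, y2) B nB).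
  by exists z.2.
- by move=> e [c [d [ac ad ->]]]; exact: prod_chart_ok.
- move=> e1 e2 [c1 [d1 [ac1 ad1 ->]]] [c2 [d2 [ac2 ad2 ->]]] j.
  have [oW1 sW1 _ _] := transition okM ac1 ac2.
  have [oW2 sW2 _ _] := transition okN ad1 ad2.
  set W1 := [set z | _] in oW1 sW1; set W2 := [set z | _] in oW2 sW2.
  have [_ _ h3 _ _] := chart_ok okM ac1; have [_ _ g3 _ _] := chart_ok okN ad1.
  have E : [set cfun (prod_chart c1 d1) x | x in cdom (prod_chart c1 d1) `&` cdom (prod_chart c2 d2)] =
      [set z | W1 (lsubmx z) /\ W2 (rsubmx z)].
    apply/seteqP; split => z.
      move=> [[x y] [[/= cx dy] [/= cx2 dy2]] <-]; rewrite row_mxKl row_mxKr.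
      by split; (split; [by (exists x + exists y) | rewrite ?h3 ?g3]).
    move=> [[[x cx ex] cx2] [[y dy ey] dy2]]; exists (x, y) => /=.
      by rewrite -ex h3 // in cx2; rewrite -ey g3 // in dy2.
    by rewrite ex ey hsubmxK.
  rewrite E.
  have oE : open [set z : 'rV[R]_(mdim M + mdim N) | W1 (lsubmx z) /\ W2 (rsubmx z)].
    have o1 : open [set z : 'rV[R]_(mdim M + mdim N) | setT z /\ W1 (lsubmx z)].
      exact (@open_preim _ _ setT W1 (fun z : 'rV[R]_(mdim M + mdim N) => lsubmx z) openT oW1 (fun z _ => @lsub_cont _ _ z)).
    have o2 : open [set z : 'rV[R]_(mdim M + mdim N) | setT z /\ W2 (rsubmx z)].
      exact (@open_preim _ _ setT W2 (fun z : 'rV[R]_(mdim M + mdim N) => rsubmx z) openT oW2 (fun z _ => @rsub_cont _ _ z)).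
    rewrite (_ : [set z | _] = [set z : 'rV[R]_(mdim M + mdim N) | setT z /\ W1 (lsubmx z)]
      `&` [set z : 'rV[R]_(mdim M + mdim N) | setT z /\ W2 (rsubmx z)]); first exact: openI.
    by apply/seteqP; split => x /=; [move=> [] | move=> [[_ ?] [_ ?]]].
  case: (split_ordP j) => i ->.
    apply: (smooth_on_eq (f := (fun z => cfun c2 (cinv c1 z) 0 i) \o (fun z : 'rV[R]_(mdim M + mdim N) => lsubmx z))) => //.
      by move=> z _ /=; rewrite row_mxEl.
    apply: (smooth_on_comp oE oW1 _ _ (sW1 i)); last by move=> z [].
    move=> l; apply: smooth_on_eq oE _ (smooth_on_coord _ (lshift (mdim N) l)) => z _.
    by rewrite lsub_coord.
  apply: (smooth_on_eq (f := (fun z => cfun d2 (cinv d1 z) 0 i) \o (fun z : 'rV[R]_(mdim M + mdim N) => rsubmx z))) => //.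
    by move=> z _ /=; rewrite row_mxEr.
  apply: (smooth_on_comp oE oW2 _ _ (sW2 i)); last by move=> z [].
  move=> l; apply: smooth_on_eq oE _ (smooth_on_coord _ (rshift (mdim M) l)) => z _.
  by rewrite rsub_coord.
move=> [x y]; have [_ _ _ /(_ x) [c ac cx]] := okM; have [_ _ _ /(_ y) [d ad dy]] := okN.
by exists (prod_chart c d); [exists c, d | ].
Qed.

Lemma sm_fst : @sm (prod_mfd M N) M (fun x => x.1).
Proof.
split; first by move=> p; exact: fst_cont.
move=> g sg; apply/(smooth_funP prod_ok) => -[x y].
have [_ _ _ /(_ x) [c ac cx]] := okM; have [_ _ _ /(_ y) [d ad dy]] := okN.
have [h1 h2 h3 h4 h5] := chart_ok okM ac.
have apr : atlas (m := prod_mfd M N) (prod_chart c d) by exists c, d.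
have [p1 p2 p3 p4 p5] := chart_ok prod_ok apr.
exists (prod_chart c d); split => //.
exists (cimg (prod_chart c d)); split => //; first by exists (x, y).
apply: (smooth_on_comp (V := cimg c) (F := fun z : 'rV[R]_(mdim M + mdim N) => lsubmx z) (f := g \o cinv c)) => //.
- move=> j; apply: smooth_on_eq p2 _ (smooth_on_coord _ (lshift (mdim N) j)) => z _.
  by rewrite lsub_coord.
- by move=> z; rewrite cimg_prod => -[].
exact: sg.
Qed.

Lemma sm_snd : @sm (prod_mfd M N) N (fun x => x.2).
Proof.
split; first by move=> p; exact: snd_cont.
move=> g sg; apply/(smooth_funP prod_ok) => -[x y].
have [_ _ _ /(_ x) [c ac cx]] := okM; have [_ _ _ /(_ y) [d ad dy]] := okN.
have [h1 h2 h3 h4 h5] := chart_ok okN ad.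
have apr : atlas (m := prod_mfd M N) (prod_chart c d) by exists c, d.
have [p1 p2 p3 p4 p5] := chart_ok prod_ok apr.
exists (prod_chart c d); split => //.
exists (cimg (prod_chart c d)); split => //; first by exists (x, y).
apply: (smooth_on_comp (V := cimg d) (F := fun z : 'rV[R]_(mdim M + mdim N) => rsubmx z) (f := g \o cinv d)) => //.
- move=> j; apply: smooth_on_eq p2 _ (smooth_on_coord _ (rshift (mdim M) j)) => z _.
  by rewrite rsub_coord.
- by move=> z; rewrite cimg_prod => -[].
exact: sg.
Qed.

Lemma sm_pair (L : mfd R) (F : L -> M) (G : L -> N) : mfd_ok L -> sm F -> sm G ->
  @sm L (prod_mfd M N) (fun x => (F x, G x)).
Proof.
move=> okL sF sG; have [cF _] := sF; have [cG _] := sG; split.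
  by move=> x; apply: cvg_pair; [exact: cF | exact: cG].
move=> g sg; apply/(smooth_funP okL) => p.
have [_ _ _ /(_ (F p)) [c ac cx]] := okM; have [_ _ _ /(_ (G p)) [d ad dy]] := okN.
have [h1 h2 h3 h4 h5] := chart_ok okM ac; have [g1 g2 g3 g4 g5] := chart_ok okN ad.
have apr : atlas (m := prod_mfd M N) (prod_chart c d) by exists c, d.
have [p1 p2 p3 p4 p5] := chart_ok prod_ok apr.
apply: (@smooth_at_near _ _ okL p (fun x => (g \o cinv (prod_chart c d)) (row_mx (cfun c (F x)) (cfun d (G x))))).
  have n1 : \forall x \near p, cdom c (F x) by exact: (cF p _ (open_nbhs_nbhs (conj h1 cx))).
  have n2 : \forall x \near p, cdom d (G x) by exact: (cG p _ (open_nbhs_nbhs (conj g1 dy))).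
  near=> x; rewrite /= row_mxKl row_mxKr h3 ?g3 //; [by near: x | by near: x].
apply: (@smooth_at_comp _ _ okL _ (g \o cinv (prod_chart c d) : _ -> R^o) (fun x => row_mx (cfun c (F x)) (cfun d (G x))) (cimg (prod_chart c d))) => //.
- exact: sg.
- by exists (F p, G p).
move=> j; case: (split_ordP j) => i ->.
  apply: (@smooth_at_near _ _ okL p (fun x => cfun c (F x) 0 i)); first by apply: nearW => x; rewrite row_mxEl.
  exact: (sm_at okL okM sF (smooth_at_coord okM i ac cx)).
apply: (@smooth_at_near _ _ okL p (fun x => cfun d (G x) 0 i)); first by apply: nearW => x; rewrite row_mxEr.
exact: (sm_at okL okN sG (smooth_at_coord okN i ad dy)).
Unshelve. all: by end_near. Qed.

End Prod.
End SM.

(** * Tangent maps and tangent vectors of products *)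

Section Tmap.
Variable R : realType.
Implicit Types M N P : mfd R.

Lemma tmapE M N (F : M -> N) (v : tvec M) g : smooth_fun g -> tmap F v g = v (g \o F).
Proof. by move=> sg; rewrite /tmap asboolT. Qed.

Lemma tmap_lin M N (F : M -> N) (a : R) (u v : tvec M) :
  tmap F (a *: u + v) = a *: tmap F u + tmap F v.
Proof.
apply/funext => g; rewrite tvecE /tmap; case: asboolP => _; first by rewrite tvecE.
by rewrite mulr0 addr0.
Qed.

Lemma tmap0 M N (F : M -> N) : tmap F 0 = 0.
Proof. by apply/funext => g; rewrite /tmap; case: asboolP. Qed.

Lemma tmapD M N (F : M -> N) (u v : tvec M) : tmap F (u + v) = tmap F u + tmap F v.
Proof. by have := tmap_lin F 1 u v; rewrite !scale1r. Qed.

Lemma tmapZ M N (F : M -> N) (a : R) (u : tvec M) : tmap F (a *: u) = a *: tmap F u.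
Proof. by have := tmap_lin F a u 0; rewrite tmap0 !addr0. Qed.

Lemma tmapN M N (F : M -> N) (u : tvec M) : tmap F (- u) = - tmap F u.
Proof. by rewrite -scaleN1r tmapZ scaleN1r. Qed.

Lemma tmapB M N (F : M -> N) (u v : tvec M) : tmap F (u - v) = tmap F u - tmap F v.
Proof. by rewrite tmapD tmapN. Qed.

Lemma tmap_comp M N P (F : M -> N) (G : N -> P) (v : tvec M) : sm G ->
  tmap G (tmap F v) = tmap (fun x => G (F x)) v.
Proof.
move=> [_ sG]; apply/funext => g; rewrite {1 3}/tmap; case: asboolP => // sg.
by rewrite tmapE //; exact: sG.
Qed.

Lemma tan_eq M (p : M) (v w : tvec M) : tangent p v -> tangent p w ->
  (forall f, smooth_fun f -> v f = w f) -> v = w.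
Proof.
move=> tv tw h; apply/funext => f; case: (pselect (smooth_fun f)) => sf; first exact: h.
by rewrite (tan_nsmooth tv sf) (tan_nsmooth tw sf).
Qed.

Lemma tmap_id M (p : M) (v : tvec M) : tangent p v -> tmap (fun x => x) v = v.
Proof.
move=> tv; apply/funext => f; rewrite /tmap; case: asboolP => // nf.
by rewrite (tan_nsmooth tv nf).
Qed.

Lemma tmap_cst M N (p : M) (y : N) (v : tvec M) : mfd_ok M -> tangent p v -> tmap (fun=> y) v = 0.
Proof.
move=> okM tv; apply/funext => f; rewrite /tmap; case: asboolP => // sf.
exact: (tan_cst okM _ tv).
Qed.

Lemma tmap_tangent M N (F : M -> N) p (v : tvec M) : mfd_ok N -> sm F -> tangent p v ->
  tangent (F p) (tmap F v).
Proof.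
move=> okN [_ sF] tv; split.
- move=> a f g sf sg; rewrite !tmapE //; last by apply: smooth_add => //; apply: smooth_mul => //; exact: smooth_cst.
  exact: (tan_lin a tv (sF _ sf) (sF _ sg)).
- move=> f g sf sg; rewrite !tmapE //; last exact: smooth_mul.
  exact: (tan_mul tv (sF _ sf) (sF _ sg)).
by move=> f nf; rewrite /tmap asboolF.
Qed.

Lemma tan0 M (p : M) : tangent p (0 : tvec M).
Proof. by have [] := tangent_subspace p. Qed.
Lemma tan_linc M (p : M) (a : R) (u v : tvec M) : tangent p u -> tangent p v -> tangent p (a *: u + v).
Proof. by have [_] := tangent_subspace p; apply. Qed.
Lemma tanD M (p : M) (u v : tvec M) : tangent p u -> tangent p v -> tangent p (u + v).
Proof. by move=> tu tv; rewrite -[u]scale1r; exact: tan_linc. Qed.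
Lemma tanZ M (p : M) (a : R) (u : tvec M) : tangent p u -> tangent p (a *: u).
Proof. by move=> tu; rewrite -[_ *: _]addr0; apply: tan_linc => //; exact: tan0. Qed.
Lemma tanN M (p : M) (u : tvec M) : tangent p u -> tangent p (- u).
Proof. by rewrite -scaleN1r; exact: tanZ. Qed.
Lemma tanB M (p : M) (u v : tvec M) : tangent p u -> tangent p v -> tangent p (u - v).
Proof. by move=> tu tv; apply: tanD => //; exact: tanN. Qed.
Lemma tan_sumc M (p : M) (I : Type) (s : seq I) (P : pred I) (F : I -> tvec M) :
  (forall i, tangent p (F i)) -> tangent p (\sum_(i <- s | P i) F i).
Proof. by move=> h; apply: big_ind => // [|u v tu tv]; [exact: tan0 | exact: tanD]. Qed.

Lemma tvec_sumE M (I : Type) (s : seq I) (P : pred I) (F : I -> tvec M) f :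
  (\sum_(i <- s | P i) F i) f = \sum_(i <- s | P i) F i f :> R.
Proof. by elim: s => [|i s IH]; rewrite ?big_nil // !big_cons; case: (P i) => //; rewrite tvecD IH. Qed.

Section Pair.
Variables M N : mfd R.
Hypotheses (okM : mfd_ok M) (okN : mfd_ok N).
Local Notation MN := (prod_mfd M N).
Implicit Types (p : M) (q : N).

Lemma slice1 (g : MN -> R) q : @smooth_fun R MN g -> smooth_fun (fun x => g (x, q)).
Proof. by move=> sg; have [_] := sm_pair okM okN okM (sm_id M) (sm_cst q okM); exact. Qed.

Lemma slice2 (g : MN -> R) p : @smooth_fun R MN g -> smooth_fun (fun y => g (p, y)).
Proof. by move=> sg; have [_] := sm_pair okM okN okN (sm_cst p okN) (sm_id N); exact. Qed.

Lemma tpairE p q u v (g : MN -> R) : @smooth_fun R MN g ->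
  tpair p q u v g = u (fun x => g (x, q)) + v (fun y => g (p, y)).
Proof. by move=> sg; rewrite /tpair asboolT. Qed.

Lemma tpair_tangent p q u v : tangent p u -> tangent q v -> @tangent R MN (p, q) (tpair p q u v).
Proof.
have okP := prod_ok okM okN.
move=> tu tv; split.
- move=> a f g sf sg; rewrite !tpairE //; last by apply: (smooth_add okP) => //; apply: (smooth_mul okP) => //; exact: smooth_cst.
  by rewrite (tan_lin a tu) ?(tan_lin a tv) //; first (by ring); (exact: slice1 || exact: slice2).
- move=> f g sf sg; rewrite !tpairE //; last exact: (smooth_mul okP).
  by rewrite (tan_mul tu) ?(tan_mul tv) //; first (by ring); (exact: slice1 || exact: slice2).
by move=> f nf; rewrite /tpair asboolF.
Qed.

Lemma tpair_lin p q a u v u' v' :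
  tpair p q (a *: u + u') (a *: v + v') = a *: tpair p q u v + tpair p q u' v'.
Proof.
apply/funext => f; rewrite tvecE /tpair; case: asboolP => _; last by rewrite mulr0 addr0.
by rewrite !tvecE; ring.
Qed.

(** Near the point the coordinates of a product chart are functions of one factor, and a derivation
    is determined by its values on coordinates. *)
Lemma tan_prod_ext (z : MN) (w1 w2 : tvec MN) : tangent z w1 -> tangent z w2 ->
  (forall g, smooth_fun g -> w1 (fun x => g x.1) = w2 (fun x => g x.1)) ->
  (forall g, smooth_fun g -> w1 (fun x => g x.2) = w2 (fun x => g x.2)) -> w1 = w2.
Proof.
have okP := prod_ok okM okN.
case: z => p q t1 t2 e1 e2; apply: (tan_eq t1 t2) => f sf.
have [_ _ _ /(_ p) [c ac cp]] := okM; have [_ _ _ /(_ q) [d ad dq]] := okN.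
have apr : atlas (m := MN) (prod_chart c d) by exists c, d.
have [Q [D [W [[oW Wz Wc] sQ vD WQ [fr _ _]]]]] := local_frame (p := (p, q)) okP apr (conj cp dq).
have [Q1 [_ [W1 [[oW1 Wz1 _] sQ1 _ WQ1 _]]]] := local_frame okM ac cp.
have [Q2 [_ [W2 [[oW2 Wz2 _] sQ2 _ WQ2 _]]]] := local_frame okN ad dq.
rewrite (fr _ _ _ Wz t1 sf) (fr _ _ _ Wz t2 sf); apply: eq_bigr => j _; congr (_ * _).
have n1 : \forall x \near (p, q), W1 x.1 by exact: (@fst_cont _ _ (p, q) _ (open_nbhs_nbhs (conj oW1 Wz1))).
have n2 : \forall x \near (p, q), W2 x.2 by exact: (@snd_cont _ _ (p, q) _ (open_nbhs_nbhs (conj oW2 Wz2))).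
have nW : \forall x \near (p, q), W x by exact: (open_nbhs_nbhs (conj oW Wz)).
case: (split_ordP j) => i ->.
  have s1 : @smooth_fun R MN (fun x => Q1 i x.1) by have [_] := sm_fst okM okN; exact.
  have nE : \forall x \near (p, q), Q (lshift (mdim N) i) x = Q1 i x.1.
    near=> x; rewrite WQ; last by near: x.
    by rewrite /= row_mxEl WQ1 //; near: x.
  by rewrite (tan_local okP t1 (sQ _) s1 nE) (tan_local okP t2 (sQ _) s1 nE) e1.
have s1 : @smooth_fun R MN (fun x => Q2 i x.2) by have [_] := sm_snd okM okN; exact.
have nE : \forall x \near (p, q), Q (rshift (mdim M) i) x = Q2 i x.2.
  near=> x; rewrite WQ; last by near: x.
  by rewrite /= row_mxEr WQ2 //; near: x.
by rewrite (tan_local okP t1 (sQ _) s1 nE) (tan_local okP t2 (sQ _) s1 nE) e2.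
Unshelve. all: by end_near. Qed.

Lemma tmap_pair (L : mfd R) (F : L -> M) (G : L -> N) (l : L) (v : tvec L) : mfd_ok L -> sm F -> sm G -> tangent l v ->
  @tmap R L MN (fun x => (F x, G x)) v = tpair (F l) (G l) (tmap F v) (tmap G v).
Proof.
move=> okL sF sG tv; have okP := prod_ok okM okN.
have sFG := sm_pair okM okN okL sF sG.
have tF := tmap_tangent okM sF tv; have tG := tmap_tangent okN sG tv.
apply: (@tan_prod_ext (F l, G l)).
- exact: (tmap_tangent okP sFG tv).
- exact: tpair_tangent.
- move=> g sg; have s1 : @smooth_fun R MN (fun x => g x.1) by have [_] := sm_fst okM okN; exact.
  by rewrite tmapE // tpairE // /= (tan_cst okN _ tG) addr0 tmapE.
move=> g sg; have s1 : @smooth_fun R MN (fun x => g x.2) by have [_] := sm_snd okM okN; exact.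
by rewrite tmapE // tpairE // /= (tan_cst okM _ tF) add0r tmapE.
Qed.

(** The coefficients k of v in the coordinates of the second factor are the same for every x, so
    v(g(x, .)) depends on x only through coordinate derivatives of g. They are chosen before the
    frame of the product, hence the quantifiers. *)
Lemma partial_expansion (g : MN -> R) a b v : @smooth_fun R MN g -> tangent b v ->
  forall c d, atlas (m := M) c -> atlas (m := N) d -> cdom c a -> cdom d b ->
  exists (k : 'I_(mdim N) -> R), forall W : set MN, forall Q D,
  open W -> W `<=` cdom (prod_chart c d) -> W (a, b) ->
  (forall i, @smooth_fun R MN (Q i)) ->
  (forall x, W x -> forall i, Q i x = cfun (prod_chart c d) x 0 i) ->
  (forall x v f, W x -> tangent x v -> smooth_fun f -> v f = \sum_i v (Q i) * D i x f) ->
  (forall j (q : 'I_(mdim N) -> N -> R) W2, open W2 -> W2 b -> smooth_fun (q j) ->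
     (forall y, W2 y -> q j y = cfun d y 0 j) -> k j = v (q j)) /\
  forall x, W (x, b) -> v (fun y => g (x, y)) = \sum_j k j * D (rshift (mdim M) j) (x, b) g.
Proof.
move=> sg tv c d ac ad ca db; have okP := prod_ok okM okN.
have [Q2 [_ [W2 [[oW2 Wz2 _] sQ2 _ WQ2 _]]]] := local_frame okN ad db.
exists (fun j => v (Q2 j)) => W Q D oW Wc Wab sQ WQ fr; split.
  move=> j q W3 oW3 W3b sq qE; apply: (tan_local okN tv (sQ2 j) sq).
  have n2 : \forall y \near b, W2 y by exact: (open_nbhs_nbhs (conj oW2 Wz2)).
  have n3 : \forall y \near b, W3 y by exact: (open_nbhs_nbhs (conj oW3 W3b)).
  by near=> y; rewrite WQ2 ?qE //; near: y.
move=> x Wx.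
have tt : @tangent R MN (x, b) (tpair x b 0 v) by apply: tpair_tangent => //; exact: tan0.
have E : v (fun y => g (x, y)) = tpair x b 0 v g by rewrite tpairE // add0r.
rewrite E (fr _ _ _ Wx tt sg).
rewrite big_split_ord /=.
rewrite big1 ?add0r.
  apply: eq_bigr => j _; congr (_ * _); rewrite tpairE // add0r.
  apply: (tan_local okN tv); [exact: slice2 | exact: sQ2 |].
  have n1 : \forall y \near b, W (x, y).
    by exact: (pair_cont (@cst_continuous _ _ x b) (@cvg_id _ (nbhs b)) (open_nbhs_nbhs (conj oW Wx))).
  have n2 : \forall y \near b, W2 y by exact: (open_nbhs_nbhs (conj oW2 Wz2)).
  by near=> y; rewrite WQ ?WQ2 //= ?row_mxEr //; near: y.
move=> j _; rewrite tpairE // add0r.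
suff -> : v (fun y => Q (lshift (mdim N) j) (x, y)) = 0 by rewrite mul0r.
rewrite -(tan_cst okN (cfun c x 0 j) tv).
apply: (tan_local okN tv); [exact: slice2 | exact: smooth_cst |].
have n1 : \forall y \near b, W (x, y).
  by exact: (pair_cont (@cst_continuous _ _ x b) (@cvg_id _ (nbhs b)) (open_nbhs_nbhs (conj oW Wx))).
by near=> y; rewrite WQ //= ?row_mxEl //; near: y.
Unshelve. all: by end_near. Qed.

(** By [partial_expansion] the function is near each point a constant combination of coordinate
    derivatives of g. The smoothness of invariant fields and of [muf] and [nuf] comes from here. *)
Lemma partial_smooth (g : MN -> R) b v : @smooth_fun R MN g -> tangent b v ->
  smooth_fun (fun x => v (fun y => g (x, y))).
Proof.
move=> sg tv; have okP := prod_ok okM okN; apply/(smooth_funP okM) => a.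
have [_ _ _ /(_ a) [c ac ca]] := okM; have [_ _ _ /(_ b) [d ad db]] := okN.
have apr : atlas (m := MN) (prod_chart c d) by exists c, d.
have [Q [D [W [[oW Wz Wc] sQ vD WQ [fr _ _]]]]] := local_frame (p := (a, b)) okP apr (conj ca db).
have [k /(_ W Q D oW Wc Wz sQ WQ fr) [_ hk]] := partial_expansion sg tv ac ad ca db.
apply: (@smooth_at_near _ _ okM a (fun x => \sum_j k j * D (rshift (mdim M) j) (x, b) g)).
  have n1 : \forall x \near a, W (x, b).
    by exact: (pair_cont (@cvg_id _ (nbhs a)) (@cst_continuous _ _ b a) (open_nbhs_nbhs (conj oW Wz))).
  by near=> x; rewrite hk //; near: x.
apply: (smooth_fun_at _ okM); apply: smooth_sum => // j; apply: smooth_mul => //; first exact: smooth_cst.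
by apply: (slice1 (g := fun z => D (rshift (mdim M) j) z g)); have [_] := vD (rshift (mdim M) j); exact.
Unshelve. all: by end_near. Qed.

End Pair.

Lemma smooth_swap M N (g : prod_mfd M N -> R) : mfd_ok M -> mfd_ok N -> @smooth_fun R (prod_mfd M N) g ->
  @smooth_fun R (prod_mfd N M) (fun z => g (z.2, z.1)).
Proof.
move=> okM okN sg.
by have [_] := sm_pair okM okN (prod_ok okN okM) (sm_snd okN okM) (sm_fst okN okM); exact.
Qed.

Lemma partial_smooth1 M N (g : prod_mfd M N -> R) (a : M) u : mfd_ok M -> mfd_ok N ->
  @smooth_fun R (prod_mfd M N) g -> tangent a u ->
  smooth_fun (fun y => u (fun x => g (x, y))).
Proof.
move=> okM okN sg tu.
exact: (partial_smooth okN okM (smooth_swap okM okN sg) tu).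
Qed.

Lemma schwarz_mfd M N (g : prod_mfd M N -> R) (a : M) (b : N) u v : mfd_ok M -> mfd_ok N ->
  @smooth_fun R (prod_mfd M N) g -> tangent a u -> tangent b v ->
  u (fun x => v (fun y => g (x, y))) = v (fun y => u (fun x => g (x, y))).
Proof.
move=> okM okN sg tu tv; have okP := prod_ok okM okN.
have [_ _ _ /(_ a) [c ac ca]] := okM; have [_ _ _ /(_ b) [d ad db]] := okN.
have apr : atlas (m := prod_mfd M N) (prod_chart c d) by exists c, d.
have [Q [D [W [[oW Wz Wc] sQ vD WQ [fr Dq DE]]]]] := local_frame (p := (a, b)) okP apr (conj ca db).
pose W' := W.
have sDg i : @smooth_fun R (prod_mfd M N) (fun z => D i z g) by have [_] := vD i; exact.
have t1 : @tangent R (prod_mfd M N) (a, b) (tpair a b u 0) by apply: tpair_tangent => //; exact: tan0.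
have t2 : @tangent R (prod_mfd M N) (a, b) (tpair a b 0 v) by apply: tpair_tangent => //; exact: tan0.
have n1 : \forall x \near a, W (x, b).
  by exact: (pair_cont (@cvg_id _ (nbhs a)) (@cst_continuous _ _ b a) (open_nbhs_nbhs (conj oW Wz))).
have n2 : \forall y \near b, W (a, y).
  by exact: (pair_cont (@cst_continuous _ _ a b) (@cvg_id _ (nbhs b)) (open_nbhs_nbhs (conj oW Wz))).
have [Q1 [_ [W1 [[oW1 Wz1 _] sQ1 _ WQ1 _]]]] := local_frame okM ac ca.
have [Q2 [_ [W2 [[oW2 Wz2 _] sQ2 _ WQ2 _]]]] := local_frame okN ad db.
have m1 : \forall x \near a, W1 x by exact: (open_nbhs_nbhs (conj oW1 Wz1)).
have m2 : \forall x \near b, W2 x by exact: (open_nbhs_nbhs (conj oW2 Wz2)).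
have Q1c i y : W (a, y) -> u (fun x => Q (lshift (mdim N) i) (x, y)) = u (Q1 i).
  move=> Wy; apply: (tan_local okM tu); [exact: slice1 | exact: sQ1 |].
  have n3 : \forall x \near a, W (x, y).
    by exact: (pair_cont (@cvg_id _ (nbhs a)) (@cst_continuous _ _ y a) (open_nbhs_nbhs (conj oW Wy))).
  by near=> x; rewrite WQ ?WQ1 //= ?row_mxEl //; near: x.
have Q1r j y : W (a, y) -> u (fun x => Q (rshift (mdim M) j) (x, y)) = 0.
  move=> Wy; rewrite -(tan_cst okM (cfun d y 0 j) tu).
  apply: (tan_local okM tu); [exact: slice1 | exact: smooth_cst |].
  have n3 : \forall x \near a, W (x, y).
    by exact: (pair_cont (@cvg_id _ (nbhs a)) (@cst_continuous _ _ y a) (open_nbhs_nbhs (conj oW Wy))).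
  by near=> x; rewrite WQ //= ?row_mxEr //; near: x.
have Q2c j x : W (x, b) -> v (fun y => Q (rshift (mdim M) j) (x, y)) = v (Q2 j).
  move=> Wx; apply: (tan_local okN tv); [exact: slice2 | exact: sQ2 |].
  have n3 : \forall y \near b, W (x, y).
    by exact: (pair_cont (@cst_continuous _ _ x b) (@cvg_id _ (nbhs b)) (open_nbhs_nbhs (conj oW Wx))).
  by near=> y; rewrite WQ ?WQ2 //= ?row_mxEr //; near: y.
have Q2l i x : W (x, b) -> v (fun y => Q (lshift (mdim N) i) (x, y)) = 0.
  move=> Wx; rewrite -(tan_cst okN (cfun c x 0 i) tv).
  apply: (tan_local okN tv); [exact: slice2 | exact: smooth_cst |].
  have n3 : \forall y \near b, W (x, y).
    by exact: (pair_cont (@cst_continuous _ _ x b) (@cvg_id _ (nbhs b)) (open_nbhs_nbhs (conj oW Wx))).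
  by near=> y; rewrite WQ //= ?row_mxEl //; near: y.
have ux y f : W (a, y) -> @smooth_fun R (prod_mfd M N) f ->
    u (fun x => f (x, y)) = \sum_i u (Q1 i) * D (lshift (mdim N) i) (a, y) f.
  move=> Wy sf.
  have tt : @tangent R (prod_mfd M N) (a, y) (tpair a y u 0) by apply: tpair_tangent => //; exact: tan0.
  have -> : u (fun x => f (x, y)) = tpair a y u 0 f by rewrite tpairE // addr0.
  rewrite (fr _ _ _ Wy tt sf) big_split_ord /=.
  rewrite [X in _ + X]big1 ?addr0; last by move=> j _; rewrite tpairE // addr0 Q1r // mul0r.
  by apply: eq_bigr => i _; rewrite tpairE // addr0 Q1c.
have vy x f : W (x, b) -> @smooth_fun R (prod_mfd M N) f ->
    v (fun y => f (x, y)) = \sum_j v (Q2 j) * D (rshift (mdim M) j) (x, b) f.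
  move=> Wx sf.
  have tt : @tangent R (prod_mfd M N) (x, b) (tpair x b 0 v) by apply: tpair_tangent => //; exact: tan0.
  have -> : v (fun y => f (x, y)) = tpair x b 0 v f by rewrite tpairE // add0r.
  rewrite (fr _ _ _ Wx tt sf) big_split_ord /=.
  rewrite big1 ?add0r; last by move=> j _; rewrite tpairE // add0r Q2l // mul0r.
  by apply: eq_bigr => i _; rewrite tpairE // add0r Q2c.
have sd j : smooth_fun (fun x => D (rshift (mdim M) j) (x, b) g).
  exact: (slice1 okM okN (g := fun z => D (rshift (mdim M) j) z g)).
have sd' i : smooth_fun (fun y => D (lshift (mdim N) i) (a, y) g).
  exact: (slice2 okM okN (g := fun z => D (lshift (mdim N) i) z g)).
transitivity (\sum_i \sum_j u (Q1 i) * v (Q2 j) * D (lshift (mdim N) i) (a, b) (fun z => D (rshift (mdim M) j) z g)).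
  rewrite (tan_local okM tu (g := fun x => \sum_j v (Q2 j) * D (rshift (mdim M) j) (x, b) g)).
  - rewrite (tan_sum okM _ tu); last by move=> j; apply: smooth_mul => //; exact: smooth_cst.
    rewrite exchange_big /=; apply: eq_bigr => j _.
    rewrite (tan_scale okM _ tu (sd j)) (ux b (fun z => D (rshift (mdim M) j) z g) Wz (sDg _)) mulr_sumr.
    by apply: eq_bigr => i _; ring.
  - exact: (partial_smooth okM okN sg tv).
  - by apply: smooth_sum => // j; apply: smooth_mul => //; exact: smooth_cst.
  by near=> x; apply: vy => //; near: x.
symmetry.
rewrite (tan_local okN tv (g := fun y => \sum_i u (Q1 i) * D (lshift (mdim N) i) (a, y) g)).
- rewrite (tan_sum okN _ tv); last by move=> j; apply: smooth_mul => //; exact: smooth_cst.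
  apply: eq_bigr => i _.
  rewrite (tan_scale okN _ tv (sd' i)) (vy a (fun z => D (lshift (mdim N) i) z g) Wz (sDg _)) mulr_sumr; apply: eq_bigr => j _.
  rewrite mulrA; congr (_ * _).
  have [_ o2 c3 _ _] := chart_ok okP apr.
  have sg' : smooth_on (cimg (prod_chart c d)) (g \o cinv (prod_chart c d)) by exact: sg.
  have imz : cimg (prod_chart c d) (cfun (prod_chart c d) (a, b)) by exists (a, b).
  have [_ _ _ _ c5] := chart_ok okP apr.
  have oV : open [set z | cimg (prod_chart c d) z /\ W (cinv (prod_chart c d) z)] by exact: open_preim o2 oW c5.
  have DD i1 i2 : D i1 (a, b) (fun z => D i2 z g) =
     'D_(evec R i1) (fun z => 'D_(evec R i2) (g \o cinv (prod_chart c d) : _ -> R^o) z) (cfun (prod_chart c d) (a, b)).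
    rewrite DE //; apply: near_eq_derive; apply: (open_near oV).
      by split => //; rewrite c3.
    by move=> z [cz Wz'] /=; rewrite DE //; have [_ ->] := cimg_dom okP apr cz.
  rewrite !DD; exact: (schwarz o2 _ _ sg' imz).
- exact: (partial_smooth1 okM okN sg tu).
- by apply: smooth_sum => // j; apply: smooth_mul => //; exact: smooth_cst.
by near=> y; apply: ux => //; near: y.
Unshelve. all: by end_near. Qed.

End Tmap.

(** * Derivatives of maps into an embedded submanifold *)

Section Embedding.
Variable R : realType.
Implicit Types M N P Q L : mfd R.

Lemma hadamard_at M (p : M) c f : mfd_ok M -> atlas (m := M) c -> cdom c p -> smooth_fun f ->
  exists g : 'I_(mdim M) -> M -> R,
  [/\ forall i, smooth_at p (g i),
      forall i, g i p = 'D_(evec R i) (f \o cinv c : _ -> R^o) (cfun c p) &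
      \forall x \near p, f x = f p + \sum_i (cfun c x 0 i - cfun c p 0 i) * g i x].
Proof.
move=> okM ac cp sf; have [h1 h2 h3 h4 h5] := chart_ok okM ac.
pose z0 := cfun c p.
have [|e e0 he] := @open_ballP R _ _ z0 h2; first by exists p.
have e2 : 0 < e / 2 by rewrite divr_gt0.
have ballV z : `|z - z0| <= e / 2 -> cimg c z.
  by move=> hz; apply: he; apply: le_lt_trans hz _; rewrite ltr_pdivrMr // ltr_pMr // ltr1n.
have sf' : smooth_on (cimg c) (f \o cinv c) by exact: sf.
have [g [sg g0 Eg]] := hadamard h2 ballV sf'.
pose B := [set z : 'rV[R]_(mdim M) | `|z - z0| < e / 2].
have oB : open B.
  rewrite (_ : B = ball z0 (e / 2)); first exact: ball_open.
  by apply/seteqP; split => z /=; rewrite -ball_normE /= distrC.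
have Bz : B z0 by rewrite /B /= subrr normr0.
exists (fun i x => g i (cfun c x)); split => //.
  move=> i; apply: (@smooth_at_comp _ _ okM _ (g i) (cfun c) B) => //.
  by move=> j; exact: smooth_at_coord.
have oW' : open [set y | cdom c y /\ B (cfun c y)] by apply: open_preim.
apply: (open_near oW') => // x [cx Bx].
by have := Eg _ Bx; rewrite /= !h3.
Qed.

Lemma near_bigand (T : topologicalType) (p : T) (I : finType) (P : I -> T -> Prop) :
  (forall i, \forall x \near p, P i x) -> \forall x \near p, forall i, P i x.
Proof. by move=> h; exact: (@filter_forall _ _ _ _ (nbhs_filter p) h). Qed.

(** Along a coordinate line the difference quotients of the [h a] stay bounded, so the derivative of
    F is at most e times a constant, for every e > 0. *)
Lemma small_derivation L (l0 : L) (F : L -> R) m (h : 'I_m -> L -> R) V : mfd_ok L ->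
  smooth_fun F -> (forall a, smooth_fun (h a)) ->
  (forall e : R, 0 < e -> \forall l \near l0, `|F l - F l0| <= e * \sum_a `|h a l - h a l0|) ->
  tangent l0 V -> V F = 0.
Proof.
move=> okL sF sh small tV.
have [_ _ _ /(_ l0) [c ac cl]] := okL; have [h1 h2 h3 h4 h5] := chart_ok okL ac.
have [q [D [W [[oW Wl Wc] sq vD Wq [fr Dq DE]]]]] := local_frame okL ac cl.
rewrite (fr _ _ _ Wl tV sF); apply: big1 => i _; rewrite DE //.
suff -> : 'D_(evec R i) (F \o cinv c : _ -> R^o) (cfun c l0) = 0 by rewrite mulr0.
pose z0 := cfun c l0.
have iz : cimg c z0 by exists l0.
have dF : derivable (F \o cinv c : _ -> R^o) z0 (evec R i) by exact: smooth_on_derivable (sF c ac) iz.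
have dh a : derivable (h a \o cinv c : _ -> R^o) z0 (evec R i) by exact: smooth_on_derivable (sh a c ac) iz.
pose S := \sum_a `|'D_(evec R i) (h a \o cinv c : _ -> R^o) z0|.
have S0 : 0 <= S by apply: sumr_ge0.
set DF := 'D_(evec R i) (F \o cinv c : _ -> R^o) (cfun c l0).
suff bound (e : R) : 0 < e -> `|DF| <= e * S.
  apply/eqP; rewrite -normr_eq0; apply/eqP/le_anti; rewrite normr_ge0 andbT.
  apply/ler_addgt0Pr => eps eps0; rewrite add0r.
  apply: le_trans (bound (eps / (S + 1)) _) _; first by rewrite divr_gt0 // ltr_wpDl.
  by rewrite mulrAC ler_pdivrMr ?ltr_wpDl // ler_wpM2l ?(ltW eps0) // lerDl.
move=> e0.
pose fF (t : R) := `|t^-1 *: ((F \o cinv c) (t *: evec R i + z0) - (F \o cinv c) z0) : R^o|.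
pose fh (t : R) := e * \sum_a `|t^-1 *: ((h a \o cinv c) (t *: evec R i + z0) - (h a \o cinv c) z0) : R^o|.
have lF : fF t @[t --> 0^'] --> `|DF| by exact: (cvg_norm dF).
have lh : fh t @[t --> 0^'] --> e * S.
  have ls : (\sum_a `|t^-1 *: ((h a \o cinv c) (t *: evec R i + z0) - (h a \o cinv c) z0) : R^o|) @[t --> 0^'] --> (S : R^o).
    by apply: cvg_bigsum => a; exact: (cvg_norm (dh a)).
  exact: (cvgM (cvg_cst e) ls).
apply: (ler_cvg_to lF lh).
have tz : (fun t : R => t *: evec R i + z0) @ 0^' --> z0.
  rewrite -[X in _ --> X]add0r -(scale0r (evec R i)); apply: cvgD; last exact: cvg_cst.
  by apply: cvgZr_tmp; exact: nbhs_dnbhs.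
have cz : {for z0, continuous (cinv c)} by exact: h5.
have := small e e0; rewrite -{1}(h3 l0 cl) => sm1.
have n1 : \forall t \near (0 : R)^', `|F (cinv c (t *: evec R i + z0)) - F l0| <= e * \sum_a `|h a (cinv c (t *: evec R i + z0)) - h a l0|.
  exact: (tz _ (cz _ sm1)).
near=> t; rewrite /fF /fh /= /z0 h3 // /GRing.scale /=.
have t0 : 0 <= `|t^-1| by [].
rewrite normrM; under eq_bigr do rewrite normrM.
rewrite -mulr_sumr mulrCA ler_wpM2l //.
by near: t.
Unshelve. all: by end_near. Qed.

Lemma near_small M (p : M) (g : M -> R) (e : R) : mfd_ok M -> smooth_at p g -> g p = 0 -> 0 < e ->
  \forall x \near p, `|g x| <= e.
Proof.
move=> okM sg g0 e0; have cg := smooth_at_cont okM sg.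
have := iffLR (@cvgrPdist_lt _ R^o _ (nbhs p) (nbhs_filter p) _ _) cg e e0.
by apply: filterS => x; rewrite g0 sub0r normrN => /ltW.
Qed.

(* J is not assumed smooth. Subtracting from f a combination of functions pulled back along Psi
   with the same differential at J l0 leaves, along J, an error that is small against the
   increments of those functions; this replaces the inverse function theorem. *)
Lemma embedding_derivative Q P L (Psi : Q -> P) (J : L -> Q) (l0 : L) x V f :
  mfd_ok Q -> mfd_ok P -> mfd_ok L -> sm Psi ->
  (forall U : set Q, open U -> exists2 W : set P, open W & U = [set q | W (Psi q)]) ->
  (forall x, tangent (J l0) x -> tmap Psi x = 0 -> x = 0) ->
  sm (fun l => Psi (J l)) -> tangent l0 V -> tangent (J l0) x ->
  tmap Psi x = tmap (fun l => Psi (J l)) V ->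
  smooth_fun f -> smooth_fun (f \o J) -> x f = V (f \o J).
Proof.
move=> okQ okP okL sPsi top imm sPJ tV tx ex sf sfJ.
pose q0 := J l0.
have cJ : continuous J.
  apply/continuousP => U oU; have [W oW ->] := top U oU.
  have [cPJ _] := sPJ; have /continuousP := cPJ; exact.
have [_ _ _ /(_ q0) [d ad dq]] := okQ; have [_ _ _ /(_ (Psi q0)) [c ac cp]] := okP.
have [y [E [W [[oW Wq Wd] sy vE Wy [fr Eq DE]]]]] := local_frame okQ ad dq.
have [z [Z [W' [[oW' Wp Wc] sz vZ Wz [fr' _ _]]]]] := local_frame okP ac cp.
pose G a := z a \o Psi.
have sG a : smooth_fun (G a) by have [_] := sPsi; apply; exact: sz.
have tE i : tangent q0 (E i q0) by have [] := vE i.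
(* The matrix of T Psi at q0. Injectivity on tangent vectors makes its rows independent, so it has a
   right inverse B. *)
pose A : 'M[R]_(mdim Q, mdim P) := \matrix_(i, a) E i q0 (G a).
have rfA : row_free A.
  rewrite -kermx_eq0; apply/eqP/row_matrixP => k; rewrite row0.
  set u := row k _; have uA : u *m A = 0 by apply/sub_kermxP; exact: row_sub.
  pose xu := \sum_i u 0 i *: E i q0.
  have txu : tangent q0 xu by apply: tan_sumc => i; exact: tanZ.
  have xuE g : xu g = \sum_i u 0 i * E i q0 g :> R.
    by rewrite /xu tvec_sumE; apply: eq_bigr => i _; rewrite tvecZ.
  have t1 := tmap_tangent okP sPsi txu.
  have /(imm _ txu) xu0 : tmap Psi xu = 0.
    suff h0 g : smooth_fun g -> tmap Psi xu g = (0 : tvec P) g.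
      exact (tan_eq t1 (tan0 (Psi q0)) h0).
    move=> sg; rewrite (fr' _ _ _ Wp t1 sg) big1 // => a _.
    have : (u *m A) 0 a = 0 by rewrite uA mxE.
    rewrite mxE tmapE // xuE => h1; transitivity (0 * Z a (Psi q0) g); last by rewrite mul0r.
    by congr (_ * _); rewrite -[RHS]h1; apply: eq_bigr => i _; rewrite [A i a]mxE.
  apply/rowP => j; rewrite [RHS]mxE; have := xuE (y j); rewrite xu0 => /esym.
  rewrite (bigD1 j) //= Eq // eqxx mulr1 big1 ?addr0 // => i ij.
  by rewrite Eq // (negbTE ij) mulr0.
pose B := pinvmx A.
have AB : A *m B = 1%:M by exact: mulmxVp.
have ABE i j : \sum_a A i a * B a j = (i == j)%:R.
  by have := congr1 (fun X : 'M[R]_(mdim Q) => X i j) AB; rewrite [LHS]mxE [RHS]mxE.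
(* Chosen so that f minus the combination of the [G a] with these coefficients has zero differential
   at q0. *)
pose lam a := \sum_i B a i * E i q0 f.
have slam a : smooth_fun (fun q => lam a * G a q) by apply: smooth_mul => //; exact: smooth_cst.
have sS : smooth_fun (fun q => \sum_a lam a * G a q) by apply: smooth_sum.
pose r q := f q - \sum_a lam a * G a q.
have sr : smooth_fun r by exact: smooth_sub.
have vr v : tangent q0 v -> v r = v f - \sum_a lam a * v (G a).
  move=> tv; rewrite (tan_sub okQ tv sf sS) (tan_sum okQ _ tv slam); congr (_ - _).
  by apply: eq_bigr => a _; rewrite (tan_scale okQ _ tv).
have Er i : E i q0 r = 0.
  rewrite vr //; apply/eqP; rewrite subr_eq0; apply/eqP.
  transitivity (\sum_j (\sum_a A i a * B a j) * E j q0 f).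
    rewrite (bigD1 i) //= ABE eqxx mul1r big1 ?addr0 // => j ji.
    by rewrite ABE eq_sym (negbTE ji) mul0r.
  under eq_bigr do rewrite mulr_suml; rewrite exchange_big /=; apply: eq_bigr => a _.
  by rewrite /lam mulr_suml; apply: eq_bigr => j _; rewrite [A i a]mxE; ring.
have xr : x r = 0 by rewrite (fr _ _ _ Wq tx sr) big1 // => i _; rewrite Er mulr0.
have xf : x f = \sum_a lam a * x (G a) by apply/eqP; rewrite -subr_eq0 -vr // xr.
have sGJ a : smooth_fun (G a \o J) by have [_ hh] := sPJ; exact: (hh _ (sz a)).
have sL : smooth_fun (fun l => \sum_a lam a * G a (J l)).
  by apply: smooth_sum => // a; apply: (smooth_mul okL); [exact: smooth_cst|exact: sGJ].
have Vr : V (r \o J) = 0; last first.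
  have := Vr; rewrite (_ : r \o J = (fun l => (f \o J) l - \sum_a lam a * G a (J l))) //.
  rewrite (tan_sub okL tV sfJ sL) => /eqP; rewrite subr_eq0 => /eqP ->.
  rewrite (tan_sum okL _ tV); last by move=> a; apply: (smooth_mul okL); [exact: smooth_cst|exact: sGJ].
  rewrite xf; apply: eq_bigr => a _; rewrite (tan_scale okL _ tV (sGJ a)); congr (_ * _).
  by rewrite -[LHS](tmapE Psi x (sz a)) ex tmapE.
have srJ : smooth_fun (r \o J) by exact: (smooth_sub okL sfJ sL).
pose Gam q := \sum_a `|G a q - G a q0|.
have Gam0 q : 0 <= Gam q by apply: sumr_ge0.
pose Y q := \sum_i `|cfun d q 0 i - cfun d q0 0 i|.
have Y0 q : 0 <= Y q by apply: sumr_ge0.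
pose n : R := (mdim Q)%:R.
have n0 : 0 <= n by exact: ler0n.
(* A function with zero differential at q0 is small against the coordinate increments Y. *)
have second (g : Q -> R) (e : R) : smooth_fun g -> (forall i, E i q0 g = 0) -> 0 < e ->
    \forall q \near q0, `|g q - g q0| <= e * Y q.
  move=> sg Eg e0; have [k [sk k0 kE]] := hadamard_at okQ ad dq sg.
  have nk : \forall q \near q0, forall i, `|k i q| <= e.
    apply: near_bigand => i; apply: near_small => //.
    by rewrite k0 -DE.
  near=> q; have -> : g q - g q0 = \sum_i (cfun d q 0 i - cfun d q0 0 i) * k i q.
    by have -> : g q = g q0 + \sum_i (cfun d q 0 i - cfun d q0 0 i) * k i q; [near: q | rewrite addrC addKr].
  apply: le_trans (ler_norm_sum _ _ _) _; rewrite /Y mulr_sumr; apply: ler_sum => i _.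
  rewrite normrM mulrC ler_wpM2r //.
  have /(_ i) : forall i, `|k i q| <= e by near: q.
  exact.
pose C := \sum_a \sum_i `|B a i|.
have C0 : 0 <= C by apply: sumr_ge0 => a _; apply: sumr_ge0.
have BC a i : `|B a i| <= C.
  rewrite /C (bigD1 a) //= (bigD1 i) //= -addrA lerDl addr_ge0 // sumr_ge0 // => b _.
  exact: sumr_ge0.
(* The coordinates too are combinations of the [G a] up to functions with zero differential; this
   bounds Y by the increments of the [G a]. *)
pose t i q := y i q - \sum_a B a i * G a q.
have sBG i : smooth_fun (fun q => \sum_a B a i * G a q).
  by apply: smooth_sum => // a; apply: (smooth_mul okQ); [exact: smooth_cst|exact: sG].
have st i : smooth_fun (t i) by exact: smooth_sub.
have Et i j : E j q0 (t i) = 0.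
  rewrite (tan_sub okQ (tE j) (sy i) (sBG i)) Eq // (tan_sum okQ _ (tE j)); last first.
    by move=> a; apply: (smooth_mul okQ); [exact: smooth_cst|exact: sG].
  rewrite -ABE; apply/eqP; rewrite subr_eq0; apply/eqP; apply: eq_bigr => a _.
  by rewrite (tan_scale okQ _ (tE j) (sG a)) [A j a]mxE mulrC.
(* With n coordinates the total error is n dl Y <= Y / 2, which the left side absorbs. *)
pose dl := (2 * (n + 1))^-1.
have n1 : 0 < n + 1 by rewrite ltr_wpDl.
have dl0 : 0 < dl by rewrite invr_gt0 mulr_gt0.
have nt : \forall q \near q0, forall i, `|t i q - t i q0| <= dl * Y q.
  by apply: near_bigand => i; apply: second.
have nW : \forall q \near q0, W q by exact: (open_nbhs_nbhs (conj oW Wq)).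
have nY : \forall q \near q0, Y q <= 2 * n * C * Gam q.
  near=> q.
  have Wq' : W q by near: q.
  have tq : forall i, `|t i q - t i q0| <= dl * Y q by near: q.
  have yi i : `|cfun d q 0 i - cfun d q0 0 i| <= dl * Y q + C * Gam q.
    rewrite -!Wy //.
    have -> : y i q - y i q0 = (t i q - t i q0) + \sum_a B a i * (G a q - G a q0).
      rewrite /t; under [X in _ = _ + X]eq_bigr do rewrite mulrBr.
      by rewrite sumrB; ring.
    apply: le_trans (ler_normD _ _) _; apply: lerD => //.
    apply: le_trans (ler_norm_sum _ _ _) _; rewrite /Gam mulr_sumr; apply: ler_sum => a _.
    by rewrite normrM ler_wpM2r.
  have : Y q <= \sum_(i < mdim Q) (dl * Y q + C * Gam q) by apply: ler_sum => i _.
  rewrite sumr_const card_ord -[leRHS]mulr_natl -/n => hY.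
  have h2 : n * (dl * Y q) <= Y q / 2.
    rewrite mulrA [leRHS]mulrC ler_wpM2r // /dl invfM mulrCA ler_piMr // ler_pdivrMr // mul1r.
    by rewrite lerDl.
  have := le_trans hY (_ : _ <= Y q / 2 + n * (C * Gam q)); rewrite mulrDr lerD2r => /(_ h2).
  rewrite -lerBlDl => h3.
  have -> : 2 * n * C * Gam q = 2 * (n * (C * Gam q)) by ring.
  rewrite -ler_pdivrMl //; apply: le_trans h3.
  by rewrite le_eqVlt; apply/orP; left; apply/eqP; field.
apply: (small_derivation okL srJ sGJ _ tV) => e e0.
have e1 : 0 < e / (2 * n * C + 1) by rewrite divr_gt0 // ltr_wpDl // !mulr_ge0.
have nr := second r _ sr Er e1.
have main : \forall q \near q0, `|r q - r q0| <= e * Gam q.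
  near=> q; apply: le_trans (_ : _ <= e / (2 * n * C + 1) * Y q) _; first by near: q.
  apply: le_trans (ler_wpM2l (ltW e1) (_ : Y q <= 2 * n * C * Gam q)) _; first by near: q.
  rewrite mulrA ler_wpM2r // mulrAC ler_pdivrMr ?ltr_wpDl ?mulr_ge0 // ler_wpM2l ?ltW //.
  by rewrite ltrDl.
exact: (cJ l0 _ main).
Unshelve. all: by end_near. Qed.

End Embedding.

(** * Vector fields and one-forms *)

Section Fields.
Variables (R : realType) (M : mfd R).
Hypothesis okM : mfd_ok M.
Implicit Types (X Y Z : M -> tvec M) (f g : M -> R) (p : M).

Lemma vf_tan X p : is_vfield X -> tangent p (X p). Proof. by case. Qed.
Lemma vf_smooth X f : is_vfield X -> smooth_fun f -> smooth_fun (fun p => X p f).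
Proof. by case=> _ h; exact: h. Qed.

Lemma vf_add X Y : is_vfield X -> is_vfield Y -> is_vfield (fun p => X p + Y p).
Proof.
move=> vX vY; split; first by move=> p; apply: tanD; exact: vf_tan.
by move=> f sf; apply: smooth_add => //; exact: vf_smooth.
Qed.

Lemma vf_scale a X : smooth_fun a -> is_vfield X -> is_vfield (fun p => a p *: X p).
Proof.
move=> sa vX; split; first by move=> p; apply: tanZ; exact: vf_tan.
by move=> f sf; apply: smooth_mul => //; exact: vf_smooth.
Qed.

Lemma vf_opp X : is_vfield X -> is_vfield (fun p => - X p).
Proof.
move=> vX; split; first by move=> p; apply: tanN; exact: vf_tan.
by move=> f sf; apply: smooth_opp => //; exact: vf_smooth.
Qed.

Lemma vf_zero : is_vfield (fun _ : M => 0 : tvec M).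
Proof. by split; [move=> p; exact: tan0 | move=> f sf; exact: smooth_cst]. Qed.

Lemma vf_sum (I : Type) (s : seq I) (F : I -> M -> tvec M) :
  (forall i, is_vfield (F i)) -> is_vfield (fun p => \sum_(i <- s) F i p).
Proof.
move=> vF; elim: s => [|i s IH]; first by under eq_fun do rewrite big_nil; exact: vf_zero.
by under eq_fun do rewrite big_cons; exact: vf_add.
Qed.

Lemma lie_tangent X Y p : is_vfield X -> is_vfield Y -> tangent p (lie X Y p).
Proof.
move=> vX vY; have sX f : smooth_fun f -> smooth_fun (vact X f) by exact: vf_smooth.
have sY f : smooth_fun f -> smooth_fun (vact Y f) by exact: vf_smooth.
have tX q := vf_tan q vX; have tY q := vf_tan q vY.
split.
- move=> a f g sf sg; rewrite /lie.
  have E (Z : M -> tvec M) : is_vfield Z -> vact Z (fun x => a * f x + g x) = (fun x => a * vact Z f x + vact Z g x).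
    by move=> vZ; apply/funext => q; exact: (tan_lin a (vf_tan q vZ) sf sg).
  by rewrite !E // (tan_lin a (tX p) (sY _ sf) (sY _ sg)) (tan_lin a (tY p) (sX _ sf) (sX _ sg)); ring.
- move=> f g sf sg; rewrite /lie.
  have E (Z : M -> tvec M) : is_vfield Z -> vact Z (fun x => f x * g x) = (fun x => vact Z f x * g x + f x * vact Z g x).
    by move=> vZ; apply/funext => q; exact: (tan_mul (vf_tan q vZ) sf sg).
  rewrite !E // (tan_add (tX p)) ?(tan_add (tY p)); try by apply: smooth_mul => //; (exact: sX || exact: sY).
  rewrite (tan_mul (tX p) (sY _ sf) sg) (tan_mul (tX p) sf (sY _ sg)) (tan_mul (tY p) (sX _ sf) sg) (tan_mul (tY p) sf (sX _ sg)).
  by rewrite /vact; ring.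
move=> f nf; rewrite /lie.
have E (Z : M -> tvec M) : is_vfield Z -> vact Z f = (fun=> 0).
  by move=> vZ; apply/funext => q; exact: (tan_nsmooth (vf_tan q vZ) nf).
by rewrite !E // (tan_cst okM _ (tX p)) (tan_cst okM _ (tY p)) subrr.
Qed.

Lemma lie_vfield X Y : is_vfield X -> is_vfield Y -> is_vfield (lie X Y).
Proof.
move=> vX vY; split; first by move=> p; exact: lie_tangent.
move=> f sf; rewrite /lie; apply: smooth_sub => //.
  by apply: vf_smooth => //; exact: vf_smooth.
by apply: vf_smooth => //; exact: vf_smooth.
Qed.

Lemma lie_anti X Y p : lie Y X p = - lie X Y p.
Proof. by apply/funext => f; rewrite tvecN /lie opprB. Qed.

Lemma lie_addr X Y Z p : is_vfield X -> is_vfield Y -> is_vfield Z ->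
  lie X (fun q => Y q + Z q) p = lie X Y p + lie X Z p.
Proof.
move=> vX vY vZ; have vYZ := vf_add vY vZ.
apply: (tan_eq (lie_tangent p vX vYZ)); first by apply: tanD; exact: lie_tangent.
move=> f sf; rewrite tvecD /lie.
have -> : vact (fun q => Y q + Z q) f = (fun q => vact Y f q + vact Z f q) by [].
rewrite (tan_add (vf_tan p vX)) ?tvecD; [|exact: vf_smooth|exact: vf_smooth].
by rewrite opprD; ring.
Qed.

Lemma lie_scaler X Y a p : is_vfield X -> is_vfield Y -> smooth_fun a ->
  lie X (fun q => a q *: Y q) p = X p a *: Y p + a p *: lie X Y p.
Proof.
move=> vX vY sa; have vaY := vf_scale sa vY.
apply: (tan_eq (lie_tangent p vX vaY)).
  by apply: tanD; apply: tanZ; [exact: vf_tan | exact: lie_tangent].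
move=> f sf; rewrite tvecD !tvecZ /lie.
have -> : vact (fun q => a q *: Y q) f = (fun q => a q * vact Y f q) by [].
rewrite (tan_mul (vf_tan p vX) sa) ?tvecZ; last exact: vf_smooth.
by rewrite /vact; ring.
Qed.

(** rho Y is the sum of the functions [Y (q i)] times the global fields rho D_i, and these functions
    vanish at p. *)
Lemma field_tensor p (A : (M -> tvec M) -> R) :
  (forall Y Z, is_vfield Y -> is_vfield Z -> A (fun q => Y q + Z q) = A Y + A Z) ->
  (forall g Y, smooth_fun g -> is_vfield Y -> A (fun q => g q *: Y q) = g p * A Y) ->
  forall Y, is_vfield Y -> Y p = 0 -> A Y = 0.
Proof.
move=> AD AZ Y vY Yp.
have [_ _ _ /(_ p) [c ac cp]] := okM.
have [q [D [W [[oW Wp Wc] sq vD Wq [fr _ _]]]]] := local_frame okM ac cp.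
have [rho [srho r1 [K [cK KW rK]]]] := bump_mfd okM oW Wp.
have rp : rho p = 1 by exact: nbhs_singleton r1.
have A0 : A (fun=> 0) = 0.
  have := AZ (fun=> 0) _ (smooth_cst okM 0) vf_zero.
  rewrite (_ : (fun q => 0 *: 0) = (fun=> 0)) ?mul0r //.
  by apply/funext => z; rewrite scaler0.
have E : (fun z => rho z *: Y z) = (fun z => \sum_i (Y z (q i)) *: (rho z *: D i z)).
  apply/funext => z; case: (pselect (W z)) => Wz; last first.
    have -> : rho z = 0 by apply: rK => /KW.
    by rewrite scale0r big1 // => i _; rewrite scale0r scaler0.
  apply: (@tan_eq R M z).
  - by apply: tanZ; exact: vf_tan.
  - by apply: tan_sumc => i; do 2 apply: tanZ; exact: vf_tan.
  move=> f sf; rewrite tvecZ (fr _ _ _ Wz (vf_tan z vY) sf) tvec_sumE mulr_sumr.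
  by apply: eq_bigr => i _; rewrite !tvecZ; ring.
have sYq i : smooth_fun (fun z => Y z (q i)) by exact: vf_smooth.
have As (s : seq 'I_(mdim M)) : A (fun z => \sum_(i <- s) (Y z (q i)) *: (rho z *: D i z)) = 0.
  elim: s => [|i s IH]; first by under eq_fun do rewrite big_nil.
  under eq_fun do rewrite big_cons.
  rewrite AD; first by rewrite IH AZ ?Yp ?mul0r ?addr0 //; exact: vf_scale.
    by do 2 apply: vf_scale => //.
  by apply: vf_sum => j; do 2 apply: vf_scale => //.
by rewrite -[A Y]mul1r -rp -AZ // E As.
Qed.

Lemma linear_onD (V : lmodType R) (S : set V) (f : V -> R) u v : linear_on S f -> S u -> S v -> f (u + v) = f u + f v.
Proof. by move=> lf Su Sv; rewrite -[u]scale1r lf // mul1r scale1r. Qed.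

Lemma linear_on0 (V : lmodType R) (S : set V) (f : V -> R) : linear_on S f -> S 0 -> f 0 = 0.
Proof.
move=> lf S0; have := linear_onD lf S0 S0; rewrite addr0 => /eqP.
by rewrite -subr_eq0 opprD addrA subrr add0r oppr_eq0 => /eqP.
Qed.

Lemma linear_onZ (V : lmodType R) (S : set V) (f : V -> R) a u : linear_on S f -> S 0 -> S u -> f (a *: u) = a * f u.
Proof. by move=> lf S0 Su; rewrite -[a *: u]addr0 lf // (linear_on0 lf) // addr0. Qed.

Lemma linear_on_sum (V : lmodType R) (S : set V) (f : V -> R) (I : Type) (s : seq I) (c : I -> R) (v : I -> V) :
  linear_on S f -> Defs.subspace S -> (forall i, S (v i)) ->
  S (\sum_(i <- s) c i *: v i) /\ f (\sum_(i <- s) c i *: v i) = \sum_(i <- s) c i * f (v i).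
Proof.
move=> lf [S0 SD] Sv; elim: s => [|i s [IH1 IH2]]; first by rewrite !big_nil; split => //; exact: (linear_on0 lf).
rewrite !big_cons; split; first exact: SD.
by rewrite lf // IH2.
Qed.

End Fields.

(** * Vector fields along a map *)

Section Along.
Variables (R : realType) (M P : mfd R).
Hypotheses (okM : mfd_ok M) (okP : mfd_ok P).
Variable phi : M -> P.
Hypothesis sphi : sm phi.

Definition along (V : M -> tvec P) : Prop :=
  (forall x, tangent (phi x) (V x)) /\ forall f, smooth_fun f -> smooth_fun (fun x => V x f).

Lemma along_expand (x0 : M) : exists (q : 'I_(mdim P) -> P -> R) (D : 'I_(mdim P) -> P -> tvec P),
  [/\ forall i, smooth_fun (q i), forall i, is_vfield (D i) &
   \forall x \near x0, forall v, tangent (phi x) v -> v = \sum_i v (q i) *: D i (phi x)].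
Proof.
have [_ _ _ /(_ (phi x0)) [c ac cp]] := okP.
have [q [D [W [[oW Wp Wc] sq vD Wq [fr _ _]]]]] := local_frame okP ac cp.
exists q, D; split => //; have [cphi _] := sphi.
have : \forall x \near x0, W (phi x) by exact: (cphi x0 _ (open_nbhs_nbhs (conj oW Wp))).
apply: filterS => x Wx v tv; apply: (tan_eq tv).
  by apply: tan_sumc => i; apply: tanZ; have [] := vD i.
move=> f sf; rewrite (fr _ _ _ Wx tv sf) tvec_sumE.
by apply: eq_bigr.
Qed.

(** Forms are known to be smooth only on vector fields, and V is not one on P. In a local frame of P
    the coefficients of V are smooth on M, and w is evaluated on the frame. *)
Lemma form1_along (w : form1 P) V : is_form1 w -> along V -> smooth_fun (fun x => w (phi x) (V x)).
Proof.
move=> [cw sw] [tV sV]; apply/(smooth_funP okM) => x0.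
have [q [D [sq vD n]]] := along_expand x0.
apply: (@smooth_at_near _ _ okM x0 (fun x => \sum_i V x (q i) * w (phi x) (D i (phi x)))).
  apply: filterS n => x /(_ _ (tV x)) E; have [lw _] := cw (phi x).
  rewrite [in RHS]E.
  by have [] := linear_on_sum (index_enum _) (fun i => V x (q i)) lw (tangent_subspace _) (fun i => vf_tan (phi x) (vD i)).
apply: smooth_fun_at => //; apply: smooth_sum => // i; apply: smooth_mul => //; first exact: sV.
by have [_ h] := sphi; exact: (h _ (sw _ (vD i))).
Qed.

Lemma form2_along (w : form2 P) V W : is_form2 w -> along V -> along W ->
  smooth_fun (fun x => w (phi x) (V x) (W x)).
Proof.
move=> [cw sw] [tV sV] [tW sW]; apply/(smooth_funP okM) => x0.
have [q [D [sq vD n]]] := along_expand x0.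
apply: (@smooth_at_near _ _ okM x0 (fun x => \sum_i V x (q i) * \sum_j W x (q j) * w (phi x) (D i (phi x)) (D j (phi x)))).
  apply: filterS n => x E; have [l1 al] := cw (phi x).
  have tD i : tangent (phi x) (D i (phi x)) by exact: vf_tan.
  have l2 v : tangent (phi x) v -> linear_on (tangent (phi x)) (w (phi x) v).
    move=> tv a u1 u2 t1 t2; rewrite al //; last exact: tan_linc.
    by rewrite (l1 v tv a u1 u2 t1 t2) opprD -mulrN -!al.
  rewrite [in RHS](E _ (tV x)).
  have [_ ->] := linear_on_sum (index_enum _) (fun i => V x (q i)) (l1 _ (tW x)) (tangent_subspace _) tD.
  apply: eq_bigr => i _; congr (_ * _); rewrite [in RHS](E _ (tW x)).
  by have [_ ->] := linear_on_sum (index_enum _) (fun i => W x (q i)) (l2 _ (tD i)) (tangent_subspace _) tD.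
apply: smooth_fun_at => //; apply: smooth_sum => // i; apply: smooth_mul => //; first exact: sV.
apply: smooth_sum => // j; apply: smooth_mul => //; first exact: sW.
by have [_ h] := sphi; exact: (h _ (sw _ _ (vD i) (vD j))).
Qed.

End Along.

(** * The standard Courant bracket paired with a third section *)

Section Exact.
Variables (R : realType) (M : mfd R).
Hypothesis okM : mfd_ok M.
Implicit Types (X Y Z : M -> tvec M) (a b c : form1 M).

(* <[[X + a, Y + b]], Z + c> for the standard Courant bracket. *)
Definition tex X a Y b Z c : M -> R := fun p =>
  X p (ev1 b Z) - b p (lie X Z p) - Y p (ev1 a Z) + Z p (ev1 a Y) + a p (lie Y Z p) + c p (lie X Y p).

Lemma form1_lin a p : is_form1 a -> linear_on (tangent p) (a p).
Proof. by move=> [h _]; have [] := h p. Qed.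

Lemma form1D a p u v : is_form1 a -> tangent p u -> tangent p v -> a p (u + v) = a p u + a p v.
Proof. by move=> fa tu tv; exact (@linear_onD R (tvec M) (tangent p) (a p) u v (form1_lin fa) tu tv). Qed.
Lemma form1Z a p k u : is_form1 a -> tangent p u -> a p (k *: u) = k * a p u.
Proof. by move=> fa tu; exact (@linear_onZ R (tvec M) (tangent p) (a p) k u (form1_lin fa) (tan0 p) tu). Qed.
Lemma form1N a p u : is_form1 a -> tangent p u -> a p (- u) = - a p u.
Proof. by move=> fa tu; rewrite -scaleN1r form1Z // mulN1r. Qed.

Lemma ev1_smooth a X : is_form1 a -> is_vfield X -> smooth_fun (ev1 a X).
Proof. by move=> [_ h]; exact: h. Qed.

Lemma tex_anti12 X a Y b Z c p : is_vfield X -> is_vfield Y -> is_vfield Z ->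
  is_form1 a -> is_form1 b -> is_form1 c ->
  tex X a Y b Z c p + tex Y b X a Z c p = Z p (fun q => ev1 a Y q + ev1 b X q).
Proof.
move=> vX vY vZ fa fb fc; rewrite (tan_add (vf_tan p vZ) (ev1_smooth fa vY) (ev1_smooth fb vX)).
rewrite /tex (lie_anti X Y) (form1N fc (lie_tangent okM p vX vY)); ring.
Qed.

Lemma tex_anti23 X a Y b Z c p : is_vfield X -> is_vfield Y -> is_vfield Z ->
  is_form1 a -> is_form1 b -> is_form1 c ->
  tex X a Y b Z c p + tex X a Z c Y b p = X p (fun q => ev1 b Z q + ev1 c Y q).
Proof.
move=> vX vY vZ fa fb fc; rewrite (tan_add (vf_tan p vX) (ev1_smooth fb vZ) (ev1_smooth fc vY)).
rewrite /tex (lie_anti Y Z) (form1N fa (lie_tangent okM p vY vZ)); ring.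
Qed.

(** [tex] without its last term: the one-form component of [[X + a, Y + b]], evaluated on Z. *)
Definition texform X a Y b Z : M -> R := fun p =>
  X p (ev1 b Z) - b p (lie X Z p) - Y p (ev1 a Z) + Z p (ev1 a Y) + a p (lie Y Z p).

(** The derivatives of g cancel: X(g) b(Z) between the first two terms, Y(g) a(Z) between the third
    and the fifth. *)
Lemma texform_scale X a Y b g Z p : is_vfield X -> is_vfield Y -> is_form1 a -> is_form1 b ->
  smooth_fun g -> is_vfield Z -> texform X a Y b (fun q => g q *: Z q) p = g p * texform X a Y b Z p.
Proof.
move=> vX vY fa fb sg vZ; rewrite /texform !(lie_scaler okM p _ vZ sg) //.
have E c W : is_form1 c -> is_vfield W -> W p (ev1 c (fun q => g q *: Z q)) = W p g * c p (Z p) + g p * W p (ev1 c Z).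
  move=> fc vW; rewrite (_ : ev1 c _ = (fun q => g q * ev1 c Z q)); last first.
    by apply/funext => q; rewrite /ev1 form1Z //; exact: vf_tan.
  by rewrite (tan_mul (vf_tan p vW) sg (ev1_smooth fc vZ)).
have tZ := vf_tan p vZ.
rewrite !E // tvecZ.
rewrite (form1D fb (tanZ _ tZ) (tanZ _ (lie_tangent okM p vX vZ))).
rewrite (form1D fa (tanZ _ tZ) (tanZ _ (lie_tangent okM p vY vZ))).
rewrite !(form1Z _ fa tZ) !(form1Z _ fb tZ) (form1Z _ fa (lie_tangent okM p vY vZ)) (form1Z _ fb (lie_tangent okM p vX vZ)).
ring.
Qed.

Lemma texform_add X a Y b Z Z' p : is_vfield X -> is_vfield Y -> is_form1 a -> is_form1 b ->
  is_vfield Z -> is_vfield Z' ->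
  texform X a Y b (fun q => Z q + Z' q) p = texform X a Y b Z p + texform X a Y b Z' p.
Proof.
move=> vX vY fa fb vZ vZ'; rewrite /texform !(lie_addr okM p _ vZ vZ') //.
have E c W : is_form1 c -> is_vfield W -> W p (ev1 c (fun q => Z q + Z' q)) = W p (ev1 c Z) + W p (ev1 c Z').
  move=> fc vW; rewrite -(tan_add (vf_tan p vW) (ev1_smooth fc vZ) (ev1_smooth fc vZ')).
  congr (W p _); apply/funext => q; rewrite /ev1 form1D //; exact: vf_tan.
rewrite !E // tvecD.
rewrite (form1D fb (lie_tangent okM p vX vZ) (lie_tangent okM p vX vZ')).
rewrite (form1D fa (lie_tangent okM p vY vZ) (lie_tangent okM p vY vZ')).
ring.
Qed.

Lemma texform_cov X a Y b p : is_vfield X -> is_vfield Y -> is_form1 a -> is_form1 b ->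
  exists al, cotangent p al /\ forall Z, is_vfield Z -> texform X a Y b Z p = al (Z p).
Proof.
move=> vX vY fa fb; pose A Z := texform X a Y b Z p.
have AD Z Z' : is_vfield Z -> is_vfield Z' -> A (fun q => Z q + Z' q) = A Z + A Z' by exact: texform_add.
have AZ g Z : smooth_fun g -> is_vfield Z -> A (fun q => g q *: Z q) = g p * A Z by exact: texform_scale.
have [_ _ _ /(_ p) [c ac cp]] := okM.
have [q [D [W [[oW Wp Wc] sq vD Wq [fr _ _]]]]] := local_frame okM ac cp.
pose al : fnl (tvec M) := restr (tangent p) (fun v => \sum_i v (q i) * A (D i)).
exists al; split.
  split; last by move=> v nv; rewrite /al /restr asboolF.
  move=> k u v tu tv; rewrite /al /restr !asboolT //; last exact: tan_linc.
  rewrite mulr_sumr -big_split; apply: eq_bigr => i _.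
  by rewrite tvecE mulrDl mulrA.
move=> Z vZ; have tZ := vf_tan p vZ.
have As (k : 'I_(mdim M) -> R) (r : seq 'I_(mdim M)) : is_vfield (fun x => \sum_(i <- r) k i *: D i x) /\
   A (fun x => \sum_(i <- r) k i *: D i x) = \sum_(i <- r) k i * A (D i).
  elim: r => [|i r [IH1 IH2]].
    rewrite big_nil; under eq_fun do rewrite big_nil; split; first exact: vf_zero.
    have := AZ (fun=> 0) _ (smooth_cst okM 0) (vf_zero okM).
    rewrite (_ : (fun q => 0 *: 0) = (fun=> 0)) ?mul0r //.
    by apply/funext => z; rewrite scaler0.
  rewrite big_cons; under eq_fun do rewrite big_cons.
  have vkD : is_vfield (fun x => k i *: D i x) by apply: (vf_scale okM (a := fun=> k i)) => //; exact: smooth_cst.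
  split; first exact: vf_add.
  by rewrite AD // IH2 (AZ (fun=> k i)) //; exact: smooth_cst.
have [vS AS] := As (fun i => Z p (q i)) (index_enum _).
have vm : is_vfield (fun x => (- 1) *: \sum_i Z p (q i) *: D i x).
  by apply: (vf_scale okM (a := fun=> -1)) => //; exact: smooth_cst.
have z0 : Z p + (- 1) *: (\sum_i Z p (q i) *: D i p) = 0.
  rewrite scaleN1r; apply/eqP; rewrite subr_eq0; apply/eqP.
  apply: (tan_eq tZ); first by apply: tan_sumc => i; apply: tanZ; exact: vf_tan.
  by move=> f sf; rewrite (fr _ _ _ Wp tZ sf) tvec_sumE.
have := field_tensor okM AD AZ (vf_add okM vZ vm) z0.
rewrite AD // (AZ (fun=> -1)) //; last exact: smooth_cst.
rewrite AS mulN1r => /eqP; rewrite subr_eq0 => /eqP; rewrite /A => ->.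
by rewrite /al /restr asboolT.
Qed.

(** Only the value of Z at p matters, so an identity for all fields may be verified on fields with
    convenient brackets, such as invariant ones. *)
Lemma texform_tensor X a Y b (Th : form3 M) (al : fnl (tvec M)) p Z1 Z2 :
  is_vfield X -> is_vfield Y -> is_form1 a -> is_form1 b -> is_vfield Z1 -> is_vfield Z2 -> Z1 p = Z2 p ->
  texform X a Y b Z1 p + Th p (X p) (Y p) (Z1 p) = al (Z1 p) ->
  texform X a Y b Z2 p + Th p (X p) (Y p) (Z2 p) = al (Z2 p).
Proof.
move=> vX vY fa fb v1 v2 e12; have [be [_ hb]] := texform_cov p vX vY fa fb.
by rewrite !hb // e12.
Qed.

End Exact.

Lemma lin_tanB (R : realType) (M : mfd R) (p : M) (f : tvec M -> R) (u v : tvec M) :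
  linear_on (tangent p) f -> tangent p u -> tangent p v -> f (u - v) = f u - f v.
Proof.
by move=> lf tu tv; rewrite -scaleN1r addrC (lf _ _ _ tv tu) mulN1r addrC.
Qed.

(** * The Lie group *)

Section Group.
Variables (R : realType) (K : lie_group_data R) (Omega : form2 (prod_mfd K K)) (Theta : form3 K).
Hypothesis SS : shifted_symplectic Omega Theta.
Local Notation "x ** y" := (lmul x y) (at level 40, left associativity).
Local Notation e := (lone K).
Local Notation KK := (prod_mfd K K).
Local Notation KKK := (prod_mfd KK K).
Implicit Types (k l : K) (u v w X Y : tvec K).

Let LG : is_lie_group K := ss_group SS.
Lemma ss_ok : mfd_ok K. Proof. exact: is_mfd_ok (lg_mfd LG). Qed.
Let okK := ss_ok.
Lemma ss_ok2 : mfd_ok KK. Proof. exact: prod_ok. Qed.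
Let okKK := ss_ok2.
Let okKKK : mfd_ok KKK := prod_ok okKK okK.

Lemma tmap_tpair (M N P : mfd R) (F : prod_mfd M N -> P) p q (u : tvec M) (v : tvec N) : mfd_ok M -> mfd_ok N ->
  sm F -> tangent p u -> tangent q v ->
  tmap F (tpair p q u v) = tmap (fun x => F (x, q)) u + tmap (fun y => F (p, y)) v.
Proof.
move=> okM okN [_ sF] tu tv; apply/funext => g; rewrite tvecD /tmap.
case: asboolP => sg; last by rewrite addr0.
by rewrite tpairE //; exact: sF.
Qed.

Lemma tmap_fst (M N : mfd R) p q (u : tvec M) (v : tvec N) : mfd_ok M -> mfd_ok N -> tangent p u -> tangent q v ->
  @tmap R (prod_mfd M N) M (fun x => x.1) (tpair p q u v) = u.
Proof.
move=> okM okN tu tv; rewrite tmap_tpair //=; last exact: sm_fst.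
by rewrite (tmap_id tu) (tmap_cst _ okN tv) addr0.
Qed.

Lemma tmap_snd (M N : mfd R) p q (u : tvec M) (v : tvec N) : mfd_ok M -> mfd_ok N -> tangent p u -> tangent q v ->
  @tmap R (prod_mfd M N) N (fun x => x.2) (tpair p q u v) = v.
Proof.
move=> okM okN tu tv; rewrite tmap_tpair //=; last exact: sm_snd.
by rewrite (tmap_cst _ okM tu) (tmap_id tv) add0r.
Qed.

Lemma sm_mul : @sm R KK K (fun x => x.1 ** x.2).
Proof. by apply: smooth_map_sm => //; exact: lg_mul_smooth. Qed.
Lemma sm_mulr k : sm (fun x : K => x ** k).
Proof. exact: (sm_comp (sm_pair okK okK okK (sm_id K) (sm_cst k okK)) sm_mul). Qed.
Lemma sm_mull k : sm (fun x : K => k ** x).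
Proof. exact: (sm_comp (sm_pair okK okK okK (sm_cst k okK) (sm_id K)) sm_mul). Qed.

Local Notation RR k := (tmap (fun x : K => x ** k)).
Local Notation LL k := (tmap (fun x : K => k ** x)).
Local Notation tge := (@tangent R K e).

Lemma tan_RR k l u : tangent l u -> tangent (l ** k) (RR k u).
Proof. by move=> tu; exact: (tmap_tangent okK (sm_mulr k) tu). Qed.
Lemma tan_LL k l u : tangent l u -> tangent (k ** l) (LL k u).
Proof. by move=> tu; exact: (tmap_tangent okK (sm_mull k) tu). Qed.
Lemma tan_R k u : tge u -> tangent k (RR k u).
Proof. by move=> tu; rewrite -[k in tangent k](lg_mul1l LG); exact: tan_RR. Qed.
Lemma tan_L k u : tge u -> tangent k (LL k u).
Proof. by move=> tu; rewrite -[k in tangent k](lg_mul1r LG); exact: tan_LL. Qed.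
Lemma RR1 l u : tangent l u -> RR e u = u.
Proof. by move=> tu; under eq_fun do rewrite (lg_mul1r LG); exact: tmap_id tu. Qed.
Lemma LL1 l u : tangent l u -> LL e u = u.
Proof. by move=> tu; under eq_fun do rewrite (lg_mul1l LG); exact: tmap_id tu. Qed.

Lemma R_surj k X : tangent k X -> exists2 w, tge w & X = RR k w.
Proof.
move=> tX; exists (RR (linv k) X); first by rewrite -(lg_mulVr LG k); exact: tan_RR.
rewrite tmap_comp; last exact: sm_mulr.
under eq_fun do rewrite -(lg_mulA LG) (lg_mulVl LG) (lg_mul1r LG).
by rewrite (tmap_id tX).
Qed.
Lemma L_surj k X : tangent k X -> exists2 w, tge w & X = LL k w.
Proof.
move=> tX; exists (LL (linv k) X); first by rewrite -(lg_mulVl LG k); exact: tan_LL.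
rewrite tmap_comp; last exact: sm_mull.
under eq_fun do rewrite (lg_mulA LG) (lg_mulVr LG) (lg_mul1l LG).
by rewrite (tmap_id tX).
Qed.

Definition om k l X Y X' Y' : R := Omega (k, l) (tpair k l X Y) (tpair k l X' Y').

Lemma tan_tp k l X Y : tangent k X -> tangent l Y -> @tangent R KK (k, l) (tpair k l X Y).
Proof. exact: tpair_tangent. Qed.

Lemma om_lin k l a X Y X2 Y2 X' Y' : tangent k X -> tangent l Y -> tangent k X2 -> tangent l Y2 ->
  tangent k X' -> tangent l Y' ->
  om k l (a *: X + X2) (a *: Y + Y2) X' Y' = a * om k l X Y X' Y' + om k l X2 Y2 X' Y'.
Proof.
move=> tX tY tX2 tY2 tX' tY'; have [/(_ (k, l)) [h _] _] := ss_Omega SS.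
by rewrite /om tpair_lin; apply: h; exact: tan_tp.
Qed.

Lemma om_anti k l X Y X' Y' : tangent k X -> tangent l Y -> tangent k X' -> tangent l Y' ->
  om k l X Y X' Y' = - om k l X' Y' X Y.
Proof.
move=> tX tY tX' tY'; have [/(_ (k, l)) [_ h] _] := ss_Omega SS.
by apply: h; exact: tan_tp.
Qed.

Lemma om0l k l X' Y' : tangent k X' -> tangent l Y' -> om k l 0 0 X' Y' = 0.
Proof.
move=> tX tY; have := om_lin 1 (tan0 k) (tan0 l) (tan0 k) (tan0 l) tX tY.
rewrite scaler0 addr0 mul1r => h; lra.
Qed.
Lemma om0r k l X Y : tangent k X -> tangent l Y -> om k l X Y 0 0 = 0.
Proof. by move=> tX tY; rewrite om_anti ?om0l ?oppr0 //; exact: tan0. Qed.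

(** The cocycle condition on vectors given by components. The relations between values of [om] at
    different points are instances with unit elements and zero components. *)
Lemma om_delta k1 k2 k3 X1 X2 X3 Y1 Y2 Y3 :
  tangent k1 X1 -> tangent k2 X2 -> tangent k3 X3 -> tangent k1 Y1 -> tangent k2 Y2 -> tangent k3 Y3 ->
  om k2 k3 X2 X3 Y2 Y3 - om (k1 ** k2) k3 (RR k2 X1 + LL k1 X2) X3 (RR k2 Y1 + LL k1 Y2) Y3
  + om k1 (k2 ** k3) X1 (RR k3 X2 + LL k2 X3) Y1 (RR k3 Y2 + LL k2 Y3) - om k1 k2 X1 X2 Y1 Y2 = 0.
Proof.
move=> t1 t2 t3 s1 s2 s3.
pose V Z1 Z2 Z3 : tvec KKK := @tpair R KK K (k1, k2) k3 (tpair k1 k2 Z1 Z2) Z3.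
have tV Z1 Z2 Z3 : tangent k1 Z1 -> tangent k2 Z2 -> tangent k3 Z3 -> @tangent R KKK ((k1,k2),k3) (V Z1 Z2 Z3).
  by move=> h1 h2 h3; apply: (tpair_tangent (M := KK)) => //; exact: tan_tp.
have m1 : @sm R KKK KK (fun x => x.1) by exact: sm_fst.
have m2 : @sm R KKK K (fun x => x.2) by exact: sm_snd.
have m11 : @sm R KKK K (fun x => x.1.1) by apply: (sm_comp m1); exact: sm_fst.
have m12 : @sm R KKK K (fun x => x.1.2) by apply: (sm_comp m1); exact: sm_snd.
have sf : @sm R KK K (fun x => x.1) by exact: sm_fst.
have ss : @sm R KK K (fun x => x.2) by exact: sm_snd.
have m112 : @sm R KKK K (fun x => x.1.1 ** x.1.2) by exact: (sm_comp (sm_pair okK okK okKKK m11 m12) sm_mul).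
have m123 : @sm R KKK K (fun x => x.1.2 ** x.2).
  exact: (sm_comp (sm_pair okK okK okKKK m12 m2) sm_mul).
have v1 Z1 Z2 Z3 : tangent k1 Z1 -> tangent k2 Z2 -> tangent k3 Z3 -> @tmap R KKK KK (fun x => x.1) (V Z1 Z2 Z3) = tpair k1 k2 Z1 Z2.
  by move=> h1 h2 h3; apply: tmap_fst => //; exact: tan_tp.
have v2 Z1 Z2 Z3 : tangent k1 Z1 -> tangent k2 Z2 -> tangent k3 Z3 -> @tmap R KKK K (fun x => x.2) (V Z1 Z2 Z3) = Z3.
  by move=> h1 h2 h3; exact (@tmap_snd KK K (k1, k2) k3 (tpair k1 k2 Z1 Z2) Z3 okKK okK (tan_tp h1 h2) h3).
have v11 Z1 Z2 Z3 : tangent k1 Z1 -> tangent k2 Z2 -> tangent k3 Z3 -> @tmap R KKK K (fun x => x.1.1) (V Z1 Z2 Z3) = Z1.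
  by move=> h1 h2 h3; rewrite -(tmap_comp (fun x : KKK => x.1 : KK) _ sf) v1 //; exact: tmap_fst.
have v12 Z1 Z2 Z3 : tangent k1 Z1 -> tangent k2 Z2 -> tangent k3 Z3 -> @tmap R KKK K (fun x => x.1.2) (V Z1 Z2 Z3) = Z2.
  by move=> h1 h2 h3; rewrite -(tmap_comp (fun x : KKK => x.1 : KK) _ ss) v1 //; exact: tmap_snd.
have v112 Z1 Z2 Z3 : tangent k1 Z1 -> tangent k2 Z2 -> tangent k3 Z3 ->
   @tmap R KKK K (fun x => x.1.1 ** x.1.2) (V Z1 Z2 Z3) = RR k2 Z1 + LL k1 Z2.
  by move=> h1 h2 h3; rewrite -(tmap_comp (fun x : KKK => x.1 : KK) _ sm_mul) v1 // tmap_tpair //; exact: sm_mul.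
have v123 Z1 Z2 Z3 : tangent k1 Z1 -> tangent k2 Z2 -> tangent k3 Z3 ->
   @tmap R KKK K (fun x => x.1.2 ** x.2) (V Z1 Z2 Z3) = RR k3 Z2 + LL k2 Z3.
  move=> h1 h2 h3; rewrite -(tmap_comp (fun x : KKK => (x.1.2, x.2) : KK) _ sm_mul).
  rewrite (tmap_pair okK okK okKKK m12 m2 (tV _ _ _ h1 h2 h3)) v12 // v2 //= tmap_tpair //; exact: sm_mul.
have := ss_delta_Omega SS (tV _ _ _ t1 t2 t3) (tV _ _ _ s1 s2 s3).
rewrite /delta_Omega /pull2 /=.
rewrite !(tmap_pair okK okK okKKK m12 m2 (tV _ _ _ t1 t2 t3)) !(tmap_pair okK okK okKKK m12 m2 (tV _ _ _ s1 s2 s3)).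
rewrite !(tmap_pair okK okK okKKK m112 m2 (tV _ _ _ t1 t2 t3)) !(tmap_pair okK okK okKKK m112 m2 (tV _ _ _ s1 s2 s3)).
rewrite !(tmap_pair okK okK okKKK m11 m123 (tV _ _ _ t1 t2 t3)) !(tmap_pair okK okK okKKK m11 m123 (tV _ _ _ s1 s2 s3)).
rewrite !(tmap_pair okK okK okKKK m11 m12 (tV _ _ _ t1 t2 t3)) !(tmap_pair okK okK okKKK m11 m12 (tV _ _ _ s1 s2 s3)).
by rewrite !v12 // !v11 // !v112 // !v123 // !v2.
Qed.

Let t0 k : @tangent R K k 0 := tan0 k.

(** The cocycle condition at (1, k, 1). [om_sF] is the same with the sides exchanged; [om_R] and
    [om_L] are the instances at (1, 1, k) and (k, 1, 1). *)
Lemma om_tE k w u : tge w -> tge u ->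
  om k e (RR k w) 0 0 u = om e k w 0 0 (LL k u).
Proof.
move=> tw tu; have := om_delta tw (t0 k) (t0 e) (t0 e) (t0 k) tu.
rewrite !(lg_mul1l LG, lg_mul1r LG) !tmap0 !(addr0, add0r) !om0l ?om0r //; try exact: t0.
by move=> h; lra.
Qed.

Lemma om_sF k w u : tge w -> tge u ->
  om e k 0 (LL k w) u 0 = om k e 0 w (RR k u) 0.
Proof.
move=> tw tu; have := om_delta (t0 e) (t0 k) tw tu (t0 k) (t0 e).
rewrite !(lg_mul1l LG, lg_mul1r LG) !tmap0 !(addr0, add0r) !om0l ?om0r //; try exact: t0.
by move=> h; lra.
Qed.

Lemma om_R k w u : tge w -> tge u ->
  om e k w 0 0 (RR k u) = om e k w 0 u 0 + om e e w 0 0 u.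
Proof.
move=> tw tu; have := om_delta tw (t0 e) (t0 k) (t0 e) tu (t0 k).
rewrite !(lg_mul1l LG, lg_mul1r LG) !tmap0 !(addr0, add0r) om0l // (RR1 tw) (LL1 tu).
by move=> h; lra.
Qed.

Lemma om_L k w u : tge w -> tge u ->
  om k e (LL k w) 0 0 u = om k e 0 w 0 u + om e e w 0 0 u.
Proof.
move=> tw tu; have := om_delta (t0 k) tw (t0 e) (t0 k) (t0 e) tu.
rewrite !(lg_mul1l LG, lg_mul1r LG) !tmap0 !(addr0, add0r) om0r // (RR1 tw) (LL1 tu).
by move=> h; lra.
Qed.

Lemma kpairE w u : tge w -> tge u -> kpair Omega w u = - om e e w 0 0 u - om e e u 0 0 w.
Proof. by move=> tw tu; rewrite /kpair -/(om e e w 0 0 u) -/(om e e 0 w u 0) (om_anti (t0 e) tw tu). Qed.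

Lemma kpairC w u : tge w -> tge u -> kpair Omega w u = kpair Omega u w.
Proof. by move=> tw tu; rewrite !kpairE //; lra. Qed.

Lemma om_lin1 k l Y X' Y' : tangent l Y -> tangent k X' -> tangent l Y' -> Y = 0 ->
  linear_on (tangent k) (fun X => om k l X Y X' Y').
Proof.
move=> tY tX' tY' Y0 a u v tu tv; rewrite -om_lin //.
by rewrite Y0 scaler0 addr0.
Qed.
Lemma om_lin2 k l X X' Y' : tangent k X -> tangent k X' -> tangent l Y' -> X = 0 ->
  linear_on (tangent l) (fun Y => om k l X Y X' Y').
Proof.
move=> tX tX' tY' X0 a u v tu tv; rewrite -om_lin //.
by rewrite X0 scaler0 addr0.
Qed.
Lemma om_lin4 k l X Y X' : tangent k X -> tangent l Y -> tangent k X' -> X' = 0 ->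
  linear_on (tangent l) (fun Y' => om k l X Y X' Y').
Proof.
move=> tX tY tX' X0 a u v tu tv; rewrite !(@om_anti _ _ X Y) //; last exact: tan_linc.
by rewrite (om_lin2 tX' tX tY X0 a tu tv) opprD mulrN.
Qed.

Lemma kpair_lin u : tge u -> linear_on tge (fun w => kpair Omega w u).
Proof.
move=> tu a w w' tw tw'; rewrite !kpairE //; last exact: tan_linc.
rewrite (om_lin1 (t0 e) (t0 e) tu erefl a tw tw').
rewrite (om_lin4 tu (t0 e) (t0 e) erefl a tw tw'); lra.
Qed.

Lemma kpair_nondeg w : tge w -> (forall u, tge u -> kpair Omega w u = 0) -> w = 0.
Proof. by move=> tw h; exact (ss_nondeg SS tw h). Qed.

(** Chosen so that [t_Omega] is the pairing of X + zeta with w^r + muf w, and [s_Omega] is minus the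
    pairing with - w^l + nuf w; see [t_OmegaE] and [s_OmegaE]. *)
Definition muf w : form1 K := fun k => restr (tangent k) (fun V => - om e k w 0 0 V).
Definition nuf w : form1 K := fun k => restr (tangent k) (fun V => om k e 0 w V 0).

Lemma mufE w k V : tangent k V -> muf w k V = - om e k w 0 0 V.
Proof. by move=> tV; rewrite /muf /restr asboolT. Qed.
Lemma nufE w k V : tangent k V -> nuf w k V = om k e 0 w V 0.
Proof. by move=> tV; rewrite /nuf /restr asboolT. Qed.

Lemma t_OmegaE k X zeta w : tangent k X -> tge w ->
  t_Omega Omega k X zeta w = zeta (RR k w) + muf w k X.
Proof.
by move=> tX tw; rewrite /t_Omega mufE // -/(om e k 0 X w 0) (om_anti (t0 e) tX tw).
Qed.
Lemma s_OmegaE k X zeta w : tangent k X -> tge w ->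
  s_Omega Omega k X zeta w = zeta (LL k w) - nuf w k X.
Proof.
by move=> tX tw; rewrite /s_Omega nufE // -/(om k e X 0 0 w) (om_anti tX (t0 e) (t0 k)).
Qed.

(* The sections E_w = w^r + muf w and F_w = - w^l + nuf w trivialise TK + T^*K: the
   first has target w and source 0, the second target 0 and source w. *)
Lemma E_t k w u : tge w -> tge u -> muf w k (RR k u) + muf u k (RR k w) = kpair Omega w u.
Proof.
move=> tw tu; rewrite !mufE; try exact: tan_R.
rewrite !om_R // kpairE // (om_anti tw (t0 k) tu) //; lra.
Qed.
Lemma E_s k w u : tge w -> tge u -> muf w k (LL k u) = nuf u k (RR k w).
Proof.
move=> tw tu; rewrite mufE ?nufE; try exact: tan_R; try exact: tan_L.
by rewrite -om_tE // om_anti ?opprK //; try exact: t0; exact: tan_R.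
Qed.
Lemma F_s k w u : tge w -> tge u -> nuf w k (LL k u) + nuf u k (LL k w) = kpair Omega w u.
Proof.
move=> tw tu; rewrite !nufE; try exact: tan_L.
rewrite (om_anti (t0 k) tw) ?(om_anti (t0 k) tu) //; try exact: tan_L.
by rewrite !om_L // kpairE // (om_anti (t0 k) tw (t0 k)) //; lra.
Qed.

Lemma muf_lin w k : tge w -> linear_on (tangent k) (muf w k).
Proof.
move=> tw a u v tu tv; rewrite !mufE //; last exact: tan_linc.
by rewrite (om_lin4 tw (t0 k) (t0 e) erefl a tu tv); lra.
Qed.
Lemma nuf_lin w k : tge w -> linear_on (tangent k) (nuf w k).
Proof.
move=> tw a u v tu tv; rewrite !nufE //; last exact: tan_linc.
rewrite !(@om_anti k e 0 w) //; last exact: tan_linc.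
by rewrite (om_lin1 (t0 e) (t0 k) tw erefl a tu tv); lra.
Qed.
Lemma muf_lin1 k V : tangent k V -> linear_on tge (fun w => muf w k V).
Proof.
by move=> tV a u v tu tv; rewrite !mufE // (om_lin1 (t0 k) (t0 e) tV erefl a tu tv); lra.
Qed.
Lemma nuf_lin1 k V : tangent k V -> linear_on tge (fun w => nuf w k V).
Proof.
by move=> tV a u v tu tv; rewrite !nufE // (om_lin2 (t0 k) tV (t0 e) erefl a tu tv).
Qed.

(** Any X is [RR k w1 - LL k w2 + RR k x] for some x. The source condition forces zeta = mu w1 + nu
    w2 + mu x; then the target condition says that x is orthogonal to the whole Lie algebra, so x =
    0. *)
Lemma rep_decompose k X zeta w1 w2 : tangent k X -> cotangent k zeta ->
  represents Omega w1 (t_Omega Omega k X zeta) -> represents Omega w2 (s_Omega Omega k X zeta) ->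
  X = RR k w1 - LL k w2 /\ forall V, tangent k V -> zeta V = muf w1 k V + nuf w2 k V.
Proof.
move=> tX [lz _] [tw1 h1] [tw2 h2].
have tR w : tge w -> tangent k (RR k w) by exact: tan_R.
have tL w : tge w -> tangent k (LL k w) by exact: tan_L.
have [x tx Ex] : exists2 x, tge x & X = RR k w1 - LL k w2 + RR k x.
  have [x tx Ex] := R_surj (tanB tX (tanB (tR _ tw1) (tL _ tw2))).
  by exists x => //; rewrite -Ex addrC subrK.
have nufX u : tge u -> nuf u k X = nuf u k (RR k w1) - nuf u k (LL k w2) + nuf u k (RR k x).
  move=> tu; have l := nuf_lin (k := k) tu.
  by rewrite Ex (linear_onD l (tanB (tR _ tw1) (tL _ tw2)) (tR _ tx)) (lin_tanB l (tR _ tw1) (tL _ tw2)).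
have mufX u : tge u -> muf u k X = muf u k (RR k w1) - muf u k (LL k w2) + muf u k (RR k x).
  move=> tu; have l := muf_lin (k := k) tu.
  by rewrite Ex (linear_onD l (tanB (tR _ tw1) (tL _ tw2)) (tR _ tx)) (lin_tanB l (tR _ tw1) (tL _ tw2)).
have zE V : tangent k V -> zeta V = muf w1 k V + nuf w2 k V + muf x k V.
  move=> /L_surj [u tu ->]; have := h2 _ tu; rewrite s_OmegaE // nufX //.
  rewrite -(E_s k tw1 tu) -(E_s k tx tu) -(F_s k tw2 tu) => h; lra.
have x0 : x = 0.
  apply: kpair_nondeg => // u tu; have := h1 _ tu; rewrite t_OmegaE // mufX // zE; last exact: tR.
  rewrite -(E_t k tw1 tu) -(E_t k tx tu) -(E_s k tu tw2) => h; lra.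
split; first by rewrite {1}Ex x0 tmap0 addr0.
move=> V tV; rewrite zE // x0 (_ : muf 0 k V = 0) ?addr0 //.
by rewrite mufE // om0l ?oppr0 //.
Qed.

Lemma rep_compose k zeta w1 w2 : tge w1 -> tge w2 ->
  (forall V, tangent k V -> zeta V = muf w1 k V + nuf w2 k V) ->
  represents Omega w1 (t_Omega Omega k (RR k w1 - LL k w2) zeta) /\
  represents Omega w2 (s_Omega Omega k (RR k w1 - LL k w2) zeta).
Proof.
move=> tw1 tw2 zE.
have tR w : tge w -> tangent k (RR k w) by exact: tan_R.
have tL w : tge w -> tangent k (LL k w) by exact: tan_L.
have tX := tanB (tR _ tw1) (tL _ tw2).
have tN := tanN (tL _ tw2).
split; split=> // u tu.
  have l := muf_lin (k := k) tu.
  rewrite t_OmegaE // zE; last exact: tR.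
  rewrite (lin_tanB l (tR _ tw1) (tL _ tw2)).
  rewrite -(E_t k tw1 tu) -(E_s k tu tw2); lra.
have l := nuf_lin (k := k) tu.
rewrite s_OmegaE // zE; last exact: tL.
rewrite (lin_tanB l (tR _ tw1) (tL _ tw2)).
rewrite -(F_s k tw2 tu) (E_s k tw1 tu); lra.
Qed.

End Group.

Lemma tvec0 (R : realType) (M : mfd R) f : (0 : tvec M) f = 0 :> R. Proof. by []. Qed.

Lemma alt3_0 (R : realType) (M : mfd R) (p : M) (w : tvec M -> tvec M -> tvec M -> R) u v :
  alt3 (tangent p) w -> tangent p u -> tangent p v -> [/\ w 0 u v = 0, w u 0 v = 0 & w u v 0 = 0].
Proof.
move=> [h1 h2] tu tv.
have z a b : tangent p a -> tangent p b -> w 0 a b = 0.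
  by move=> ta tb; have := linear_on0 (h1 _ _ ta tb); apply; exact: tan0.
split; first exact: z.
  by have [-> _] := h2 _ _ _ tu (tan0 p) tv; rewrite z ?oppr0.
by have [_ ->] := h2 _ _ _ tu tv (tan0 p); have [-> _] := h2 _ _ _ tu (tan0 p) tv; rewrite z ?oppr0.
Qed.

(** * Brackets of vector fields on a product *)

Section ProductFields.
Variables (R : realType) (M N : mfd R).
Hypotheses (okM : mfd_ok M) (okN : mfd_ok N).
Local Notation MN := (prod_mfd M N).

Definition fstf (A : M -> tvec M) : MN -> tvec MN := fun p => tpair p.1 p.2 (A p.1) 0.
Definition sndf (B : N -> tvec N) : MN -> tvec MN := fun p => tpair p.1 p.2 0 (B p.2).

Lemma fstfE A k l f : @smooth_fun R MN f -> fstf A (k, l) f = A k (fun x => f (x, l)).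
Proof. by move=> sf; rewrite /fstf tpairE // tvec0 addr0. Qed.
Lemma sndfE B k l f : @smooth_fun R MN f -> sndf B (k, l) f = B l (fun y => f (k, y)).
Proof. by move=> sf; rewrite /sndf tpairE // tvec0 add0r. Qed.

Lemma lie_fst A B k l : is_vfield A -> is_vfield B -> is_vfield (fstf A) -> is_vfield (fstf B) ->
  lie (fstf A) (fstf B) (k, l) = tpair k l (lie A B k) 0.
Proof.
move=> vA vB vA' vB'; apply: (tan_eq (lie_tangent (prod_ok okM okN) (k, l) vA' vB')).
  by apply: tpair_tangent => //; [exact: lie_tangent | exact: tan0].
move=> f sf; rewrite tpairE // tvec0 addr0 /lie !fstfE; try exact: vf_smooth.
by congr (_ - _); [congr (A k _) | congr (B k _)]; apply/funext => x; rewrite /vact fstfE.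
Qed.

Lemma lie_snd A B k l : is_vfield A -> is_vfield B -> is_vfield (sndf A) -> is_vfield (sndf B) ->
  lie (sndf A) (sndf B) (k, l) = tpair k l 0 (lie A B l).
Proof.
move=> vA vB vA' vB'; apply: (tan_eq (lie_tangent (prod_ok okM okN) (k, l) vA' vB')).
  by apply: tpair_tangent => //; [exact: tan0 | exact: lie_tangent].
move=> f sf; rewrite tpairE // tvec0 add0r /lie !sndfE; try exact: vf_smooth.
by congr (_ - _); [congr (A l _) | congr (B l _)]; apply/funext => x; rewrite /vact sndfE.
Qed.

Lemma lie_fst_snd A B k l : is_vfield A -> is_vfield B -> is_vfield (fstf A) -> is_vfield (sndf B) ->
  lie (fstf A) (sndf B) (k, l) = 0.
Proof.
move=> vA vB vA' vB'; apply: (tan_eq (lie_tangent (prod_ok okM okN) (k, l) vA' vB')); first exact: tan0.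
move=> f sf; rewrite tvec0 /lie fstfE ?sndfE; try exact: vf_smooth.
apply/eqP; rewrite subr_eq0; apply/eqP.
rewrite (_ : (fun x => vact (sndf B) f (x, l)) = (fun x => B l (fun y => f (x, y)))); last first.
  by apply/funext => x; rewrite /vact sndfE.
rewrite (_ : (fun y => vact (fstf A) f (k, y)) = (fun y => A k (fun x => f (x, y)))); last first.
  by apply/funext => y; rewrite /vact fstfE.
exact (schwarz_mfd okM okN sf (vf_tan k vA) (vf_tan l vB)).
Qed.

End ProductFields.

(** * Invariant fields of K and the twisted Courant bracket of their lifts *)

Section Brackets.
Variables (R : realType) (K : lie_group_data R) (Omega : form2 (prod_mfd K K)) (Theta : form3 K).
Hypothesis SS : shifted_symplectic Omega Theta.
Local Notation "x ** y" := (lmul x y) (at level 40, left associativity).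
Local Notation e := (lone K).
Local Notation KK := (prod_mfd K K).
Implicit Types (k l : K) (u v w : tvec K).

Let LG : is_lie_group K := ss_group SS.
Let okK : mfd_ok K := ss_ok SS.
Let okKK : mfd_ok KK := ss_ok2 SS.
Local Notation RR k := (tmap (fun x : K => x ** k)).
Local Notation LL k := (tmap (fun x : K => k ** x)).
Local Notation tge := (@tangent R K e).
Local Notation mu := (muf Omega).
Local Notation nu := (nuf Omega).
Local Notation br := (@lie_algebra_bracket R K).
Let t0 k : @tangent R K k 0 := tan0 k.

Lemma right_invE w k f : smooth_fun f -> right_inv w k f = w (fun x => f (x ** k)).
Proof. by move=> sf; rewrite /right_inv tmapE. Qed.
Lemma left_invE w k f : smooth_fun f -> left_inv w k f = w (fun x => f (k ** x)).
Proof. by move=> sf; rewrite /left_inv tmapE. Qed.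

(** The generator of a family of maps through the identity; the invariant fields on K, and on one
    factor of K x K, are all of this kind. *)
Lemma flow_vfield (M : mfd R) (Psi : prod_mfd K M -> M) w : mfd_ok M -> sm Psi ->
  (forall p, Psi (e, p) = p) -> tge w -> is_vfield (fun p => tmap (fun x => Psi (x, p)) w).
Proof.
move=> okM sP P1 tw; split.
  move=> p; rewrite -[p in tangent p]P1; apply: (tmap_tangent (F := fun x => Psi (x, p))) => //.
  by apply: (sm_comp (sm_pair okK okM okK (sm_id K) (sm_cst p okK)) sP).
move=> f sf.
rewrite (_ : (fun p => _) = (fun p => w (fun x => f (Psi (x, p))))); last by apply/funext => p; rewrite tmapE.
by apply: (partial_smooth1 (g := fun z => f (Psi z)) okK okM _ tw); have [_ h] := sP; exact: h.
Qed.

Let sm1 : @sm R KK K (fun x => x.1) := sm_fst okK okK.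
Let sm2 : @sm R KK K (fun x => x.2) := sm_snd okK okK.

Lemma right_vf w : tge w -> is_vfield (right_inv w).
Proof.
by move=> tw; apply: (flow_vfield okK (sm_mul SS) _ tw) => p; exact: lg_mul1l.
Qed.
Lemma left_vf w : tge w -> is_vfield (left_inv w).
Proof.
move=> tw; have sP : @sm R KK K (fun z => z.2 ** z.1) by exact: (sm_comp (sm_pair okK okK okKK sm2 sm1) (sm_mul SS)).
by apply: (flow_vfield okK sP _ tw) => p /=; exact: lg_mul1r.
Qed.

Let okP : mfd_ok (prod_mfd K KK) := prod_ok okK okKK.
Let p1 : @sm R (prod_mfd K KK) K (fun x => x.1) := sm_fst okK okKK.
Let p2 : @sm R (prod_mfd K KK) KK (fun x => x.2) := sm_snd okK okKK.
Let p21 : @sm R (prod_mfd K KK) K (fun x => x.2.1) := sm_comp p2 sm1.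
Let p22 : @sm R (prod_mfd K KK) K (fun x => x.2.2) := sm_comp p2 sm2.

Lemma tmap_fstc (F : K -> K) l w : tge w -> sm F ->
  @tmap R K KK (fun x => (F x, l)) w = tpair (F e) l (tmap F w) 0.
Proof. by move=> tw sF; rewrite (tmap_pair okK okK okK sF (sm_cst l okK) tw) (tmap_cst l okK tw). Qed.
Lemma tmap_sndc (F : K -> K) l w : tge w -> sm F ->
  @tmap R K KK (fun x => (l, F x)) w = tpair l (F e) 0 (tmap F w).
Proof. by move=> tw sF; rewrite (tmap_pair okK okK okK (sm_cst l okK) sF tw) (tmap_cst l okK tw). Qed.

Lemma fst_right_vf w : tge w -> is_vfield (fstf (N := K) (right_inv w)).
Proof.
move=> tw; have sP : @sm R (prod_mfd K KK) KK (fun z => (z.1 ** z.2.1, z.2.2)).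
  apply: (sm_pair okK okK okP _ p22).
  exact: (sm_comp (sm_pair okK okK okP p1 p21) (sm_mul SS)).
have := flow_vfield okKK sP _ tw; rewrite (_ : (fun p => _) = fstf (right_inv w)).
  by apply=> -[a b] /=; rewrite (lg_mul1l LG).
apply/funext => -[k l] /=; rewrite (tmap_fstc (F := fun x => x ** k) _ tw (sm_mulr SS k)).
by rewrite (lg_mul1l LG).
Qed.
Lemma snd_left_vf w : tge w -> is_vfield (sndf (M := K) (left_inv w)).
Proof.
move=> tw; have sP : @sm R (prod_mfd K KK) KK (fun z => (z.2.1, z.2.2 ** z.1)).
  apply: (sm_pair okK okK okP p21).
  exact: (sm_comp (sm_pair okK okK okP p22 p1) (sm_mul SS)).
have := flow_vfield okKK sP _ tw; rewrite (_ : (fun p => _) = sndf (left_inv w)).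
  by apply=> -[a b] /=; rewrite (lg_mul1r LG).
apply/funext => -[k l] /=; rewrite (tmap_sndc (F := fun x => l ** x) _ tw (sm_mull SS l)).
by rewrite (lg_mul1r LG).
Qed.

Lemma br_tan w w' : tge w -> tge w' -> tge (br w w').
Proof. by move=> tw tw'; exact: (lie_tangent okK e (right_vf tw) (right_vf tw')). Qed.

Lemma right_right w w' k f : tge w -> tge w' -> smooth_fun f ->
  right_inv w k (vact (right_inv w') f) = w (fun x => w' (fun y => f (y ** (x ** k)))).
Proof.
move=> tw tw' sf; rewrite right_invE; last exact: vf_smooth (right_vf tw') sf.
by congr (w _); apply/funext => x; rewrite /vact right_invE.
Qed.
Lemma left_left w w' k f : tge w -> tge w' -> smooth_fun f ->
  left_inv w k (vact (left_inv w') f) = w (fun x => w' (fun y => f (k ** x ** y))).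
Proof.
move=> tw tw' sf; rewrite left_invE; last exact: vf_smooth (left_vf tw') sf.
by congr (w _); apply/funext => x; rewrite /vact left_invE.
Qed.

Lemma lie_right w w' k : tge w -> tge w' -> lie (right_inv w) (right_inv w') k = right_inv (br w w') k.
Proof.
move=> tw tw'; apply: (tan_eq (lie_tangent okK k (right_vf tw) (right_vf tw'))).
  by apply: vf_tan; apply: right_vf; exact: br_tan.
move=> f sf; have sfk : smooth_fun (fun x => f (x ** k)) by have [_ h] := sm_mulr SS k; exact: h.
rewrite right_invE // /lie_algebra_bracket /lie !right_right //.
by congr (w _ - w' _); apply/funext => x; [congr (w' _) | congr (w _)]; apply/funext => y;
  rewrite (lg_mul1r LG) -(lg_mulA LG).
Qed.

Lemma smooth_mul2 (f : K -> R) k : smooth_fun f -> @smooth_fun R KK (fun z => f (k ** (z.2 ** z.1))).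
Proof.
move=> sf; have s21 := sm_comp (sm_pair okK okK okKK sm2 sm1) (sm_mul SS).
by have [_ h] := sm_comp s21 (sm_mull SS k); exact: (h _ sf).
Qed.

(** The sign reflects that the bracket is defined by right-invariant fields: along left translates
    the two derivations are composed in the opposite order, which [schwarz_mfd] exchanges. *)
Lemma lie_left w w' k : tge w -> tge w' -> lie (left_inv w) (left_inv w') k = - left_inv (br w w') k.
Proof.
move=> tw tw'; apply: (tan_eq (lie_tangent okK k (left_vf tw) (left_vf tw'))).
  by apply: tanN; apply: vf_tan; apply: left_vf; exact: br_tan.
move=> f sf; have sfk : smooth_fun (fun x => f (k ** x)) by have [_ h] := sm_mull SS k; exact: h.
rewrite tvecN left_invE // /lie_algebra_bracket /lie !right_right // !left_left // opprB.
have := schwarz_mfd okK okK (smooth_mul2 k sf) tw tw'.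
have := schwarz_mfd okK okK (smooth_mul2 k sf) tw' tw; rewrite /= => h1 h2.
congr (_ - _).
  rewrite -[RHS](_ : w' (fun x : K => w (fun y : K => f (k ** (y ** x)))) = _); last first.
    by congr (w' _); apply/funext => x; congr (w _); apply/funext => y; rewrite (lg_mul1r LG).
  by rewrite h1; congr (w _); apply/funext => x; congr (w' _); apply/funext => y; rewrite (lg_mulA LG).
rewrite -[RHS](_ : w (fun x : K => w' (fun y : K => f (k ** (y ** x)))) = _); last first.
  by congr (w _); apply/funext => x; congr (w' _); apply/funext => y; rewrite (lg_mul1r LG).
by rewrite h2; congr (w' _); apply/funext => x; congr (w _); apply/funext => y; rewrite (lg_mulA LG).
Qed.

Lemma lie_right_left w u k : tge w -> tge u -> lie (right_inv w) (left_inv u) k = 0.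
Proof.
move=> tw tu; apply: (tan_eq (lie_tangent okK k (right_vf tw) (left_vf tu))); first exact: tan0.
move=> f sf; rewrite tvec0 /lie right_invE ?left_invE; try exact: vf_smooth (left_vf tu) sf; try exact: vf_smooth (right_vf tw) sf.
have sg : @smooth_fun R KK (fun z => f (z.1 ** k ** z.2)).
  have h1 := sm_comp sm1 (sm_mulr SS k).
  by have [_ h] := sm_comp (sm_pair okK okK okKK h1 sm2) (sm_mul SS); exact: (h _ sf).
have := schwarz_mfd okK okK sg tw tu => /= E.
apply/eqP; rewrite subr_eq0; apply/eqP; transitivity (w (fun x : K => u (fun y : K => f (x ** k ** y)))).
  by congr (w _); apply/funext => x; rewrite /vact left_invE.
rewrite E; congr (u _); apply/funext => y; rewrite /vact right_invE //.
by congr (w _); apply/funext => x; rewrite (lg_mulA LG).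
Qed.

Let smL k : @sm R K KK (fun x => (k, x)) := sm_pair okK okK okK (sm_cst k okK) (sm_id K).
Let smR k : @sm R K KK (fun x => (x, k)) := sm_pair okK okK okK (sm_id K) (sm_cst k okK).

Lemma muf_form1 w : tge w -> is_form1 (mu w).
Proof.
move=> tw; split.
  move=> k; split; first exact: (muf_lin SS).
  by move=> v nv; rewrite /muf /restr asboolF.
move=> X vX; rewrite (_ : ev1 _ _ = (fun k => - Omega (e, k) (tpair e k w 0) (tpair e k 0 (X k)))); last first.
  by apply/funext => k; rewrite /ev1 mufE //; exact: vf_tan.
apply: smooth_opp => //; apply: (form2_along okK okKK (smL e)) => //; first exact: ss_Omega SS.
  split; first by move=> k; exact (tan_tp SS tw (t0 k)).
  move=> f sf; rewrite (_ : (fun k => _) = (fun k => w (fun x => f (x, k)))); last first.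
    by apply/funext => k; rewrite tpairE // tvec0 addr0.
  exact (partial_smooth1 okK okK sf tw).
split; first by move=> k; exact (tan_tp SS (t0 e) (vf_tan k vX)).
move=> f sf; rewrite (_ : (fun k => _) = (fun k => X k (fun x => f (e, x)))); last first.
  by apply/funext => k; rewrite tpairE // tvec0 add0r.
by apply: vf_smooth => //; exact: slice2.
Qed.

Lemma nuf_form1 w : tge w -> is_form1 (nu w).
Proof.
move=> tw; split.
  move=> k; split; first exact: (nuf_lin SS).
  by move=> v nv; rewrite /nuf /restr asboolF.
move=> X vX; rewrite (_ : ev1 _ _ = (fun k => Omega (k, e) (tpair k e 0 w) (tpair k e (X k) 0))); last first.
  by apply/funext => k; rewrite /ev1 nufE //; exact: vf_tan.
apply: (form2_along okK okKK (smR e)) => //; first exact: ss_Omega SS.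
  split; first by move=> k; exact (tan_tp SS (t0 k) tw).
  move=> f sf; rewrite (_ : (fun k => _) = (fun k => w (fun x => f (k, x)))); last first.
    by apply/funext => k; rewrite tpairE // tvec0 add0r.
  exact (partial_smooth okK okK sf tw).
split; first by move=> k; exact (tan_tp SS (vf_tan k vX) (t0 e)).
move=> f sf; rewrite (_ : (fun k => _) = (fun k => X k (fun x => f (x, e)))); last first.
  by apply/funext => k; rewrite tpairE // tvec0 addr0.
by apply: vf_smooth => //; exact: slice1.
Qed.

Let aTh k : alt3 (tangent k) (Theta k). Proof. by have [h _] := ss_Theta SS. Qed.

(** The condition delta Theta = - d Omega at (k, 1) on the fields (w^r, 0), (w'^r, 0), (0, u^l). In
    delta Theta only the multiplication term survives, since each projection kills at least one of
    the vectors. *)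
Lemma Theta_d1 w w' u k : tge w -> tge w' -> tge u ->
  Theta k (right_inv w k) (right_inv w' k) (left_inv u k) =
  - right_inv w k (ev1 (mu w') (left_inv u)) + right_inv w' k (ev1 (mu w) (left_inv u))
  - left_inv u k (ev1 (mu w) (right_inv w')) + mu (br w w') k (left_inv u k).
Proof.
move=> tw tw' tu.
have vX := fst_right_vf tw; have vY := fst_right_vf tw'; have vZ := snd_left_vf tu.
have tb := br_tan tw tw'.
have [_ sOm] := ss_Omega SS.
have Lu1 : left_inv u e = u by exact: (LL1 SS tu).
have tR v l : tge v -> tangent l (right_inv v l) by exact: (tan_R SS).
have tL v l : tge v -> tangent l (left_inv v l) by exact: (tan_L SS).
have := ss_delta_Theta SS vX vY vZ (k, e).
rewrite /ev3 /delta_Theta /pull3 /=.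
have XE v : tge v -> fstf (right_inv v) (k, e) = tpair k e (right_inv v k) 0 by [].
have ZE : sndf (left_inv u) (k, e) = tpair k e 0 u by rewrite /sndf /= Lu1.
rewrite ZE !XE // !tmap_fst ?tmap_snd //; try exact: tR.
rewrite !(tmap_tpair okK okK (sm_mul SS)) //=; try exact: tR.
rewrite !tmap0 !addr0 add0r !(RR1 SS (tR _ _ _)) // (lg_mul1r LG).
have [_ _ ->] := alt3_0 (aTh k) (tR w k tw) (tR w' k tw').
have [-> _ _] := alt3_0 (aTh e) (t0 e) tu.
rewrite add0r add0r -/(left_inv u k) => E.
have mE v l : tge v -> om Omega l e (right_inv v l) 0 0 u = - mu v l (left_inv u l).
  by move=> tv; rewrite (om_tE SS) // mufE ?opprK //; exact: tL.
have sM v Y : tge v -> is_vfield Y -> smooth_fun (ev1 (mu v) Y).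
  by move=> tv vv; apply: ev1_smooth => //; exact: muf_form1.
have E1 v v' : tge v -> tge v' -> fstf (right_inv v) (k, e) (ev2 Omega (fstf (right_inv v')) (sndf (left_inv u)))
   = - right_inv v k (ev1 (mu v') (left_inv u)).
  move=> tv tv'; rewrite fstfE; last by apply: sOm => //; exact: fst_right_vf.
  rewrite -(tan_opp okK (tR v k tv)); last by apply: sM => //; exact: left_vf.
  congr (right_inv v k _); apply/funext => l.
  rewrite /ev1 -mE // /ev2 /om.
  by rewrite /fstf /sndf /= Lu1.
have E2 : sndf (left_inv u) (k, e) (ev2 Omega (fstf (right_inv w)) (fstf (right_inv w')))
   = - left_inv u k (ev1 (mu w) (right_inv w')).
  have s2 := sOm _ _ vX vY.
  rewrite sndfE // Lu1 left_invE; last by apply: sM => //; exact: right_vf.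
  have sl := slice2 okK okK k s2.
  rewrite -(tan_opp okK tu); last first.
    by have [_ h] := sm_mull SS k; apply: h; apply: sM => //; exact: right_vf.
  (* By [om_R] and the cocycle condition at (1, k, l) the two functions of l differ by the constant
     added here, which a derivation does not see. *)
  rewrite -[LHS]addr0 -(tan_cst okK (om Omega e k w 0 w' 0 + om Omega e e w 0 0 w') tu) -(tan_add tu) //; last exact: smooth_cst.
  congr (u _); apply/funext => l /=.
  rewrite /ev1 mufE; last exact: tR.
  rewrite opprK -/(om Omega e (k ** l) w 0 0 (RR (k ** l) w')) (om_R SS) //.
  have := om_delta SS tw (t0 k) (t0 l) tw' (t0 k) (t0 l).
  rewrite !tmap0 !addr0 (lg_mul1l LG) (om0l SS (t0 k) (t0 l)) => D.
  rewrite /ev2 /fstf /= -/(om Omega k l (right_inv w k) 0 (right_inv w' k) 0).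
  rewrite -/(right_inv w k) -/(right_inv w' k) in D; lra.
have Om0 : forall p V, @tangent R KK p V -> Omega p 0 V = 0.
  move=> p V tV; have [/(_ p) [h _] _] := ss_Omega SS.
  by apply: (linear_on0 (h _ tV)); exact: tan0.
have tp A B : tangent k A -> tangent e B -> @tangent R KK (k, e) (tpair k e A B) by exact: (tan_tp SS).
move: E; rewrite /dform2 /koszul2 /vact E1 // E1 // E2 /ev2.
rewrite (lie_fst okK okK) //; try exact: right_vf.
rewrite (lie_right k tw tw').
rewrite !(lie_fst_snd okK okK) //; try exact: right_vf; try exact: left_vf.
rewrite !Om0 ?XE //; try (apply: tp => //; exact: tR).
rewrite ZE -/(om Omega k e (right_inv (br w w') k) 0 0 u) mE // => E; lra.
Qed.

(** By [texform_tensor] it suffices to take Y left-invariant. Then it commutes with the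
    right-invariant fields, and [Theta_d1] is the claim. *)
Lemma texform_E w w' k Y : tge w -> tge w' -> is_vfield Y ->
  texform (right_inv w) (mu w) (right_inv w') (mu w') Y k + Theta k (right_inv w k) (right_inv w' k) (Y k)
  = mu (br w w') k (Y k).
Proof.
move=> tw tw' vY; have [u tu Eu] := L_surj SS (vf_tan k vY).
apply: (@texform_tensor _ _ okK _ _ _ _ Theta (mu (br w w') k) k (left_inv u)) => //; try exact: right_vf; try exact: left_vf; try exact: muf_form1.
rewrite Theta_d1 // /texform !lie_right_left //.
rewrite (linear_on0 (muf_lin SS tw) (t0 k)) (linear_on0 (muf_lin SS tw') (t0 k)); lra.
Qed.

(** The mirror image of [Theta_d1], at (1, k) on (0, w^l), (0, w'^l), (u^r, 0). *)
Lemma Theta_d2 w w' u k : tge w -> tge w' -> tge u ->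
  Theta k (left_inv w k) (left_inv w' k) (right_inv u k) =
  left_inv w k (ev1 (nu w') (right_inv u)) - left_inv w' k (ev1 (nu w) (right_inv u))
  + right_inv u k (ev1 (nu w) (left_inv w')) + nu (br w w') k (right_inv u k).
Proof.
move=> tw tw' tu.
have vX := snd_left_vf tw; have vY := snd_left_vf tw'; have vZ := fst_right_vf tu.
have tb := br_tan tw tw'.
have [_ sOm] := ss_Omega SS.
have Ru1 : right_inv u e = u by exact: (RR1 SS tu).
have tR v l : tge v -> tangent l (right_inv v l) by exact: (tan_R SS).
have tL v l : tge v -> tangent l (left_inv v l) by exact: (tan_L SS).
have := ss_delta_Theta SS vX vY vZ (e, k).
rewrite /ev3 /delta_Theta /pull3 /=.
have XE v : tge v -> sndf (left_inv v) (e, k) = tpair e k 0 (left_inv v k) by [].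
have ZE : fstf (right_inv u) (e, k) = tpair e k u 0 by rewrite /fstf /= Ru1.
rewrite ZE !XE // !tmap_fst ?tmap_snd //; try exact: tL.
rewrite !(tmap_tpair okK okK (sm_mul SS)) //=; try exact: tL.
rewrite !tmap0 !addr0 !add0r !(LL1 SS (tL _ _ _)) // (lg_mul1l LG).
have [_ _ ->] := alt3_0 (aTh k) (tL w k tw) (tL w' k tw').
have [-> _ _] := alt3_0 (aTh e) (t0 e) tu.
rewrite !add0r -/(right_inv u k) => E.
have nE v l : tge v -> om Omega e l 0 (left_inv v l) u 0 = nu v l (right_inv u l).
  by move=> tv; rewrite (om_sF SS) // nufE //; exact: tR.
have sM v Y : tge v -> is_vfield Y -> smooth_fun (ev1 (nu v) Y).
  by move=> tv vv; apply: ev1_smooth => //; exact: nuf_form1.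
have E1 v v' : tge v -> tge v' -> sndf (left_inv v) (e, k) (ev2 Omega (sndf (left_inv v')) (fstf (right_inv u)))
   = left_inv v k (ev1 (nu v') (right_inv u)).
  move=> tv tv'; rewrite sndfE; last by apply: sOm => //; exact: snd_left_vf.
  congr (left_inv v k _); apply/funext => l.
  rewrite /ev1 -nE // /ev2 /om.
  by rewrite /fstf /sndf /= Ru1.
have E2 : fstf (right_inv u) (e, k) (ev2 Omega (sndf (left_inv w)) (sndf (left_inv w')))
   = right_inv u k (ev1 (nu w) (left_inv w')).
  have s2 := sOm _ _ vX vY.
  rewrite fstfE // Ru1 right_invE; last by apply: sM => //; exact: left_vf.
  have sl := slice1 okK okK k s2.
  rewrite -[LHS]addr0 -(tan_cst okK (om Omega k e 0 w 0 w' - om Omega e e w' 0 0 w) tu) -(tan_add tu) //; last exact: smooth_cst.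
  congr (u _); apply/funext => l /=.
  rewrite /ev1 nufE; last exact: tL.
  rewrite -/(om Omega (l ** k) e 0 w (LL (l ** k) w') 0) (om_anti SS (t0 _) tw (tan_L SS (l ** k) tw') (t0 e)) (om_L SS) //.
  have := om_delta SS (t0 l) (t0 k) tw (t0 l) (t0 k) tw'.
  rewrite !tmap0 !addr0 !add0r (lg_mul1r LG) (om0l SS (t0 l) (t0 k)) => D.
  rewrite /ev2 /sndf /= -/(om Omega l k 0 (left_inv w k) 0 (left_inv w' k)).
  rewrite -/(left_inv w k) -/(left_inv w' k) in D.
  rewrite (om_anti SS (t0 (l ** k)) tw' (t0 _) tw); lra.
have Om0 : forall p V, @tangent R KK p V -> Omega p 0 V = 0.
  move=> p V tV; have [/(_ p) [h _] _] := ss_Omega SS.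
  by apply: (linear_on0 (h _ tV)); exact: tan0.
have tp A B : tangent e A -> tangent k B -> @tangent R KK (e, k) (tpair e k A B) by exact: (tan_tp SS).
have lsf v : tge v -> lie (sndf (left_inv v)) (fstf (right_inv u)) (e, k) = 0.
  move=> tv; rewrite lie_anti (lie_fst_snd okK okK) ?oppr0 //; try exact: right_vf; try exact: left_vf.
  exact: snd_left_vf.
move: E; rewrite /dform2 /koszul2 /vact E1 // E1 // E2 /ev2.
rewrite (lie_snd okK okK) //; try exact: left_vf.
rewrite (lie_left k tw tw') !lsf //.
rewrite !Om0 ?XE //; try (apply: tp => //; exact: tL).
have -> : tpair e k 0 (- left_inv (br w w') k) = - tpair e k 0 (left_inv (br w w') k) :> tvec KK.
  apply/funext => f; rewrite tvecN /tpair; case: asboolP => sf; last by rewrite oppr0.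
  by rewrite tvecN !tvec0 !add0r.
have -> : Omega (e, k) (- tpair e k 0 (left_inv (br w w') k)) (fstf (right_inv u) (e, k)) = - nu (br w w') k (right_inv u k).
  have [/(_ (e, k)) [h _] _] := ss_Omega SS.
  rewrite ZE -nE // /om -scaleN1r (linear_onZ (-1) (h _ (tp _ _ tu (t0 k))) (tan0 _) (tp _ _ (t0 e) (tL _ _ tb))).
  by rewrite mulN1r.
move=> E; lra.
Qed.

Lemma lie_opp (X Y : K -> tvec K) k : is_vfield X -> is_vfield Y ->
  lie (fun q => - X q) (fun q => - Y q) k = lie X Y k.
Proof.
move=> vX vY; apply: (tan_eq (lie_tangent okK k (vf_opp okK vX) (vf_opp okK vY)) (lie_tangent okK k vX vY)).
move=> f sf; rewrite /lie !tvecN.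
have E (Z : K -> tvec K) : vact (fun q => - Z q) f = (fun q => - vact Z f q) by [].
rewrite !E (tan_opp okK (vf_tan k vX)) ?(tan_opp okK (vf_tan k vY)) ?opprK //; exact: vf_smooth.
Qed.

(** The boolean selects the half of the trivialisation: true for w^r + muf w, false for - w^l + nuf
    w. [sgb] is the sign of the pairing on that half. *)
Definition tsv (b : bool) w : K -> tvec K := fun k => if b then right_inv w k else - left_inv w k.
Definition tsf (b : bool) w : form1 K := fun k => if b then mu w k else nu w k.
Definition sgb (b : bool) : R := if b then 1 else -1.

Lemma tsv_vf b w : tge w -> is_vfield (tsv b w).
Proof. by case: b => tw; [exact: right_vf | apply: vf_opp => //; exact: left_vf]. Qed.
Lemma tsf_form b w : tge w -> is_form1 (tsf b w).
Proof. by case: b => tw; [exact: muf_form1 | exact: nuf_form1]. Qed.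

Lemma ts_pair b b' w w' k : tge w -> tge w' ->
  tsf b w k (tsv b' w' k) + tsf b' w' k (tsv b w k) = if b == b' then sgb b * kpair Omega w w' else 0.
Proof.
move=> tw tw'.
have mN v v' : tge v -> tge v' -> mu v k (- left_inv v' k) = - mu v k (left_inv v' k).
  by move=> tv tv'; rewrite (form1N (muf_form1 tv)) //; exact: (tan_L SS).
have nN v v' : tge v -> tge v' -> nu v k (- left_inv v' k) = - nu v k (left_inv v' k).
  by move=> tv tv'; rewrite (form1N (nuf_form1 tv)) //; exact: (tan_L SS).
case: b; case: b'; rewrite /tsf /tsv /= /sgb.
- by rewrite mul1r; exact: (E_t SS).
- by rewrite mN // /left_inv (E_s SS) //; rewrite addNr.
- by rewrite mN // /left_inv (E_s SS) // subrr.
by rewrite !nN // mulN1r -(F_s SS k tw tw') opprD.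
Qed.

Lemma texform_F w w' k Y : tge w -> tge w' -> is_vfield Y ->
  texform (tsv false w) (nu w) (tsv false w') (nu w') Y k + Theta k (tsv false w k) (tsv false w' k) (Y k)
  = nu (br w w') k (Y k).
Proof.
move=> tw tw' vY; have [u tu Eu] := R_surj SS (vf_tan k vY).
apply: (@texform_tensor _ _ okK _ _ _ _ Theta (nu (br w w') k) k (right_inv u)) => //; try exact: (tsv_vf false); try exact: right_vf; try exact: nuf_form1.
have tL v l : tge v -> tangent l (left_inv v l) by exact: (tan_L SS).
have tR v l : tge v -> tangent l (right_inv v l) by exact: (tan_R SS).
have lz v : tge v -> lie (tsv false v) (right_inv u) k = 0.
  move=> tv; rewrite lie_anti; apply/eqP; rewrite oppr_eq0; apply/eqP.
  have := lie_scaler okK k (right_vf tu) (left_vf tv) (smooth_cst okK (-1)).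
  rewrite (tan_cst okK _ (tR u k tu)) scale0r add0r lie_right_left // scaler0.
  by rewrite (_ : tsv false v = (fun q => -1 *: left_inv v q)) //; apply/funext => q; rewrite scaleN1r.
have [hl ha] := aTh k.
have ThN a b c : tangent k a -> tangent k b -> tangent k c -> Theta k (- a) b c = - Theta k a b c.
  by move=> ta tb tc; rewrite -scaleN1r (linear_onZ (-1) (hl _ _ tb tc) (t0 k) ta) mulN1r.
have -> : Theta k (tsv false w k) (tsv false w' k) (right_inv u k) = Theta k (left_inv w k) (left_inv w' k) (right_inv u k).
  rewrite /tsv ThN //; try exact: tL; try exact: tR; try (apply: tanN; exact: tL).
  have [-> _] := ha _ _ _ (tL w k tw) (tanN (tL w' k tw')) (tR u k tu).
  rewrite opprK ThN //; try exact: tL; try exact: tR.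
  by have [-> _] := ha _ _ _ (tL w k tw) (tL w' k tw') (tR u k tu).
rewrite Theta_d2 // /texform !lz // (linear_on0 (nuf_lin SS tw) (t0 k)) (linear_on0 (nuf_lin SS tw') (t0 k)).
have sN v v' : tge v -> tge v' -> right_inv v' k (ev1 (nu v) (tsv false w')) = - right_inv v' k (ev1 (nu v) (left_inv w')).
  move=> tv tv'; rewrite -(tan_opp okK (tR _ _ _)) //; last by apply: ev1_smooth; [exact: nuf_form1 | exact: left_vf].
  by congr (right_inv v' k _); apply/funext => l; rewrite /ev1 /tsv (form1N (nuf_form1 tv) (tL _ _ tw')).
rewrite sN // /tsv !tvecN; lra.
Qed.

(** <[[., .]], .> for the Courant bracket of TK + T^*K twisted by Theta, on the trivialising
    sections. *)
Definition texT b1 w1 b2 w2 b3 w3 k : R :=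
  tex (tsv b1 w1) (tsf b1 w1) (tsv b2 w2) (tsf b2 w2) (tsv b3 w3) (tsf b3 w3) k
  + Theta k (tsv b1 w1 k) (tsv b2 w2 k) (tsv b3 w3 k).

Lemma texT_anti12 b1 w1 b2 w2 b3 w3 k : tge w1 -> tge w2 -> tge w3 ->
  texT b1 w1 b2 w2 b3 w3 k = - texT b2 w2 b1 w1 b3 w3 k.
Proof.
move=> t1 t2 t3; have v1 := tsv_vf b1 t1; have v2 := tsv_vf b2 t2; have v3 := tsv_vf b3 t3.
have f1 := tsf_form b1 t1; have f2 := tsf_form b2 t2; have f3 := tsf_form b3 t3.
have := tex_anti12 okK k v1 v2 v3 f1 f2 f3.
under [X in _ = tsv _ _ _ X]eq_fun do rewrite /ev1 ts_pair //.
rewrite (tan_cst okK _ (vf_tan k v3)) /texT => h.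
have [_ ha] := aTh k; have [-> _] := ha _ _ _ (vf_tan k v1) (vf_tan k v2) (vf_tan k v3); lra.
Qed.
Lemma texT_anti23 b1 w1 b2 w2 b3 w3 k : tge w1 -> tge w2 -> tge w3 ->
  texT b1 w1 b2 w2 b3 w3 k = - texT b1 w1 b3 w3 b2 w2 k.
Proof.
move=> t1 t2 t3; have v1 := tsv_vf b1 t1; have v2 := tsv_vf b2 t2; have v3 := tsv_vf b3 t3.
have f1 := tsf_form b1 t1; have f2 := tsf_form b2 t2; have f3 := tsf_form b3 t3.
have := tex_anti23 okK k v1 v2 v3 f1 f2 f3.
under [X in _ = tsv _ _ _ X]eq_fun do rewrite /ev1 ts_pair //.
rewrite (tan_cst okK _ (vf_tan k v1)) /texT => h.
have [_ ha] := aTh k; have [_ ->] := ha _ _ _ (vf_tan k v1) (vf_tan k v2) (vf_tan k v3); lra.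
Qed.

Lemma texT_same b b3 w1 w2 w3 k : tge w1 -> tge w2 -> tge w3 ->
  texT b w1 b w2 b3 w3 k = if b == b3 then sgb b * kpair Omega (br w1 w2) w3 else 0.
Proof.
move=> t1 t2 t3; rewrite -(ts_pair _ _ k) //; last exact: br_tan.
have tb := br_tan t1 t2.
have -> : texT b w1 b w2 b3 w3 k = texform (tsv b w1) (tsf b w1) (tsv b w2) (tsf b w2) (tsv b3 w3) k
   + Theta k (tsv b w1 k) (tsv b w2 k) (tsv b3 w3 k) + tsf b3 w3 k (lie (tsv b w1) (tsv b w2) k).
  by rewrite /texT /tex /texform; ring.
case: b; first by rewrite (texform_E k t1 t2 (tsv_vf b3 t3)); congr (_ + tsf _ _ _ _); exact: lie_right.
rewrite (texform_F k t1 t2 (tsv_vf b3 t3)); congr (_ + tsf _ _ _ _).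
exact (etrans (lie_opp k (left_vf t1) (left_vf t2)) (lie_left k t1 t2)).
Qed.

(** Pairings of these sections are constant, so [texT] is totally antisymmetric; of three booleans
    two agree and can be moved to the front, where [texT_same] applies. The structure functions are
    thus those of the Lie algebra plus a copy with the opposite pairing. *)
Lemma texTE b1 w1 b2 w2 b3 w3 k : tge w1 -> tge w2 -> tge w3 ->
  texT b1 w1 b2 w2 b3 w3 k = if (b1 == b2) && (b2 == b3) then sgb b1 * kpair Omega (br w1 w2) w3 else 0.
Proof.
move=> t1 t2 t3; case: (eqVneq b1 b2) => [->|n12] /=; first exact: texT_same.
case: (eqVneq b2 b3) => [e23|n23].
  rewrite e23 texT_anti12 // texT_anti23 // texT_same //.
  by rewrite -e23 eq_sym (negbTE n12) !oppr0.
have -> : b3 = b1 by move: n12 n23; case: (b1); case: (b2); case: (b3).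
by rewrite texT_anti23 // texT_same // (negbTE n12) oppr0.
Qed.

(** Invariance of the pairing is the antisymmetry of [texT] on right-invariant sections at the
    unit. *)
Lemma kpair_br_anti w1 w2 w3 : tge w1 -> tge w2 -> tge w3 ->
  kpair Omega (br w1 w2) w3 = - kpair Omega (br w1 w3) w2.
Proof.
move=> t1 t2 t3; have := texT_anti23 true true true e t1 t2 t3.
by rewrite !texTE //= /sgb !mul1r.
Qed.

Lemma br_antisym w1 w2 : br w2 w1 = - br w1 w2.
Proof. by rewrite /lie_algebra_bracket lie_anti. Qed.

End Brackets.

(** * The groupoid and the relation R *)

Section Groupoid.
Variables (R : realType) (G : groupoid_data R).
Hypothesis GD : is_lie_groupoid G.
Local Notation H := (arr G).
Local Notation N := (obj G).
Local Notation Q := (cpb G).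
Local Notation s := (@src R G).
Local Notation t := (@tgt R G).
Local Notation unit := (@unt R G).
Local Notation inv := (@ginv R G).
Local Notation pr1 := (@cpr1 R G).
Local Notation pr2 := (@cpr2 R G).
Local Notation gmm := (@gm R G).
Implicit Types (g h : H) (x : N) (q : Q).

Lemma gd_okH : mfd_ok H. Proof. exact: is_mfd_ok (gd_arr GD). Qed.
Lemma gd_okN : mfd_ok N. Proof. exact: is_mfd_ok (gd_obj GD). Qed.
Let okH := gd_okH.
Let okN := gd_okN.
Let CM := gd_cpb GD.
Let okQ : mfd_ok Q := is_mfd_ok (cm_mfd CM).
Lemma gd_sm_s : sm s. Proof. by apply: smooth_map_sm => //; exact: gd_src_smooth. Qed.
Lemma gd_sm_t : sm t. Proof. by apply: smooth_map_sm => //; exact: gd_tgt_smooth. Qed.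
Lemma gd_sm_u : sm unit. Proof. by apply: smooth_map_sm => //; exact: gd_unt_smooth. Qed.
Lemma gd_sm_i : sm inv. Proof. by apply: smooth_map_sm => //; exact: gd_inv_smooth. Qed.
Lemma gd_sm_m : sm gmm. Proof. by apply: smooth_map_sm => //; exact: gd_mul_smooth. Qed.
Lemma gd_sm_1 : sm pr1. Proof. by apply: smooth_map_sm => //; exact: cm_pr1. Qed.
Lemma gd_sm_2 : sm pr2. Proof. by apply: smooth_map_sm => //; exact: cm_pr2. Qed.
Let sms := gd_sm_s. Let smt := gd_sm_t. Let smu := gd_sm_u. Let smi := gd_sm_i.
Let smm := gd_sm_m. Let sm1 := gd_sm_1. Let sm2 := gd_sm_2.

Lemma comp_st q : s (pr1 q) = t (pr2 q).
Proof. by apply/(cm_image CM); exists q. Qed.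

Lemma tmap_comp_tangent (M P S : mfd R) (F : M -> P) (F' : P -> S) (k : M -> S) (v : tvec M) :
  sm F' -> (forall m, F' (F m) = k m) -> tmap F' (tmap F v) = tmap k v.
Proof. by move=> sF' E; rewrite tmap_comp //; congr (tmap _ v); apply/funext => m. Qed.

Lemma pr_inj q v w : tangent q v -> tangent q w -> tmap pr1 v = tmap pr1 w -> tmap pr2 v = tmap pr2 w -> v = w.
Proof.
move=> tv tw e1 e2; apply/eqP; rewrite -subr_eq0; apply/eqP.
by apply: (cm_immersion CM (q := q)); [exact: tanB | rewrite tmapB e1 subrr | rewrite tmapB e2 subrr].
Qed.

Lemma tmulE q z : tangent q z -> tmul (pr1 q) (pr2 q) (tmap pr1 z) (tmap pr2 z) = tmap gmm z.
Proof.
move=> tz; rewrite /tmul; case: xgetP => [y _ [q' [x [e1 e2 tx [f1 f2 <-]]]]|/(_ (tmap gmm z)) []].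
  have eq : q' = q by exact: (cm_inj CM).
  by rewrite eq in tx; rewrite (pr_inj tx tz f1 f2).
by exists q, z.
Qed.

Lemma tmul_ex g h v w : s g = t h -> tangent g v -> tangent h w -> tmap s v = tmap t w ->
  exists q z, [/\ pr1 q = g, pr2 q = h, tangent q z & [/\ tmap pr1 z = v, tmap pr2 z = w & tmul g h v w = tmap gmm z]].
Proof.
move=> /(cm_image CM) [q e1 e2] tv tw E; subst g h.
have [z [tz e1 e2]] := (cm_tangent CM tv tw).1 E.
by exists q, z; split => //; split => //; rewrite -e1 -e2 tmulE.
Qed.

Lemma tmul_tangent g h v w : s g = t h -> tangent g v -> tangent h w -> tmap s v = tmap t w ->
  [/\ tangent (gmul g h) (tmul g h v w), tmap s (tmul g h v w) = tmap s w & tmap t (tmul g h v w) = tmap t v].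
Proof.
move=> E tv tw e; have [q [z [e1 e2 tz [f1 f2 ->]]]] := tmul_ex E tv tw e.
split.
- by rewrite -e1 -e2; exact: (tmap_tangent okH smm tz).
- rewrite (tmap_comp_tangent (k := fun q => s (pr2 q)) _ sms) => [|m]; last by rewrite /gm (gd_src_mul GD) ?comp_st.
  by rewrite -f2 tmap_comp.
rewrite (tmap_comp_tangent (k := fun q => t (pr1 q)) _ smt) => [|m]; last by rewrite /gm (gd_tgt_mul GD) ?comp_st.
by rewrite -f1 tmap_comp.
Qed.

Lemma tmul_lin g h a v w v' w' : s g = t h -> tangent g v -> tangent h w -> tmap s v = tmap t w ->
  tangent g v' -> tangent h w' -> tmap s v' = tmap t w' ->
  tmul g h (a *: v + v') (a *: w + w') = a *: tmul g h v w + tmul g h v' w'.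
Proof.
move=> E tv tw e tv' tw' e'; have [q [z [e1 e2 tz [f1 f2 ->]]]] := tmul_ex E tv tw e.
have [q' [z' [e1' e2' tz' [f1' f2' ->]]]] := tmul_ex E tv' tw' e'.
have eq : q' = q by apply: (cm_inj CM); rewrite ?e1 ?e2.
rewrite eq in tz'; rewrite -e1 -e2 -f1 -f2 -f1' -f2' -!tmap_lin tmulE //.
exact: tan_linc.
Qed.

Lemma tmulD g h v w v' w' : s g = t h -> tangent g v -> tangent h w -> tmap s v = tmap t w ->
  tangent g v' -> tangent h w' -> tmap s v' = tmap t w' ->
  tmul g h (v + v') (w + w') = tmul g h v w + tmul g h v' w'.
Proof. by move=> E tv tw e tv' tw' e'; have := tmul_lin 1 E tv tw e tv' tw' e'; rewrite !scale1r. Qed.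

(* The derivative of a product of two composable families is Tm of their
   derivatives; no smoothness of the induced map into the composable pairs is
   needed. *)
Lemma tmul_curve (L : mfd R) (a b c : L -> H) l V : mfd_ok L -> sm a -> sm b -> sm c ->
  (forall l, s (a l) = t (b l)) -> (forall l, gmul (a l) (b l) = c l) -> tangent l V ->
  tmap s (tmap a V) = tmap t (tmap b V) /\ tmul (a l) (b l) (tmap a V) (tmap b V) = tmap c V.
Proof.
move=> okL sa sb sc ab abc tV.
have ta : tangent (a l) (tmap a V) by exact: tmap_tangent.
have tb : tangent (b l) (tmap b V) by exact: tmap_tangent.
have E : tmap s (tmap a V) = tmap t (tmap b V).
  by rewrite (tmap_comp_tangent (k := fun l => t (b l)) _ sms) ?tmap_comp.
split=> //; have [q [z [e1 e2 tz [f1 f2 ->]]]] := tmul_ex (ab l) ta tb E.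
have exq l' : exists q', pr1 q' = a l' /\ pr2 q' = b l'.
  by have /(cm_image CM) [q' h1 h2] := ab l'; exists q'.
(* J lifts (a, b) to the composable pairs. It is only a map of sets, which [embedding_derivative]
   allows. *)
have [J hJ] := choice exq.
have eq : J l = q by apply: (cm_inj CM); [rewrite e1 | rewrite e2]; have [] := hJ l.
have mJ l' : gmm (J l') = c l' by rewrite /gm; have [-> ->] := hJ l'; exact: abc.
have PJ : (fun l => (pr1 (J l), pr2 (J l))) = (fun l => (a l, b l)).
  by apply/funext => l'; have [-> ->] := hJ l'.
have okHH := prod_ok okH okH.
have sP : @sm R Q (prod_mfd H H) (fun q => (pr1 q, pr2 q)) by exact: sm_pair.
rewrite -eq in tz; apply: (tan_eq (p := gmm (J l))).
- exact: tmap_tangent.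
- by rewrite mJ; exact: tmap_tangent.
move=> f sf; rewrite !tmapE //; have sfm : smooth_fun (f \o gmm) by have [_ h] := smm; exact: h.
have fc : (f \o gmm) \o J = f \o c by apply/funext => l' /=; rewrite mJ.
have sfc : smooth_fun (f \o c) by have [_ h] := sc; exact: h.
rewrite -fc; apply: (@embedding_derivative R Q (prod_mfd H H) L (fun q => (pr1 q, pr2 q)) J l z V (f \o gmm)) => //.
- exact: (cm_topology CM).
- move=> y ty y0; rewrite (tmap_pair okH okH okQ sm1 sm2 ty) in y0.
  have t1 := tmap_tangent okH sm1 ty; have t2 := tmap_tangent okH sm2 ty.
  apply: (cm_immersion CM ty).
    by rewrite -(tmap_fst okH okH t1 t2) y0 tmap0.
  by rewrite -(tmap_snd okH okH t1 t2) y0 tmap0.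
- by rewrite PJ; exact: sm_pair.
- rewrite PJ (tmap_pair okH okH okQ sm1 sm2 tz) (tmap_pair okH okH okL sa sb tV) f1 f2.
  by have [-> ->] := hJ l.
by rewrite fc.
Qed.

Lemma gd_inv_unt x : inv (unit x) = unit x.
Proof.
rewrite -[LHS](gd_mul1r GD) (gd_src_inv GD) (gd_tgt_unt GD) (gd_mulVl GD).
by rewrite (gd_src_unt GD).
Qed.

Lemma gd_invK h : inv (inv h) = h.
Proof.
rewrite -[LHS](gd_mul1r GD) (gd_src_inv GD) (gd_tgt_inv GD) -(gd_mulVl GD) -(gd_mulA GD).
- by rewrite (gd_mulVl GD) (gd_src_inv GD) (gd_mul1l GD).
- by rewrite (gd_src_inv GD).
by rewrite (gd_src_inv GD).
Qed.

Lemma tmul_unit_l h V : tangent h V ->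
  tmap s (tmap unit (tmap t V)) = tmap t V /\ tmul (unit (t h)) h (tmap unit (tmap t V)) V = V.
Proof.
move=> tV; have E : tmap unit (tmap t V) = tmap (fun h => unit (t h)) V by rewrite tmap_comp.
have := @tmul_curve H (fun h => unit (t h)) (fun h => h) (fun h => h) h V okH (sm_comp smt smu) (sm_id H) (sm_id H) _ _ tV.
rewrite (tmap_id tV) -E; apply; first by move=> l; rewrite (gd_src_unt GD).
by move=> l; rewrite (gd_mul1l GD).
Qed.

Lemma tmul_unit_r h V : tangent h V ->
  tmap t (tmap unit (tmap s V)) = tmap s V /\ tmul h (unit (s h)) V (tmap unit (tmap s V)) = V.
Proof.
move=> tV; have E : tmap unit (tmap s V) = tmap (fun h => unit (s h)) V by rewrite tmap_comp.
have := @tmul_curve H (fun h => h) (fun h => unit (s h)) (fun h => h) h V okH (sm_id H) (sm_comp sms smu) (sm_id H) _ _ tV.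
rewrite (tmap_id tV) -E => h1; have [||<- ->] := h1 => //.
  by move=> l; rewrite (gd_tgt_unt GD).
by move=> l; rewrite (gd_mul1r GD).
Qed.

Lemma tan_unit x v : tangent x v -> tangent (unit x) (tmap unit v).
Proof. by move=> tv; exact: tmap_tangent. Qed.

(** Split (v, w) as (v, T1(Ts v)) + (0, w - T1(Tt w)): the first pair has product v, the second its
    right entry. *)
Lemma tmul_at_unit x v w : tangent (unit x) v -> tangent (unit x) w -> tmap s v = tmap t w ->
  tmul (unit x) (unit x) v w = v + w - tmap unit (tmap t w).
Proof.
move=> tv tw E; have su := gd_src_unt GD x; have tu := gd_tgt_unt GD x.
have ts : tangent x (tmap s v) by rewrite -[x in tangent x]su; exact: tmap_tangent.
have te := tan_unit ts.
have [l1 l2] := tmul_unit_l tw; have [r1 r2] := tmul_unit_r tv.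
rewrite su in r2; rewrite tu in l2.
have tw' : tangent (unit x) (w - tmap unit (tmap t w)) by apply: tanB => //; rewrite -E.
have e0 : tmap t (w - tmap unit (tmap t w)) = 0 by rewrite tmapB -E r1 subrr.
have [_ z2] := tmul_unit_l tw'; rewrite e0 tmap0 tu in z2.
have -> : tmul (unit x) (unit x) v w = tmul (unit x) (unit x) (v + 0) (tmap unit (tmap s v) + (w - tmap unit (tmap t w))).
  by rewrite addr0 E addrC subrK.
rewrite tmulD ?su ?tu ?tmap0 ?e0 //; last exact: tan0.
by rewrite r2 z2 addrA.
Qed.

(** The last formula differentiates i(h) h = 1(s h) at a unit, where [tmul_at_unit] computes the
    product. *)
Lemma tinv_algd x u : algd x u ->
  [/\ tangent (unit x) (tmap inv u), tmap t (tmap inv u) = 0, tmap s (tmap inv u) = tmap t u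
    & tmap inv u = tmap unit (tmap t u) - u].
Proof.
move=> [tu su]; have ti : tangent (unit x) (tmap inv u) by rewrite -[X in tangent X]gd_inv_unt; exact: tmap_tangent.
have e1 : tmap t (tmap inv u) = 0.
  by rewrite (tmap_comp_tangent (k := s) _ smt) // => m; rewrite (gd_tgt_inv GD).
have e2 : tmap s (tmap inv u) = tmap t u.
  by rewrite (tmap_comp_tangent (k := t) _ sms) // => m; rewrite (gd_src_inv GD).
split=> //.
have [_ E] := @tmul_curve H inv (fun h => h) (fun h => unit (s h)) _ u okH smi (sm_id H) (sm_comp sms smu)
  (gd_src_inv GD) (gd_mulVl GD) tu.
move: E; rewrite (tmap_id tu) gd_inv_unt tmul_at_unit //.
rewrite -(tmap_comp s u smu) su tmap0 => /eqP; rewrite subr_eq0 => /eqP <-.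
by rewrite addrK.
Qed.

Lemma right_ext_tan h u : algd (t h) u ->
  [/\ tangent h (right_ext h u), tmap s (right_ext h u) = 0 & tmap t (right_ext h u) = tmap t u].
Proof.
move=> [tu su]; have := tmul_tangent (gd_src_unt GD (t h)) tu (tan0 h) _.
by rewrite (gd_mul1l GD) !tmap0; exact.
Qed.

Lemma left_ext_tan h u : algd (s h) u ->
  [/\ tangent h (left_ext h (tmap inv u)), tmap s (left_ext h (tmap inv u)) = tmap t u
   & tmap t (left_ext h (tmap inv u)) = 0].
Proof.
move=> au; have [ti e1 e2 _] := tinv_algd au; have := tmul_tangent (esym (gd_tgt_unt GD (s h))) (tan0 h) ti _.
by rewrite (gd_mul1r GD) !tmap0 e1 e2; exact.
Qed.

Lemma right_ext_lin h a u v : algd (t h) u -> algd (t h) v ->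
  right_ext h (a *: u + v) = a *: right_ext h u + right_ext h v.
Proof.
move=> [tu su] [tv sv]; rewrite /right_ext -tmul_lin ?scaler0 ?addr0 ?tmap0 //; try exact: tan0.
exact: (gd_src_unt GD).
Qed.

Lemma right_ext_unit x u : algd x u -> right_ext (unit x) u = u.
Proof.
move=> [tu su]; rewrite /right_ext (gd_tgt_unt GD) tmul_at_unit ?tmap0 ?subr0 ?addr0 //; exact: tan0.
Qed.

Lemma algd_linc x a u v : algd x u -> algd x v -> algd x (a *: u + v).
Proof. by move=> [tu su] [tv sv]; split; [exact: tan_linc | rewrite tmap_lin su sv scaler0 addr0]. Qed.
Lemma algd0 x : algd (G := G) x 0. Proof. by split; [exact: tan0 | exact: tmap0]. Qed.

(* (l, k) |-> (l k, k^-1) is an involution of the composable pairs that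
   exchanges m and pr1. *)
Lemma tmul_surj g h W : s g = t h -> tangent (gmul g h) W ->
  exists v w, [/\ tangent g v, tangent h w, tmap s v = tmap t w & tmul g h v w = W].
Proof.
move=> E tW; have sgh := gd_src_mul GD E.
have tsW : tangent (t (inv h)) (tmap s W) by rewrite (gd_tgt_inv GD) -sgh; exact: tmap_tangent.
have [w' tw' ew'] := gd_tgt_subm GD tsW.
have Egh : s (gmul g h) = t (inv h) by rewrite sgh (gd_tgt_inv GD).
have [q [z [e1 e2 tz [f1 f2 _]]]] := tmul_ex Egh tW tw' (esym ew').
have C1 (l : Q) : s (gmm l) = t (inv (pr2 l)) by rewrite /gm (gd_src_mul GD) ?comp_st // (gd_tgt_inv GD).
have C2 (l : Q) : gmul (gmm l) (inv (pr2 l)) = pr1 l.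
  rewrite /gm (gd_mulA GD) ?comp_st ?(gd_tgt_inv GD) // (gd_mulVr GD) -comp_st; exact: (gd_mul1r GD).
have [h1 h2] := tmul_curve okQ smm (sm_comp sm2 smi) sm1 C1 C2 tz.
have Eg : gmm q = g by rewrite /gm e1 e2 (gd_mulA GD) ?(gd_tgt_inv GD) // (gd_mulVr GD) -E (gd_mul1r GD).
have Eh : inv (pr2 q) = h by rewrite e2 gd_invK.
have ta := tmap_tangent okH smm tz; have tb := tmap_tangent okH (sm_comp sm2 smi) tz.
rewrite Eg in ta h2; rewrite Eh in tb h2.
by exists (tmap gmm z), (tmap (fun l => inv (pr2 l)) z); split => //; rewrite h2.
Qed.

End Groupoid.

Lemma prod_lin1 (R : realType) (U V : lmodType R) a (x y : U * V) : (a *: x + y).1 = a *: x.1 + y.1.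
Proof. by []. Qed.
Lemma prod_lin2 (R : realType) (U V : lmodType R) a (x y : U * V) : (a *: x + y).2 = a *: x.2 + y.2.
Proof. by []. Qed.

Section EvecProj.
Variables (R : realType) (K : lie_group_data R) (G : groupoid_data R).
Implicit Types e : Evec K G.
Local Notation TN := (tvec (obj G)).
Lemma EvE1 a e1 e2 : (a *: e1 + e2).1.1 = a *: e1.1.1 + e2.1.1.
Proof.
rewrite (@prod_lin1 R (TN * fnl TN)%type (tvec K) a e1 e2).
exact: (@prod_lin1 R TN (fnl TN) a e1.1 e2.1).
Qed.
Lemma EvE2 a e1 e2 X : (a *: e1 + e2).1.2 X = a * e1.1.2 X + e2.1.2 X.
Proof.
rewrite (@prod_lin1 R (TN * fnl TN)%type (tvec K) a e1 e2).
by rewrite (@prod_lin2 R TN (fnl TN) a e1.1 e2.1).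
Qed.
Lemma EvE3 a e1 e2 : (a *: e1 + e2).2 = a *: e1.2 + e2.2.
Proof. exact: (@prod_lin2 R (TN * fnl TN)%type (tvec K) a e1 e2). Qed.
Lemma EvE02 X : (0 : Evec K G).1.2 X = 0. Proof. reflexivity. Qed.
Lemma EvE03 : (0 : Evec K G).2 = 0. Proof. reflexivity. Qed.
End EvecProj.

(** * The lagrangian morphism and the algebra of the relation R *)

Section Lagr.
Variables (R : realType) (K : lie_group_data R) (Omega : form2 (prod_mfd K K)) (Theta : form3 K).
Variables (G : groupoid_data R) (Phi : arr G -> K) (sigma : form2 (arr G)) (eta : form3 (obj G)).
Hypothesis SS : shifted_symplectic Omega Theta.
Hypothesis LM : lagrangian_morphism Omega Theta Phi sigma eta.
Local Notation "x ** y" := (lmul x y) (at level 40, left associativity).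
Local Notation e := (lone K).
Local Notation KK := (prod_mfd K K).
Local Notation H := (arr G).
Local Notation N := (obj G).
Local Notation s := (@src R G).
Local Notation t := (@tgt R G).
Local Notation unit := (@unt R G).
Local Notation inv := (@ginv R G).
Local Notation RR k := (tmap (fun x : K => x ** k)).
Local Notation LL k := (tmap (fun x : K => k ** x)).
Local Notation tge := (@tangent R K e).
Local Notation mu := (muf Omega).
Local Notation nu := (nuf Omega).
Local Notation TP := (tmap Phi).
Local Notation embs := (emb Phi sigma).
Local Notation lam := (lambda_sigma sigma).
Local Notation EP := (@Epair R K Omega G).
Implicit Types (g h : H) (x : N) (u : tvec H).

Let GD : is_lie_groupoid G := lm_groupoid LM.
Let LG : is_lie_group K := ss_group SS.
Let okK : mfd_ok K := ss_ok SS.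
Let okH : mfd_ok H := gd_okH GD.
Let okN : mfd_ok N := gd_okN GD.
Let sms := gd_sm_s GD. Let smt := gd_sm_t GD. Let smu := gd_sm_u GD.
Let t0 (M : mfd R) (p : M) : @tangent R M p 0 := tan0 p.

Lemma lm_sm_Phi : sm Phi. Proof. by apply: smooth_map_sm => //; exact: lm_smooth LM. Qed.
Let smP := lm_sm_Phi.

Lemma Phi_unt x : Phi (unit x) = e.
Proof.
have := lm_morphism LM (g := unit x) (h := unit x); rewrite (gd_src_unt GD) (gd_tgt_unt GD) => /(_ erefl).
have gu : gmul (unit x) (unit x) = unit x by have := gd_mul1l GD (unit x); rewrite (gd_tgt_unt GD).
rewrite gu => E.
have : linv (Phi (unit x)) ** Phi (unit x) = linv (Phi (unit x)) ** (Phi (unit x) ** Phi (unit x)) by rewrite -E.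
by rewrite (lg_mulA LG) (lg_mulVl LG) (lg_mul1l LG).
Qed.

Lemma TP_unt x v : tangent x v -> TP (tmap unit v) = 0.
Proof. by move=> tv; rewrite (tmap_comp_tangent (k := fun=> e) _ smP Phi_unt) (tmap_cst _ okN tv). Qed.

Lemma tan_TP h V : tangent h V -> tangent (Phi h) (TP V).
Proof. by move=> tV; exact: tmap_tangent. Qed.
Lemma tan_Tt h V : tangent h V -> tangent (t h) (tmap t V).
Proof. by move=> tV; exact: tmap_tangent. Qed.
Lemma tan_Ts h V : tangent h V -> tangent (s h) (tmap s V).
Proof. by move=> tV; exact: tmap_tangent. Qed.

Lemma algd_TP x u : algd x u -> tge (TP u).
Proof. by move=> [tu _]; rewrite -(Phi_unt x); exact: tan_TP. Qed.
Lemma algd_Tt x u : algd x u -> tangent x (tmap t u).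
Proof. by move=> [tu _]; rewrite -[x in tangent x](gd_tgt_unt GD); exact: tan_Tt. Qed.

Lemma TP_mul g h v w : s g = t h -> tangent g v -> tangent h w -> tmap s v = tmap t w ->
  TP (tmul g h v w) = RR (Phi h) (TP v) + LL (Phi g) (TP w).
Proof.
move=> E tv tw ev; have [q [z [e1 e2 tz [f1 f2 ->]]]] := tmul_ex GD E tv tw ev.
have sm1 := gd_sm_1 GD; have sm2 := gd_sm_2 GD.
have okQ : mfd_ok (cpb G) := is_mfd_ok (cm_mfd (gd_cpb GD)).
rewrite (tmap_comp_tangent (k := fun q => Phi (cpr1 q) ** Phi (cpr2 q)) _ smP); last first.
  by move=> m; rewrite /gm (lm_morphism LM) ?(comp_st GD).
have s1 := sm_comp sm1 smP; have s2 := sm_comp sm2 smP.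
rewrite -(tmap_comp (fun q => (Phi (cpr1 q), Phi (cpr2 q)) : KK) z (sm_mul SS)).
rewrite (tmap_pair okK okK okQ s1 s2 tz).
have T1 : tangent (Phi (cpr1 q)) (tmap (fun l => Phi (cpr1 l)) z) by exact: (tmap_tangent okK s1 tz).
have T2 : tangent (Phi (cpr2 q)) (tmap (fun l => Phi (cpr2 l)) z) by exact: (tmap_tangent okK s2 tz).
by rewrite (tmap_tpair okK okK (sm_mul SS) T1 T2) /= -(tmap_comp (@cpr1 R G) z smP) -(tmap_comp (@cpr2 R G) z smP) e1 e2 f1 f2.
Qed.

Lemma sg_lin h V : tangent h V -> linear_on (tangent h) (fun U => sigma h U V).
Proof. by have [/(_ h) [l _] _] := lm_sigma LM; exact: l. Qed.
Lemma sg_anti h U V : tangent h U -> tangent h V -> sigma h U V = - sigma h V U.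
Proof. by have [/(_ h) [_ a] _] := lm_sigma LM; exact: a. Qed.
Lemma sg0l h V : tangent h V -> sigma h 0 V = 0.
Proof. by move=> tV; exact (linear_on0 (sg_lin tV) (t0 h)). Qed.
Lemma sg_linr h U : tangent h U -> linear_on (tangent h) (fun V => sigma h U V).
Proof.
move=> tU a v w tv tw; rewrite (sg_anti tU (tan_linc a tv tw)) (sg_lin tU a tv tw) (sg_anti tU tv) (sg_anti tU tw); ring.
Qed.

Lemma sigma_mul g h v w v' w' : s g = t h -> tangent g v -> tangent h w -> tmap s v = tmap t w ->
  tangent g v' -> tangent h w' -> tmap s v' = tmap t w' ->
  sigma (gmul g h) (tmul g h v w) (tmul g h v' w') =
  sigma g v v' + sigma h w w' - om Omega (Phi g) (Phi h) (TP v) (TP w) (TP v') (TP w').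
Proof.
move=> E tv tw ev tv' tw' ev'; have [q [z [e1 e2 tz [f1 f2 ->]]]] := tmul_ex GD E tv tw ev.
have [q' [z' [e1' e2' tz' [f1' f2' ->]]]] := tmul_ex GD E tv' tw' ev'.
have eq : q' = q by apply: (cm_inj (gd_cpb GD)); rewrite ?e1 ?e2.
rewrite eq in tz'; have := lm_delta_sigma LM tz tz'.
have s1 := sm_comp (gd_sm_1 GD) smP; have s2 := sm_comp (gd_sm_2 GD) smP.
have okQ : mfd_ok (cpb G) := is_mfd_ok (cm_mfd (gd_cpb GD)).
rewrite /pull2 (tmap_pair okK okK okQ s1 s2 tz) (tmap_pair okK okK okQ s1 s2 tz').
rewrite -(tmap_comp (@cpr1 R G) z smP) -(tmap_comp (@cpr2 R G) z smP) -(tmap_comp (@cpr1 R G) z' smP) -(tmap_comp (@cpr2 R G) z' smP).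
rewrite (_ : gm q = gmul g h) ?f1 ?f2 ?f1' ?f2' ?e1 ?e2; last by rewrite /gm e1 e2.
rewrite -/(om Omega _ _ _ _ _ _); lra.
Qed.

Lemma lamE x u X : tangent x X -> lam x u X = sigma (unit x) u (tmap unit X).
Proof. by move=> tX; rewrite /lambda_sigma /restr asboolT. Qed.

(** u^r = Tm(u, 0) and V = Tm(T1(Tt V), V), so multiplicativity of sigma moves the evaluation to a
    unit; the Omega term is [muf]. *)
Lemma sigma_right h u V : algd (t h) u -> tangent h V ->
  sigma h (right_ext h u) V = lam (t h) u (tmap t V) + mu (TP u) (Phi h) (TP V).
Proof.
move=> au tV; have [tu su] := au; have [e1 e2] := tmul_unit_l GD tV.
have tt := tan_Tt tV; have te := tan_unit GD tt.
have := sigma_mul (gd_src_unt GD (t h)) tu (t0 h) _ te tV e1.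
rewrite tmap0 su e2 (gd_mul1l GD) => /(_ erefl); rewrite -/(right_ext h u) => ->.
rewrite lamE // sg0l // tmap0 (TP_unt tt) Phi_unt addr0 mufE //; exact: tan_TP.
Qed.

(** Here V = Tm(V, T1(Ts V)). The sign of lambda comes from i(u) = T1(Tt u) - u, as sigma vanishes
    on vectors tangent to the units. *)
Lemma sigma_left h u V : algd (s h) u -> tangent h V ->
  sigma h (left_ext h (tmap inv u)) V = - lam (s h) u (tmap s V) + nu (TP u) (Phi h) (TP V).
Proof.
move=> au tV; have [tu su] := au; have [e1 e2] := tmul_unit_r GD tV.
have [ti ti1 ti2 ti3] := tinv_algd GD au.
have tt := tan_Ts tV; have te := tan_unit GD tt.
have Es := esym (gd_tgt_unt GD (s h)).
have := sigma_mul Es (t0 h) ti _ tV te (esym e1).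
rewrite tmap0 ti1 e2 (gd_mul1r GD) => /(_ erefl); rewrite -/(left_ext h (tmap inv u)) => ->.
rewrite sg0l // tmap0 (TP_unt tt) Phi_unt add0r lamE // {1}ti3.
have tTu := algd_Tt au; have tuu := tan_unit GD tTu.
rewrite (lin_tanB (sg_lin te) tuu tu).
have := lm_sigma_unt LM tTu tt; rewrite /pull2 => ->.
have TPi : TP (tmap inv u) = - TP u by rewrite ti3 tmapB (TP_unt tTu) sub0r.
rewrite TPi nufE; last exact: tan_TP.
have tw := algd_TP au.
have := linear_onZ (-1) (om_lin2 SS (t0 (Phi h)) (tan_TP tV) (t0 e) erefl) (t0 e) tw.
rewrite scaleN1r => ->; lra.
Qed.

Lemma lam_cot x u : algd x u -> cotangent x (lam x u).
Proof.
move=> [tu _]; split; last by move=> v nv; rewrite /lambda_sigma /restr asboolF.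
move=> a v w tv tw; rewrite !lamE //; last exact: tan_linc.
by rewrite tmap_lin (sg_linr tu) //; exact: tan_unit.
Qed.

Lemma Efib_lin x a e1 e2 : @Efib R K G x e1 -> @Efib R K G x e2 -> @Efib R K G x (a *: e1 + e2).
Proof.
move=> [t1 [c1 z1] l1] [t2 [c2 z2] l2]; split.
- by rewrite EvE1; exact: tan_linc.
- split=> [b u v tu tv|v nv]; rewrite !EvE2; first by rewrite c1 // c2 //; ring.
  by rewrite z1 // z2 // mulr0 addr0.
by rewrite EvE3; exact: tan_linc.
Qed.

Lemma Efib0 x : @Efib R K G x 0.
Proof. by split; [exact: tan0 | split => //; move=> a u v _ _ /=; rewrite mulr0 addr0 | exact: tan0]. Qed.

Lemma emb_fib x u : algd x u -> @Efib R K G x (embs x u).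
Proof. by move=> au; split; [exact: algd_Tt | exact: lam_cot | exact: (algd_TP au)]. Qed.

Lemma emb_lin x a u v : algd x u -> algd x v -> embs x (a *: u + v) = a *: embs x u + embs x v.
Proof.
move=> [tu _] [tv _]; rewrite /emb !tmap_lin; congr (_, _, _).
apply/funext => X; change (lam x (a *: u + v) X = a * lam x u X + lam x v X).
case: (pselect (tangent x X)) => tX; last by rewrite /lambda_sigma /restr !asboolF // mulr0 addr0.
by rewrite !lamE // (sg_lin (tan_unit GD tX)).
Qed.

Lemma EP_lin x e3 : @Efib R K G x e3 -> linear_on (@Efib R K G x) (fun e1 => EP e1 e3).
Proof.
move=> [t3 [c3 _] l3] a e1 e2 [t1 _ l1] [t2 _ l2]; rewrite /Epair.
rewrite EvE1 EvE2 EvE3 c3 // (kpair_lin SS l3 a l1 l2); ring.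
Qed.

Lemma EPC x e1 e2 : @Efib R K G x e1 -> @Efib R K G x e2 -> EP e1 e2 = EP e2 e1.
Proof. by move=> [_ _ l1] [_ _ l2]; rewrite /Epair (kpairC SS l1 l2); ring. Qed.

Lemma EP_linr x e3 : @Efib R K G x e3 -> linear_on (@Efib R K G x) (fun e1 => EP e3 e1).
Proof.
move=> E3 a e1 e2 E1 E2; rewrite (EPC E3 (Efib_lin a E1 E2)) (EP_lin E3 a E1 E2).
by rewrite (EPC E3 E1) (EPC E3 E2).
Qed.

Lemma EP_nondeg x e1 : @Efib R K G x e1 -> (forall e2, @Efib R K G x e2 -> EP e1 e2 = 0) -> e1 = 0.
Proof.
move=> [t1 [c1 z1] l1] h; case: e1 t1 c1 z1 l1 h => [[X a] w] /= tX la za lw h.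
have a0 : a 0 = 0 by exact (linear_on0 la (t0 x)).
have kw0 : kpair Omega w 0 = 0.
  by rewrite (kpairC SS lw (t0 e)); exact (linear_on0 (kpair_lin SS lw) (t0 e)).
have X0 : X = 0.
  apply: (tan_eq tX (t0 x)) => f sf; have := h (0, differential x f, 0); rewrite /Epair /= a0 kw0 add0r addr0.
  rewrite /differential /restr asboolT // tvec0; apply; split => //=; try exact: t0.
  split; last by move=> v nv; rewrite asboolF.
  by move=> b u v tu tv; rewrite !asboolT //; exact: tan_linc.
have w0 : w = 0.
  apply: (kpair_nondeg SS lw) => v tv; have := h (0, 0, v); rewrite /Epair /= a0 add0r add0r.
  apply; split => //=; try exact: t0.
  by have [_ ? _] := Efib0 x.
have aa : a = 0.
  apply/funext => Y; case: (pselect (tangent x Y)) => tY; last by rewrite za.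
  have := h (Y, 0, 0); rewrite /Epair /= kw0 !addr0; apply; split => //=; try exact: t0.
  by have [_ ? _] := Efib0 x.
by rewrite X0 w0 aa.
Qed.

(* The relation R with zeta eliminated: T Phi (U) and zeta are the images of the k-components
   of e1 and e2 under the trivialisation of TK + T^*K. *)
Definition relR' h (U : tvec H) (b : fnl (tvec H)) (e1 e2 : Evec K G) : Prop :=
  [/\ [/\ tangent h U, cotangent h b, Efib (t h) e1 & Efib (s h) e2],
   e1.1.1 = tmap t U, e2.1.1 = tmap s U, TP U = RR (Phi h) e1.2 - LL (Phi h) e2.2 &
   forall V, tangent h V -> b V = e1.1.2 (tmap t V) - e2.1.2 (tmap s V)
      + (mu e1.2 (Phi h) (TP V) + nu e2.2 (Phi h) (TP V)) - sigma h U V].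

Lemma relRP h U b e1 e2 : relR Omega Phi sigma h U b e1 e2 <-> relR' h U b e1 e2.
Proof.
split.
  move=> [tU cb E1 E2 [z cz [[h1 h2] r1 r2 hb]]].
  have [XE zE] := rep_decompose SS (tan_TP tU) cz r1 r2.
  by split => // V tV; rewrite hb // zE //; exact: tan_TP.
move=> [[tU cb E1 E2] h1 h2 XE hb]; have [_ _ l1] := E1; have [_ _ l2] := E2.
split => //; exists (mu e1.2 (Phi h) + nu e2.2 (Phi h)).
  have [/(_ (Phi h)) [lm zm] _] := muf_form1 SS l1; have [/(_ (Phi h)) [ln zn] _] := nuf_form1 SS l2.
  split.
    move=> a u v tu tv.
    change (mu e1.2 (Phi h) (a *: u + v) + nu e2.2 (Phi h) (a *: u + v)
     = a * (mu e1.2 (Phi h) u + nu e2.2 (Phi h) u) + (mu e1.2 (Phi h) v + nu e2.2 (Phi h) v)).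
    by rewrite lm // ln //; ring.
  move=> v nv; change (mu e1.2 (Phi h) v + nu e2.2 (Phi h) v = 0).
  by rewrite zm // zn // addr0.
have [r1 r2] := rep_compose SS (k := Phi h) (zeta := mu e1.2 (Phi h) + nu e2.2 (Phi h)) l1 l2 (fun V _ => erefl).
by split => //; rewrite XE.
Qed.

Lemma relR'_lin h a U b e1 e2 U' b' e1' e2' : relR' h U b e1 e2 -> relR' h U' b' e1' e2' ->
  relR' h (a *: U + U') (a *: b + b') (a *: e1 + e1') (a *: e2 + e2').
Proof.
move=> [[tU [cb zb] E1 E2] h1 h2 XE hb] [[tU' [cb' zb'] E1' E2'] h1' h2' XE' hb'].
have [_ _ l1] := E1; have [_ _ l2] := E2; have [_ _ l1'] := E1'; have [_ _ l2'] := E2'.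
split.
- split; [exact: tan_linc | split | exact: Efib_lin | exact: Efib_lin].
    move=> c u v tu tv; change (a * b (c *: u + v) + b' (c *: u + v) = c * (a * b u + b' u) + (a * b v + b' v)).
    by rewrite cb // cb' //; ring.
  by move=> v nv; change (a * b v + b' v = 0); rewrite zb // zb' // mulr0 addr0.
- by rewrite EvE1 tmap_lin h1 h1'.
- by rewrite EvE1 tmap_lin h2 h2'.
- rewrite tmap_lin XE XE' !EvE3.
  by rewrite !tmap_lin scalerBr opprD; apply/funext => f; rewrite !(tvecD, tvecN, tvecZ); ring.
move=> V tV; have tPV := tan_TP tV.
rewrite (_ : (a *: b + b') V = a * b V + b' V) // !EvE2 !EvE3.
rewrite hb // hb' // (muf_lin1 SS tPV a l1 l1') (nuf_lin1 SS tPV a l2 l2') (sg_lin tV a tU tU'); ring.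
Qed.

(** The sigma terms cancel by antisymmetry, and [E_t], [F_s] and [E_s] turn the terms at K into the
    pairings of the k-components. *)
Lemma relR'_iso h U b e1 e2 U' b' e1' e2' : relR' h U b e1 e2 -> relR' h U' b' e1' e2' ->
  b U' + b' U = EP e1 e1' - EP e2 e2'.
Proof.
move=> [[tU cb E1 E2] h1 h2 XE hb] [[tU' cb' E1' E2'] h1' h2' XE' hb'].
have [_ _ l1] := E1; have [_ _ l2] := E2; have [_ _ l1'] := E1'; have [_ _ l2'] := E2'.
rewrite hb // hb' // (sg_anti tU' tU) -h1 -h2 -h1' -h2' XE XE' /Epair.
have m w w1 w2 : tge w -> tge w1 -> tge w2 -> mu w (Phi h) (RR (Phi h) w1 - LL (Phi h) w2) = mu w (Phi h) (RR (Phi h) w1) - mu w (Phi h) (LL (Phi h) w2).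
  by move=> tw tw1 tw2; exact: (lin_tanB (muf_lin SS tw) (tan_R SS _ tw1) (tan_L SS _ tw2)).
have n w w1 w2 : tge w -> tge w1 -> tge w2 -> nu w (Phi h) (RR (Phi h) w1 - LL (Phi h) w2) = nu w (Phi h) (RR (Phi h) w1) - nu w (Phi h) (LL (Phi h) w2).
  by move=> tw tw1 tw2; exact: (lin_tanB (nuf_lin SS tw) (tan_R SS _ tw1) (tan_L SS _ tw2)).
rewrite !m // !n // -(E_t SS (Phi h) l1 l1') -(F_s SS (Phi h) l2 l2') !(E_s SS) //; ring.
Qed.

Lemma cot0 (M : mfd R) (p : M) : cotangent p (0 : fnl (tvec M)).
Proof. by split => //; move=> a u v _ _ /=; rewrite mulr0 addr0. Qed.

Lemma mu0 k V : tangent k V -> mu 0 k V = 0.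
Proof. by move=> tV; exact (linear_on0 (muf_lin1 SS tV) (t0 e)). Qed.
Lemma nu0 k V : tangent k V -> nu 0 k V = 0.
Proof. by move=> tV; exact (linear_on0 (nuf_lin1 SS tV) (t0 e)). Qed.

Lemma TP_right h u : algd (t h) u -> TP (right_ext h u) = RR (Phi h) (TP u).
Proof.
move=> [tu su]; rewrite /right_ext (TP_mul (gd_src_unt GD _) tu (t0 h)); last by rewrite su tmap0.
by rewrite tmap0 tmap0 addr0.
Qed.

Lemma TP_inv x u : algd x u -> TP (tmap inv u) = - TP u.
Proof. by move=> au; have [_ _ _ ->] := tinv_algd GD au; rewrite tmapB (TP_unt (algd_Tt au)) sub0r. Qed.

Lemma TP_left h u : algd (s h) u -> TP (left_ext h (tmap inv u)) = - LL (Phi h) (TP u).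
Proof.
move=> au; have [ti e1 e2 _] := tinv_algd GD au.
rewrite /left_ext (TP_mul (esym (gd_tgt_unt GD _)) (t0 h) ti); last by rewrite e1 tmap0.
by rewrite tmap0 tmap0 add0r (TP_inv au) tmapN.
Qed.

Lemma relR_right h u : algd (t h) u -> relR' h (right_ext h u) 0 (embs (t h) u) 0.
Proof.
move=> au; have [tU sU tU'] := right_ext_tan GD au.
split.
- by split; [ | exact: cot0 | exact: emb_fib | exact: Efib0].
- by rewrite tU'.
- by rewrite sU.
- by rewrite TP_right // EvE03 tmap0 subr0.
move=> V tV; rewrite sigma_right //= nu0; last exact: tan_TP.
by rewrite subr0 addr0 subrr.
Qed.

Lemma relR_left h u : algd (s h) u -> relR' h (left_ext h (tmap inv u)) 0 0 (embs (s h) u).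
Proof.
move=> au; have [tU sU tU'] := left_ext_tan GD au.
split.
- by split; [ | exact: cot0 | exact: Efib0 | exact: emb_fib].
- by rewrite tU'.
- by rewrite sU.
- by rewrite TP_left // EvE03 tmap0 sub0r.
move=> V tV; rewrite sigma_left //= mu0; last exact: tan_TP.
by rewrite sub0r add0r subrr.
Qed.

Lemma EP0r x e1 : @Efib R K G x e1 -> EP e1 0 = 0.
Proof. by move=> E1; exact (linear_on0 (EP_linr E1) (Efib0 x)). Qed.
Lemma EP0l x e1 : @Efib R K G x e1 -> EP 0 e1 = 0.
Proof. by move=> E1; exact (linear_on0 (EP_lin E1) (Efib0 x)). Qed.

Lemma relR_pair_right h U b e1 e2 u : relR' h U b e1 e2 -> algd (t h) u ->
  b (right_ext h u) = EP e1 (embs (t h) u).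
Proof.
move=> r au; have := relR'_iso r (relR_right au); have [[_ _ E1 E2] _ _ _ _] := r.
by rewrite (EP0r E2) addr0 subr0.
Qed.

Lemma relR_pair_left h U b e1 e2 u : relR' h U b e1 e2 -> algd (s h) u ->
  b (left_ext h (tmap inv u)) = - EP e2 (embs (s h) u).
Proof.
move=> r au; have := relR'_iso r (relR_left au); have [[_ _ E1 E2] _ _ _ _] := r.
by rewrite (EP0r E1) addr0 sub0r.
Qed.

(** Isotropy of R at a unit, applied to ((u^r, 0), (u, 0)) and ((v^r, 0), (v, 0)), whose covectors
    are both zero. *)
Lemma emb_isotropic x u v : algd x u -> algd x v -> EP (embs x u) (embs x v) = 0.
Proof.
rewrite -[x](gd_tgt_unt GD) => au av.
have := relR_pair_right (relR_right au) av => /= <-; by [].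
Qed.

(** At a unit [sigma_right] expresses sigma(u, .) by [lambda_sigma] and T Phi(u). If these vanish
    together with Tt(u), then u lies in the kernel that [lm_nondeg] makes trivial. *)
Lemma emb_inj x u : algd x u -> embs x u = 0 -> u = 0.
Proof.
move=> au [e1 e2 e3]; have [tu su] := au.
apply: (lm_nondeg LM tu) => // w tw.
have au' : algd (t (unit x)) u by rewrite (gd_tgt_unt GD).
have := sigma_right au' tw; rewrite (right_ext_unit GD au) e3 mu0 ?(gd_tgt_unt GD) ?e2; last exact: tan_TP.
by move=> ->; rewrite addr0.
Qed.

Lemma RL_comm k l v : RR l (LL k v) = LL k (RR l v).
Proof.
rewrite (tmap_comp _ _ (sm_mulr SS l)) (tmap_comp _ _ (sm_mull SS k)); congr (tmap _ v).
by apply/funext => x; rewrite (lg_mulA LG).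
Qed.
Lemma RR_comp k l v : RR l (RR k v) = RR (k ** l) v.
Proof.
rewrite (tmap_comp _ _ (sm_mulr SS l)); congr (tmap _ v).
by apply/funext => x; rewrite (lg_mulA LG).
Qed.
Lemma LL_comp k l v : LL k (LL l v) = LL (k ** l) v.
Proof.
rewrite (tmap_comp _ _ (sm_mull SS k)); congr (tmap _ v).
by apply/funext => x; rewrite (lg_mulA LG).
Qed.

(** The cocycle condition at (1, k, l); [om_mul2] and [om_mul3] are its instances at (k, l, 1) and
    (k, 1, l). Together they evaluate the Omega term in sigma of a product when the first vectors
    come from R. *)
Lemma om_mul1 k l w X X' : tge w -> tangent k X -> tangent l X' ->
  om Omega k l (RR k w) 0 X X' = mu w k X - mu w (k ** l) (RR l X + LL k X').
Proof.
move=> tw tX tX'; have := om_delta SS tw (t0 k) (t0 l) (t0 e) tX tX'.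
rewrite !tmap0 !addr0 !add0r !(lg_mul1l LG) (LL1 SS tX) (om0l SS tX tX') => E.
rewrite !mufE //; last by apply: tanD; [exact: (tan_RR SS) | exact: (tan_LL SS)].
lra.
Qed.
Lemma om_mul2 k l w X X' : tge w -> tangent k X -> tangent l X' ->
  om Omega k l 0 (LL l w) X X' = nu w (k ** l) (RR l X + LL k X') - nu w l X'.
Proof.
move=> tw tX tX'; have := om_delta SS (t0 k) (t0 l) tw tX tX' (t0 e).
rewrite !tmap0 !addr0 !add0r !(lg_mul1r LG) (RR1 SS tX') (om0l SS tX tX') => E.
rewrite !nufE //; last by apply: tanD; [exact: (tan_RR SS) | exact: (tan_LL SS)].
lra.
Qed.
Lemma om_mul3 k l w X X' : tge w -> tangent k X -> tangent l X' ->
  om Omega k l 0 (RR l w) X X' = om Omega k l (LL k w) 0 X X' + nu w k X + mu w l X'.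
Proof.
move=> tw tX tX'; have := om_delta SS (t0 k) tw (t0 l) tX (t0 e) tX'.
rewrite !tmap0 !addr0 !add0r !(lg_mul1r LG, lg_mul1l LG) (RR1 SS tX) (LL1 SS tX') => E.
rewrite mufE // nufE //; lra.
Qed.
Lemma om_split k l X1 X2 Y1 Y2 X' Y' : tangent k X1 -> tangent k X2 -> tangent l Y1 -> tangent l Y2 ->
  tangent k X' -> tangent l Y' -> om Omega k l (X1 - X2) (Y1 - Y2) X' Y' =
   om Omega k l X1 0 X' Y' - om Omega k l X2 0 X' Y' + om Omega k l 0 Y1 X' Y' - om Omega k l 0 Y2 X' Y'.
Proof.
move=> a1 a2 b1 b2 c d.
have L1 := om_lin1 SS (t0 l) c d erefl; have L2 := om_lin2 SS (t0 k) c d erefl.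
have := om_lin SS 1 (tanB a1 a2) (t0 l) (t0 k) (tanB b1 b2) c d.
rewrite !scale1r addr0 add0r (lin_tanB L1 a1 a2) (lin_tanB L2 b1 b2) => ->; lra.
Qed.

(** Geometrically, (g x^-1)(x h) is constant in x. The proof shows instead that the vector lies in
    all the kernels of [lm_nondeg]; for sigma it is tested against products, which are all tangent
    vectors by [tmul_surj]. *)
Lemma tmul_left_right g h u : s g = t h -> algd (s g) u ->
  tmul g h (left_ext g (tmap inv u)) (right_ext h u) = 0.
Proof.
move=> E au; have au' : algd (t h) u by rewrite -E.
have [tl sl tl'] := left_ext_tan GD au; have [tr sr tr'] := right_ext_tan GD au'.
have Ec : tmap s (left_ext g (tmap inv u)) = tmap t (right_ext h u) by rewrite sl tr'.
have [tz sz tz'] := tmul_tangent GD E tl tr Ec.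
have tw := algd_TP au.
apply: (lm_nondeg LM tz); rewrite ?sz ?tz' //; last first.
  by rewrite TP_mul // TP_left // TP_right // tmapN RL_comm addNr.
move=> W tW; have [v [w [tv twv evw <-]]] := tmul_surj GD E tW.
rewrite sigma_mul // sigma_left // sigma_right // evw E TP_left // TP_right //.
have Xv := tan_TP tv; have Xw := tan_TP twv.
have tL := tan_L SS (Phi g) tw; have tR := tan_R SS (Phi h) tw.
have := om_split (t0 (Phi g)) tL tR (t0 (Phi h)) Xv Xw; rewrite sub0r subr0 => ->.
rewrite (om0l SS Xv Xw) (om_mul3 tw Xv Xw); lra.
Qed.

Section Complement.
Variable C : N -> set (Evec K G).
Hypothesis IC : isotropic_complement Omega Phi sigma C.

Lemma C_fib x c : C x c -> Efib x c.
Proof. by have [[h _] _ _ _] := IC; have [+ _] := h x; exact. Qed.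
Lemma C_sub x : Defs.subspace (C x).
Proof. by have [[h _] _ _ _] := IC; have [_ +] := h x; exact. Qed.
Lemma C_linc x a c c' : C x c -> C x c' -> C x (a *: c + c').
Proof. by have [_ h] := C_sub x; exact: h. Qed.
Lemma C0 x : C x 0. Proof. by have [h _] := C_sub x. Qed.

Lemma C_ortho x c : C x c -> (forall u, algd x u -> EP c (embs x u) = 0) -> c = 0.
Proof.
move=> Cc h; have [_ sp _ iso] := IC; apply: (EP_nondeg (C_fib Cc)) => e2 E2.
have [u au Cu] := sp _ _ E2.
have := EP_linr (C_fib Cc) 1 (emb_fib au) (C_fib Cu).
by rewrite scale1r addrC subrK => ->; rewrite h // (iso _ _ _ Cc Cu) mulr0 addr0.
Qed.

Lemma relR_inj h U e1 e2 : relR' h U 0 e1 e2 -> C (t h) e1 -> C (s h) e2 ->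
  [/\ U = 0, e1 = 0 & e2 = 0].
Proof.
move=> r C1 C2.
have e10 : e1 = 0.
  by apply: (C_ortho C1) => u au; rewrite -(relR_pair_right r au).
have e20 : e2 = 0.
  apply: (C_ortho C2) => u au; have := relR_pair_left r au => /eqP.
  by rewrite eq_sym oppr_eq0 => /eqP.
split=> //; have [[tU _ _ _] h1 h2 XE hb] := r.
have TU : TP U = 0 by rewrite XE e10 e20 /= !tmap0 subr0.
apply: (lm_nondeg LM tU) => //; rewrite -?h1 -?h2 ?e10 ?e20 //.
move=> V tV; have := hb _ tV; rewrite e10 e20 !EvE02 !EvE03 mu0 ?nu0; try exact: tan_TP.
by rewrite (_ : (0 : fnl (tvec H)) V = 0) // => E; lra.
Qed.

(** The covector condition is tested on (i(u)^l, u^r), whose product is 0: it says that e2 - f1 is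
    orthogonal to the algebroid, so e2 = f1 because both lie in C. After that all terms add up along
    the product. Multiplicativity of the bivector rests on this. *)
Lemma relR_mul g h Ua Ub a b c e1 e2 f1 f2 : s g = t h ->
  relR' g Ua a e1 e2 -> relR' h Ub b f1 f2 -> C (s g) e2 -> C (t h) f1 ->
  cotangent (gmul g h) c ->
  (forall v w, tangent g v -> tangent h w -> tmap s v = tmap t w -> c (tmul g h v w) = - (a v + b w)) ->
  tmap s Ua = tmap t Ub /\ relR' (gmul g h) (tmul g h Ua Ub) (- c) e1 f2.
Proof.
move=> E ra rb C2 C1 cc hc.
have [[tUa ca E1 E2] h1 h2 XE hb] := ra; have [[tUb cb F1 F2] k1 k2 YE kb] := rb.
have [lc zc] := cc.
have tm v w : tangent g v -> tangent h w -> tmap s v = tmap t w -> tangent (gmul g h) (tmul g h v w).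
  by move=> tv tw ev; have [] := tmul_tangent GD E tv tw ev.
have ef : e2 = f1.
  apply/eqP; rewrite -subr_eq0; apply/eqP; rewrite -E in C1 F1.
  have Cd : C (s g) (e2 - f1) by rewrite -scaleN1r addrC; apply: C_linc.
  apply: (C_ortho Cd) => u au; have au' : algd (t h) u by rewrite -E.
  have [tl sl _] := left_ext_tan GD au; have [tr _ tr'] := right_ext_tan GD au'.
  have := hc _ _ tl tr; rewrite sl tr' tmul_left_right // (linear_on0 lc (t0 _)) => /(_ erefl).
  rewrite (relR_pair_left ra au) (relR_pair_right rb au') -E.
  have := EP_lin (emb_fib au) (-1) F1 E2; rewrite scaleN1r (addrC (- f1) e2) => -> h0; lra.
have eU : tmap s Ua = tmap t Ub by rewrite -h2 -k1 ef.
split=> //; have [tz sz tz'] := tmul_tangent GD E tUa tUb eU.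
have [_ _ l1] := E1; have [_ _ l2] := E2; have [_ _ l3] := F2.
have tg := gd_tgt_mul GD E; have sg := gd_src_mul GD E; have Pm := lm_morphism LM E.
split.
- split; rewrite ?tg ?sg //; split; last first.
    by move=> v nv; change (- c v = 0); rewrite zc ?oppr0.
  move=> x u v tu tv; change (- c (x *: u + v) = x * (- c u) + (- c v)).
  by rewrite lc //; ring.
- by rewrite tz'.
- by rewrite sz.
- rewrite TP_mul // XE YE -ef !tmapB RR_comp RL_comm LL_comp Pm addrA subrK //.
move=> V /(tmul_surj GD E) [v [w [tv tw ev <-]]].
change (- c (tmul g h v w) = e1.1.2 (tmap t (tmul g h v w)) - f2.1.2 (tmap s (tmul g h v w))
  + (mu e1.2 (Phi (gmul g h)) (TP (tmul g h v w)) + nu f2.2 (Phi (gmul g h)) (TP (tmul g h v w)))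
  - sigma (gmul g h) (tmul g h Ua Ub) (tmul g h v w)).
have [_ -> ->] := tmul_tangent GD E tv tw ev.
rewrite hc // opprK hb // kb // sigma_mul // TP_mul // Pm XE YE -ef ev.
have Xv := tan_TP tv; have Xw := tan_TP tw.
have tL k v' : tge v' -> tangent k (LL k v') by exact: (tan_L SS).
have tR k v' : tge v' -> tangent k (RR k v') by exact: (tan_R SS).
rewrite (om_split (tR _ _ l1) (tL _ _ l2) (tR _ _ l2) (tL _ _ l3) Xv Xw).
rewrite (om_mul1 l1 Xv Xw) (om_mul2 l3 Xv Xw) (om_mul3 l2 Xv Xw); lra.
Qed.

End Complement.
End Lagr.

(** * Frames and the smooth solution of R o (C x C) *)

Section SmoothAlgebra.
Variables (R : realType) (M : mfd R).
Hypothesis okM : mfd_ok M.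
Implicit Types (p x : M).

Lemma smooth_at_sum (I : Type) (r : seq I) (P : pred I) p (F : I -> M -> R) :
  (forall i, smooth_at p (F i)) -> smooth_at p (fun x => \sum_(i <- r | P i) F i x).
Proof.
move=> sF; elim: r => [|i r IH].
  by under eq_fun do rewrite big_nil; exact: smooth_at_cst.
under eq_fun do rewrite big_cons.
by case: (P i) => //; exact: smooth_at_add.
Qed.

Lemma smooth_at_prod (I : Type) (r : seq I) (P : pred I) p (F : I -> M -> R) :
  (forall i, smooth_at p (F i)) -> smooth_at p (fun x => \prod_(i <- r | P i) F i x).
Proof.
move=> sF; elim: r => [|i r IH].
  by under eq_fun do rewrite big_nil; exact: smooth_at_cst.
under eq_fun do rewrite big_cons.
by case: (P i) => //; exact: smooth_at_mul.
Qed.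

Lemma smooth_at_det n p (A : M -> 'M[R]_n) : (forall i j, smooth_at p (fun x => A x i j)) ->
  smooth_at p (fun x => \det (A x)).
Proof.
move=> sA; apply: smooth_at_sum => s; apply: smooth_at_mul => //; first exact: smooth_at_cst.
by apply: smooth_at_prod.
Qed.

Lemma smooth_at_adj n p (A : M -> 'M[R]_n) i j : (forall i j, smooth_at p (fun x => A x i j)) ->
  smooth_at p (fun x => (\adj (A x)) i j).
Proof.
move=> sA; under eq_fun do rewrite mxE.
apply: smooth_at_mul => //; first exact: smooth_at_cst.
apply: smooth_at_det => k l; by under eq_fun do rewrite !mxE.
Qed.

Lemma inj_card (I J : finType) (A : I -> J -> R) :
  (forall z : J -> R, (forall i, \sum_j A i j * z j = 0) -> forall j, z j = 0) -> (#|J| <= #|I|)%N.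
Proof.
move=> inj; pose B : 'M[R]_(#|J|, #|I|) := \matrix_(k, l) A (enum_val l) (enum_val k).
have : row_free B.
  apply: inj_row_free => v vB; apply/rowP => k; rewrite mxE.
  have := inj (fun j => v 0 (enum_rank j)) => /(_ _ (enum_val k)); rewrite enum_valK; apply => i.
  have := congr1 (fun w : 'rV[R]_#|I| => w 0 (enum_rank i)) vB; rewrite !mxE => e0; rewrite -[RHS]e0.
  rewrite (reindex (@enum_val J predT)) /=; last exact/onW_bij/enum_val_bij.
  by apply: eq_bigr => k' _; rewrite mxE !enum_rankK enum_valK mulrC.
by move=> /eqP <-; exact: rank_leq_col.
Qed.

(** The formula with adjugate and determinant is smooth where the determinant is nonzero, hence near
    p. Equations and unknowns have different index types in the application; [f] and [f'] reindex
    the equations. *)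
Lemma smooth_solve (I J : finType) (A : M -> I -> J -> R) (b : M -> I -> R) p :
  #|I| = #|J| ->
  (forall i j, smooth_at p (fun x => A x i j)) -> (forall i, smooth_at p (fun x => b x i)) ->
  (forall z : J -> R, (forall i, \sum_j A p i j * z j = 0) -> forall j, z j = 0) ->
  exists Z : M -> J -> R, (forall j, smooth_at p (fun x => Z x j)) /\
    \forall x \near p, forall i, \sum_j A x i j * Z x j = b x i.
Proof.
move=> E sA sb inj.
pose f (l : 'I_#|J|) : I := enum_val (cast_ord (esym E) l).
pose f' (i : I) : 'I_#|J| := cast_ord E (enum_rank i).
have fK i : f (f' i) = i by rewrite /f /f' cast_ordK enum_rankK.
pose B x : 'M[R]_#|J| := \matrix_(k, l) A x (f l) (enum_val k).
have sB k l : smooth_at p (fun x => B x k l) by under eq_fun do rewrite mxE.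
have d0 : \det (B p) != 0.
  suff : B p \in unitmx by rewrite unitmxE unitfE.
  rewrite -row_free_unit.
  apply: inj_row_free => v vB; apply/rowP => k; rewrite mxE.
  have := inj (fun j => v 0 (enum_rank j)) => /(_ _ (enum_val k)); rewrite enum_valK; apply => i.
  have := congr1 (fun w : 'rV[R]_#|J| => w 0 (f' i)) vB; rewrite !mxE => e0; rewrite -[RHS]e0.
  rewrite (reindex (@enum_val J predT)) /=; last exact/onW_bij/enum_val_bij.
  by apply: eq_bigr => k' _; rewrite mxE fK enum_valK mulrC.
exists (fun x j => \sum_k b x (f k) * ((\det (B x))^-1 * (\adj (B x)) k (enum_rank j))); split.
  move=> j; apply: smooth_at_sum => k; apply: smooth_at_mul => //; apply: smooth_at_mul => //.
    by apply: smooth_at_inv => //; exact: smooth_at_det.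
  exact: smooth_at_adj.
have cd : {for p, continuous ((fun x => \det (B x)) : M -> R^o)}.
  by apply: smooth_at_cont => //; exact: smooth_at_det.
have : \forall x \near p, \det (B x) != 0.
  have := cd _ (open_nbhs_nbhs (conj (@open_neq R^o 0) d0)); exact.
apply: filterS => x dx i.
pose y : 'rV[R]_#|J| := \row_k b x (f k).
have : ((y *m ((\det (B x))^-1 *: \adj (B x))) *m B x) 0 (f' i) = y 0 (f' i).
  by rewrite -mulmxA -scalemxAl mul_adj_mx -scalemx1 scalerA mulVf // scale1r mulmx1.
rewrite [y _ _]mxE fK => <-; rewrite mxE (reindex (@enum_val J predT)) /=; last exact/onW_bij/enum_val_bij.
apply: eq_bigr => k _; rewrite [B x k _]mxE fK mulrC; congr (_ * _).
by rewrite mxE; apply: eq_bigr => l _; rewrite enum_valK !mxE.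
Qed.

(** S comes without a basis, so vectors are taken whose evaluation matrix has maximal rank. If this
    rank were less than r, some combination of the [f i] would vanish on all of them but not at some
    x of S, and x in place of a redundant vector would raise the rank. *)
Lemma dual_vectors (V : lmodType R) (S : set V) r (f : 'I_r -> V -> R) : Defs.subspace S ->
  (forall i, linear_on S (f i)) ->
  (forall a : 'I_r -> R, (forall v, S v -> \sum_i a i * f i v = 0) -> forall i, a i = 0) ->
  exists v : 'I_r -> V, (forall i, S (v i)) /\ forall i j, f i (v j) = (i == j)%:R.
Proof.
move=> sS lf ind.
pose F k (v : 'I_k -> V) : 'M[R]_(k, r) := \matrix_(a, i) f i (v a).
pose has k := `[< exists v : 'I_r -> V, (forall i, S (v i)) /\ \rank (F r v) = k >].
have h0 : exists k, has k.
  exists (\rank (F r (fun=> 0))); apply/asboolP; exists (fun=> 0); split => // _; by case: sS.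
have hb k : has k -> (k <= r)%N by move=> /asboolP [v [_ <-]]; exact: rank_leq_row.
case: (ex_maxnP h0 hb) => k /asboolP [v [Sv rv]] maxk.
case: (leqP r k) => rk.
  have fullF : row_full (F r v) by rewrite /row_full eqn_leq rank_leq_col rv rk.
  have uF : F r v \in unitmx by rewrite -row_full_unit.
  exists (fun j => \sum_a (invmx (F r v)) j a *: v a); split.
    by move=> j; have [] := linear_on_sum (index_enum _) (fun a => invmx (F r v) j a) (lf j) sS Sv.
  move=> i j; have [_ ->] := linear_on_sum (index_enum _) (fun a => invmx (F r v) j a) (lf i) sS Sv.
  have := congr1 (fun Y : 'M[R]_r => Y j i) (mulVmx uF); rewrite !mxE eq_sym => <-.
  by apply: eq_bigr => a _; rewrite mxE.
exfalso.
have [a Fa a0] : exists2 a : 'cV[R]_r, F r v *m a = 0 & a != 0.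
  have : kermx (F r v)^T != 0 by rewrite -mxrank_eq0 mxrank_ker mxrank_tr rv subn_eq0 -ltnNge.
  move=> /rowV0Pn [w wk w0]; exists w^T; last by rewrite -(inj_eq trmx_inj) trmxK trmx0.
  by apply: trmx_inj; rewrite trmx_mul trmxK trmx0; apply/eqP; rewrite -sub_kermx.
have [x Sx fx] : exists2 x, S x & \sum_i a i 0 * f i x != 0.
  apply/not_exists2P => h; move/eqP: a0; apply; apply/colP => i; rewrite [RHS]mxE.
  apply: (ind (fun i => a i 0)) => y Sy; apply/eqP; have [//|/negP] := h y; by rewrite negbK.
have [w [Sw ew]] : exists w : 'I_r -> V, (forall i, S (w i)) /\ (k.+1 <= \rank (F r w))%N.
  have rk' : (\rank (F r v) < r)%N by rewrite rv.
  have : ~~ row_free (F r v) by rewrite /row_free neq_ltn rk'.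
  move=> nf; have [i0 si0] : exists i0, (F r v <= row' i0 (F r v))%MS.
    have : kermx (F r v) != 0 by rewrite kermx_eq0.
    move=> /rowV0Pn [z zk z0].
    have [i0 zi0] : exists i0, z 0 i0 != 0.
      apply/existsP; apply: contraNT z0; rewrite negb_exists => /forallP h.
      by apply/eqP/rowP => i; rewrite mxE; apply/eqP; have := h i; rewrite negbK.
    exists i0; have rowsub j : (row j (row' i0 (F r v)) <= row' i0 (F r v))%MS by exact: row_sub.
    have rl j : j != i0 -> (row j (F r v) <= row' i0 (F r v))%MS.
      rewrite eq_sym => /unlift_some [j' -> _]; rewrite (_ : row _ _ = row j' (row' i0 (F r v))) //.
      by apply/rowP => l; rewrite !mxE.
    have zF : z *m F r v = 0 by apply/eqP; rewrite -sub_kermx.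
    apply/row_subP => j; case: (eqVneq j i0) => [->|]; last exact: rl.
    have E : row i0 (F r v) = \sum_(j | j != i0) (- (z 0 i0)^-1 * z 0 j) *: row j (F r v).
      apply/rowP => l; have := congr1 (fun y : 'rV[R]_r => y 0 l) zF; rewrite !mxE (bigD1 i0) //= => e0.
      have eF b : F r v b l = f l (v b) by rewrite mxE.
      move: e0; under eq_bigr do rewrite eF; rewrite eF => /eqP; rewrite addr_eq0 => /eqP e1.
      have -> : f l (v i0) = - (z 0 i0)^-1 * \sum_(j0 < r | j0 != i0) z 0 j0 * f l (v j0).
        by rewrite mulNr -mulrN -e1 mulKf.
      rewrite summxE mulr_sumr; apply: eq_bigr => j' _; by rewrite !mxE mulrA.
    by rewrite E; apply: summx_sub => j' nj'; apply: scalemx_sub; exact: rl.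
  exists (fun i => if i == i0 then x else v i); split; first by move=> i; case: ifP.
  set w := fun i => _.
  have s1 : (row' i0 (F r v) <= F r w)%MS.
    apply/row_subP => j; have -> : row j (row' i0 (F r v)) = row (lift i0 j) (F r w).
      by apply/rowP => l; rewrite !mxE /w eq_sym (negbTE (neq_lift _ _)).
    exact: row_sub.
  have s2 : (F r v <= F r w)%MS by exact: submx_trans s1.
  rewrite -rv; apply: rank_ltmx; rewrite /ltmx s2 /=.
  apply/negP => s3; have : (row i0 (F r w) <= F r v)%MS by apply: submx_trans s3; exact: row_sub.
  move=> /submxP [D ED]; move/eqP: fx; apply.
  have := congr1 (fun Y => (Y *m a) 0 0) ED; rewrite -mulmxA Fa mulmx0 [RHS]mxE mxE => e0; rewrite -[RHS]e0.
  by apply: eq_bigr => i _; rewrite !mxE /w eqxx mulrC.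
have := maxk (\rank (F r w)); rewrite leqNgt ew => /(_ _)/negP; apply => //.
by apply/asboolP; exists w.
Qed.

End SmoothAlgebra.

Lemma frame_at (R : realType) (M : mfd R) (p : M) : mfd_ok M ->
  exists (q : 'I_(mdim M) -> M -> R) (D : 'I_(mdim M) -> M -> tvec M),
  [/\ forall i, smooth_fun (q i), forall i, is_vfield (D i) &
   \forall x \near p, (forall v, tangent x v -> v = \sum_i v (q i) *: D i x) /\
      forall i j, D i x (q j) = (i == j)%:R].
Proof.
move=> okM; have [_ _ _ /(_ p) [c ac cp]] := okM.
have [q [D [W [[oW Wp Wc] sq vD Wq [fr dl _]]]]] := local_frame okM ac cp.
exists q, D; split => //.
apply: filterS (open_nbhs_nbhs (conj oW Wp)) => x Wx; split; last by move=> i j; exact: dl.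
move=> v tv; apply: (tan_eq tv).
  by apply: tan_sumc => i; apply: tanZ; exact: vf_tan.
by move=> f sf; rewrite (fr _ _ _ Wx tv sf) tvec_sumE.
Qed.

Section FormComb.
Variables (R : realType) (M : mfd R).
Hypothesis okM : mfd_ok M.

Lemma form1_linc (a : M -> R) (w w' : form1 M) : smooth_fun a -> is_form1 w -> is_form1 w' ->
  is_form1 (fun x => a x *: w x + w' x).
Proof.
move=> sa [c s] [c' s']; split.
  move=> x; have [l z] := c x; have [l' z'] := c' x; split.
    move=> k u v tu tv.
    change (a x * w x (k *: u + v) + w' x (k *: u + v) = k * (a x * w x u + w' x u) + (a x * w x v + w' x v)).
    by rewrite l // l' //; ring.
  by move=> v nv; change (a x * w x v + w' x v = 0); rewrite z // z' // mulr0 addr0.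
move=> X vX; apply: (smooth_add okM); last exact: s'.
by apply: (smooth_mul okM) => //; exact: s.
Qed.

Lemma form1_0 : is_form1 (fun _ : M => 0 : fnl (tvec M)).
Proof. by split => [x|X vX]; [exact: cot0 | exact: smooth_cst]. Qed.

Lemma differential_form (f : M -> R) : smooth_fun f -> is_form1 (fun x => differential x f).
Proof.
move=> sf; split.
  move=> x; split; last by move=> v nv; rewrite /differential /restr asboolF.
  by move=> k u v tu tv; rewrite /differential /restr !asboolT //; exact: tan_linc.
move=> X vX; rewrite (_ : ev1 _ X = (fun x => X x f)); first exact: vf_smooth.
by apply/funext => x; rewrite /ev1 /differential /restr asboolT //; exact: vf_tan.
Qed.

Lemma differentialE (f : M -> R) x v : tangent x v -> differential x f v = v f.
Proof. by move=> tv; rewrite /differential /restr asboolT. Qed.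

End FormComb.

(** * Dual local frames of the complement and of the algebroid *)

Section Frames.
Variables (R : realType) (K : lie_group_data R) (Omega : form2 (prod_mfd K K)) (Theta : form3 K).
Variables (G : groupoid_data R) (Phi : arr G -> K) (sigma : form2 (arr G)) (eta : form3 (obj G)).
Hypothesis SS : shifted_symplectic Omega Theta.
Hypothesis LM : lagrangian_morphism Omega Theta Phi sigma eta.
Local Notation e := (lone K).
Local Notation H := (arr G).
Local Notation N := (obj G).
Local Notation s := (@src R G).
Local Notation t := (@tgt R G).
Local Notation unit := (@unt R G).
Local Notation tge := (@tangent R K e).
Local Notation embs := (emb Phi sigma).
Local Notation EP := (@Epair R K Omega G).
Local Notation kp := (kpair Omega).
Implicit Types (g h : H) (x : N).

Let GD : is_lie_groupoid G := lm_groupoid LM.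
Let LG : is_lie_group K := ss_group SS.
Let okK : mfd_ok K := ss_ok SS.
Let okH : mfd_ok H := gd_okH GD.
Let okN : mfd_ok N := gd_okN GD.
Let sms := gd_sm_s GD. Let smt := gd_sm_t GD. Let smu := gd_sm_u GD.
Let smP := lm_sm_Phi SS LM.
Let t0 (M : mfd R) (p : M) : @tangent R M p 0 := tan0 p.

(** The coordinates [kap] turn smoothness of a map into the Lie algebra, which is tested on
    functions on K, into smoothness of finitely many coefficients. *)
Lemma lie_basis : exists (kap : 'I_(mdim K) -> K -> R) (W : 'I_(mdim K) -> tvec K),
  [/\ forall i, smooth_fun (kap i), forall i, tge (W i), forall i j, W i (kap j) = (i == j)%:R &
   forall w, tge w -> w = \sum_i w (kap i) *: W i].
Proof.
have [q [D [sq vD /nbhs_singleton [ex dl]]]] := frame_at e okK.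
by exists q, (fun i => D i e); split => // i; exact: vf_tan.
Qed.

Lemma kp_linr w : tge w -> linear_on tge (fun u => kp w u).
Proof.
move=> tw a u v tu tv; rewrite (kpairC SS tw (tan_linc a tu tv)) (kpair_lin SS tw a tu tv).
by rewrite (kpairC SS tu tw) (kpairC SS tv tw).
Qed.

Lemma sum_on (V : lmodType R) (S : set V) (f : V -> R) (I : finType) (c : I -> R) (v : I -> V) :
  linear_on S f -> Defs.subspace S -> (forall i, S (v i)) -> f (\sum_i c i *: v i) = \sum_i c i * f (v i).
Proof. by move=> lf sS Sv; have [_] := linear_on_sum (index_enum I) c lf sS Sv. Qed.

Lemma sum_in (V : lmodType R) (S : set V) (I : finType) (c : I -> R) (v : I -> V) :
  Defs.subspace S -> (forall i, S (v i)) -> S (\sum_i c i *: v i).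
Proof.
move=> sS Sv; have l0 : linear_on S (fun=> 0) by move=> a u w _ _; rewrite mulr0 addr0.
by have [] := linear_on_sum (index_enum I) c l0 sS Sv.
Qed.

Lemma kp_expand kap (W : 'I_(mdim K) -> tvec K) w w' :
  (forall i, tge (W i)) -> (forall w, tge w -> w = \sum_i w (kap i) *: W i) -> tge w -> tge w' ->
  kp w w' = \sum_i \sum_j w (kap i) * w' (kap j) * kp (W i) (W j).
Proof.
move=> tW ex tw tw'; rewrite {1}(ex _ tw) (sum_on _ (kpair_lin SS tw') (tangent_subspace e) tW).
apply: eq_bigr => i _; rewrite {1}(ex _ tw') (sum_on _ (kp_linr (tW i)) (tangent_subspace e) tW) mulr_sumr.
by apply: eq_bigr => j _; rewrite mulrA.
Qed.

Definition ksm (M : mfd R) (w : M -> tvec K) : Prop :=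
  (forall z, tge (w z)) /\ forall f, smooth_fun f -> smooth_fun (fun z => w z f).

Lemma kp_smooth (M : mfd R) (w w' : M -> tvec K) : mfd_ok M -> ksm w -> ksm w' -> smooth_fun (fun z => kp (w z) (w' z)).
Proof.
move=> okM [tw sw] [tw' sw']; have [kap [W [sk tW dl ex]]] := lie_basis.
rewrite (_ : (fun z => _) = (fun z => \sum_i \sum_j w z (kap i) * w' z (kap j) * kp (W i) (W j))); last first.
  by apply/funext => z; exact: kp_expand.
apply: (smooth_sum okM) => i; apply: (smooth_sum okM) => j; apply: (smooth_mul okM); last exact: smooth_cst.
by apply: (smooth_mul okM); [exact: sw | exact: sw'].
Qed.

Lemma Efib_subspace x : Defs.subspace (@Efib R K G x).
Proof. by split; [exact: Efib0 | move=> a u v; exact: Efib_lin]. Qed.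
Lemma algd_subspace x : Defs.subspace (algd (G := G) x).
Proof. by split; [exact: algd0 | move=> a u v; exact: algd_linc]. Qed.

Lemma Esec_lin (a : N -> R) (e1 e2 : N -> Evec K G) : smooth_fun a -> is_Esection e1 -> is_Esection e2 ->
  is_Esection (fun x => a x *: e1 x + e2 x).
Proof.
move=> sa [E1 v1 f1 w1] [E2 v2 f2 w2]; split.
- by move=> x; exact: Efib_lin.
- rewrite (_ : (fun x => _) = (fun x => a x *: (e1 x).1.1 + (e2 x).1.1)); last by apply/funext => x; rewrite EvE1.
  by apply: vf_add => //; exact: vf_scale.
- rewrite (_ : (fun x => _) = (fun x => a x *: (e1 x).1.2 + (e2 x).1.2)); first exact: form1_linc.
  by apply/funext => x; apply/funext => v; rewrite EvE2.
move=> f sf; rewrite (_ : (fun x => _) = (fun x => a x * (e1 x).2 f + (e2 x).2 f)).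
  by apply: (smooth_add okN); [apply: (smooth_mul okN) => //; exact: w1 | exact: w2].
by apply/funext => x; rewrite EvE3 tvecE.
Qed.

Lemma Esec0 : is_Esection (fun _ : N => 0 : Evec K G).
Proof.
split; [by move=> x; exact: Efib0 | exact: vf_zero | exact: form1_0 | by move=> f sf; exact: smooth_cst].
Qed.

Lemma Esec_sum (I : finType) (a : I -> N -> R) (c : I -> N -> Evec K G) :
  (forall i, smooth_fun (a i)) -> (forall i, is_Esection (c i)) -> is_Esection (fun x => \sum_i a i x *: c i x).
Proof.
move=> sa sc; elim: (index_enum I) => [|i r IH].
  by under eq_fun do rewrite big_nil; exact: Esec0.
by under eq_fun do rewrite big_cons; exact: Esec_lin.
Qed.

Lemma Esec_ksm c : is_Esection c -> ksm (fun x : N => (c x : Evec K G).2).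
Proof. by move=> [E _ _ w]; split => // x; have [_ _ ?] := E x. Qed.

Lemma EP_smooth e1 e2 : is_Esection e1 -> is_Esection e2 -> smooth_fun (fun x => EP (e1 x) (e2 x)).
Proof.
move=> S1 S2; have [_ v1 f1 _] := S1; have [_ v2 f2 _] := S2.
apply: (smooth_add okN); last by apply: kp_smooth => //; exact: Esec_ksm.
by apply: (smooth_add okN); [exact: (ev1_smooth f1 v2) | exact: (ev1_smooth f2 v1)].
Qed.

Lemma emb_Esection (u : N -> tvec H) : is_section u -> is_Esection (fun x => embs x (u x)).
Proof.
move=> [au su]; split.
- by move=> x; exact: (emb_fib SS LM).
- split; first by move=> x /=; exact: (algd_Tt LM).
  move=> f sf; rewrite (_ : (fun x => _) = (fun x => u x (f \o t))); last by apply/funext => x /=; rewrite tmapE.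
  by apply: su; have [_ h] := smt; exact: h.
- split; first by move=> x /=; exact: (lam_cot LM).
  move=> X vX; rewrite (_ : ev1 _ X = (fun x => sigma (unit x) (u x) (tmap unit (X x)))); last first.
    by apply/funext => x; rewrite /ev1 /= lamE //; exact: vf_tan.
  apply: (form2_along okN okH smu (lm_sigma LM)).
    by split; [move=> x; have [] := au x | exact: su].
  split; first by move=> x; apply: (tan_unit GD); exact: vf_tan.
  move=> f sf; rewrite (_ : (fun x => _) = (fun x => X x (f \o unit))); last by apply/funext => x; rewrite tmapE.
  by apply: vf_smooth => //; have [_ h] := smu; exact: h.
move=> f sf; rewrite (_ : (fun x => _) = (fun x => u x (f \o Phi))); last by apply/funext => x /=; rewrite tmapE.
by apply: su; have [_ h] := smP; exact: h.
Qed.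

Lemma section_sum (I : finType) (a : I -> N -> R) (u : I -> N -> tvec H) :
  (forall i, smooth_fun (a i)) -> (forall i, is_section (u i)) -> is_section (fun x => \sum_i a i x *: u i x).
Proof.
move=> sa su; split; first by move=> x; apply: (sum_in _ (algd_subspace x)) => i; have [+ _] := su i; exact.
move=> f sf; rewrite (_ : (fun x => _) = (fun x => \sum_i a i x * u i x f)).
  by apply: (smooth_sum okN) => i; apply: (smooth_mul okN) => //; have [_ h] := su i; exact: h.
by apply/funext => x; rewrite tvec_sumE.
Qed.

(** v is extended with constant coefficients in a frame near the unit, restricted to the units, and
    projected to the kernel of Ts by subtracting T1(Ts X). *)
Lemma section_through x0 v : algd x0 v -> exists u : N -> tvec H, is_section u /\ u x0 = v.
Proof.
move=> [tv sv]; have [q [D [sq vD /nbhs_singleton [ex dl]]]] := frame_at (unit x0) okH.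
pose X h := \sum_i v (q i) *: D i h.
have vX : is_vfield X by apply: (vf_sum okH) => i; apply: (vf_scale okH (a := fun=> v (q i))) => //; exact: smooth_cst.
have tX x : tangent (unit x) (X (unit x)) by exact: vf_tan.
have tsX x : tangent x (tmap s (X (unit x))) by rewrite -[x in tangent x](gd_src_unt GD); exact: (tan_Ts LM).
exists (fun x => X (unit x) - tmap unit (tmap s (X (unit x)))); split; last first.
  have -> : X (unit x0) = v by rewrite [RHS]ex.
  by rewrite sv tmap0 subr0.
split.
  move=> x; split; first by apply: tanB => //; exact: (tan_unit GD).
  rewrite tmapB [X in _ - X](_ : _ = tmap s (X (unit x))) ?subrr //.
  rewrite (tmap_comp_tangent (k := fun x => x) _ sms); last by exact: gd_src_unt.
  by rewrite (tmap_id (tsX x)).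
move=> f sf; have [_ hu] := smu; have [_ hs] := sms.
rewrite (_ : (fun x => _) = (fun x => X (unit x) f - X (unit x) (f \o unit \o s))).
  apply: (smooth_sub okN).
    by apply: (hu (fun h => X h f)); exact: vf_smooth.
  apply: (hu (fun h => X h (f \o unit \o s))); apply: vf_smooth => //.
  by apply: hs; exact: hu.
by apply/funext => x; rewrite tvecB !tmapE //; exact: hu.
Qed.

Section Complement.
Variable C : N -> set (Evec K G).
Hypothesis IC : isotropic_complement Omega Phi sigma C.

(* At x, (c i) is a basis of the complement and (u i) is the basis of the algebroid dual to it. *)
Definition cpoint r (c : 'I_r -> N -> Evec K G) (u : 'I_r -> N -> tvec H) x : Prop :=
  [/\ forall i, C x (c i x), forall i j, EP (c i x) (embs x (u j x)) = (i == j)%:R,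
   forall e1, C x e1 -> e1 = \sum_j EP e1 (embs x (u j x)) *: c j x &
   forall v, algd x v -> v = \sum_j EP (c j x) (embs x v) *: u j x].

(** The sections are global but form dual frames only near x0. The rank equation says that C has
    half the rank of E; it makes the system of [relR_solve] square. *)
Definition cframe x0 r (c : 'I_r -> N -> Evec K G) (u : 'I_r -> N -> tvec H) : Prop :=
  [/\ forall i, is_Esection (c i), forall i, is_section (u i), (2 * r = 2 * mdim N + mdim K)%N &
   \forall x \near x0, cpoint c u x].

Lemma algd_emb0 x v : algd x v -> (forall c, C x c -> EP c (embs x v) = 0) -> v = 0.
Proof.
move=> av h; apply: (emb_inj SS LM av); apply: (EP_nondeg SS (emb_fib SS LM av)) => e2 E2.
have [_ sp _ _] := IC; have [u au Cu] := sp _ _ E2.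
have Fu := emb_fib SS LM au; have Fv := emb_fib SS LM av.
have := EP_linr SS Fv 1 Fu (C_fib IC Cu); rewrite scale1r addrC subrK => ->.
by rewrite (emb_isotropic SS LM av au) mulr0 add0r (EPC SS Fv (C_fib IC Cu)) h.
Qed.

(** C is maximal isotropic: the algebroid part v of e1 is orthogonal to C as well as to the
    algebroid, so it vanishes. *)
Lemma cpoint_C r (c : 'I_r -> N -> Evec K G) u x e1 : cpoint c u x -> Efib x e1 ->
  (forall j, EP e1 (c j x) = 0) -> C x e1.
Proof.
move=> [Cc dl exC exA] E1 h; have [_ sp _ iso] := IC; have [v av Cv] := sp _ _ E1.
suff v0 : v = 0.
  move: Cv; rewrite v0 (_ : embs x 0 = 0) ?subr0 //.
  have := emb_lin LM (-1) (algd0 x) (algd0 x); rewrite scaler0 addr0 => ->.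
  by rewrite scaleN1r addNr.
apply: (algd_emb0 av) => c' Cc'; have Fv := emb_fib SS LM av.
rewrite (exC _ Cc') (sum_on _ (EP_lin SS Fv) (Efib_subspace x)); last by move=> i; exact: (C_fib IC (Cc i)).
rewrite big1 // => j _; rewrite [EP (c j x) _](_ : _ = 0) ?mulr0 //.
have Fc := C_fib IC (Cc j).
have := EP_linr SS Fc (-1) (C_fib IC Cv) E1; rewrite scaleN1r opprB subrK => ->.
by rewrite (iso _ _ _ (Cc j) Cv) mulr0 add0r (EPC SS Fc E1).
Qed.

(** Dual vectors exist at x0 by [dual_vectors]; they are extended by [section_through] and corrected
    near x0 by the inverse of their matrix of pairings with c. The rank of C is found by comparing
    the frame (c, u) of E at x0 with a coordinate basis, in both directions by [inj_card]. *)
Lemma dual_frame x0 : exists r c u, @cframe x0 r c u.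
Proof.
have [[sub fr] sp dir iso] := IC.
have [r [c [U [sc nU hU]]]] := fr x0.
have Cc x : U x -> forall i, C x (c i x).
  move=> Ux i; apply/(hU x Ux).1; exists (fun j => (j == i)%:R).
  rewrite (bigD1 i) //= eqxx scale1r big1 ?addr0 // => j nj.
  by rewrite (negbTE nj) scale0r.
have Fc x i : Efib x (c i x) by have [h _ _ _] := sc i.
have Ux0 : U x0 := nbhs_singleton nU.
have [v [av dv]] : exists v : 'I_r -> tvec H, (forall i, algd x0 (v i)) /\
    forall i j, EP (c i x0) (embs x0 (v j)) = (i == j)%:R.
  apply: (dual_vectors (S := algd x0) (f := fun i u => EP (c i x0) (embs x0 u))).
  - exact: algd_subspace.
  - move=> i a u w au aw; rewrite (emb_lin LM a au aw) (EP_linr SS (Fc x0 i)) //; exact: (emb_fib SS LM).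
  move=> a ha; have [_ ind] := hU x0 Ux0; apply: ind; apply: (C_ortho SS LM IC (x := x0)).
    by apply: (sum_in _ (C_sub IC x0)) => i; exact: Cc.
  move=> u au; rewrite (sum_on _ (EP_lin SS (emb_fib SS LM au)) (Efib_subspace x0)); last by move=> i; exact: Fc.
  exact: ha.
have [w hw] := choice (fun i => section_through (av i)).
pose Mx x i k := EP (c i x) (embs x (w k x)).
have sM i k : smooth_fun (fun x => Mx x i k).
  by apply: EP_smooth => //; apply: emb_Esection; have [] := hw k.
have M0 i k : Mx x0 i k = (i == k)%:R by rewrite /Mx; have [_ ->] := hw k.
(* The matrix of pairings is the identity at x0, so near x0 it has a smooth inverse, whose column j
   gives the dual section j. *)
have solv j : exists g : 'I_r -> N -> R, (forall k, smooth_fun (g k)) /\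
    \forall x \near x0, forall i, \sum_k Mx x i k * g k x = (i == j)%:R.
  have [||||Z [sZ nZ]] := @smooth_solve R N okN 'I_r 'I_r Mx (fun _ i => (i == j)%:R) x0 => //.
  - by move=> i k; exact: smooth_fun_at.
  - by move=> i; exact: smooth_at_cst.
  - move=> z hz k; have := hz k; rewrite (bigD1 k) //= M0 eqxx mul1r big1 ?addr0 // => l nl.
    by rewrite M0 eq_sym (negbTE nl) mul0r.
  have [g hg] := choice (fun k => smooth_at_global okN (sZ k)).
  exists g; split; first by move=> k; have [] := hg k.
  have : \forall x \near x0, forall k, Z x k = g k x by apply: near_bigand => k; have [] := hg k.
  move=> ng; apply: filterS2 nZ ng => x h1 h2 i; rewrite -h1.
  by apply: eq_bigr => k _; rewrite h2.
have [g hg] := choice solv.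
pose u j x := \sum_k g j k x *: w k x.
have su j : is_section (u j) by apply: section_sum => k; [have [+ _] := hg j; exact | have [] := hw k].
have ndl : \forall x \near x0, forall j i, EP (c i x) (embs x (u j x)) = (i == j)%:R.
  have : \forall x \near x0, forall j i, \sum_k Mx x i k * g j k x = (i == j)%:R.
    by apply: near_bigand => j; have [] := hg j.
  apply: filterS => x h j i; rewrite -h /u.
  have lin : linear_on (algd x) (fun v => EP (c i x) (embs x v)).
    by move=> a u1 u2 a1 a2; rewrite (emb_lin LM a a1 a2) (EP_linr SS (Fc x i)) //; exact: (emb_fib SS LM).
  rewrite (sum_on _ lin (algd_subspace x)); last by move=> k; have [[+ _] _] := hw k; exact.
  by apply: eq_bigr => k _; rewrite mulrC.
have np : \forall x \near x0, cpoint c u x.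
  apply: filterS2 nU ndl => x Ux dl.
  have au j : algd x (u j x) by have [+ _] := su j; exact.
  have exC e1 : C x e1 -> e1 = \sum_j EP e1 (embs x (u j x)) *: c j x.
    move=> Ce; have [h1 _] := hU x Ux; have [a ->] := (h1 e1).1 Ce.
    apply: eq_bigr => i _; congr (_ *: _).
    rewrite (sum_on _ (EP_lin SS (emb_fib SS LM (au i))) (Efib_subspace x)); last by move=> k; exact: Fc.
    rewrite (bigD1 i) //= dl eqxx mulr1 big1 ?addr0 // => k nk.
    by rewrite dl (negbTE nk) mulr0.
  split => //; first exact: Cc.
  move=> z az; apply/eqP; rewrite -subr_eq0; apply/eqP.
  have az' : algd x (\sum_j EP (c j x) (embs x z) *: u j x) by exact: (sum_in _ (algd_subspace x)).
  have ad : algd x (z - \sum_j EP (c j x) (embs x z) *: u j x).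
    by rewrite -scaleN1r addrC; exact: algd_linc.
  apply: (algd_emb0 ad) => c' Cc'.
  have lin i : linear_on (algd x) (fun v => EP (c i x) (embs x v)).
    by move=> a u1 u2 a1 a2; rewrite (emb_lin LM a a1 a2) (EP_linr SS (Fc x i)) //; exact: (emb_fib SS LM).
  rewrite (exC _ Cc') (sum_on _ (EP_lin SS (emb_fib SS LM ad)) (Efib_subspace x)); last by move=> k; exact: Fc.
  rewrite big1 // => i _; rewrite [X in _ * X](_ : _ = 0) ?mulr0 //.
  have := lin i (-1) _ _ az' az; rewrite scaleN1r addrC => ->.
  rewrite (sum_on _ (lin i) (algd_subspace x)) // (bigD1 i) //= dl eqxx mulr1 big1; last first.
    by move=> k nk; rewrite dl eq_sym (negbTE nk) mulr0.
  by rewrite addr0 mulN1r addNr.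
exists r, c, u; split => //.
have [Cx0 dl exC exA] := nbhs_singleton np.
have au j : algd x0 (u j x0) by have [+ _] := su j; exact.
have Fu j := emb_fib SS LM (au j).
have [q [D [sq vD /nbhs_singleton [exD dD]]]] := frame_at x0 okN.
have [kap [W [sk tW dW exW]]] := lie_basis.
have tD i : tangent x0 (D i x0) by exact: vf_tan.
have cq i : cotangent x0 (differential x0 (q i)) by have [+ _] := differential_form (sq i); exact.
(* Index set of a coordinate basis B of the fibre of E, with dual functionals T. *)
pose J := ('I_(mdim N) + ('I_(mdim N) + 'I_(mdim K)))%type.
pose B (j : J) : Evec K G := match j with
  | inl i => (D i x0, 0, 0) | inr (inl i) => (0, differential x0 (q i), 0) | inr (inr k) => (0, 0, W k) end.
have FB j : Efib x0 (B j).
  by case: j => [i|[i|k]]; split; rewrite /B; simpl; [exact: tD | exact (cot0 x0) | exact (t0 e) | exact (t0 x0) | exact: cq | exact (t0 e) | exact (t0 x0) | exact (cot0 x0) | exact: tW].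
pose P (j : 'I_r + 'I_r) : Evec K G := match j with inl i => c i x0 | inr i => embs x0 (u i x0) end.
have FP j : Efib x0 (P j) by case: j => i; [exact: Fc | exact: Fu].
pose T (j : J) (e1 : Evec K G) : R := match j with
  | inl i => e1.1.1 (q i) | inr (inl i) => e1.1.2 (D i x0) | inr (inr k) => e1.2 (kap k) end.
have lT j : linear_on (@Efib R K G x0) (T j).
  move=> a e1 e2 [_ [l1 _] _] [_ [l2 _] _]; case: j => [i|[i|k]]; rewrite /T.
  - by rewrite EvE1 tvecE.
  - by rewrite EvE2.
  - by rewrite EvE3 tvecE.
have T0 e1 : Efib x0 e1 -> (forall j, T j e1 = 0) -> e1 = 0.
  case: e1 => [[X al] om'] [/= tX [la za] lw] h.
  have -> : X = 0 by rewrite (exD _ tX) big1 // => i _; have /= -> := h (inl i); rewrite scale0r.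
  have -> : om' = 0 by rewrite (exW _ lw) big1 // => i _; have /= -> := h (inr (inr i)); rewrite scale0r.
  have -> // : al = 0.
  apply/funext => Y; case: (pselect (tangent x0 Y)) => tY; last by rewrite za.
  rewrite (exD _ tY) (sum_on _ la (tangent_subspace x0) tD) big1 // => i _.
  by have /= -> := h (inr (inl i)); rewrite mulr0.
have TB i j : T i (B j) = (i == j)%:R.
  have e0 (M : mfd R) (f : M -> R) : (0 : tvec M) f = 0 by [].
  case: i => [i|[i|i]]; case: j => [j|[j|j]] //=; rewrite ?differentialE ?dD ?dW //;
    by rewrite ?(inj_eq inr_inj) ?(inj_eq inl_inj) eq_sym.
have bracket_pair i j : EP (P i) (P j) = (match i, j with inl a, inr b => a == b | inr a, inl b => a == b | _, _ => false end)%:R.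
  case: i => i; case: j => j /=.
  - by apply: iso; exact: Cx0.
  - exact: dl.
  - by rewrite (EPC SS (Fu i) (Fc x0 j)) dl eq_sym.
  - by rewrite (emb_isotropic SS LM).
have c1 : (#|{: 'I_r + 'I_r}| <= #|{: J}|)%N.
  apply: (@inj_card R J ('I_r + 'I_r)%type (fun i j => T i (P j))) => z hz.
  have z0 : \sum_j z j *: P j = 0.
    apply: T0; first exact: (sum_in _ (Efib_subspace x0)).
    move=> j; rewrite (sum_on _ (lT j) (Efib_subspace x0)) //.
    by rewrite -[RHS](hz j); apply: eq_bigr => k _; rewrite mulrC.
  have zp k : \sum_j z j * EP (P j) (P k) = 0.
    rewrite -(sum_on _ (EP_lin SS (FP k)) (Efib_subspace x0)) // z0.
    exact: (EP0l SS (FP k)).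
  move=> j; pose k : 'I_r + 'I_r := match j with inl i => inr i | inr i => inl i end.
  rewrite -[RHS](zp k) (bigD1 j) //= bracket_pair big1 ?addr0.
    by rewrite /k; case: (j) => i; rewrite eqxx mulr1.
  move=> j' nj; rewrite bracket_pair /k; case: (j) nj => i; case: j' => i' //=; rewrite ?mulr0 //.
    by rewrite (inj_eq inl_inj) => /negbTE ->; rewrite mulr0.
  by rewrite (inj_eq inr_inj) => /negbTE ->; rewrite mulr0.
have c2 : (#|{: J}| <= #|{: 'I_r + 'I_r}|)%N.
  apply: (@inj_card R ('I_r + 'I_r)%type J (fun i j => EP (P i) (B j))) => z hz.
  have Fz : Efib x0 (\sum_j z j *: B j) by exact: (sum_in _ (Efib_subspace x0)).
  have z0 : \sum_j z j *: B j = 0.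
    apply: (EP_nondeg SS Fz) => e2 E2.
    have zP i : EP (\sum_j z j *: B j) (P i) = 0.
      rewrite (EPC SS Fz (FP i)) (sum_on _ (EP_linr SS (FP i)) (Efib_subspace x0)) //.
      by rewrite -[RHS](hz i); apply: eq_bigr => k _; rewrite mulrC.
    have [v' av' Cv'] := sp _ _ E2.
    have := EP_linr SS Fz 1 (emb_fib SS LM av') (C_fib IC Cv'); rewrite scale1r addrC subrK => ->.
    rewrite mul1r {1}(exC _ Cv') (sum_on _ (EP_linr SS Fz) (Efib_subspace x0)); last by move=> i; exact: Fc.
    rewrite [X in _ + X]big1 ?addr0; last by move=> i _; have /= -> := zP (inl i); rewrite mulr0.
    have lin : linear_on (algd x0) (fun v => EP (\sum_j z j *: B j) (embs x0 v)).
      by move=> a u1 u2 a1 a2; rewrite (emb_lin LM a a1 a2) (EP_linr SS Fz) //; exact: (emb_fib SS LM).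
    rewrite {1}(exA _ av') (sum_on _ lin (algd_subspace x0)) // big1 // => i _.
    by have /= -> := zP (inr i); rewrite mulr0.
  move=> j; have [F0 _] := Efib_subspace x0; have := linear_on0 (lT j) F0; rewrite -[X in T j X]z0 (sum_on _ (lT j) (Efib_subspace x0)) // => <-.
  rewrite (bigD1 j) //= TB eqxx mulr1 big1 ?addr0 // => k nk.
  by rewrite TB eq_sym (negbTE nk) mulr0.
move: c1 c2; rewrite !card_sum !card_ord; lia.
Qed.

End Complement.
End Frames.

(** * The square linear system for the relation R *)

Section Solve.
Variables (R : realType) (K : lie_group_data R) (Omega : form2 (prod_mfd K K)) (Theta : form3 K).
Variables (G : groupoid_data R) (Phi : arr G -> K) (sigma : form2 (arr G)) (eta : form3 (obj G)).
Hypothesis SS : shifted_symplectic Omega Theta.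
Hypothesis LM : lagrangian_morphism Omega Theta Phi sigma eta.
Local Notation "x ** y" := (lmul x y) (at level 40, left associativity).
Local Notation e := (lone K).
Local Notation H := (arr G).
Local Notation N := (obj G).
Local Notation s := (@src R G).
Local Notation t := (@tgt R G).
Local Notation RR k := (tmap (fun x : K => x ** k)).
Local Notation LL k := (tmap (fun x : K => k ** x)).
Local Notation tge := (@tangent R K e).
Local Notation mu := (muf Omega).
Local Notation nu := (nuf Omega).
Local Notation TP := (tmap Phi).
Local Notation EP := (@Epair R K Omega G).
Local Notation relR'' := (@relR' R K Omega G Phi sigma).
Implicit Types (h : H).

Let GD : is_lie_groupoid G := lm_groupoid LM.
Let LG : is_lie_group K := ss_group SS.
Let okK : mfd_ok K := ss_ok SS.
Let okH : mfd_ok H := gd_okH GD.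
Let okN : mfd_ok N := gd_okN GD.
Let sms := gd_sm_s GD. Let smt := gd_sm_t GD. Let smu := gd_sm_u GD.
Let smP := lm_sm_Phi SS LM.
Let t0 (M : mfd R) (p : M) : @tangent R M p 0 := tan0 p.

(** The covector that R attaches to (U, e1, e2), so that only these three are unknowns of the
    system. *)
Definition bform h (U : tvec H) (e1 e2 : Evec K G) : fnl (tvec H) :=
  restr (tangent h) (fun V => e1.1.2 (tmap t V) - e2.1.2 (tmap s V)
      + (mu e1.2 (Phi h) (TP V) + nu e2.2 (Phi h) (TP V)) - sigma h U V).
(** The conditions of R that the choice of unknowns satisfies by itself; the condition on T Phi(U)
    remains as a set of equations. *)
Definition anchored h (U : tvec H) (e1 e2 : Evec K G) : Prop :=
  [/\ tangent h U, Efib (t h) e1, Efib (s h) e2, e1.1.1 = tmap t U & e2.1.1 = tmap s U].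

Lemma anchored_lin h a U e1 e2 U' e1' e2' : anchored h U e1 e2 -> anchored h U' e1' e2' ->
  anchored h (a *: U + U') (a *: e1 + e1') (a *: e2 + e2').
Proof.
move=> [g1 g2 g3 g4 g5] [k1 k2 k3 k4 k5]; split.
- exact: tan_linc.
- exact: Efib_lin.
- exact: Efib_lin.
- by rewrite EvE1 tmap_lin g4 k4.
by rewrite EvE1 tmap_lin g5 k5.
Qed.

Lemma anchored0 h : anchored h 0 0 0.
Proof. by split; rewrite ?tmap0 //; exact: Efib0. Qed.

Lemma bformE h U e1 e2 V : tangent h V -> bform h U e1 e2 V = e1.1.2 (tmap t V) - e2.1.2 (tmap s V)
      + (mu e1.2 (Phi h) (TP V) + nu e2.2 (Phi h) (TP V)) - sigma h U V.
Proof. by move=> tV; rewrite /bform /restr asboolT. Qed.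

Lemma bform_cot h U e1 e2 : anchored h U e1 e2 -> cotangent h (bform h U e1 e2).
Proof.
move=> [tU [_ [c1 _] l1] [_ [c2 _] l2] _ _]; split; last by move=> v nv; rewrite /bform /restr asboolF.
move=> a u v tu tv; rewrite !bformE //; last exact: tan_linc.
rewrite !tmap_lin c1 ?c2 ?(muf_lin SS l1) ?(nuf_lin SS l2) ?(sg_linr LM tU a tu tv); first ring.
all: by [exact: (tan_Tt LM) | exact: (tan_Ts LM) | exact: (tan_TP SS LM)].
Qed.

Lemma bform_lin h a U e1 e2 U' e1' e2' V : anchored h U e1 e2 -> anchored h U' e1' e2' -> tangent h V ->
  bform h (a *: U + U') (a *: e1 + e1') (a *: e2 + e2') V = a * bform h U e1 e2 V + bform h U' e1' e2' V.
Proof.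
move=> [tU [_ _ l1] [_ _ l2] _ _] [tU' [_ _ l1'] [_ _ l2'] _ _] tV; rewrite !bformE // !EvE2 !EvE3.
have tPV := tan_TP SS LM tV.
rewrite (muf_lin1 SS tPV a l1 l1') (nuf_lin1 SS tPV a l2 l2') (sg_lin LM tV a tU tU'); ring.
Qed.

Lemma relR_of_anchored h U e1 e2 : anchored h U e1 e2 -> TP U = RR (Phi h) e1.2 - LL (Phi h) e2.2 ->
  relR'' h U (bform h U e1 e2) e1 e2.
Proof.
move=> g E; have cb := bform_cot g; have [tU E1 E2 h1 h2] := g; split => // V tV.
by rewrite bformE.
Qed.

Lemma anchored_sum h (F : tvec H -> Evec K G -> Evec K G -> R) (J : finType) (z : J -> R) BU B1 B2 :
  (forall a U e1 e2 U' e1' e2', anchored h U e1 e2 -> anchored h U' e1' e2' ->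
     F (a *: U + U') (a *: e1 + e1') (a *: e2 + e2') = a * F U e1 e2 + F U' e1' e2') ->
  (forall j, anchored h (BU j) (B1 j) (B2 j)) ->
  anchored h (\sum_j z j *: BU j) (\sum_j z j *: B1 j) (\sum_j z j *: B2 j) /\
  F (\sum_j z j *: BU j) (\sum_j z j *: B1 j) (\sum_j z j *: B2 j) = \sum_j z j * F (BU j) (B1 j) (B2 j).
Proof.
move=> lF gB; elim: (index_enum J) => [|j r [IH1 IH2]].
  rewrite !big_nil; split; first exact: anchored0.
  have := lF 1 _ _ _ _ _ _ (anchored0 h) (anchored0 h); rewrite !scaler0 !addr0 mul1r => h0.
  by apply: (addrI (F 0 0 0)); rewrite addr0 -h0.
rewrite !big_cons; split; first exact: anchored_lin.
by rewrite lF // IH2.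
Qed.

(** A vector field along phi, a pulled back one-form and a constant in the Lie algebra: the shape of
    the basis elements in [relR_solve], for which the coefficients of the system are smooth. *)
Definition field_along (phi : H -> N) (E : H -> Evec K G) : Prop := exists V g w,
  [/\ along phi V, is_form1 g, tge w & forall h, E h = (V h, g (phi h), w)].

Lemma along_tmap (M P : mfd R) (phi : M -> P) (X : M -> tvec M) : mfd_ok P -> sm phi -> is_vfield X ->
  along phi (fun x => tmap phi (X x)).
Proof.
move=> okP sphi vX; split; first by move=> x; apply: tmap_tangent => //; exact: vf_tan.
move=> f sf; rewrite (_ : (fun x => _) = (fun x => X x (f \o phi))); last by apply/funext => x; rewrite tmapE.
by apply: vf_smooth => //; have [_ h] := sphi; exact: h.
Qed.

Lemma along0 (M P : mfd R) (phi : M -> P) : mfd_ok M -> along phi (fun _ => 0).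
Proof. by move=> okM; split => [x|f sf]; [exact: tan0 | exact: smooth_cst]. Qed.

Lemma field_along_form phi E X : sm phi -> field_along phi E -> is_vfield X -> smooth_fun (fun h => (E h).1.2 (tmap phi (X h))).
Proof.
move=> sphi [V [g [w [aV fg tw EE]]]] vX.
rewrite (_ : (fun h => _) = (fun h => g (phi h) (tmap phi (X h)))); last by apply/funext => h; rewrite EE.
by apply: (form1_along okH okN sphi fg); exact: along_tmap.
Qed.

Lemma field_along_EP phi E c : sm phi -> field_along phi E -> is_Esection c -> smooth_fun (fun h => EP (E h) (c (phi h))).
Proof.
move=> sphi [V [g [w [aV fg tw EE]]]] sc; have [Ec vc fc wc] := sc.
have [_ hphi] := sphi.
rewrite (_ : (fun h => _) = (fun h => ev1 g (fun x => (c x).1.1) (phi h) + (c (phi h)).1.2 (V h) + kpair Omega w (c (phi h)).2)); last first.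
  by apply/funext => h; rewrite EE.
apply: (smooth_add okH); last first.
  apply: (kp_smooth SS okH); first by split => // f sf; exact: smooth_cst.
  by split => [z|f sf]; [have [] := Ec (phi z) | exact: (hphi _ (wc _ sf))].
apply: (smooth_add okH); first exact: (hphi _ (ev1_smooth fg vc)).
exact: (form1_along okH okN sphi fc aV).
Qed.

Section Complement.
Variable C : N -> set (Evec K G).
Hypothesis IC : isotropic_complement Omega Phi sigma C.
Local Notation cframe := (@cframe R K Omega G Phi sigma C).

Definition coord_frame h0 (q : 'I_(mdim H) -> H -> R) (D : 'I_(mdim H) -> H -> tvec H) : Prop :=
  [/\ forall i, smooth_fun (q i), forall i, is_vfield (D i) &
   \forall x \near h0, (forall v, tangent x v -> v = \sum_i v (q i) *: D i x) /\
      forall i j, D i x (q j) = (i == j)%:R].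

Lemma cot_frame0 h (D : 'I_(mdim H) -> tvec H) (q : 'I_(mdim H) -> H -> R) b : (forall i, tangent h (D i)) ->
  (forall v, tangent h v -> v = \sum_i v (q i) *: D i) -> cotangent h b -> (forall i, b (D i) = 0) -> b = 0.
Proof.
move=> tD ex [lb zb] hb; apply/funext => V; case: (pselect (tangent h V)) => tV; last by rewrite zb.
rewrite (ex _ tV) (sum_on _ lb (tangent_subspace h) tD) big1 // => i _.
by rewrite hb mulr0.
Qed.

(** There are dim H + 2 dim N + 2 dim K unknowns and dim H + dim K + r1 + r2 equations, equal in
    number since r1 + r2 = 2 dim N + dim K by the rank equations of the frames. A kernel vector is a
    point of R over C x C with zero covector, so [relR_inj] applies. The data y1 and y2 are 0 over C
    x C; other values serve families such as u^r. *)
Lemma relR_solve h0 q D r1 c1 u1 r2 c2 u2 (y0 : 'I_(mdim H) -> H -> R) (y1 : 'I_r1 -> H -> R) (y2 : 'I_r2 -> H -> R) :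
  coord_frame h0 q D -> cframe (t h0) c1 u1 -> cframe (s h0) c2 u2 ->
  (forall i, smooth_at h0 (y0 i)) -> (forall i, smooth_at h0 (y1 i)) -> (forall i, smooth_at h0 (y2 i)) ->
  exists (U : H -> tvec H) e1 e2, (forall f, smooth_fun f -> smooth_at h0 (fun h => U h f)) /\
   \forall h \near h0, [/\ relR'' h (U h) (bform h (U h) (e1 h) (e2 h)) (e1 h) (e2 h),
     forall i, bform h (U h) (e1 h) (e2 h) (D i h) = y0 i h,
     forall j, EP (e1 h) (c1 j (t h)) = y1 j h & forall j, EP (e2 h) (c2 j (s h)) = y2 j h].
Proof.
move=> [sq vD nD] [sc1 su1 dim1 nc1] [sc2 su2 dim2 nc2] sy0 sy1 sy2.
have [exD dD] := nbhs_singleton nD.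
have [q1 [D1 [sq1 vD1 /nbhs_singleton [ex1 dD1]]]] := frame_at (t h0) okN.
have [q2 [D2 [sq2 vD2 /nbhs_singleton [ex2 dD2]]]] := frame_at (s h0) okN.
have [kap [DK [sk vDK nDK]]] := frame_at (Phi h0) okK.
have [kae [W [ske tW dW exW]]] := lie_basis SS.
have tD i h : tangent h (D i h) by exact: vf_tan.
(* Unknowns: coefficients of U, of the one-forms at t and at s, and of the two k-components. The
   anchors of e1 and e2 follow U. *)
pose J := ('I_(mdim H) + ('I_(mdim N) + ('I_(mdim N) + ('I_(mdim K) + 'I_(mdim K)))))%type.
(* Equations: the values of the covector on the frame D, the condition on T Phi(U), and the pairings
   with the frames of C at t and at s. *)
pose I := ('I_(mdim H) + ('I_(mdim K) + ('I_r1 + 'I_r2)))%type.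
pose BU (j : J) h : tvec H := match j with inl i => D i h | _ => 0 end.
pose B1 (j : J) h : Evec K G := match j with
  | inl i => (tmap t (D i h), 0, 0)
  | inr (inl i) => (0, differential (t h) (q1 i), 0)
  | inr (inr (inl i)) => (0, 0, 0)
  | inr (inr (inr (inl k))) => (0, 0, W k)
  | inr (inr (inr (inr k))) => (0, 0, 0) end.
pose B2 (j : J) h : Evec K G := match j with
  | inl i => (tmap s (D i h), 0, 0)
  | inr (inl i) => (0, 0, 0)
  | inr (inr (inl i)) => (0, differential (s h) (q2 i), 0)
  | inr (inr (inr (inl k))) => (0, 0, 0)
  | inr (inr (inr (inr k))) => (0, 0, W k) end.
pose Eq h (i : I) U e1 e2 : R := match i with
  | inl i => bform h U e1 e2 (D i h)
  | inr (inl k) => TP U (kap k) - (RR (Phi h) e1.2 (kap k) - LL (Phi h) e2.2 (kap k))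
  | inr (inr (inl j)) => EP e1 (c1 j (t h))
  | inr (inr (inr j)) => EP e2 (c2 j (s h)) end.
have Fc1 j x : Efib x (c1 j x) by have [h _ _ _] := sc1 j.
have Fc2 j x : Efib x (c2 j x) by have [h _ _ _] := sc2 j.
have Eql h i a U e1 e2 U' e1' e2' : anchored h U e1 e2 -> anchored h U' e1' e2' ->
  Eq h i (a *: U + U') (a *: e1 + e1') (a *: e2 + e2') = a * Eq h i U e1 e2 + Eq h i U' e1' e2'.
  move=> g g'; have [_ E1 E2 _ _] := g; have [_ E1' E2' _ _] := g'; case: i => [i|[i|[j|j]]]; rewrite /Eq.
  - exact: bform_lin.
  - by rewrite !EvE3 !tmap_lin !tvecE; ring.
  - exact: (EP_lin SS (Fc1 j (t h)) a E1 E1').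
  - exact: (EP_lin SS (Fc2 j (s h)) a E2 E2').
have n1 j : field_along t (B1 j).
  case: j => [i|[i|[i|[k|k]]]].
  - exists (fun h => tmap t (D i h)), (fun=> 0), 0; split => //; [exact: along_tmap | exact: form1_0].
  - exists (fun=> 0), (fun x => differential x (q1 i)), 0; split => //; [exact: along0 | exact: differential_form].
  - exists (fun=> 0), (fun=> 0), 0; split => //; [exact: along0 | exact: form1_0].
  - exists (fun=> 0), (fun=> 0), (W k); split => //; [exact: along0 | exact: form1_0].
  - exists (fun=> 0), (fun=> 0), 0; split => //; [exact: along0 | exact: form1_0].
have n2 j : field_along s (B2 j).
  case: j => [i|[i|[i|[k|k]]]].
  - exists (fun h => tmap s (D i h)), (fun=> 0), 0; split => //; [exact: along_tmap | exact: form1_0].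
  - exists (fun=> 0), (fun=> 0), 0; split => //; [exact: along0 | exact: form1_0].
  - exists (fun=> 0), (fun x => differential x (q2 i)), 0; split => //; [exact: along0 | exact: differential_form].
  - exists (fun=> 0), (fun=> 0), 0; split => //; [exact: along0 | exact: form1_0].
  - exists (fun=> 0), (fun=> 0), (W k); split => //; [exact: along0 | exact: form1_0].
have vBU j : is_vfield (BU j).
  by case: j => [i|j]; [exact: vD | exact (vf_zero okH)].
have gB j h : anchored h (BU j h) (B1 j h) (B2 j h).
  have [V1 [g1 [w1 [[tV1 _] [cg1 _] tw1 E1]]]] := n1 j; have [V2 [g2 [w2 [[tV2 _] [cg2 _] tw2 E2]]]] := n2 j.
  split; first exact: vf_tan.
  - by rewrite E1; split; [exact: tV1 | exact: cg1 | exact: tw1].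
  - by rewrite E2; split; [exact: tV2 | exact: cg2 | exact: tw2].
  - by case: (j) => [i|[i|[i|[k|k]]]] //=; rewrite tmap0.
  - by case: (j) => [i|[i|[i|[k|k]]]] //=; rewrite tmap0.
have sEq i j : smooth_fun (fun h => Eq h i (BU j h) (B1 j h) (B2 j h)).
  have [V1 [g1 [w1 [_ _ tw1 E1]]]] := n1 j; have [V2 [g2 [w2 [_ _ tw2 E2]]]] := n2 j.
  have [_ hP] := smP.
  case: i => [i|[k|[l|l]]] /=.
  - rewrite (_ : (fun h => _) = (fun h => (B1 j h).1.2 (tmap t (D i h)) - (B2 j h).1.2 (tmap s (D i h))
      + (mu w1 (Phi h) (TP (D i h)) + nu w2 (Phi h) (TP (D i h))) - ev2 sigma (BU j) (D i) h)); last first.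
      by apply/funext => h; rewrite bformE // E1 E2.
    apply: (smooth_sub okH); last by have [_ hs] := lm_sigma LM; exact: hs.
    apply: (smooth_add okH).
      by apply: (smooth_sub okH); apply: field_along_form.
    apply: (smooth_add okH).
      by apply: (form1_along okH okK smP (muf_form1 SS tw1)); exact: along_tmap.
    by apply: (form1_along okH okK smP (nuf_form1 SS tw2)); exact: along_tmap.
  - rewrite (_ : (fun h => _) = (fun h => BU j h (kap k \o Phi) - (right_inv w1 (Phi h) (kap k) - left_inv w2 (Phi h) (kap k)))); last first.
      by apply/funext => h; rewrite E1 E2 tmapE.
    apply: (smooth_sub okH); first by apply: (vf_smooth (vBU j)); exact: hP.
    apply: (smooth_sub okH).
      by apply: (hP (fun k' => right_inv w1 k' (kap k))); exact: (vf_smooth (right_vf SS tw1)).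
    by apply: (hP (fun k' => left_inv w2 k' (kap k))); exact: (vf_smooth (left_vf SS tw2)).
  - exact: field_along_EP.
  - exact: field_along_EP.
pose S (z : J -> R) h := (\sum_j z j *: BU j h, \sum_j z j *: B1 j h, \sum_j z j *: B2 j h).
have SE z h i : \sum_j Eq h i (BU j h) (B1 j h) (B2 j h) * z j = Eq h i (\sum_j z j *: BU j h) (\sum_j z j *: B1 j h) (\sum_j z j *: B2 j h).
  have [_ ->] := anchored_sum z (Eql h i) (fun j => gB j h).
  by apply: eq_bigr => j _; rewrite mulrC.
have gS z h : anchored h (\sum_j z j *: BU j h) (\sum_j z j *: B1 j h) (\sum_j z j *: B2 j h).
  by have [] := anchored_sum z (F := fun _ _ _ => 0) (fun a _ _ _ _ _ _ _ _ => esym (etrans (addr0 _) (mulr0 a))) (fun j => gB j h).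
have rel h U e1 e2 : (forall v, tangent (Phi h) v -> v = \sum_i v (kap i) *: DK i (Phi h)) ->
  anchored h U e1 e2 -> (forall k, Eq h (inr (inl k)) U e1 e2 = 0) -> relR'' h U (bform h U e1 e2) e1 e2.
  move=> exK g h0'; apply: relR_of_anchored => //; have [tU [_ _ l1] [_ _ l2] _ _] := g.
  rewrite (exK _ (tan_TP SS LM tU)) [RHS](exK _ (tanB (tan_R SS (Phi h) l1) (tan_L SS (Phi h) l2))).
  apply: eq_bigr => k _; congr (_ *: _); rewrite tvecB.
  by apply/eqP; rewrite -subr_eq0; apply/eqP; exact: (h0' k).
have [cP _] := smP; have [cs _] := sms; have [ct _] := smt.
have nK : \forall h \near h0, forall v, tangent (Phi h) v -> v = \sum_i v (kap i) *: DK i (Phi h).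
  have : \forall h \near h0, (forall v, tangent (Phi h) v -> v = \sum_i v (kap i) *: DK i (Phi h)) /\
      forall i j, DK i (Phi h) (kap j) = (i == j)%:R by exact (cP h0 _ nDK).
  by apply: filterS => h [].
have card : #|{: I}| = #|{: J}| by rewrite !card_sum !card_ord; lia.
have [||||Z [sZ nZ]] := @smooth_solve R H okH I J (fun h i j => Eq h i (BU j h) (B1 j h) (B2 j h))
  (fun h i => match i with inl i => y0 i h | inr (inl k) => 0 | inr (inr (inl j)) => y1 j h | inr (inr (inr j)) => y2 j h end) h0 => //.
- by move=> i j; apply: smooth_fun_at => //.
- by case=> [i|[k|[j|j]]] //; exact: smooth_at_cst.
- move=> z hz; pose U := \sum_j z j *: BU j h0; pose e1 := \sum_j z j *: B1 j h0; pose e2 := \sum_j z j *: B2 j h0.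
  have g : anchored h0 U e1 e2 := gS z h0.
  have hE i : Eq h0 i U e1 e2 = 0 by rewrite -[RHS](hz i) SE.
  have r := rel _ _ _ _ (nbhs_singleton nK) g (fun k => hE (inr (inl k))).
  have b0 : bform h0 U e1 e2 = 0.
    by apply: (cot_frame0 (D := D^~ h0) _ exD (bform_cot g)) => // i; exact: (hE (inl i)).
  rewrite b0 in r; have [_ E1 E2 _ _] := g.
  have C1 : C (t h0) e1 by apply: (cpoint_C SS LM IC (nbhs_singleton nc1) E1) => j; exact: (hE (inr (inr (inl j)))).
  have C2 : C (s h0) e2 by apply: (cpoint_C SS LM IC (nbhs_singleton nc2) E2) => j; exact: (hE (inr (inr (inr j)))).
  have [U0 e10 e20] := relR_inj SS LM IC r C1 C2.
  (* Functionals dual to the basis triples: once U, e1 and e2 vanish, so do the coefficients. *)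
  pose T (j : J) (U : tvec H) (e1 e2 : Evec K G) : R := match j with
   | inl i => U (q i) | inr (inl i) => e1.1.2 (D1 i (t h0)) | inr (inr (inl i)) => e2.1.2 (D2 i (s h0))
   | inr (inr (inr (inl k))) => e1.2 (kae k) | inr (inr (inr (inr k))) => e2.2 (kae k) end.
  have lT j a U1 e11 e21 U1' e11' e21' : anchored h0 U1 e11 e21 -> anchored h0 U1' e11' e21' ->
    T j (a *: U1 + U1') (a *: e11 + e11') (a *: e21 + e21') = a * T j U1 e11 e21 + T j U1' e11' e21'.
    by move=> _ _; case: j => [i|[i|[i|[k|k]]]]; rewrite /T ?EvE2 ?EvE3 ?tvecE.
  have TB i j : T i (BU j h0) (B1 j h0) (B2 j h0) = (i == j)%:R.
    have tD1 l : tangent (t h0) (D1 l (t h0)) by exact: vf_tan.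
    have tD2 l : tangent (s h0) (D2 l (s h0)) by exact: vf_tan.
    case: i => [i|[i|[i|[i|i]]]]; case: j => [j|[j|[j|[j|j]]]] //=; rewrite ?differentialE ?dD ?dW ?dD1 ?dD2 //;
      by rewrite ?(inj_eq inr_inj) ?(inj_eq inl_inj) eq_sym.
  move=> j; have [_] := anchored_sum z (lT j) (fun j => gB j h0).
  rewrite -/U -/e1 -/e2 U0 e10 e20 (bigD1 j) //= TB eqxx mulr1 big1; last first.
    by move=> k nk; rewrite TB eq_sym (negbTE nk) mulr0.
  by rewrite addr0 => <-; case: (j) => [i|[i|[i|[k|k]]]].
exists (fun h => \sum_j Z h j *: BU j h), (fun h => \sum_j Z h j *: B1 j h), (fun h => \sum_j Z h j *: B2 j h); split.
  move=> f sf; rewrite (_ : (fun h => _) = (fun h => \sum_j Z h j * BU j h f)); last first.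
    by apply/funext => h; rewrite tvec_sumE.
  apply: smooth_at_sum => // j; apply: smooth_at_mul => //; apply: smooth_fun_at => //.
  exact: (vf_smooth (vBU j)).
apply: filterS2 nK nZ => h hK hZ.
have hE i := etrans (esym (SE (Z h) h i)) (hZ i).
split.
- by apply: (rel _ _ _ _ hK (gS _ _)) => k; exact: (hE (inr (inl k))).
- by move=> i; exact: (hE (inl i)).
- by move=> j; exact: (hE (inr (inr (inl j)))).
by move=> j; exact: (hE (inr (inr (inr j)))).
Qed.

Lemma coord_frame_at h0 : exists q D, coord_frame h0 q D.
Proof. by have [q [D hD]] := frame_at h0 okH; exists q, D. Qed.

(** Only the solution at h is wanted, so the data are frozen there: the values of b on the frame,
    and zero pairings with C. *)
Lemma graph_ex h b : cotangent h b -> exists U e1 e2, [/\ C (t h) e1, C (s h) e2 & relR'' h U b e1 e2].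
Proof.
move=> cb; have [q [D hD]] := coord_frame_at h.
have [r1 [c1 [u1 hc1]]] := dual_frame SS LM IC (t h); have [r2 [c2 [u2 hc2]]] := dual_frame SS LM IC (s h).
have [|||U [e1 [e2 [_ /nbhs_singleton [r hb h1 h2]]]]] :=
   @relR_solve h q D r1 c1 u1 r2 c2 u2 (fun i _ => b (D i h)) (fun _ _ => 0) (fun _ _ => 0) hD hc1 hc2; try (by move=> i; exact: smooth_at_cst).
exists (U h), (e1 h), (e2 h); have [_ vD /nbhs_singleton [exD _]] := hD.
have [[tU cb' E1 E2] _ _ _ _] := r.
have [_ _ _ /nbhs_singleton p1] := hc1; have [_ _ _ /nbhs_singleton p2] := hc2.
split; [exact: (cpoint_C SS LM IC p1 E1) | exact: (cpoint_C SS LM IC p2 E2) | ].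
suff -> : b = bform h (U h) (e1 h) (e2 h) by [].
apply/eqP; rewrite -subr_eq0; apply/eqP; apply: (cot_frame0 (D := D^~ h) _ exD) => [i||i]; first exact: vf_tan.
  have [l z] := cb; have [l' z'] := cb'; split.
    move=> a u v tu tv; change (b (a *: u + v) - bform h (U h) (e1 h) (e2 h) (a *: u + v)
      = a * (b u - bform h (U h) (e1 h) (e2 h) u) + (b v - bform h (U h) (e1 h) (e2 h) v)).
    by rewrite l // l' //; ring.
  by move=> v nv; change (b v - bform h (U h) (e1 h) (e2 h) v = 0); rewrite z // z' // subrr.
by change (b (D i h) - bform h (U h) (e1 h) (e2 h) (D i h) = 0); rewrite hb subrr.
Qed.

Lemma relR_uniq h b U e1 e2 U' e1' e2' : relR'' h U b e1 e2 -> relR'' h U' b e1' e2' ->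
  C (t h) (e1 - e1') -> C (s h) (e2 - e2') -> [/\ U = U', e1 = e1' & e2 = e2'].
Proof.
move=> r r' C1 C2; have := relR'_lin SS LM (-1) r' r; rewrite !scaleN1r => rd.
have b0 : - b + b = 0 by rewrite addNr.
rewrite b0 in rd; rewrite addrC in C1; rewrite addrC in C2.
have [/eqP h1 /eqP h2 /eqP h3] := relR_inj SS LM IC rd C1 C2.
by split; apply/eqP; rewrite -subr_eq0 addrC.
Qed.

(** The system with the same data has a smooth solution near h0. It differs from the given family by
    elements of C, since the pairings with the frames agree, so [relR_uniq] identifies the two. *)
Lemma relR_field (U : H -> tvec H) b e1 e2 : (forall h, relR'' h (U h) (b h) (e1 h) (e2 h)) -> is_form1 b ->
  (forall h0 r c u, cframe (t h0) (r := r) c u -> forall j, smooth_at h0 (fun h => EP (e1 h) (c j (t h)))) ->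
  (forall h0 r c u, cframe (s h0) (r := r) c u -> forall j, smooth_at h0 (fun h => EP (e2 h) (c j (s h)))) ->
  is_vfield U.
Proof.
move=> r fb s1 s2; split; first by move=> h; have [[]] := r h.
move=> f sf; apply/(smooth_funP okH) => h0.
have [q [D hD]] := coord_frame_at h0; have [_ vD nD] := hD.
have [r1 [c1 [u1 hc1]]] := dual_frame SS LM IC (t h0); have [r2 [c2 [u2 hc2]]] := dual_frame SS LM IC (s h0).
have [|||U' [e1' [e2' [sU n]]]] :=
   @relR_solve h0 q D r1 c1 u1 r2 c2 u2 (fun i h => b h (D i h)) (fun j h => EP (e1 h) (c1 j (t h))) (fun j h => EP (e2 h) (c2 j (s h))) hD hc1 hc2.
- by move=> i; apply: smooth_fun_at => //; exact: (ev1_smooth fb (vD i)).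
- exact: (s1 _ _ _ _ hc1).
- exact: (s2 _ _ _ _ hc2).
apply: (@smooth_at_near R H okH h0 (fun h => U' h f)); last exact: sU.
have [cs _] := sms; have [ct _] := smt.
have [_ _ _ p1] := hc1; have [_ _ _ p2] := hc2.
have n1 : \forall h \near h0, cpoint Omega Phi sigma C c1 u1 (t h) := ct h0 _ p1.
have n2 : \forall h \near h0, cpoint Omega Phi sigma C c2 u2 (s h) := cs h0 _ p2.
near=> h; have [r' hb h1 h2] : [/\ relR'' h (U' h) (bform h (U' h) (e1' h) (e2' h)) (e1' h) (e2' h),
     forall i, bform h (U' h) (e1' h) (e2' h) (D i h) = b h (D i h),
     forall j, EP (e1' h) (c1 j (t h)) = EP (e1 h) (c1 j (t h)) & forall j, EP (e2' h) (c2 j (s h)) = EP (e2 h) (c2 j (s h))] by near: h.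
have [exD _] : (forall v, tangent h v -> v = \sum_i v (q i) *: D i h) /\ forall i j, D i h (q j) = (i == j)%:R by near: h.
have c1' : cpoint Omega Phi sigma C c1 u1 (t h) by near: h.
have c2' : cpoint Omega Phi sigma C c2 u2 (s h) by near: h.
have rh := r h; have [[_ cb E1 E2] _ _ _ _] := rh; have [[_ cb' E1' E2'] _ _ _ _] := r'.
have eb : bform h (U' h) (e1' h) (e2' h) = b h.
  apply/eqP; rewrite -subr_eq0; apply/eqP; apply: (cot_frame0 (D := D^~ h) _ exD) => [i||i]; first exact: vf_tan.
    have [l z] := cb; have [l' z'] := cb'; split.
      move=> a u v tu tv; change (bform h (U' h) (e1' h) (e2' h) (a *: u + v) - b h (a *: u + v)
        = a * (bform h (U' h) (e1' h) (e2' h) u - b h u) + (bform h (U' h) (e1' h) (e2' h) v - b h v)).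
      by rewrite l // l' //; ring.
    by move=> v nv; change (bform h (U' h) (e1' h) (e2' h) v - b h v = 0); rewrite z // z' // subrr.
  by change (bform h (U' h) (e1' h) (e2' h) (D i h) - b h (D i h) = 0); rewrite hb subrr.
rewrite eb in r'.
have Fc1 j : Efib (t h) (c1 j (t h)) by have [+ _ _ _] := c1'; move=> hc; exact: (C_fib IC (hc j)).
have Fc2 j : Efib (s h) (c2 j (s h)) by have [+ _ _ _] := c2'; move=> hc; exact: (C_fib IC (hc j)).
have Ed1 : Efib (t h) (e1' h - e1 h) by rewrite -scaleN1r addrC; exact: Efib_lin.
have Ed2 : Efib (s h) (e2' h - e2 h) by rewrite -scaleN1r addrC; exact: Efib_lin.
have C1 : C (t h) (e1' h - e1 h).
  apply: (cpoint_C SS LM IC c1' Ed1) => j; have := EP_lin SS (Fc1 j) (-1) E1 E1'.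
  by rewrite scaleN1r addrC => ->; rewrite h1 mulN1r addNr.
have C2 : C (s h) (e2' h - e2 h).
  apply: (cpoint_C SS LM IC c2' Ed2) => j; have := EP_lin SS (Fc2 j) (-1) E2 E2'.
  by rewrite scaleN1r addrC => ->; rewrite h2 mulN1r addNr.
by have [-> _ _] := relR_uniq r' rh C1 C2.
Unshelve. all: by end_near.
Qed.

End Complement.
End Solve.

(** * The Jacobi identity of the Courant bracket *)

Section Jacobi.
Variables (R : realType) (M : mfd R).
Hypothesis okM : mfd_ok M.
Implicit Types (X Y Z : M -> tvec M) (a b c : form1 M).

Lemma lie_jacobi X Y Z p : is_vfield X -> is_vfield Y -> is_vfield Z ->
  lie X (lie Y Z) p - lie Y (lie X Z) p + lie Z (lie X Y) p = 0.
Proof.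
move=> vX vY vZ; have vYZ := lie_vfield okM vY vZ; have vXZ := lie_vfield okM vX vZ; have vXY := lie_vfield okM vX vY.
apply: (tan_eq (p := p)); last 1 first.
- move=> f sf; rewrite tvecD tvecB tvec0.
  have sv (U : M -> tvec M) (g : M -> R) : is_vfield U -> smooth_fun g -> smooth_fun (vact U g) by exact: vf_smooth.
  have E U V W : is_vfield U -> is_vfield V -> is_vfield W ->
     U p (vact (lie V W) f) = U p (vact V (vact W f)) - U p (vact W (vact V f)).
    move=> vU vV vW; exact: (tan_sub okM (vf_tan p vU) (sv _ _ vV (sv _ _ vW sf)) (sv _ _ vW (sv _ _ vV sf))).
  rewrite /lie -/(lie Y Z) -/(lie X Z) -/(lie X Y) !E // /lie /vact; ring.
- by apply: tanD; [apply: tanB; exact: lie_tangent | exact: lie_tangent].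
exact: tan0.
Qed.

Lemma form1_jacobi a X Y Z p : is_form1 a -> is_vfield X -> is_vfield Y -> is_vfield Z ->
  a p (lie X (lie Y Z) p) = a p (lie Y (lie X Z) p) - a p (lie Z (lie X Y) p).
Proof.
move=> fa vX vY vZ; have vYZ := lie_vfield okM vY vZ; have vXZ := lie_vfield okM vX vZ; have vXY := lie_vfield okM vX vY.
have t2 := lie_tangent okM p vY vXZ; have t3 := lie_tangent okM p vZ vXY.
rewrite -(lin_tanB (form1_lin fa) t2 t3); congr (a p _).
by have /eqP := lie_jacobi p vX vY vZ; rewrite addr_eq0 subr_eq => /eqP ->; rewrite addrC.
Qed.

Lemma tan_tex p (v : tvec M) X a Y b Z c : tangent p v -> is_vfield X -> is_vfield Y -> is_vfield Z ->
  is_form1 a -> is_form1 b -> is_form1 c ->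
  v (tex X a Y b Z c) = v (vact X (ev1 b Z)) - v (ev1 b (lie X Z)) - v (vact Y (ev1 a Z)) + v (vact Z (ev1 a Y))
    + v (ev1 a (lie Y Z)) + v (ev1 c (lie X Y)).
Proof.
move=> tv vX vY vZ fa fb fc.
have sE (d : form1 M) (U : M -> tvec M) : is_form1 d -> is_vfield U -> smooth_fun (ev1 d U) by exact: ev1_smooth.
have sV (U : M -> tvec M) (d : form1 M) (W : M -> tvec M) : is_vfield U -> is_form1 d -> is_vfield W -> smooth_fun (vact U (ev1 d W)).
  by move=> vU fd vW; apply: vf_smooth => //; exact: sE.
have lV := lie_vfield okM.
have s1 := sV _ _ _ vX fb vZ; have s2 := sE _ _ fb (lV _ _ vX vZ); have s3 := sV _ _ _ vY fa vZ.
have s4 := sV _ _ _ vZ fa vY; have s5 := sE _ _ fa (lV _ _ vY vZ); have s6 := sE _ _ fc (lV _ _ vX vY).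
rewrite -(tan_sub okM tv s1 s2) -(tan_sub okM tv (smooth_sub okM s1 s2) s3).
have q3 := smooth_sub okM (smooth_sub okM s1 s2) s3.
rewrite -(tan_add tv q3 s4); have q4 := smooth_add okM q3 s4.
rewrite -(tan_add tv q4 s5); have q5 := smooth_add okM q4 s5.
by rewrite -(tan_add tv q5 s6).
Qed.

Lemma tex_smooth X a Y b Z c : is_vfield X -> is_vfield Y -> is_vfield Z ->
  is_form1 a -> is_form1 b -> is_form1 c -> smooth_fun (tex X a Y b Z c).
Proof.
move=> vX vY vZ fa fb fc.
have sE (d : form1 M) (U : M -> tvec M) : is_form1 d -> is_vfield U -> smooth_fun (ev1 d U) by exact: ev1_smooth.
have sV (U : M -> tvec M) (d : form1 M) (W : M -> tvec M) : is_vfield U -> is_form1 d -> is_vfield W -> smooth_fun (vact U (ev1 d W)).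
  by move=> vU fd vW; apply: vf_smooth => //; exact: sE.
have lV := lie_vfield okM.
have s1 := sV _ _ _ vX fb vZ; have s2 := sE _ _ fb (lV _ _ vX vZ); have s3 := sV _ _ _ vY fa vZ.
have s4 := sV _ _ _ vZ fa vY; have s5 := sE _ _ fa (lV _ _ vY vZ); have s6 := sE _ _ fc (lV _ _ vX vY).
exact: (smooth_add okM (smooth_add okM (smooth_add okM (smooth_sub okM (smooth_sub okM s1 s2) s3) s4) s5) s6).
Qed.

(** Everything is expanded into iterated derivatives and brackets. The right side is the alternating
    sum of <[[., .]], [[., .]]>, where the one-form component of each bracket meets the Lie bracket
    of the other pair. *)
Lemma jac_tex p X1 a1 X2 a2 X3 a3 X4 a4 : is_vfield X1 -> is_vfield X2 -> is_vfield X3 -> is_vfield X4 ->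
  is_form1 a1 -> is_form1 a2 -> is_form1 a3 -> is_form1 a4 ->
  X1 p (tex X2 a2 X3 a3 X4 a4) - X2 p (tex X1 a1 X3 a3 X4 a4) + X3 p (tex X1 a1 X2 a2 X4 a4) - X4 p (tex X1 a1 X2 a2 X3 a3) =
  (texform X1 a1 X2 a2 (lie X3 X4) p + texform X3 a3 X4 a4 (lie X1 X2) p)
  - (texform X1 a1 X3 a3 (lie X2 X4) p + texform X2 a2 X4 a4 (lie X1 X3) p)
  + (texform X1 a1 X4 a4 (lie X2 X3) p + texform X2 a2 X3 a3 (lie X1 X4) p).
Proof.
move=> v1 v2 v3 v4 f1 f2 f3 f4; have tX X : is_vfield X -> tangent p (X p) by exact: vf_tan.
rewrite !(@tan_tex p) //; try exact: tX.
rewrite /texform.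
have L X Y f : lie X Y p f = X p (vact Y f) - Y p (vact X f) by [].
rewrite (L X3 X4) (L X1 X2) (L X2 X4) (L X1 X3) (L X2 X3) (L X1 X4).
rewrite (form1_jacobi p f1 v2 v3 v4) (form1_jacobi p f2 v1 v3 v4) (form1_jacobi p f3 v1 v2 v4) (form1_jacobi p f4 v1 v2 v3).
(* Orients the inner brackets so that [ring] recognises equal terms. *)
have an a X Y Z : is_form1 a -> is_vfield X -> is_vfield Y -> is_vfield Z -> a p (lie X (lie Y Z) p) = - a p (lie X (lie Z Y) p).
  move=> fa vX vY vZ; rewrite -(form1N fa (lie_tangent okM p vX (lie_vfield okM vZ vY))); congr (a p _).
  have -> : lie Y Z = (fun q => -1 *: lie Z Y q) by apply/funext => q; rewrite (lie_anti Z Y) scaleN1r.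
  rewrite (lie_scaler okM p vX (lie_vfield okM vZ vY) (smooth_cst okM (-1))) (tan_cst okM _ (tX _ vX)) scale0r add0r.
  by rewrite scaleN1r.
ring.
Qed.

End Jacobi.

(** * The Courant bracket of E *)

Section CourantPair.
Variables (R : realType) (K : lie_group_data R) (Omega : form2 (prod_mfd K K)) (Theta : form3 K).
Variables (G : groupoid_data R) (Phi : arr G -> K) (sigma : form2 (arr G)) (eta : form3 (obj G)).
Hypothesis SS : shifted_symplectic Omega Theta.
Hypothesis LM : lagrangian_morphism Omega Theta Phi sigma eta.
Local Notation e := (lone K).
Local Notation N := (obj G).
Local Notation tge := (@tangent R K e).
Local Notation EP := (@Epair R K Omega G).
Local Notation kp := (kpair Omega).
Local Notation br := (@lie_algebra_bracket R K).
Local Notation Lk := (@lieK R K G).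
Local Notation cp := (@courant_pair R K Omega G eta).
Local Notation CF := (@courant_form R K Omega G eta).
Local Notation CL := (@courant_lie R K G).
Implicit Types (x : N) (X Y : N -> tvec N).

Let GD : is_lie_groupoid G := lm_groupoid LM.
Let okK : mfd_ok K := ss_ok SS.
Let okN : mfd_ok N := gd_okN GD.

Lemma lieKv_tan x (v : tvec N) w : tangent x v -> ksm w -> tge (fun f => v (fun y => w y f)).
Proof.
move=> tv [tw sw]; split.
- move=> a f g sf sg; rewrite -(tan_lin a tv (sw _ sf) (sw _ sg)); congr (v _).
  by apply/funext => y; rewrite (tan_lin a (tw y) sf sg).
- move=> f g sf sg.
  rewrite -[v _ * g e]mulrC -(tan_scale okN _ tv (sw _ sf)) -(tan_scale okN _ tv (sw _ sg)).
  rewrite -(tan_add tv); try by apply: (smooth_mul okN); [exact: smooth_cst | exact: sw].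
  congr (v _); apply/funext => y; rewrite (tan_mul (tw y) sf sg); ring.
move=> f nf; rewrite (_ : (fun y => _) = (fun=> 0)); first exact: (tan_cst okN _ tv).
by apply/funext => y; exact: (tan_nsmooth (tw y) nf).
Qed.

Lemma lieK_ksm X w : is_vfield X -> ksm w -> ksm (Lk X w).
Proof.
move=> vX kw; split; first by move=> x; exact: (lieKv_tan (vf_tan x vX) kw).
by move=> f sf; apply: (vf_smooth vX); have [_ sw] := kw; exact: sw.
Qed.

Lemma kp_deriv X w w' x : is_vfield X -> ksm w -> ksm w' ->
  X x (fun y => kp (w y) (w' y)) = kp (Lk X w x) (w' x) + kp (w x) (Lk X w' x).
Proof.
move=> vX kw kw'; have [kap [W [sk tW dl ex]]] := lie_basis SS.
have [tw sw] := kw; have [tw' sw'] := kw'; have tX := vf_tan x vX.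
have [tL _] := lieK_ksm vX kw; have [tL' _] := lieK_ksm vX kw'.
rewrite (kp_expand SS tW ex (tL x) (tw' x)) (kp_expand SS tW ex (tw x) (tL' x)).
rewrite (_ : (fun y => _) = (fun y => \sum_i \sum_j (w y (kap i) * w' y (kap j)) * kp (W i) (W j))); last first.
  by apply/funext => y; exact: (kp_expand SS tW ex).
have s2 i j : smooth_fun (fun y => (w y (kap i) * w' y (kap j))).
  by apply: (smooth_mul okN); [exact: sw | exact: sw'].
have s3 i j : smooth_fun (fun y => (w y (kap i) * w' y (kap j)) * kp (W i) (W j)).
  by apply: (smooth_mul okN) => //; exact: smooth_cst.
rewrite (tan_sum okN _ tX); last by move=> i; exact: (smooth_sum okN).
rewrite -big_split; apply: eq_bigr => i _ /=; rewrite (tan_sum okN _ tX) //.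
rewrite -big_split; apply: eq_bigr => j _ /=.
rewrite (tan_mul tX (s2 i j) (smooth_cst okN _)) (tan_cst okN _ tX) (tan_mul tX (sw _ (sk i)) (sw' _ (sk j))).
by rewrite /lieK; ring.
Qed.

Lemma br_linl w0 : tge w0 -> forall a u v, tge u -> tge v -> br (a *: u + v) w0 = a *: br u w0 + br v w0.
Proof.
move=> tw a u v tu tv; apply: (tan_eq (p := e)).
- by apply: (br_tan SS) => //; exact: tan_linc.
- by apply: tan_linc; exact: (br_tan SS).
move=> f sf; rewrite tvecE /lie_algebra_bracket /lie.
have rl k g : right_inv (a *: u + v) k g = a * right_inv u k g + right_inv v k g.
  by rewrite /right_inv tmap_lin tvecE.
rewrite rl; have -> : vact (right_inv (a *: u + v)) f = (fun k => a * vact (right_inv u) f k + vact (right_inv v) f k).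
  by apply/funext => k; rewrite /vact rl.
rewrite (tan_lin a (vf_tan e (right_vf SS tw))); try by apply: vf_smooth => //; exact: (right_vf SS).
ring.
Qed.

(** The Cartan three-form of the quadratic Lie algebra. *)
Definition ctri u v w : R := kp (br u v) w.

Lemma ctri_lin1 v w : tge v -> tge w -> linear_on tge (fun u => ctri u v w).
Proof.
move=> tv tw a u u' tu tu'; rewrite /ctri br_linl //.
by apply: (kpair_lin SS tw); exact: (br_tan SS).
Qed.
Lemma ctri_lin3 u v : tge u -> tge v -> linear_on tge (fun w => ctri u v w).
Proof. by move=> tu tv; exact: (kp_linr SS (br_tan SS tu tv)). Qed.
Lemma ctri_anti12 u v w : tge u -> tge v -> tge w -> ctri u v w = - ctri v u w.
Proof.
move=> tu tv tw; rewrite /ctri (br_antisym v u) -scaleN1r.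
have := linear_onZ (-1) (kpair_lin SS tw) (tan0 e) (br_tan SS tv tu) => ->.
by rewrite mulN1r.
Qed.
Lemma ctri_anti23 u v w : tge u -> tge v -> tge w -> ctri u v w = - ctri u w v.
Proof. by move=> tu tv tw; rewrite /ctri (kpair_br_anti SS). Qed.
Lemma ctri_lin2 u w : tge u -> tge w -> linear_on tge (fun v => ctri u v w).
Proof.
move=> tu tw a v v' tv tv'; rewrite ctri_anti12 //; last exact: tan_linc.
by rewrite (ctri_lin1 tu tw a tv tv') (ctri_anti12 tu tv tw) (ctri_anti12 tu tv' tw); ring.
Qed.

Lemma ctri_expand kap (W : 'I_(mdim K) -> tvec K) u v w :
  (forall i, tge (W i)) -> (forall w, tge w -> w = \sum_i w (kap i) *: W i) -> tge u -> tge v -> tge w ->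
  ctri u v w = \sum_i \sum_j \sum_k ((u (kap i) * v (kap j)) * w (kap k)) * ctri (W i) (W j) (W k).
Proof.
move=> tW ex tu tv tw; rewrite {1}(ex _ tu) (sum_on _ (ctri_lin1 tv tw) (tangent_subspace e) tW).
apply: eq_bigr => i _; rewrite {1}(ex _ tv) (sum_on _ (ctri_lin2 (tW i) tw) (tangent_subspace e) tW) mulr_sumr.
apply: eq_bigr => j _; rewrite {1}(ex _ tw) (sum_on _ (ctri_lin3 (tW i) (tW j)) (tangent_subspace e) tW) !mulr_sumr.
by apply: eq_bigr => k _; ring.
Qed.

Lemma ctri_smooth (w1 w2 w3 : N -> tvec K) : ksm w1 -> ksm w2 -> ksm w3 -> smooth_fun (fun y => ctri (w1 y) (w2 y) (w3 y)).
Proof.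
move=> [t1 s1] [t2 s2] [t3 s3]; have [kap [W [sk tW dl ex]]] := lie_basis SS.
rewrite (_ : (fun y => _) = (fun y => \sum_i \sum_j \sum_k ((w1 y (kap i) * w2 y (kap j)) * w3 y (kap k)) * ctri (W i) (W j) (W k))); last first.
  by apply/funext => y; exact: (ctri_expand tW ex).
do 3 (apply: (smooth_sum okN) => ?); apply: (smooth_mul okN); last exact: smooth_cst.
by apply: (smooth_mul okN); [apply: (smooth_mul okN); [exact: s1 | exact: s2] | exact: s3].
Qed.

Lemma ctri_deriv X w1 w2 w3 x : is_vfield X -> ksm w1 -> ksm w2 -> ksm w3 ->
  X x (fun y => ctri (w1 y) (w2 y) (w3 y)) =
  ctri (Lk X w1 x) (w2 x) (w3 x) + ctri (w1 x) (Lk X w2 x) (w3 x) + ctri (w1 x) (w2 x) (Lk X w3 x).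
Proof.
move=> vX k1 k2 k3; have [kap [W [sk tW dl ex]]] := lie_basis SS.
have [t1 s1] := k1; have [t2 s2] := k2; have [t3 s3] := k3; have tX := vf_tan x vX.
have [l1 _] := lieK_ksm vX k1; have [l2 _] := lieK_ksm vX k2; have [l3 _] := lieK_ksm vX k3.
have cex := ctri_expand tW ex.
rewrite (cex _ _ _ (l1 x) (t2 x) (t3 x)) (cex _ _ _ (t1 x) (l2 x) (t3 x)) (cex _ _ _ (t1 x) (t2 x) (l3 x)).
rewrite (_ : (fun y => ctri _ _ _) = (fun y => \sum_i \sum_j \sum_k ((w1 y (kap i) * w2 y (kap j)) * w3 y (kap k)) * ctri (W i) (W j) (W k))); last first.
  by apply/funext => y; exact: cex.
have p2 i j : smooth_fun (fun y => w1 y (kap i) * w2 y (kap j)).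
  by apply: (smooth_mul okN); [exact: s1 | exact: s2].
have p3 i j k : smooth_fun (fun y => (w1 y (kap i) * w2 y (kap j)) * w3 y (kap k)).
  by apply: (smooth_mul okN) => //; exact: s3.
have p4 i j k : smooth_fun (fun y => (w1 y (kap i) * w2 y (kap j)) * w3 y (kap k) * ctri (W i) (W j) (W k)).
  by apply: (smooth_mul okN) => //; exact: smooth_cst.
rewrite (tan_sum okN _ tX); last by move=> i; do 2 (apply: (smooth_sum okN) => ?).
rewrite -!big_split; apply: eq_bigr => i _ /=; rewrite (tan_sum okN _ tX); last by move=> j; apply: (smooth_sum okN).
rewrite -!big_split; apply: eq_bigr => j _ /=; rewrite (tan_sum okN _ tX) //.
rewrite -!big_split; apply: eq_bigr => k _ /=.
rewrite (tan_mul tX (p3 i j k) (smooth_cst okN _)) (tan_cst okN _ tX) (tan_mul tX (p2 i j) (s3 _ (sk k))).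
rewrite (tan_mul tX (s1 _ (sk i)) (s2 _ (sk j))).
by rewrite /lieK; ring.
Qed.

Lemma br_jacobi u v w : tge u -> tge v -> tge w -> br u (br v w) - br v (br u w) + br w (br u v) = 0.
Proof.
move=> tu tv tw; have := lie_jacobi okK e (right_vf SS tu) (right_vf SS tv) (right_vf SS tw).
have E a b : tge a -> tge b -> lie (right_inv a) (right_inv b) = right_inv (br a b).
  by move=> ta tb; apply/funext => k; exact: (lie_right SS).
by rewrite (E v w) // (E u w) // (E u v).
Qed.

(** By invariance each term is the pairing of a with an iterated bracket of b, c and d. *)
Lemma ctri_jacobi a b c d : tge a -> tge b -> tge c -> tge d ->
  kp (br a b) (br c d) - kp (br a c) (br b d) + kp (br a d) (br b c) = 0.
Proof.
move=> ta tb tc td; have tt u v : tge u -> tge v -> tge (br u v) by exact: (br_tan SS).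
have E u v w : tge u -> tge v -> tge w -> kp (br a u) (br v w) = kp a (br u (br v w)).
  move=> tu tv tw; have h := tt _ _ tv tw.
  rewrite -[LHS]/(ctri a u (br v w)) (ctri_anti12 ta tu h) (ctri_anti23 tu ta h) opprK.
  exact: (kpairC SS (tt _ _ tu h) ta).
rewrite !E //.
have l := kp_linr SS ta.
have t1 := tt _ _ tb (tt _ _ tc td); have t2 := tt _ _ tc (tt _ _ tb td); have t3 := tt _ _ td (tt _ _ tb tc).
rewrite -(lin_tanB l t1 t2) -(linear_onD l (tanB t1 t2) t3) br_jacobi //.
exact (linear_on0 l (tan0 e)).
Qed.

(** The share of the k-components in <[[., .]], .>; the rest is [tex] and eta, by [cpE]. *)
Definition kap3 X1 w1 X2 w2 X3 w3 x : R :=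
  kp (Lk X3 w1 x) (w2 x) + kp (Lk X1 w2 x) (w3 x) - kp (Lk X2 w1 x) (w3 x) + ctri (w1 x) (w2 x) (w3 x).

Lemma kap3_smooth X1 w1 X2 w2 X3 w3 : is_vfield X1 -> is_vfield X2 -> is_vfield X3 ->
  ksm w1 -> ksm w2 -> ksm w3 -> smooth_fun (kap3 X1 w1 X2 w2 X3 w3).
Proof.
move=> v1 v2 v3 k1 k2 k3; have s4 := ctri_smooth k1 k2 k3.
have s1 := kp_smooth SS okN (lieK_ksm v3 k1) k2.
have s2 := kp_smooth SS okN (lieK_ksm v1 k2) k3.
have s3 := kp_smooth SS okN (lieK_ksm v2 k1) k3.
exact: (smooth_add okN (smooth_sub okN (smooth_add okN s1 s2) s3) s4).
Qed.

Section Forms.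
Implicit Types z : N -> Evec K G.

Lemma Es_v z1 : is_Esection z1 -> is_vfield (fun x => (z1 x).1.1). Proof. by case. Qed.
Lemma Es_a z1 : is_Esection z1 -> is_form1 (fun x => (z1 x).1.2). Proof. by case. Qed.
Lemma Es_w z1 : is_Esection z1 -> ksm (fun x => (z1 x).2). Proof. exact: Esec_ksm. Qed.

Local Notation Vf z1 := (fun x => (z1 x).1.1).
Local Notation Af z1 := (fun x => (z1 x).1.2).
Local Notation Wf z1 := (fun x => (z1 x).2).

Lemma CFE z1 z2 Y x : CF z1 z2 Y x = texform (Vf z1) (Af z1) (Vf z2) (Af z2) Y x
   + eta x (z1 x).1.1 (z2 x).1.1 (Y x) + kp (Lk Y (Wf z1) x) (z2 x).2.
Proof.
have aux (p q r k l : R) : p - q - (r - k - l) = p - q - r + k + l by ring.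
by rewrite /courant_form; congr (_ + _ + _); exact: aux.
Qed.

Lemma CLE z1 z2 x : CL z1 z2 x = Lk (Vf z1) (Wf z2) x - Lk (Vf z2) (Wf z1) x + br (z1 x).2 (z2 x).2.
Proof. by []. Qed.

Lemma kp3_lin a b c w : tge a -> tge b -> tge c -> tge w -> kp (a - b + c) w = kp a w - kp b w + kp c w.
Proof.
move=> ta tb tc tw; have l := kpair_lin SS tw.
by rewrite (linear_onD l (tanB ta tb) tc) (lin_tanB l ta tb).
Qed.

Lemma cpE z1 z2 z3 x : is_Esection z1 -> is_Esection z2 -> is_Esection z3 ->
  cp z1 z2 z3 x = tex (Vf z1) (Af z1) (Vf z2) (Af z2) (Vf z3) (Af z3) x + eta x (z1 x).1.1 (z2 x).1.1 (z3 x).1.1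
   + kap3 (Vf z1) (Wf z1) (Vf z2) (Wf z2) (Vf z3) (Wf z3) x.
Proof.
move=> s1 s2 s3; rewrite /courant_pair CFE CLE /courant_vec /kap3 /ctri.
have [t1 _] := Es_w s1; have [t2 _] := Es_w s2; have [t3 _] := Es_w s3.
have [l1 _] := lieK_ksm (Es_v s1) (Es_w s2); have [l2 _] := lieK_ksm (Es_v s2) (Es_w s1).
rewrite (kp3_lin (l1 x) (l2 x) (br_tan SS (t1 x) (t2 x)) (t3 x)).
have -> : tex (Vf z1) (Af z1) (Vf z2) (Af z2) (Vf z3) (Af z3) x = texform (Vf z1) (Af z1) (Vf z2) (Af z2) (Vf z3) x + (z3 x).1.2 (lie (Vf z1) (Vf z2) x) by [].
ring.
Qed.

Let alt_eta x : alt3 (tangent x) (eta x). Proof. by have [h _] := lm_eta LM. Qed.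

Lemma cp_anti12 z1 z2 z3 x : is_Esection z1 -> is_Esection z2 -> is_Esection z3 ->
  cp z1 z2 z3 x + cp z2 z1 z3 x = (z3 x).1.1 (fun y => EP (z1 y) (z2 y)).
Proof.
move=> s1 s2 s3; rewrite !cpE //.
have v1 := Es_v s1; have v2 := Es_v s2; have v3 := Es_v s3.
have a1 := Es_a s1; have a2 := Es_a s2; have a3 := Es_a s3.
have k1 := Es_w s1; have k2 := Es_w s2; have k3 := Es_w s3.
have := tex_anti12 okN x v1 v2 v3 a1 a2 a3 => T.
have t3 := vf_tan x v3.
rewrite [RHS](tan_add t3); last first.
- exact: (kp_smooth SS okN k1 k2).
- exact (smooth_add okN (ev1_smooth a1 v2) (ev1_smooth a2 v1)).
rewrite (kp_deriv x v3 k1 k2).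
have [_ /(_ _ _ _ (vf_tan x v1) (vf_tan x v2) t3) [h _]] := alt_eta x.
have [tw1 _] := k1; have [tw2 _] := k2; have [tw3 _] := k3; have [tl _] := lieK_ksm v3 k2.
move: T; rewrite /kap3 h (ctri_anti12 (tw1 x) (tw2 x) (tw3 x)) (kpairC SS (tw1 x) (tl x)) => T.
move: T; set A := tex _ _ _ _ _ _ x; set B := tex _ _ _ _ _ _ x; rewrite /ev1; set D := (z3 x).1.1 _ => T.
rewrite -T; ring.
Qed.

Lemma cp_anti23 z1 z2 z3 x : is_Esection z1 -> is_Esection z2 -> is_Esection z3 ->
  cp z1 z2 z3 x + cp z1 z3 z2 x = (z1 x).1.1 (fun y => EP (z2 y) (z3 y)).
Proof.
move=> s1 s2 s3; rewrite !cpE //.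
have v1 := Es_v s1; have v2 := Es_v s2; have v3 := Es_v s3.
have a1 := Es_a s1; have a2 := Es_a s2; have a3 := Es_a s3.
have k1 := Es_w s1; have k2 := Es_w s2; have k3 := Es_w s3.
have := tex_anti23 okN x v1 v2 v3 a1 a2 a3 => T.
have t1 := vf_tan x v1.
rewrite [RHS](tan_add t1); last first.
- exact: (kp_smooth SS okN k2 k3).
- exact (smooth_add okN (ev1_smooth a2 v3) (ev1_smooth a3 v2)).
rewrite (kp_deriv x v1 k2 k3).
have [_ /(_ _ _ _ t1 (vf_tan x v2) (vf_tan x v3)) [_ h]] := alt_eta x.
have [tw1 _] := k1; have [tw2 _] := k2; have [tw3 _] := k3; have [tl _] := lieK_ksm v1 k3.
move: T; rewrite /kap3 h (ctri_anti23 (tw1 x) (tw2 x) (tw3 x)) (kpairC SS (tw2 x) (tl x)) => T.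
move: T; set A := tex _ _ _ _ _ _ x; set B := tex _ _ _ _ _ _ x; rewrite /ev1; set D := (z1 x).1.1 _ => T.
rewrite -T; ring.
Qed.

(** The bracket at x as a vector of the fibre: its one-form component is given by values on fields,
    and [texform_cov] shows that these come from a covector. The vector can then be expanded in
    bases of the fibre. *)
Lemma cbr_ex z1 z2 x : is_Esection z1 -> is_Esection z2 -> exists v : Evec K G,
  [/\ Efib x v, v.1.1 = lie (Vf z1) (Vf z2) x, v.2 = CL z1 z2 x &
   forall Y, is_vfield Y -> CF z1 z2 Y x = v.1.2 (Y x)].
Proof.
move=> s1 s2.
have v1 := Es_v s1; have v2 := Es_v s2; have a1 := Es_a s1; have a2 := Es_a s2; have k1 := Es_w s1; have k2 := Es_w s2.
have [al [[la za] hal]] := texform_cov okN x v1 v2 a1 a2.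
have [tw1 _] := k1; have [tw2 _] := k2.
have [l1 _] := lieK_ksm v1 k2; have [l2 _] := lieK_ksm v2 k1.
pose A : fnl (tvec N) := restr (tangent x) (fun Z => al Z + eta x (z1 x).1.1 (z2 x).1.1 Z + kp (fun f => Z (fun y => (z1 y).2 f)) (z2 x).2).
exists (lie (Vf z1) (Vf z2) x, A, CL z1 z2 x); split => //.
  split; [exact: (lie_tangent okN) | split | ].
  - have [h1 h2] := alt_eta x.
    have eC Z : tangent x Z -> eta x (z1 x).1.1 (z2 x).1.1 Z = eta x Z (z1 x).1.1 (z2 x).1.1.
      move=> tZ; have [_ ->] := h2 _ _ _ (vf_tan x v1) (vf_tan x v2) tZ.
      by have [-> _] := h2 _ _ _ (vf_tan x v1) tZ (vf_tan x v2); rewrite opprK.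
    move=> k u v tu tv; rewrite /= /A /restr !asboolT //; last exact: tan_linc.
    rewrite la // !eC //; last exact: tan_linc.
    rewrite (h1 _ _ (vf_tan x v1) (vf_tan x v2) k u v tu tv).
    have tku := lieKv_tan tu k1; have tkv := lieKv_tan tv k1.
    have := kpair_lin SS (tw2 x) k tku tkv.
    rewrite (_ : _ *: _ + _ = (fun f => (k *: u + v) (fun y => (z1 y).2 f))) => [->|]; first ring.
    by apply/funext => f; rewrite tvecE.
  - by move=> v nv; rewrite /= /A /restr asboolF.
  - by apply: tanD; [apply: tanB; [exact: l1 | exact: l2] | exact: (br_tan SS)].
move=> Y vY; rewrite CFE hal //; rewrite [RHS](_ : _ = A (Y x)) // /A /restr asboolT //; exact: vf_tan.
Qed.

Lemma cp_val z1 z2 z3 x (v : Evec K G) : is_Esection z3 -> v.1.1 = lie (Vf z1) (Vf z2) x -> v.2 = CL z1 z2 x ->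
  (forall Y, is_vfield Y -> CF z1 z2 Y x = v.1.2 (Y x)) -> cp z1 z2 z3 x = EP v (z3 x).
Proof.
by move=> s3 E1 E2 hY; rewrite /courant_pair (hY _ (Es_v s3)) /courant_vec -E1 -E2.
Qed.

Lemma cp_smooth z1 z2 z3 : is_Esection z1 -> is_Esection z2 -> is_Esection z3 -> smooth_fun (cp z1 z2 z3).
Proof.
move=> s1 s2 s3.
have v1 := Es_v s1; have v2 := Es_v s2; have v3 := Es_v s3.
have a1 := Es_a s1; have a2 := Es_a s2; have a3 := Es_a s3.
have k1 := Es_w s1; have k2 := Es_w s2; have k3 := Es_w s3.
rewrite (_ : cp z1 z2 z3 = (fun x => tex (Vf z1) (Af z1) (Vf z2) (Af z2) (Vf z3) (Af z3) x + eta x (z1 x).1.1 (z2 x).1.1 (z3 x).1.1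
   + kap3 (Vf z1) (Wf z1) (Vf z2) (Wf z2) (Vf z3) (Wf z3) x)); last by apply/funext => x; exact: cpE.
apply: (smooth_add okN); last first.
  by apply: kap3_smooth.
apply: (smooth_add okN); first exact: tex_smooth.
by have [_ h] := lm_eta LM; exact: (h _ _ _ v1 v2 v3).
Qed.

(* <[[a, b]], [[c, d]]> *)
Definition bracket_pair (a b c d : N -> Evec K G) x : R :=
  CF a b (lie (Vf c) (Vf d)) x + CF c d (lie (Vf a) (Vf b)) x + kp (CL a b x) (CL c d x).

Lemma kap3_deriv X X1 w1 X2 w2 X3 w3 x : is_vfield X -> is_vfield X1 -> is_vfield X2 -> is_vfield X3 ->
  ksm w1 -> ksm w2 -> ksm w3 ->
  X x (kap3 X1 w1 X2 w2 X3 w3) =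
   (kp (Lk X (Lk X3 w1) x) (w2 x) + kp (Lk X3 w1 x) (Lk X w2 x))
   + (kp (Lk X (Lk X1 w2) x) (w3 x) + kp (Lk X1 w2 x) (Lk X w3 x))
   - (kp (Lk X (Lk X2 w1) x) (w3 x) + kp (Lk X2 w1 x) (Lk X w3 x))
   + (ctri (Lk X w1 x) (w2 x) (w3 x) + ctri (w1 x) (Lk X w2 x) (w3 x) + ctri (w1 x) (w2 x) (Lk X w3 x)).
Proof.
move=> v v1 v2 v3 k1 k2 k3; have tX := vf_tan x v; have c2 := ctri_smooth k1 k2 k3.
have s1 := kp_smooth SS okN (lieK_ksm v3 k1) k2.
have s2 := kp_smooth SS okN (lieK_ksm v1 k2) k3.
have s3 := kp_smooth SS okN (lieK_ksm v2 k1) k3.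
have s12 := smooth_add okN s1 s2; have s123 := smooth_sub okN s12 s3.
rewrite -(ctri_deriv x v k1 k2 k3) -(kp_deriv x v (lieK_ksm v3 k1) k2) -(kp_deriv x v (lieK_ksm v1 k2) k3) -(kp_deriv x v (lieK_ksm v2 k1) k3).
by rewrite -(tan_add tX s1 s2) -(tan_sub okN tX s12 s3) -(tan_add tX s123 c2).
Qed.

Lemma kp_bil3 a b c a' b' c' : tge a -> tge b -> tge c -> tge a' -> tge b' -> tge c' ->
  kp (a - b + c) (a' - b' + c') =
  kp a a' - kp a b' + kp a c' - kp b a' + kp b b' - kp b c' + kp c a' - kp c b' + kp c c'.
Proof.
move=> ta tb tc ta' tb' tc'; have t' := tanD (tanB ta' tb') tc'.
have r u : tge u -> kp u (a' - b' + c') = kp u a' - kp u b' + kp u c'.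
  by move=> tu; have l := kp_linr SS tu; rewrite (linear_onD l (tanB ta' tb') tc') (lin_tanB l ta' tb').
by rewrite kp3_lin // !r //; ring.
Qed.

(** After the Leibniz rule, second derivatives combine to Lie brackets, products of first
    derivatives match by symmetry of the pairing, and the algebraic terms reduce to
    [ctri_jacobi]. *)
Lemma jac_kap X1 w1 X2 w2 X3 w3 X4 w4 x : is_vfield X1 -> is_vfield X2 -> is_vfield X3 -> is_vfield X4 ->
  ksm w1 -> ksm w2 -> ksm w3 -> ksm w4 ->
  let cl Xa wa Xb wb := Lk Xa wb x - Lk Xb wa x + br (wa x) (wb x) in
  X1 x (kap3 X2 w2 X3 w3 X4 w4) - X2 x (kap3 X1 w1 X3 w3 X4 w4) + X3 x (kap3 X1 w1 X2 w2 X4 w4) - X4 x (kap3 X1 w1 X2 w2 X3 w3) =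
  (kp (Lk (lie X3 X4) w1 x) (w2 x) + kp (Lk (lie X1 X2) w3 x) (w4 x) + kp (cl X1 w1 X2 w2) (cl X3 w3 X4 w4))
  - (kp (Lk (lie X2 X4) w1 x) (w3 x) + kp (Lk (lie X1 X3) w2 x) (w4 x) + kp (cl X1 w1 X3 w3) (cl X2 w2 X4 w4))
  + (kp (Lk (lie X2 X3) w1 x) (w4 x) + kp (Lk (lie X1 X4) w2 x) (w3 x) + kp (cl X1 w1 X4 w4) (cl X2 w2 X3 w3)).
Proof.
move=> v1 v2 v3 v4 k1 k2 k3 k4 /=.
rewrite !kap3_deriv //.
have [t1 _] := k1; have [t2 _] := k2; have [t3 _] := k3; have [t4 _] := k4.
have tL X w : is_vfield X -> ksm w -> tge (Lk X w x) by move=> vX kw; have [+ _] := lieK_ksm vX kw; exact.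
have tb u v : tge u -> tge v -> tge (br u v) by exact: (br_tan SS).
have LL X Y w u : is_vfield X -> is_vfield Y -> ksm w -> tge u ->
   kp (Lk (lie X Y) w x) u = kp (Lk X (Lk Y w) x) u - kp (Lk Y (Lk X w) x) u.
  by move=> vX vY kw tu; rewrite -(lin_tanB (kpair_lin SS tu) (tL _ _ vX (lieK_ksm vY kw)) (tL _ _ vY (lieK_ksm vX kw))).
rewrite !LL // !kp_bil3 //; try exact: tL; try exact: tb.
have q := ctri_jacobi (t1 x) (t2 x) (t3 x) (t4 x).
have cR a b c : tge a -> tge b -> tge c -> kp a (br b c) = ctri a b c.
  move=> ta tb' tc; rewrite (kpairC SS ta (tb _ _ tb' tc)) -/(ctri b c a) ctri_anti23 // ctri_anti12 // opprK.
  by [].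
have c1 a : tge a -> kp a (br (w3 x) (w4 x)) = ctri a (w3 x) (w4 x) by move=> ta; exact: cR.
have c2 a : tge a -> kp a (br (w2 x) (w4 x)) = ctri a (w2 x) (w4 x) by move=> ta; exact: cR.
have c3 a : tge a -> kp a (br (w2 x) (w3 x)) = ctri a (w2 x) (w3 x) by move=> ta; exact: cR.
rewrite !c1 ?c2 ?c3 //; try exact: tL; try exact: tb.
move: q; rewrite (c1 _ (tb _ _ (t1 x) (t2 x))) (c2 _ (tb _ _ (t1 x) (t3 x))) (c3 _ (tb _ _ (t1 x) (t4 x))) => q.
rewrite -!/(ctri _ _ _).
have S X w X' w' : is_vfield X -> ksm w -> is_vfield X' -> ksm w' -> kp (Lk X w x) (Lk X' w' x) = kp (Lk X' w' x) (Lk X w x).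
  by move=> vX kw vX' kw'; apply: (kpairC SS); exact: tL.
rewrite (S X4 w2 X1 w3) // (S X3 w2 X1 w4) // (S X2 w3 X1 w4) // (S X4 w1 X2 w3) // (S X3 w1 X2 w4) // (S X4 w1 X3 w2) //.
rewrite (S X2 w1 X3 w4) // (S X2 w1 X4 w3) // (S X3 w1 X4 w2) // (S X1 w2 X4 w3) // (S X1 w2 X3 w4) //.
rewrite (ctri_anti12 (t2 x) (tL _ _ v1 k3) (t4 x)) (ctri_anti23 (t1 x) (tL _ _ v2 k3) (t4 x)).
rewrite (ctri_anti23 (t1 x) (tL _ _ v3 k2) (t4 x)) (ctri_anti23 (t1 x) (tL _ _ v4 k2) (t3 x)).
rewrite (ctri_anti23 (t2 x) (t3 x) (tL _ _ v1 k4)) (ctri_anti12 (t2 x) (tL _ _ v1 k4) (t3 x)).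
lra.
Qed.

(** This is d eta = 0 with the Lie brackets moved to the last slot. *)
Lemma jac_eta X1 X2 X3 X4 x : is_vfield X1 -> is_vfield X2 -> is_vfield X3 -> is_vfield X4 ->
  X1 x (ev3 eta X2 X3 X4) - X2 x (ev3 eta X1 X3 X4) + X3 x (ev3 eta X1 X2 X4) - X4 x (ev3 eta X1 X2 X3) =
  (eta x (X1 x) (X2 x) (lie X3 X4 x) + eta x (X3 x) (X4 x) (lie X1 X2 x))
  - (eta x (X1 x) (X3 x) (lie X2 X4 x) + eta x (X2 x) (X4 x) (lie X1 X3 x))
  + (eta x (X1 x) (X4 x) (lie X2 X3 x) + eta x (X2 x) (X3 x) (lie X1 X4 x)).
Proof.
move=> v1 v2 v3 v4; have := lm_eta_closed LM v1 v2 v3 v4 x; rewrite /dform3 /koszul3 /vact /ev3.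
have [_ h2] := alt_eta x.
have rot A B Z : tangent x A -> tangent x B -> tangent x Z -> eta x Z A B = eta x A B Z.
  move=> tA tB tZ; have [-> _] := h2 _ _ _ tZ tA tB.
  by have [_ ->] := h2 _ _ _ tA tZ tB; rewrite opprK.
rewrite !(rot (X3 x) (X4 x)) ?(rot (X2 x) (X4 x)) ?(rot (X2 x) (X3 x)) ?(rot (X1 x) (X4 x)) ?(rot (X1 x) (X3 x)) ?(rot (X1 x) (X2 x)) //;
  try exact: vf_tan; try exact: (lie_tangent okN).
move=> h; lra.
Qed.

(* This form of the Jacobi identity of the Courant bracket holds for all sections of E; for
   sections of C it says that d_* chi = 0. *)
Lemma cp_jacobi z1 z2 z3 z4 x : is_Esection z1 -> is_Esection z2 -> is_Esection z3 -> is_Esection z4 ->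
  (z1 x).1.1 (cp z2 z3 z4) - (z2 x).1.1 (cp z1 z3 z4) + (z3 x).1.1 (cp z1 z2 z4) - (z4 x).1.1 (cp z1 z2 z3) =
  bracket_pair z1 z2 z3 z4 x - bracket_pair z1 z3 z2 z4 x + bracket_pair z1 z4 z2 z3 x.
Proof.
move=> s1 s2 s3 s4.
have v1 := Es_v s1; have v2 := Es_v s2; have v3 := Es_v s3; have v4 := Es_v s4.
have a1 := Es_a s1; have a2 := Es_a s2; have a3 := Es_a s3; have a4 := Es_a s4.
have k1 := Es_w s1; have k2 := Es_w s2; have k3 := Es_w s3; have k4 := Es_w s4.
have split4 (v : tvec N) (ea eb ec : N -> Evec K G) : tangent x v -> is_Esection ea -> is_Esection eb -> is_Esection ec ->
  v (cp ea eb ec) = v (tex (Vf ea) (Af ea) (Vf eb) (Af eb) (Vf ec) (Af ec)) + v (ev3 eta (Vf ea) (Vf eb) (Vf ec))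
    + v (kap3 (Vf ea) (Wf ea) (Vf eb) (Wf eb) (Vf ec) (Wf ec)).
  move=> tv sa sb sc; have [_ h] := lm_eta LM.
  have q1 := tex_smooth okN (Es_v sa) (Es_v sb) (Es_v sc) (Es_a sa) (Es_a sb) (Es_a sc).
  have q2 := h _ _ _ (Es_v sa) (Es_v sb) (Es_v sc).
  have q3 := kap3_smooth (Es_v sa) (Es_v sb) (Es_v sc) (Es_w sa) (Es_w sb) (Es_w sc).
  rewrite -(tan_add tv q1 q2) -(tan_add tv (smooth_add okN q1 q2) q3).
  by congr (v _); apply/funext => y; exact: cpE.
rewrite (split4 _ z2 z3 z4 (vf_tan x v1) s2 s3 s4) (split4 _ z1 z3 z4 (vf_tan x v2) s1 s3 s4) (split4 _ z1 z2 z4 (vf_tan x v3) s1 s2 s4) (split4 _ z1 z2 z3 (vf_tan x v4) s1 s2 s3).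
have J1 := jac_tex okN x v1 v2 v3 v4 a1 a2 a3 a4.
have J2 := jac_eta x v1 v2 v3 v4.
have J3 := jac_kap x v1 v2 v3 v4 k1 k2 k3 k4.
rewrite /bracket_pair !CFE !CLE.
move: J1 J2 J3 => /= J1 J2 J3.
set A1 := (z1 x).1.1 (tex _ _ _ _ _ _) in J1 *; set A2 := (z2 x).1.1 (tex _ _ _ _ _ _) in J1 *.
set A3 := (z3 x).1.1 (tex _ _ _ _ _ _) in J1 *; set A4 := (z4 x).1.1 (tex _ _ _ _ _ _) in J1 *.
set B1 := (z1 x).1.1 (ev3 _ _ _ _) in J2 *; set B2 := (z2 x).1.1 (ev3 _ _ _ _) in J2 *.
set B3 := (z3 x).1.1 (ev3 _ _ _ _) in J2 *; set B4 := (z4 x).1.1 (ev3 _ _ _ _) in J2 *.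
set C1 := (z1 x).1.1 (kap3 _ _ _ _ _ _) in J3 *; set C2 := (z2 x).1.1 (kap3 _ _ _ _ _ _) in J3 *.
set C3 := (z3 x).1.1 (kap3 _ _ _ _ _ _) in J3 *; set C4 := (z4 x).1.1 (kap3 _ _ _ _ _ _) in J3 *.
have -> : A1 + B1 + C1 - (A2 + B2 + C2) + (A3 + B3 + C3) - (A4 + B4 + C4) =
   (A1 - A2 + A3 - A4) + (B1 - B2 + B3 - B4) + (C1 - C2 + C3 - C4) by ring.
rewrite J1 J2 J3; ring.
Qed.

End Forms.
End CourantPair.

(** * Differential identities on R *)

Section Sums.
Variables (R : realType) (I : finType).
Implicit Types (x y z : I -> R) (g : I -> I -> R) (T : I -> I -> I -> R).

Definition bsum x y g : R := \sum_j \sum_k x j * y k * g j k.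
Definition tsum x y z T : R := \sum_j \sum_k \sum_l x j * y k * z l * T j k l.

Lemma bsumC x y g : bsum x y g = bsum y x (fun j k => g k j).
Proof. by rewrite /bsum exchange_big; do 2 (apply: eq_bigr => ? _); rewrite [x _ * _]mulrC. Qed.
Lemma bsumDr x y g g' : bsum x y g + bsum x y g' = bsum x y (fun j k => g j k + g' j k).
Proof. by rewrite /bsum -big_split; apply: eq_bigr => j _; rewrite -big_split; apply: eq_bigr => k _; rewrite mulrDr. Qed.
Lemma bsumBm x y y' g : bsum x (fun k => y k - y' k) g = bsum x y g - bsum x y' g.
Proof.
rewrite /bsum -sumrB; apply: eq_bigr => j _; rewrite -sumrB; apply: eq_bigr => k _.
by rewrite mulrBr mulrBl.
Qed.
Lemma eq_bsum x x' y y' g g' : (forall j, x j = x' j) -> (forall j, y j = y' j) -> (forall j k, g j k = g' j k) ->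
  bsum x y g = bsum x' y' g'.
Proof. by move=> h1 h2 h3; do 2 (apply: eq_bigr => ? _); rewrite h1 h2 h3. Qed.
Lemma bsum0g x y g : (forall j k, g j k = 0) -> bsum x y g = 0.
Proof. by move=> h; rewrite /bsum big1 // => j _; rewrite big1 // => k _; rewrite h mulr0. Qed.

Lemma tsumD x y z T T' : tsum x y z T + tsum x y z T' = tsum x y z (fun j k l => T j k l + T' j k l).
Proof. by rewrite /tsum -big_split; apply: eq_bigr => j _; rewrite -big_split; apply: eq_bigr => k _; rewrite -big_split; apply: eq_bigr => l _; rewrite mulrDr. Qed.
Lemma tsumN x y z T : - tsum x y z T = tsum x y z (fun j k l => - T j k l).
Proof. by rewrite /tsum -sumrN; apply: eq_bigr => j _; rewrite -sumrN; apply: eq_bigr => k _; rewrite -sumrN; apply: eq_bigr => l _; rewrite mulrN. Qed.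
Lemma eq_tsum x y z T T' : (forall j k l, T j k l = T' j k l) -> tsum x y z T = tsum x y z T'.
Proof. by move=> h; do 3 (apply: eq_bigr => ? _); rewrite h. Qed.
Lemma tsum_132 x y z T : tsum x z y T = tsum x y z (fun j k l => T j l k).
Proof. by apply: eq_bigr => j _; rewrite exchange_big; do 2 (apply: eq_bigr => ? _); congr (_ * _); ring. Qed.
Lemma tsum_213 x y z T : tsum y x z T = tsum x y z (fun j k l => T k j l).
Proof. by rewrite /tsum exchange_big; do 3 (apply: eq_bigr => ? _); congr (_ * _); ring. Qed.
Lemma tsum_231 x y z T : tsum y z x T = tsum x y z (fun j k l => T k l j).
Proof. by rewrite tsum_132 tsum_213. Qed.
Lemma tsum_321 x y z T : tsum z y x T = tsum x y z (fun j k l => T l k j).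
Proof. by rewrite tsum_213 tsum_231. Qed.

End Sums.

Section SumType.
Variables (R : realType) (A B : finType).

Lemma sum_inlr (F : A + B -> R) : \sum_j F j = \sum_a F (inl a) + \sum_b F (inr b).
Proof. exact: big_sumType. Qed.

Lemma bsum_inlr (x y : A + B -> R) g : (forall a b, g (inl a) (inr b) = 0) -> (forall a b, g (inr b) (inl a) = 0) ->
  bsum x y g = bsum (x \o inl) (y \o inl) (fun a a' => g (inl a) (inl a')) + bsum (x \o inr) (y \o inr) (fun b b' => g (inr b) (inr b')).
Proof.
move=> h1 h2; rewrite /bsum sum_inlr; congr (_ + _); apply: eq_bigr => a _; rewrite sum_inlr.
  by rewrite [X in _ + X]big1 ?addr0 // => b _; rewrite h1 mulr0.
by rewrite [X in X + _]big1 ?add0r // => b _; rewrite h2 mulr0.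
Qed.

Lemma tsum_inlr (x y z : A + B -> R) T :
  (forall a b c, T (inl a) (inl b) (inr c) = 0) -> (forall a b c, T (inl a) (inr b) c = 0) ->
  (forall a b c, T (inr a) (inl b) c = 0) -> (forall a b c, T (inr a) (inr b) (inl c) = 0) ->
  tsum x y z T = tsum (x \o inl) (y \o inl) (z \o inl) (fun a b c => T (inl a) (inl b) (inl c))
    + tsum (x \o inr) (y \o inr) (z \o inr) (fun a b c => T (inr a) (inr b) (inr c)).
Proof.
move=> h1 h2 h3 h4; rewrite /tsum sum_inlr; congr (_ + _); apply: eq_bigr => a _; rewrite sum_inlr.
  rewrite [X in _ + X]big1 ?addr0; last by move=> b _; rewrite big1 // => c _; rewrite h2 mulr0.
  apply: eq_bigr => b _; rewrite sum_inlr [X in _ + X]big1 ?addr0 // => c _; by rewrite h1 mulr0.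
rewrite [X in X + _]big1 ?add0r; last by move=> b _; rewrite big1 // => c _; rewrite h3 mulr0.
apply: eq_bigr => b _; rewrite sum_inlr [X in X + _]big1 ?add0r // => c _; by rewrite h4 mulr0.
Qed.

End SumType.

(** * [tex] for fields and forms expanded in a family along a map *)

Section Pull.
Variables (R : realType) (H M : mfd R).
Hypotheses (okH : mfd_ok H) (okM : mfd_ok M).
Variable phi : H -> M.
Hypothesis sphi : sm phi.
Variables (I : finType) (V : I -> M -> tvec M) (gam : I -> form1 M).
Hypotheses (vV : forall j, is_vfield (V j)) (fg : forall j, is_form1 (gam j)).
Implicit Types (a b c : I -> H -> R).

Definition pform a : form1 H := fun h => restr (tangent h) (fun X => \sum_j a j h * gam j (phi h) (tmap phi X)).

Lemma pformE a h X : tangent h X -> pform a h X = \sum_j a j h * gam j (phi h) (tmap phi X).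
Proof. by move=> tX; rewrite /pform /restr asboolT. Qed.

Lemma pform_form a : (forall j, smooth_fun (a j)) -> is_form1 (pform a).
Proof.
move=> sa; split.
  move=> h; split; last by move=> v nv; rewrite /pform /restr asboolF.
  move=> k u v tu tv; rewrite !pformE //; last exact: tan_linc.
  rewrite mulr_sumr -big_split; apply: eq_bigr => j _ /=.
  rewrite tmap_lin (form1_lin (fg j) k (tmap_tangent okM sphi tu) (tmap_tangent okM sphi tv)); ring.
move=> X vX; rewrite (_ : ev1 _ X = (fun h => \sum_j a j h * gam j (phi h) (tmap phi (X h)))); last first.
  by apply/funext => h; rewrite /ev1 pformE //; exact: vf_tan.
apply: (smooth_sum okH) => j; apply: (smooth_mul okH) => //.
by apply: (form1_along okH okM sphi (fg j)); exact: along_tmap.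
Qed.

(** The anchor part of an expansion in the family, with coefficients on H. It is required near h0,
    as these coefficients get differentiated. *)
Definition famd (U : H -> tvec H) a (h0 : H) : Prop :=
  \forall h \near h0, tmap phi (U h) = \sum_j a j h *: V j (phi h).

Let tV j x : tangent x (V j x). Proof. exact: vf_tan. Qed.
Let G j k x := gam j x (V k x).
Let sG j k : smooth_fun (G j k). Proof. exact: (ev1_smooth (fg j) (vV k)). Qed.
Let sGp j k : smooth_fun (fun h => G j k (phi h)).
Proof. by have [_ h] := sphi; exact: (h _ (sG j k)). Qed.
Let ssum (F : I -> H -> R) : (forall j, smooth_fun (F j)) -> smooth_fun (fun h => \sum_j F j h).
Proof. by move=> sF; exact: smooth_sum. Qed.

Lemma fam_apply U a h0 f : famd U a h0 -> smooth_fun f -> U h0 (f \o phi) = \sum_j a j h0 * V j (phi h0) f.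
Proof.
move=> /nbhs_singleton E sf; rewrite -(tmapE phi (U h0) sf) E tvec_sumE.
by apply: eq_bigr => j _; rewrite tvecZ.
Qed.

Lemma fam_apply_near U a h0 f : famd U a h0 -> smooth_fun f ->
  \forall h \near h0, U h (f \o phi) = \sum_j a j h * V j (phi h) f.
Proof.
move=> fa sf; apply: filterS fa => h E; rewrite -(tmapE phi (U h) sf) E tvec_sumE.
by apply: eq_bigr => j _; rewrite tvecZ.
Qed.

Lemma pull_deriv Ua a b Uc c h0 : is_vfield Ua -> is_vfield Uc ->
  (forall j, smooth_fun (b j)) -> (forall j, smooth_fun (c j)) ->
  famd Ua a h0 -> famd Uc c h0 ->
  Ua h0 (ev1 (pform b) Uc) = bsum (fun j => Ua h0 (b j)) (c^~ h0) (fun j k => G j k (phi h0))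
    + bsum (b^~ h0) (fun k => Ua h0 (c k)) (fun j k => G j k (phi h0))
    + tsum (b^~ h0) (c^~ h0) (a^~ h0) (fun j k l => V l (phi h0) (G j k)).
Proof.
move=> va vc sb sc fa fc; have tU := vf_tan h0 va.
have sbc j k : smooth_fun (fun h => b j h * c k h) by exact: smooth_mul.
have s3 j k : smooth_fun (fun h => b j h * c k h * G j k (phi h)) by exact: smooth_mul.
have s2 j : smooth_fun (fun h => \sum_k b j h * c k h * G j k (phi h)) by exact: ssum.
have s1 : smooth_fun (fun h => \sum_j \sum_k b j h * c k h * G j k (phi h)) by exact: ssum.
rewrite (tan_local okH tU (ev1_smooth (pform_form sb) vc) s1); last first.
  apply: filterS fc => h E; rewrite /ev1 pformE; last exact: vf_tan.
  apply: eq_bigr => j _; rewrite E (sum_on _ (form1_lin (fg j)) (tangent_subspace (phi h))); last by move=> k; exact: tV.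
  by rewrite mulr_sumr; apply: eq_bigr => k _; rewrite mulrA.
rewrite (tan_sum okH _ tU s2) /bsum /tsum -!big_split; apply: eq_bigr => j _ /=.
rewrite (tan_sum okH _ tU (s3 j)) -!big_split; apply: eq_bigr => k _ /=.
rewrite (tan_mul tU (sbc j k) (sGp j k)) (tan_mul tU (sb j) (sc k)).
have -> : Ua h0 (fun h => G j k (phi h)) = \sum_l a l h0 * V l (phi h0) (G j k) by exact: (fam_apply fa (sG j k)).
rewrite mulr_sumr; under [X in _ = _ + X]eq_bigr do rewrite -mulrA.
ring.
Qed.

Lemma pull_lie Ua a Uc c h0 : is_vfield Ua -> is_vfield Uc ->
  (forall j, smooth_fun (a j)) -> (forall j, smooth_fun (c j)) -> famd Ua a h0 -> famd Uc c h0 ->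
  tmap phi (lie Ua Uc h0) = \sum_k (Ua h0 (c k) - Uc h0 (a k)) *: V k (phi h0)
    + \sum_k \sum_l (c k h0 * a l h0) *: lie (V l) (V k) (phi h0).
Proof.
move=> va vc sa sc fa fc.
have D U (x : I -> H -> R) U' (x' : I -> H -> R) f : is_vfield U -> is_vfield U' -> (forall j, smooth_fun (x j)) -> (forall j, smooth_fun (x' j)) ->
   famd U x h0 -> famd U' x' h0 -> smooth_fun f ->
   U h0 (vact U' (f \o phi)) = \sum_k U h0 (x' k) * V k (phi h0) f + \sum_k \sum_l x' k h0 * x l h0 * V l (phi h0) (vact (V k) f).
  move=> vU vU' sx sx' fU fU' sf; have tU := vf_tan h0 vU.
  have sfp : smooth_fun (f \o phi) by have [_ h] := sphi; exact: h.
  have sVf k : smooth_fun (vact (V k) f) by exact: vf_smooth (vV k) sf.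
  have sVp k : smooth_fun (fun h => V k (phi h) f) by have [_ h] := sphi; exact: (h _ (sVf k)).
  have s1 k : smooth_fun (fun h => x' k h * V k (phi h) f) by exact: smooth_mul.
  rewrite (tan_local okH tU (vf_smooth vU' sfp) (ssum s1)); last exact: fam_apply_near.
  rewrite (tan_sum okH _ tU s1) -big_split; apply: eq_bigr => k _ /=.
  rewrite (tan_mul tU (sx' k) (sVp k)); congr (_ + _).
  have -> : U h0 (fun h => V k (phi h) f) = \sum_l x l h0 * V l (phi h0) (vact (V k) f) by exact: (fam_apply fU (sVf k)).
  by rewrite mulr_sumr; apply: eq_bigr => l _; rewrite mulrA.
apply: (tan_eq (p := phi h0)).
- by apply: (tmap_tangent okM sphi); exact: lie_tangent.
- apply: tanD; apply: tan_sumc => k; first exact: tanZ.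
  by apply: tan_sumc => l; apply: tanZ; exact: lie_tangent.
move=> f sf; rewrite (tmapE phi _ sf) tvecD !tvec_sumE /lie (D Ua a Uc c) // (D Uc c Ua a) //.
under [X in _ = _ + X]eq_bigr => k _ do
  (rewrite tvec_sumE; under eq_bigr => l _ do rewrite tvecZ mulrBr; rewrite sumrB).
under [X in _ = X + _]eq_bigr => k _ do rewrite tvecZ mulrBl.
rewrite !sumrB [X in _ - (_ + X)]exchange_big /=.
have -> : \sum_i \sum_j a j h0 * c i h0 * V i (phi h0) (vact (V j) f) = \sum_i \sum_j c i h0 * a j h0 * V i (phi h0) (vact (V j) f).
  by apply: eq_bigr => i _; apply: eq_bigr => j _; rewrite [a _ _ * _]mulrC.
rewrite /vact; ring.
Qed.

Lemma pull_form_lie Ua a b Uc c h0 : is_vfield Ua -> is_vfield Uc ->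
  (forall j, smooth_fun (a j)) -> (forall j, smooth_fun (c j)) -> famd Ua a h0 -> famd Uc c h0 ->
  pform b h0 (lie Ua Uc h0) = bsum (b^~ h0) (fun k => Ua h0 (c k)) (fun j k => G j k (phi h0))
   - bsum (b^~ h0) (fun k => Uc h0 (a k)) (fun j k => G j k (phi h0))
   + tsum (b^~ h0) (c^~ h0) (a^~ h0) (fun j k l => gam j (phi h0) (lie (V l) (V k) (phi h0))).
Proof.
move=> va vc sa sc fa fc; rewrite pformE; last exact: lie_tangent.
rewrite (pull_lie va vc sa sc fa fc) -bsumBm /bsum /tsum -[RHS]big_split; apply: eq_bigr => j _ /=.
have lg := form1_lin (p := phi h0) (fg j); have sT := @tangent_subspace R M (phi h0).
have tl k l : tangent (phi h0) (lie (V l) (V k) (phi h0)) by exact: lie_tangent.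
rewrite (linear_onD lg); last 2 first.
- by apply: tan_sumc => k; exact: tanZ.
- by apply: tan_sumc => k; apply: tan_sumc => l; exact: tanZ.
rewrite mulrDr; congr (_ + _).
  rewrite (sum_on _ lg sT) // mulr_sumr; apply: eq_bigr => k _; by rewrite mulrA.
have -> : \sum_k \sum_l (c k h0 * a l h0) *: lie (V l) (V k) (phi h0) = \sum_k 1 *: (\sum_l (c k h0 * a l h0) *: lie (V l) (V k) (phi h0)).
  by apply: eq_bigr => k _; rewrite scale1r.
rewrite (sum_on (fun=> 1) lg sT); last by move=> k; exact: (sum_in _ sT).
rewrite mulr_sumr; apply: eq_bigr => k _; rewrite mul1r (sum_on _ lg sT) // mulr_sumr.
by apply: eq_bigr => l _; rewrite !mulrA.
Qed.

(** Derivatives of the coefficients meet the family only through its symmetric pairings [gs]; what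
    remains is trilinear in the coefficients, with the structure functions of the family. *)
Lemma pull_tex U1 a1 U2 a2 U3 a3 h0 : is_vfield U1 -> is_vfield U2 -> is_vfield U3 ->
  (forall j, smooth_fun (a1 j)) -> (forall j, smooth_fun (a2 j)) -> (forall j, smooth_fun (a3 j)) ->
  famd U1 a1 h0 -> famd U2 a2 h0 -> famd U3 a3 h0 ->
  let gs j k := gam j (phi h0) (V k (phi h0)) + gam k (phi h0) (V j (phi h0)) in
  tex U1 (pform a1) U2 (pform a2) U3 (pform a3) h0 =
   bsum (fun j => U1 h0 (a2 j)) (a3^~ h0) gs - bsum (fun j => U2 h0 (a1 j)) (a3^~ h0) gs
   + bsum (fun j => U3 h0 (a1 j)) (a2^~ h0) gs
   + tsum (a1^~ h0) (a2^~ h0) (a3^~ h0) (fun j k l => tex (V j) (gam j) (V k) (gam k) (V l) (gam l) (phi h0)).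
Proof.
move=> v1 v2 v3 s1 s2 s3 f1 f2 f3 gs.
rewrite /tex (pull_deriv v1 v3 s2 s3 f1 f3) (pull_deriv v2 v3 s1 s3 f2 f3) (pull_deriv v3 v2 s1 s2 f3 f2).
rewrite (pull_form_lie a2 v1 v3 s1 s3 f1 f3) (pull_form_lie a1 v2 v3 s2 s3 f2 f3) (pull_form_lie a3 v1 v2 s1 s2 f1 f2).
set x1 := a1^~ h0; set x2 := a2^~ h0; set x3 := a3^~ h0.
set g := (fun j k => G j k (phi h0)).
have gE x y : bsum x y gs = bsum x y g + bsum y x g by rewrite (bsumC y x) bsumDr.
rewrite !gE.
rewrite [tsum x2 x3 x1 _]tsum_231 [tsum x1 x3 x2 _]tsum_132 [tsum x2 x3 x1 _]tsum_231 [tsum x1 x3 x2 _]tsum_132 [tsum x3 x2 x1 _]tsum_321.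
have -> : tsum x1 x2 x3 (fun j k l => V j (phi h0) (ev1 (gam k) (V l)) - gam k (phi h0) (lie (V j) (V l) (phi h0))
    - V k (phi h0) (ev1 (gam j) (V l)) + V l (phi h0) (ev1 (gam j) (V k))
    + gam j (phi h0) (lie (V k) (V l) (phi h0)) + gam l (phi h0) (lie (V j) (V k) (phi h0)))
  = tsum x1 x2 x3 (fun j k l => V j (phi h0) (G k l)) - tsum x1 x2 x3 (fun j k l => gam k (phi h0) (lie (V j) (V l) (phi h0)))
   - tsum x1 x2 x3 (fun j k l => V k (phi h0) (G j l)) + tsum x1 x2 x3 (fun j k l => V l (phi h0) (G j k))
   + tsum x1 x2 x3 (fun j k l => gam j (phi h0) (lie (V k) (V l) (phi h0)))
   + tsum x1 x2 x3 (fun j k l => gam l (phi h0) (lie (V j) (V k) (phi h0))).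
  by rewrite !tsumN !tsumD.
ring.
Qed.

Lemma fam_form3 (Th : form3 M) U1 a1 U2 a2 U3 a3 h0 : is_form3 Th -> famd U1 a1 h0 -> famd U2 a2 h0 -> famd U3 a3 h0 ->
  Th (phi h0) (tmap phi (U1 h0)) (tmap phi (U2 h0)) (tmap phi (U3 h0)) =
  tsum (a1^~ h0) (a2^~ h0) (a3^~ h0) (fun j k l => Th (phi h0) (V j (phi h0)) (V k (phi h0)) (V l (phi h0))).
Proof.
move=> [/(_ (phi h0)) [h1 h2] _] /nbhs_singleton -> /nbhs_singleton -> /nbhs_singleton ->.
have sT := @tangent_subspace R M (phi h0).
have l2 u w : tangent (phi h0) u -> tangent (phi h0) w -> linear_on (tangent (phi h0)) (fun v => Th (phi h0) u v w).
  move=> tu tw k v v' tv tv'; have [-> _] := h2 _ _ _ tu (tan_linc k tv tv') tw.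
  rewrite (h1 _ _ tu tw k v v' tv tv'); have [-> _] := h2 _ _ _ tu tv tw; have [-> _] := h2 _ _ _ tu tv' tw; ring.
have l3 u v : tangent (phi h0) u -> tangent (phi h0) v -> linear_on (tangent (phi h0)) (fun w => Th (phi h0) u v w).
  move=> tu tv k w w' tw tw'; have [_ ->] := h2 _ _ _ tu tv (tan_linc k tw tw').
  rewrite (l2 _ _ tu tv k w w' tw tw'); have [_ ->] := h2 _ _ _ tu tv tw; have [_ ->] := h2 _ _ _ tu tv tw'; ring.
have tS (a : I -> R) : tangent (phi h0) (\sum_j a j *: V j (phi h0)) by apply: (sum_in _ sT) => j; exact: tV.
rewrite (sum_on _ (h1 _ _ (tS _) (tS _)) sT) // /tsum; apply: eq_bigr => j _.
rewrite (sum_on _ (l2 _ _ (tV j _) (tS _)) sT) // mulr_sumr; apply: eq_bigr => k _.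
rewrite (sum_on _ (l3 _ _ (tV j _) (tV k _)) sT) // !mulr_sumr; apply: eq_bigr => l _.
by rewrite !mulrA.
Qed.

End Pull.

Section TexLinear.
Variables (R : realType) (H : mfd R).
Hypothesis okH : mfd_ok H.

(** [option bool] is a three-element type that indexes the slots of [tex]. The families p, q, r, s
    will be the parts at t, at s, at Phi and from sigma. *)
Lemma tex_split h0 (U1 U2 U3 : H -> tvec H) (b p q r s : option bool -> form1 H) :
  is_vfield U1 -> is_vfield U2 -> is_vfield U3 ->
  (forall i, is_form1 (b i)) -> (forall i, is_form1 (p i)) -> (forall i, is_form1 (q i)) ->
  (forall i, is_form1 (r i)) -> (forall i, is_form1 (s i)) ->
  (\forall h \near h0, forall i X, tangent h X -> b i h X = p i h X - q i h X + r i h X - s i h X) ->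
  let T (z : option bool -> form1 H) := tex U1 (z None) U2 (z (Some true)) U3 (z (Some false)) h0 in
  T b = T p - T q + T r - T s.
Proof.
move=> v1 v2 v3 fb fp fq fr fs E T.
have D U V i : is_vfield U -> is_vfield V -> U h0 (ev1 (b i) V) =
   U h0 (ev1 (p i) V) - U h0 (ev1 (q i) V) + U h0 (ev1 (r i) V) - U h0 (ev1 (s i) V).
  move=> vU vV; have tU := vf_tan h0 vU.
  have sp := ev1_smooth (fp i) vV; have sq := ev1_smooth (fq i) vV; have sr := ev1_smooth (fr i) vV; have ss := ev1_smooth (fs i) vV.
  have s1 := smooth_sub okH sp sq; have s2 := smooth_add okH s1 sr.
  rewrite -(tan_sub okH tU sp sq) -(tan_add tU s1 sr) -(tan_sub okH tU s2 ss).
  apply: (tan_local okH tU (ev1_smooth (fb i) vV) (smooth_sub okH s2 ss)).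
  by apply: filterS E => h Eh; rewrite /ev1 Eh //; exact: vf_tan.
have B U V i : is_vfield U -> is_vfield V -> b i h0 (lie U V h0) =
   p i h0 (lie U V h0) - q i h0 (lie U V h0) + r i h0 (lie U V h0) - s i h0 (lie U V h0).
  by move=> vU vV; apply: (nbhs_singleton E); exact: lie_tangent.
rewrite /T /tex !D // !B //; ring.
Qed.

End TexLinear.

(** * The Courant pairing at t and at s, compared with [tex] on H *)

Section SideTerms.
Variables (R : realType) (K : lie_group_data R) (Omega : form2 (prod_mfd K K)) (Theta : form3 K).
Variables (G : groupoid_data R) (Phi : arr G -> K) (sigma : form2 (arr G)) (eta : form3 (obj G)).
Hypothesis SS : shifted_symplectic Omega Theta.
Hypothesis LM : lagrangian_morphism Omega Theta Phi sigma eta.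
Local Notation e := (lone K).
Local Notation H := (arr G).
Local Notation N := (obj G).
Local Notation s := (@src R G).
Local Notation t := (@tgt R G).
Local Notation tge := (@tangent R K e).
Local Notation EP := (@Epair R K Omega G).
Local Notation kp := (kpair Omega).
Local Notation Lk := (@lieK R K G).
Local Notation cp := (@courant_pair R K Omega G eta).
Local Notation d := (mdim K).
Local Notation Ev := (Evec K G).

Let GD : is_lie_groupoid G := lm_groupoid LM.
Let okK : mfd_ok K := ss_ok SS.
Let okN : mfd_ok N := gd_okN GD.
Let okH : mfd_ok H := gd_okH GD.

Section Side.
Variables (phi : H -> N) (I : finType) (c : I -> N -> Ev).
Hypotheses (sphi : sm phi) (sc : forall j, is_Esection (c j)).
Local Notation V := (fun j x => (c j x).1.1).
Local Notation gam := (fun j x => (c j x).1.2).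
Let vV j : is_vfield (V j). Proof. exact: Es_v. Qed.
Let fg j : is_form1 (gam j). Proof. exact: Es_a. Qed.
Let kc j : ksm (fun x => (c j x).2). Proof. exact: Es_w. Qed.
Let tc j x : tge ((c j x).2). Proof. by have [h _] := kc j. Qed.

Variables (kap : 'I_d -> K -> R) (W : 'I_d -> tvec K).
Hypotheses (sk : forall i, smooth_fun (kap i)) (tW : forall i, tge (W i)).
Hypothesis exW : forall w, tge w -> w = \sum_i w (kap i) *: W i.

Definition kcf (a : I -> H -> R) : 'I_d -> H -> R := fun m h => \sum_j a j h * (c j (phi h)).2 (kap m).

Lemma kcf_smooth a : (forall j, smooth_fun (a j)) -> forall m, smooth_fun (kcf a m).
Proof.
move=> sa m; apply: (smooth_sum okH) => j; apply: (smooth_mul okH) => //.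
by have [_ hp] := sphi; have [_ hk] := kc j; exact: (hp _ (hk _ (sk m))).
Qed.

Lemma kcfE a h m : (\sum_j a j h *: (c j (phi h)).2) (kap m) = kcf a m h.
Proof. by rewrite tvec_sumE. Qed.

Definition Gc h j k := EP (c j (phi h)) (c k (phi h)).

(** <[[., .]], .> for combinations of the c_j along phi with coefficients on H: the Leibniz terms of
    the coefficients, weighted by pairings, and the trilinear term. *)
Definition side U1 a1 U2 a2 U3 a3 (h0 : H) : R :=
  bsum (fun j => U1 h0 (a2 j)) (a3^~ h0) (Gc h0) - bsum (fun j => U2 h0 (a1 j)) (a3^~ h0) (Gc h0)
  + bsum (fun j => U3 h0 (a1 j)) (a2^~ h0) (Gc h0)
  + tsum (a1^~ h0) (a2^~ h0) (a3^~ h0) (fun j k l => cp (c j) (c k) (c l) (phi h0)).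

(** The contribution of the k-components to [side], in a fixed basis of the Lie algebra so that it
    can be compared with the terms at Phi. *)
Definition kside U1 a1 U2 a2 U3 a3 (h0 : H) : R :=
  let kk m n := kp (W m) (W n) in
  bsum (fun m => U1 h0 (kcf a2 m)) (fun n => kcf a3 n h0) kk - bsum (fun m => U2 h0 (kcf a1 m)) (fun n => kcf a3 n h0) kk
  + bsum (fun m => U3 h0 (kcf a1 m)) (fun n => kcf a2 n h0) kk
  + tsum (fun m => kcf a1 m h0) (fun m => kcf a2 m h0) (fun m => kcf a3 m h0) (fun l m n => ctri Omega (W l) (W m) (W n)).

Lemma sum_kp x y (w w' : I -> tvec K) : (forall j, tge (w j)) -> (forall j, tge (w' j)) ->
  kp (\sum_j x j *: w j) (\sum_k y k *: w' k) = bsum x y (fun j k => kp (w j) (w' k)).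
Proof.
move=> tw tw'; have sT := @tangent_subspace R K e.
have ts : tge (\sum_k y k *: w' k) by exact: (sum_in _ sT).
rewrite (sum_on _ (kpair_lin SS ts) sT) //; apply: eq_bigr => j _.
rewrite (sum_on _ (kp_linr SS (tw j)) sT) // mulr_sumr; apply: eq_bigr => k _; ring.
Qed.

(** The product rule for the coefficients in W: the derivative of the section c itself produces the
    [lieK] terms of the Courant bracket. *)
Lemma kterm U a2 a3 a h0 : is_vfield U -> (forall j, smooth_fun (a2 j)) -> famd phi V U a h0 ->
  bsum (fun m => U h0 (kcf a2 m)) (fun n => kcf a3 n h0) (fun m n => kp (W m) (W n)) =
  bsum (fun j => U h0 (a2 j)) (a3^~ h0) (fun j k => kp (c j (phi h0)).2 (c k (phi h0)).2)
  + tsum (a2^~ h0) (a3^~ h0) (a^~ h0) (fun j k l => kp (Lk (V l) (fun x => (c j x).2) (phi h0)) (c k (phi h0)).2).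
Proof.
move=> vU sa2 fU; have tU := vf_tan h0 vU.
have tL l j : tge (Lk (V l) (fun x => (c j x).2) (phi h0)).
  by have [h _] := lieK_ksm LM (vV l) (kc j); exact: h.
have [_ hp] := sphi.
have sT := @tangent_subspace R K e.
pose A1 := \sum_j U h0 (a2 j) *: (c j (phi h0)).2.
pose A2 := \sum_j a2 j h0 *: (\sum_l a l h0 *: Lk (V l) (fun x => (c j x).2) (phi h0)).
pose B := \sum_k a3 k h0 *: (c k (phi h0)).2.
have tA1 : tge A1 by exact: (sum_in _ sT).
have tS j : tge (\sum_l a l h0 *: Lk (V l) (fun x => (c j x).2) (phi h0)) by exact: (sum_in _ sT).
have tA2 : tge A2 by exact: (sum_in _ sT).
have tB : tge B by exact: (sum_in _ sT).
have UE m : U h0 (kcf a2 m) = (A1 + A2) (kap m).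
  have sj j : smooth_fun (fun h => (c j (phi h)).2 (kap m)).
    by have [_ hk] := kc j; exact: (hp _ (hk _ (sk m))).
  have s2 j : smooth_fun (fun h => a2 j h * (c j (phi h)).2 (kap m)) by exact: smooth_mul.
  rewrite /kcf (tan_sum okH _ tU s2) tvecD /A1 /A2 !tvec_sumE -big_split; apply: eq_bigr => j _ /=.
  rewrite (tan_mul tU (sa2 j) (sj j)) tvecZ tvec_sumE; congr (_ + _ * _).
  have [_ hk] := kc j; have -> := fam_apply fU (hk _ (sk m)).
  by apply: eq_bigr => l _; rewrite tvecZ.
transitivity (kp (A1 + A2) B).
  rewrite (kp_expand SS tW exW (tanD tA1 tA2) tB); apply: eq_bigr => m _; apply: eq_bigr => n _.
  by rewrite UE /B kcfE.
rewrite (linear_onD (kpair_lin SS tB) tA1 tA2); congr (_ + _); first exact: sum_kp.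
rewrite sum_kp // /tsum /bsum; apply: eq_bigr => j _; apply: eq_bigr => k _.
rewrite (sum_on _ (kpair_lin SS (tc k _)) sT) // mulr_sumr; apply: eq_bigr => l _; ring.
Qed.

Lemma ktri a1 a2 a3 h0 :
  tsum (fun m => kcf a1 m h0) (fun m => kcf a2 m h0) (fun m => kcf a3 m h0) (fun l m n => ctri Omega (W l) (W m) (W n)) =
  tsum (a1^~ h0) (a2^~ h0) (a3^~ h0) (fun j k l => ctri Omega (c j (phi h0)).2 (c k (phi h0)).2 (c l (phi h0)).2).
Proof.
have sT := @tangent_subspace R K e.
pose A a := \sum_j a j h0 *: (c j (phi h0)).2.
have tA a : tge (A a) by exact: (sum_in _ sT).
transitivity (ctri Omega (A a1) (A a2) (A a3)).
  rewrite (ctri_expand SS tW exW) //; do 3 (apply: eq_bigr => ? _); by rewrite /A !kcfE.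
rewrite {1}/A (sum_on _ (ctri_lin1 SS (tA _) (tA _)) sT) //; apply: eq_bigr => j _.
rewrite {1}/A (sum_on _ (ctri_lin2 SS (tc _ _) (tA _)) sT) // mulr_sumr; apply: eq_bigr => k _.
rewrite {1}/A (sum_on _ (ctri_lin3 SS (tc _ _) (tc _ _)) sT) // !mulr_sumr; apply: eq_bigr => l _; ring.
Qed.

Lemma side_tex U1 a1 U2 a2 U3 a3 h0 : is_vfield U1 -> is_vfield U2 -> is_vfield U3 ->
  (forall j, smooth_fun (a1 j)) -> (forall j, smooth_fun (a2 j)) -> (forall j, smooth_fun (a3 j)) ->
  famd phi V U1 a1 h0 -> famd phi V U2 a2 h0 -> famd phi V U3 a3 h0 ->
  tex U1 (pform phi gam a1) U2 (pform phi gam a2) U3 (pform phi gam a3) h0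
  + eta (phi h0) (tmap phi (U1 h0)) (tmap phi (U2 h0)) (tmap phi (U3 h0))
  + kside U1 a1 U2 a2 U3 a3 h0 = side U1 a1 U2 a2 U3 a3 h0.
Proof.
move=> v1 v2 v3 s1 s2 s3 f1 f2 f3.
rewrite (pull_tex okH okN sphi vV fg v1 v2 v3 s1 s2 s3 f1 f2 f3).
rewrite (fam_form3 vV (lm_eta LM) f1 f2 f3) /kside (kterm a3 v1 s2 f1) (kterm a3 v2 s1 f2) (kterm a2 v3 s1 f3) ktri.
rewrite /side.
have -> : tsum (a1^~ h0) (a2^~ h0) (a3^~ h0) (fun j k l => cp (c j) (c k) (c l) (phi h0)) =
   tsum (a1^~ h0) (a2^~ h0) (a3^~ h0) (fun j k l => tex (V j) (gam j) (V k) (gam k) (V l) (gam l) (phi h0))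
   + tsum (a1^~ h0) (a2^~ h0) (a3^~ h0) (fun j k l => eta (phi h0) (V j (phi h0)) (V k (phi h0)) (V l (phi h0)))
   + (tsum (a1^~ h0) (a2^~ h0) (a3^~ h0) (fun j k l => kp (Lk (V l) (fun x => (c j x).2) (phi h0)) (c k (phi h0)).2)
     + tsum (a2^~ h0) (a3^~ h0) (a1^~ h0) (fun j k l => kp (Lk (V l) (fun x => (c j x).2) (phi h0)) (c k (phi h0)).2)
     - tsum (a1^~ h0) (a3^~ h0) (a2^~ h0) (fun j k l => kp (Lk (V l) (fun x => (c j x).2) (phi h0)) (c k (phi h0)).2)
     + tsum (a1^~ h0) (a2^~ h0) (a3^~ h0) (fun j k l => ctri Omega (c j (phi h0)).2 (c k (phi h0)).2 (c l (phi h0)).2)).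
  rewrite [tsum (a2^~ h0) (a3^~ h0) _ _]tsum_231 [tsum _ (a3^~ h0) (a2^~ h0) _]tsum_132 tsumN !tsumD.
  by apply: eq_tsum => j k l; exact: (cpE SS LM).
have GE x y : bsum x y (Gc h0) = bsum x y (fun j k => gam j (phi h0) (V k (phi h0)) + gam k (phi h0) (V j (phi h0)))
    + bsum x y (fun j k => kp (c j (phi h0)).2 (c k (phi h0)).2).
  by rewrite bsumDr.
rewrite !GE; set kc2 := (fun j k => kp (c j (phi h0)).2 (c k (phi h0)).2).
set g2 := (fun j k => gam j (phi h0) (V k (phi h0)) + gam k (phi h0) (V j (phi h0))).
ring.
Qed.

End Side.

Lemma Ev_sum1 (I : finType) (a : I -> R) (z : I -> Ev) : (\sum_j a j *: z j).1.1 = \sum_j a j *: (z j).1.1.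
Proof. by elim/big_rec2: _ => [|j y1 y2 _ <-]; rewrite ?EvE1. Qed.
Lemma Ev_sum2 (I : finType) (a : I -> R) (z : I -> Ev) X : (\sum_j a j *: z j).1.2 X = \sum_j a j * (z j).1.2 X.
Proof. by elim/big_rec2: _ => [|j y1 y2 _ <-]; rewrite ?EvE2. Qed.
Lemma Ev_sum3 (I : finType) (a : I -> R) (z : I -> Ev) : (\sum_j a j *: z j).2 = \sum_j a j *: (z j).2.
Proof. by elim/big_rec2: _ => [|j y1 y2 _ <-]; rewrite ?EvE3. Qed.
Lemma tmap_sumc (M P : mfd R) (F : M -> P) (I : finType) (a : I -> R) (v : I -> tvec M) :
  tmap F (\sum_j a j *: v j) = \sum_j a j *: tmap F (v j).
Proof. by elim/big_rec2: _ => [|j y1 y2 _ <-]; [exact: tmap0 | exact: tmap_lin]. Qed.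

(** For contractions of sigma the terms of [tex] are those of Cartan's formula for d sigma. *)
Lemma tex_sigma U1 U2 U3 h0 : is_vfield U1 -> is_vfield U2 -> is_vfield U3 ->
  let sg (U : H -> tvec H) : form1 H := fun h => restr (tangent h) (sigma h (U h)) in
  tex U1 (sg U1) U2 (sg U2) U3 (sg U3) h0 = dform2 sigma U1 U2 U3 h0.
Proof.
move=> v1 v2 v3 sg.
have sgE U Z h : tangent h Z -> sg U h Z = sigma h (U h) Z by move=> tZ; rewrite /sg /restr asboolT.
have eE U V : is_vfield V -> ev1 (sg U) V = ev2 sigma U V.
  by move=> vV; apply/funext => h; rewrite /ev1 sgE //; exact: vf_tan.
have tl U V : is_vfield U -> is_vfield V -> tangent h0 (lie U V h0) by move=> vU vV; exact: lie_tangent.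
rewrite /tex /dform2 /koszul2 !eE // !sgE; try exact: tl.
rewrite /ev2 /vact.
rewrite (sg_anti LM (tl _ _ v1 v2) (vf_tan h0 v3)) (sg_anti LM (tl _ _ v1 v3) (vf_tan h0 v2)) (sg_anti LM (tl _ _ v2 v3) (vf_tan h0 v1)).
ring.
Qed.

Section Master.
Variables (I J : finType) (c : I -> N -> Ev) (c' : J -> N -> Ev).
Hypotheses (sc : forall j, is_Esection (c j)) (sc' : forall j, is_Esection (c' j)).

(* (U, b) with its partner (e1, e2) in R written in families of sections of E at t and at s. *)
Definition relR_lift (h0 : H) (U : H -> tvec H) (b : form1 H) (a : I -> H -> R) (a' : J -> H -> R) : Prop :=
  [/\ is_vfield U, is_form1 b, forall j, smooth_fun (a j), forall j, smooth_fun (a' j) &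
   \forall h \near h0, relR' Omega Phi sigma h (U h) (b h) (\sum_j a j h *: c j (t h)) (\sum_j a' j h *: c' j (s h))].

(* The relation R writes b as a difference of one-forms pulled back along t, s and Phi, minus
   the contraction of sigma, so that tex splits; the terms at Phi cancel by the brackets of the
   invariant fields of K and by [lm_d_sigma]. *)
Lemma tex_relR h0 U1 b1 a1 a1' U2 b2 a2 a2' U3 b3 a3 a3' :
  relR_lift h0 U1 b1 a1 a1' -> relR_lift h0 U2 b2 a2 a2' -> relR_lift h0 U3 b3 a3 a3' ->
  tex U1 b1 U2 b2 U3 b3 h0 = side t c U1 a1 U2 a2 U3 a3 h0 - side s c' U1 a1' U2 a2' U3 a3' h0.
Proof.
move=> m1 m2 m3; have [kap [W [sk tW dW exW]]] := lie_basis SS.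
have sms := gd_sm_s GD; have smt := gd_sm_t GD; have smP := lm_sm_Phi SS LM.
have [v1 f1 s1 s1' _] := m1; have [v2 f2 s2 s2' _] := m2; have [v3 f3 s3 s3' _] := m3.
(* Index set of the trivialising sections of TK + T^*K: [inl] carries the k-components at t, [inr]
   those at s. *)
pose L := ('I_d + 'I_d)%type.
pose bl (x : L) := if x is inl _ then true else false.
pose ix (x : L) := match x with inl m => m | inr m => m end.
pose VK (x : L) := tsv (bl x) (W (ix x)).
pose gK (x : L) := tsf Omega (bl x) (W (ix x)).
have vK x : is_vfield (VK x) by exact: (tsv_vf SS).
have fK x : is_form1 (gK x) by exact: (tsf_form SS).
pose co (a : I -> H -> R) (a' : J -> H -> R) (x : L) : H -> R :=
  match x with inl m => kcf t c kap a m | inr m => kcf s c' kap a' m end.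
have sco a a' : (forall j, smooth_fun (a j)) -> (forall j, smooth_fun (a' j)) -> forall x, smooth_fun (co a a' x).
  by move=> sa sa' [m|m]; [exact: (kcf_smooth smt sc sk sa) | exact: (kcf_smooth sms sc' sk sa')].
have tge1 (a : I -> R) x : tge (\sum_j a j *: (c j x).2).
  by apply: (sum_in _ (tangent_subspace e)) => j; have [h _] := Es_w (sc j); exact: h.
have tge2 (a : J -> R) x : tge (\sum_j a j *: (c' j x).2).
  by apply: (sum_in _ (tangent_subspace e)) => j; have [h _] := Es_w (sc' j); exact: h.
have ft U b a a' : relR_lift h0 U b a a' -> famd t (fun j x => (c j x).1.1) U a h0.
  by move=> [_ _ _ _]; apply: filterS => h [_ h1 _ _ _]; rewrite -h1 Ev_sum1.
have fs U b a a' : relR_lift h0 U b a a' -> famd s (fun j x => (c' j x).1.1) U a' h0.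
  by move=> [_ _ _ _]; apply: filterS => h [_ _ h1 _ _]; rewrite -h1 Ev_sum1.
have fP U b a a' : relR_lift h0 U b a a' -> famd Phi VK U (co a a') h0.
  move=> [_ _ _ _]; apply: filterS => h [_ _ _ -> _]; rewrite !Ev_sum3 big_sumType /=.
  rewrite (exW _ (tge1 (a^~ h) (t h))) (exW _ (tge2 (a'^~ h) (s h))) !tmap_sumc -sumrN.
  congr (_ + _); apply: eq_bigr => m _; first by rewrite kcfE.
  by rewrite kcfE /VK /tsv /= scalerN.
pose pick (T : Type) (x y z : T) (i : option bool) := match i with None => x | Some true => y | Some false => z end.
pose sg (U : H -> tvec H) : form1 H := fun h => restr (tangent h) (sigma h (U h)).
have fsg U : is_vfield U -> is_form1 (sg U).
  move=> vU; split.
    move=> h; have tU := vf_tan h vU; split; last by move=> v nv; rewrite /sg /restr asboolF.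
    by move=> k u v tu tv; rewrite /sg /restr !asboolT //; [exact: (sg_linr LM) | exact: tan_linc].
  move=> X vX; rewrite (_ : ev1 _ X = ev2 sigma U X); first by have [_ hs] := lm_sigma LM; exact: hs.
  by apply/funext => h; rewrite /ev1 /sg /restr asboolT //; exact: vf_tan.
pose p a := pform t (fun j x => (c j x).1.2) a; pose q a' := pform s (fun j x => (c' j x).1.2) a'.
pose r a a' := pform Phi gK (co a a').
have bE U b a a' : relR_lift h0 U b a a' -> \forall h \near h0, forall X, tangent h X ->
    b h X = p a h X - q a' h X + r a a' h X - sg U h X.
  move=> [_ _ _ _]; apply: filterS => h [_ _ _ _ hb] X tX; rewrite hb // /p /q /r !pformE // !Ev_sum2.
  have tPX := tan_TP SS LM tX; have sT := @tangent_subspace R K e.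
  rewrite !Ev_sum3 big_sumType /= {1}(exW _ (tge1 (a^~ h) (t h))) {1}(exW _ (tge2 (a'^~ h) (s h))).
  rewrite (sum_on _ (muf_lin1 SS tPX) sT tW) (sum_on _ (nuf_lin1 SS tPX) sT tW).
  rewrite /sg /restr asboolT //; congr (_ + (_ + _) - _); apply: eq_bigr => m _; by rewrite kcfE.
have fp a : (forall j, smooth_fun (a j)) -> is_form1 (p a).
  by apply: (pform_form okH okN smt) => j; exact: Es_a.
have fq a' : (forall j, smooth_fun (a' j)) -> is_form1 (q a').
  by apply: (pform_form okH okN sms) => j; exact: Es_a.
have fr a a' : (forall j, smooth_fun (a j)) -> (forall j, smooth_fun (a' j)) -> is_form1 (r a a').
  by move=> sa sa'; apply: (pform_form okH okK smP fK); exact: sco.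
have E := @tex_split R H okH h0 U1 U2 U3 (pick _ b1 b2 b3) (pick _ (p a1) (p a2) (p a3))
  (pick _ (q a1') (q a2') (q a3')) (pick _ (r a1 a1') (r a2 a2') (r a3 a3')) (pick _ (sg U1) (sg U2) (sg U3)) v1 v2 v3.
rewrite /= in E; rewrite {}E; last 6 first.
- by case=> [[]|].
- by case=> [[]|]; exact: fp.
- by case=> [[]|]; exact: fq.
- by case=> [[]|]; exact: fr.
- by case=> [[]|]; exact: fsg.
- near=> h; case=> [[]|] X tX /=.
  + by have : forall X, tangent h X -> b2 h X = p a2 h X - q a2' h X + r a2 a2' h X - sg U2 h X by [near: h; exact: bE]; exact.
  + by have : forall X, tangent h X -> b3 h X = p a3 h X - q a3' h X + r a3 a3' h X - sg U3 h X by [near: h; exact: bE]; exact.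
  + by have : forall X, tangent h X -> b1 h X = p a1 h X - q a1' h X + r a1 a1' h X - sg U1 h X by [near: h; exact: bE]; exact.
have St := side_tex smt sc sk tW exW v1 v2 v3 s1 s2 s3 (ft _ _ _ _ m1) (ft _ _ _ _ m2) (ft _ _ _ _ m3).
have Ss := side_tex sms sc' sk tW exW v1 v2 v3 s1' s2' s3' (fs _ _ _ _ m1) (fs _ _ _ _ m2) (fs _ _ _ _ m3).
have D := lm_d_sigma LM v1 v2 v3 h0; rewrite /ev3 /pull3 -(tex_sigma h0 v1 v2 v3) -/(sg U1) -/(sg U2) -/(sg U3) in D.
(* At Phi pairings and structure functions are constant: [ts_pair] and [texTE] give the terms at t
   with sign +, those at s with sign -, and nothing mixed. *)
suff P : tex U1 (r a1 a1') U2 (r a2 a2') U3 (r a3 a3') h0 + Theta (Phi h0) (tmap Phi (U1 h0)) (tmap Phi (U2 h0)) (tmap Phi (U3 h0))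
    = kside t c kap W U1 a1 U2 a2 U3 a3 h0 - kside s c' kap W U1 a1' U2 a2' U3 a3' h0.
  rewrite /p /q; lra.
rewrite (pull_tex okH okK smP vK fK v1 v2 v3 (sco _ _ s1 s1') (sco _ _ s2 s2') (sco _ _ s3 s3') (fP _ _ _ _ m1) (fP _ _ _ _ m2) (fP _ _ _ _ m3)).
rewrite (fam_form3 vK (ss_Theta SS) (fP _ _ _ _ m1) (fP _ _ _ _ m2) (fP _ _ _ _ m3)) -addrA tsumD.
have B (x y : L -> R) : bsum x y (fun j k => gK j (Phi h0) (VK k (Phi h0)) + gK k (Phi h0) (VK j (Phi h0))) =
   bsum (x \o inl) (y \o inl) (fun m n => kp (W m) (W n)) - bsum (x \o inr) (y \o inr) (fun m n => kp (W m) (W n)).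
  rewrite (@eq_bsum _ _ x x y y _ (fun j k => if bl j == bl k then sgb R (bl j) * kp (W (ix j)) (W (ix k)) else 0)) //; last first.
    by move=> j k; exact: (ts_pair SS).
  rewrite bsum_inlr //; congr (_ + _).
    by apply: eq_bsum => // m n; rewrite /= /sgb mul1r.
  rewrite /bsum -sumrN; apply: eq_bigr => m _; rewrite -sumrN; apply: eq_bigr => n _ /=; rewrite /sgb; ring.
have T (x y z : L -> R) : tsum x y z (fun j k l => tex (VK j) (gK j) (VK k) (gK k) (VK l) (gK l) (Phi h0) + Theta (Phi h0) (VK j (Phi h0)) (VK k (Phi h0)) (VK l (Phi h0)))
   = tsum (x \o inl) (y \o inl) (z \o inl) (fun l m n => ctri Omega (W l) (W m) (W n))
    - tsum (x \o inr) (y \o inr) (z \o inr) (fun l m n => ctri Omega (W l) (W m) (W n)).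
  rewrite (@eq_tsum _ _ x y z _ (fun j k l => if (bl j == bl k) && (bl k == bl l) then sgb R (bl j) * ctri Omega (W (ix j)) (W (ix k)) (W (ix l)) else 0)); last first.
    by move=> j k l; exact: (texTE SS).
  rewrite tsum_inlr //; congr (_ + _).
    by apply: eq_tsum => l m n; rewrite /= /sgb mul1r.
  by rewrite tsumN; apply: eq_tsum => l m n /=; rewrite /sgb mulN1r.
rewrite !B T /kside; ring.
Unshelve. all: by end_near.
Qed.

End Master.
End SideTerms.

Section Sums2.
Variables (R : realType) (I J : finType).

Lemma bsum_bsum (x y : I -> R) (p q : I -> J -> R) g :
  bsum x y (fun i j => bsum (p i) (q j) g) = bsum (fun k => \sum_i x i * p i k) (fun l => \sum_j y j * q j l) g.
Proof.
transitivity (\sum_i \sum_j \sum_k \sum_l (x i * p i k) * (y j * q j l) * g k l).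
  apply: eq_bigr => i _; apply: eq_bigr => j _; rewrite mulr_sumr; apply: eq_bigr => k _.
  by rewrite mulr_sumr; apply: eq_bigr => l _; ring.
under eq_bigr => i _ do rewrite exchange_big; rewrite exchange_big; apply: eq_bigr => k _.
under eq_bigr => i _ do rewrite exchange_big; rewrite exchange_big; apply: eq_bigr => l _.
rewrite mulr_suml mulr_suml; apply: eq_bigr => i _; rewrite mulr_sumr mulr_suml.
by apply: eq_bigr => j _.
Qed.

Lemma tsum_tsum (x y z : I -> R) (p q r : I -> J -> R) T :
  tsum x y z (fun i j k => tsum (p i) (q j) (r k) T) =
  tsum (fun l => \sum_i x i * p i l) (fun m => \sum_j y j * q j m) (fun n => \sum_k z k * r k n) T.
Proof.
rewrite /tsum.
transitivity (\sum_l \sum_i \sum_j \sum_k \sum_m \sum_n x i * p i l * (y j * q j m) * (z k * r k n) * T l m n).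
  rewrite [RHS]exchange_big; apply: eq_bigr => i _; rewrite [RHS]exchange_big; apply: eq_bigr => j _.
  rewrite [RHS]exchange_big; apply: eq_bigr => k _; rewrite mulr_sumr; apply: eq_bigr => l _.
  rewrite mulr_sumr; apply: eq_bigr => m _; rewrite mulr_sumr; apply: eq_bigr => n _; ring.
apply: eq_bigr => l _.
have -> : \sum_i \sum_j \sum_k \sum_m \sum_n x i * p i l * (y j * q j m) * (z k * r k n) * T l m n
  = \sum_m \sum_n \sum_i \sum_j \sum_k x i * p i l * (y j * q j m) * (z k * r k n) * T l m n.
  rewrite [RHS](_ : _ = \sum_m \sum_i \sum_n \sum_j \sum_k x i * p i l * (y j * q j m) * (z k * r k n) * T l m n); last first.
    by apply: eq_bigr => m _; exact: exchange_big.
  rewrite [RHS]exchange_big; apply: eq_bigr => i _.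
  rewrite [RHS](_ : _ = \sum_m \sum_j \sum_n \sum_k x i * p i l * (y j * q j m) * (z k * r k n) * T l m n); last first.
    by apply: eq_bigr => m _; exact: exchange_big.
  rewrite [RHS]exchange_big; apply: eq_bigr => j _.
  rewrite [RHS](_ : _ = \sum_m \sum_k \sum_n x i * p i l * (y j * q j m) * (z k * r k n) * T l m n); last first.
    by apply: eq_bigr => m _; exact: exchange_big.
  by rewrite [RHS]exchange_big.
apply: eq_bigr => m _; apply: eq_bigr => n _; rewrite !mulr_suml; apply: eq_bigr => i _.
rewrite [X in _ = X * _ * _]mulr_sumr !mulr_suml; apply: eq_bigr => j _.
by rewrite [X in _ = X * _]mulr_sumr mulr_suml; apply: eq_bigr => k _.
Qed.

End Sums2.

(** * The quasi-Poisson structure *)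

Lemma differential_cot (R : realType) (M : mfd R) (p : M) (f : M -> R) : cotangent p (differential p f).
Proof.
split; last by move=> v nv; rewrite /differential /restr asboolF.
by move=> k u v tu tv; rewrite /differential /restr !asboolT //; exact: tan_linc.
Qed.

Lemma cot_lin (R : realType) (M : mfd R) (h : M) (k : R) (b b' : fnl (tvec M)) : cotangent h b -> cotangent h b' -> cotangent h (k *: b + b').
Proof.
move=> [l z] [l' z']; split.
  move=> a u v tu tv; change (k * b (a *: u + v) + b' (a *: u + v) = a * (k * b u + b' u) + (k * b v + b' v)).
  by rewrite l // l' //; ring.
by move=> v nv; change (k * b v + b' v = 0); rewrite z // z' // mulr0 addr0.
Qed.

Section Complement.
Variables (R : realType) (K : lie_group_data R) (Omega : form2 (prod_mfd K K)) (Theta : form3 K).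
Variables (G : groupoid_data R) (Phi : arr G -> K) (sigma : form2 (arr G)) (eta : form3 (obj G)).
Hypothesis SS : shifted_symplectic Omega Theta.
Hypothesis LM : lagrangian_morphism Omega Theta Phi sigma eta.
Local Notation H := (arr G).
Local Notation N := (obj G).
Local Notation s := (@src R G).
Local Notation t := (@tgt R G).
Local Notation inv := (@ginv R G).
Local Notation embs := (emb Phi sigma).
Local Notation EP := (@Epair R K Omega G).
Local Notation cp := (@courant_pair R K Omega G eta).
Local Notation Ev := (Evec K G).
Local Notation relR'' := (@relR' R K Omega G Phi sigma).
Local Notation right_field := (@right_field R G).
Variable C : N -> set Ev.
Hypothesis IC : isotropic_complement Omega Phi sigma C.
Local Notation cpt := (cpoint Omega Phi sigma C).
Local Notation cfr := (cframe Omega Phi sigma C).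
Local Notation embu u := (fun y : N => embs y (u y)).
Local Notation d_ f := (fun h : H => differential h f).
Local Notation rf u f := (fun j h => right_field (u j) h f).

Let GD : is_lie_groupoid G := lm_groupoid LM.
Let okN : mfd_ok N := gd_okN GD.
Let okH : mfd_ok H := gd_okH GD.
Let sms := gd_sm_s GD. Let smt := gd_sm_t GD.

(** The sections of a local frame lie in C only near their base point, and the Courant pairing at x
    depends only on germs at x. *)
Definition Cnear (x : N) (xi : N -> Ev) : Prop := is_Esection xi /\ \forall y \near x, C y (xi y).

Lemma cframe_near x0 r (c : 'I_r -> N -> Ev) u : cfr x0 c u -> \forall x \near x0, cfr x c u.
Proof. by move=> [h1 h2 h3 /near_join h4]; near=> x; split => //; near: x. Unshelve. all: by end_near. Qed.

Lemma cframe_Cnear x r (c : 'I_r -> N -> Ev) u : cfr x c u -> forall i, Cnear x (c i).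
Proof. by move=> [h1 _ _ h4] i; split => //; apply: filterS h4 => y [h _ _ _]. Qed.

Lemma cframe_cpoint x r (c : 'I_r -> N -> Ev) u : cfr x c u -> cpt c u x.
Proof. by move=> [_ _ _ h4]; exact: (nbhs_singleton h4). Qed.

Lemma Cnear_EP0 x xi xi' v : Cnear x xi -> Cnear x xi' -> tangent x v -> v (fun y => EP (xi y) (xi' y)) = 0.
Proof.
move=> [s1 n1] [s2 n2] tv; rewrite -(tan_cst okN 0 tv).
apply: (tan_local okN tv (EP_smooth SS LM s1 s2) (smooth_cst okN 0)).
by apply: filterS2 n1 n2 => y c1 c2; have [_ _ _ iso] := IC; exact: (iso _ _ _ c1 c2).
Qed.

Lemma cp_Canti12 x z1 z2 z3 : Cnear x z1 -> Cnear x z2 -> is_Esection z3 -> cp z1 z2 z3 x = - cp z2 z1 z3 x.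
Proof.
move=> c1 c2 s3; have [s1 _] := c1; have [s2 _] := c2.
have := cp_anti12 SS LM x s1 s2 s3; rewrite (Cnear_EP0 c1 c2 (vf_tan x (Es_v s3))) => /eqP.
by rewrite addr_eq0 => /eqP.
Qed.
Lemma cp_Canti23 x z1 z2 z3 : is_Esection z1 -> Cnear x z2 -> Cnear x z3 -> cp z1 z2 z3 x = - cp z1 z3 z2 x.
Proof.
move=> s1 c2 c3; have [s2 _] := c2; have [s3 _] := c3.
have := cp_anti23 SS LM x s1 s2 s3; rewrite (Cnear_EP0 c2 c3 (vf_tan x (Es_v s1))) => /eqP.
by rewrite addr_eq0 => /eqP.
Qed.

Lemma cp_fib z1 z2 x : is_Esection z1 -> is_Esection z2 ->
  exists v, Efib x v /\ forall z3, is_Esection z3 -> cp z1 z2 z3 x = EP v (z3 x).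
Proof.
move=> s1 s2; have [v [Fv v1 v2 hv]] := cbr_ex SS LM x s1 s2; exists v; split => // z3 s3.
exact: cp_val.
Qed.

(** * Computations in one dual frame *)

Section OneFrame.
Variables (x : N) (r : nat) (c : 'I_r -> N -> Ev) (u : 'I_r -> N -> tvec H).
Hypothesis hF : cfr x c u.

Definition coor (v : Ev) (j : 'I_r) : R := EP v (embs x (u j x)).
Let sc j : is_Esection (c j). Proof. by have [h _ _ _] := hF. Qed.
Let cN j : Cnear x (c j). Proof. exact: (cframe_Cnear hF). Qed.
Let pt := cframe_cpoint hF.

Lemma cp_expand3 z1 z2 xi : is_Esection z1 -> is_Esection z2 -> Cnear x xi ->
  cp z1 z2 xi x = \sum_j coor (xi x) j * cp z1 z2 (c j) x.
Proof.
move=> s1 s2 [s3 /nbhs_singleton c3]; have [v [Fv hv]] := cp_fib x s1 s2; rewrite hv //.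
have [_ _ ex _] := pt.
rewrite {1}(ex _ c3) (sum_on _ (EP_linr SS Fv) (Efib_subspace K x)); last by move=> j; have [h _ _ _] := sc j; exact: h.
by apply: eq_bigr => j _; rewrite hv.
Qed.

Lemma cp_expand23 z xi2 xi3 : is_Esection z -> Cnear x xi2 -> Cnear x xi3 ->
  cp z xi2 xi3 x = bsum (coor (xi2 x)) (coor (xi3 x)) (fun i j => cp z (c i) (c j) x).
Proof.
move=> s1 c2 c3; have [s2 _] := c2; rewrite (cp_expand3 s1 s2 c3) bsumC; apply: eq_bigr => j _.
rewrite (cp_Canti23 s1 c2 (cN j)) (cp_expand3 s1 (sc j) c2) -sumrN mulr_sumr; apply: eq_bigr => i _.
by rewrite (cp_Canti23 s1 (cN j) (cN i)); ring.
Qed.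

Lemma cp_expand123 xi1 xi2 xi3 : Cnear x xi1 -> Cnear x xi2 -> Cnear x xi3 ->
  cp xi1 xi2 xi3 x = tsum (coor (xi1 x)) (coor (xi2 x)) (coor (xi3 x)) (fun i j k => cp (c i) (c j) (c k) x).
Proof.
move=> c1 c2 c3; have [s1 _] := c1; have [s2 _] := c2; have [s3 _] := c3.
have E : cp xi1 xi2 xi3 x = \sum_i coor (xi1 x) i * cp (c i) xi2 xi3 x.
  rewrite (cp_Canti12 c1 c2 s3) (cp_Canti23 s2 c1 c3) opprK (cp_expand3 s2 s3 c1); apply: eq_bigr => i _.
  by rewrite (cp_Canti12 (cN i) c2 s3) (cp_Canti23 s2 (cN i) c3) opprK.
rewrite E /tsum; apply: eq_bigr => i _; rewrite (cp_expand23 (sc i) c2 c3) mulr_sumr; apply: eq_bigr => j _.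
by rewrite mulr_sumr; apply: eq_bigr => k _; ring.
Qed.

(** Change of frames: the values of a functional on u are recovered from those on u' through the
    coordinates of c'. This makes [chi3] and [dsec] independent of the chosen frames. *)
Lemma dual_coor (f : fnl (tvec H)) r' (c' : 'I_r' -> N -> Ev) (u' : 'I_r' -> N -> tvec H) j :
  dual (algd x) f -> cfr x c' u' -> \sum_i f (u' i x) * coor (c' i x) j = f (u j x).
Proof.
move=> [lf _] hF'; have [_ _ _ exA] := cframe_cpoint hF'; have [_ su _ _] := hF; have [au _] := su j.
have [_ su' _ _] := hF'; have au' i : algd x (u' i x) by have [h _] := su' i; exact: h.
rewrite [in RHS](exA _ (au x)) (sum_on _ lf (algd_subspace x)) //; apply: eq_bigr => i _; exact: mulrC.
Qed.

Let au j : algd x (u j x). Proof. by have [_ h _ _] := hF; have [h' _] := h j; exact: h'. Qed.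
Let su j : is_Esection (embu (u j)). Proof. by apply: (emb_Esection SS LM); have [_ h _ _] := hF. Qed.
Let Fc j : Efib x (c j x). Proof. by have [h _ _ _] := sc j; exact: h. Qed.
Let Fu j : Efib x (embs x (u j x)). Proof. exact: (emb_fib SS LM). Qed.

(** v is the sum of an algebroid part and a part in C. Both summands of E are isotropic, so pairings
    with u_m see only the part in C and pairings with c_m only the algebroid part. *)
Lemma Efib_split v w : Efib x v -> Efib x w ->
  EP v w = \sum_m (EP v (embs x (u m x)) * EP (c m x) w + EP v (c m x) * EP (embs x (u m x)) w).
Proof.
move=> Fv Fw; have [_ sp _ iso] := IC; have [a aa Ck] := sp _ _ Fv; set k := v - embs x a in Ck.
have Fa := emb_fib SS LM aa; have Fk := C_fib IC Ck; have [Cc _ exC exA] := pt.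
have lz z : Efib x z -> EP v z = EP (embs x a) z + EP k z.
  by move=> Fz; rewrite -[in LHS](subrK (embs x a) v) -/k addrC (linear_onD (EP_lin SS Fz) Fa Fk).
have la : linear_on (algd x) (fun a => EP (embs x a) w).
  move=> b a1 a2 h1 h2; rewrite (emb_lin LM b h1 h2); apply: (EP_lin SS Fw); exact: (emb_fib SS LM).
rewrite big_split /= lz // [RHS]addrC; congr (_ + _).
  rewrite {1}(exA _ aa) (sum_on _ la (algd_subspace x) au); apply: eq_bigr => m _.
  by rewrite lz // (iso _ _ _ Ck (Cc m)) addr0 (EPC SS Fa (Fc m)).
rewrite {1}(exC _ Ck) (sum_on _ (EP_lin SS Fw) (Efib_subspace K x) Fc).
by apply: eq_bigr => m _; rewrite lz // (emb_isotropic SS LM aa (au m)) add0r.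
Qed.

(* Freezing the coefficients at x turns the multilinear identity for the functions
   <[[c i, c j]], c k> into the Jacobi identity of four isotropic sections. *)
Definition csum (a : 'I_r -> R) : N -> Ev := fun y => \sum_j a j *: c j y.
Lemma csum_Cnear a : Cnear x (csum a).
Proof.
split; first by apply: (Esec_sum LM (a := fun j _ => a j)) => // j; exact: smooth_cst.
have [_ _ _ n] := hF; apply: filterS n => y [h _ _ _].
exact: (sum_in _ (C_sub IC y)).
Qed.
Lemma csum_pair a m : \forall y \near x, EP (csum a y) (embs y (u m y)) = a m.
Proof.
have [_ su' _ n] := hF; apply: filterS n => y [h1 h2 _ _].
have au' : algd y (u m y) by have [h' _] := su' m; exact: h'.
rewrite (sum_on _ (EP_lin SS (emb_fib SS LM au')) (Efib_subspace K y)); last by move=> j; exact: (C_fib IC (h1 j)).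
by rewrite (bigD1 m) //= h2 eqxx mulr1 big1 ?addr0 // => j nj; rewrite h2 (negbTE nj) mulr0.
Qed.
Lemma csum_coor a : coor (csum a x) = a.
Proof. by apply/funext => m; exact: (nbhs_singleton (csum_pair a m)). Qed.

(** With constant coefficients the pairings with u_m are constant near x, so the defects of
    antisymmetry vanish and the arguments may be rotated although [embu (u m)] does not lie in C. *)
Lemma csum_emb_rot a b m : cp (csum a) (csum b) (embu (u m)) x = cp (embu (u m)) (csum a) (csum b) x.
Proof.
have [sa _] := csum_Cnear a; have [sb _] := csum_Cnear b.
have z v z1 : is_Esection z1 -> tangent x v -> (exists k, \forall y \near x, EP (z1 y) (embs y (u m y)) = k) ->
    v (fun y => EP (z1 y) (embs y (u m y))) = 0.
  move=> s1 tv [k n]; rewrite -(tan_cst okN k tv).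
  exact: (tan_local okN tv (EP_smooth SS LM s1 (su m)) (smooth_cst okN k) n).
have h1 := cp_anti23 SS LM x sa sb (su m); have h2 := cp_anti12 SS LM x sa (su m) sb.
rewrite z // in h1; [ | exact: (vf_tan x (Es_v sa)) | by exists (b m); exact: csum_pair].
rewrite z // in h2; [ | exact: (vf_tan x (Es_v sb)) | by exists (a m); exact: csum_pair].
lra.
Qed.

Lemma cp_rot z1 z2 z3 : Cnear x z1 -> Cnear x z2 -> Cnear x z3 -> cp z1 z2 z3 x = cp z3 z1 z2 x.
Proof.
move=> c1 c2 c3; have [s1 _] := c1; have [s2 _] := c2.
by rewrite (cp_Canti23 s1 c2 c3) (cp_Canti12 c1 c3 s2) opprK.
Qed.

(** One of the two terms of <[[., .]], [[., .]]> in dual bases: the part in C of the first bracket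
    paired with the algebroid part of the second. *)
Definition dual_pair_sum a1 a2 a3 a4 : R :=
  \sum_m cp (embu (u m)) (csum a1) (csum a2) x * cp (c m) (csum a3) (csum a4) x.

Lemma bracket_pair_csum a1 a2 a3 a4 : bracket_pair Omega eta (csum a1) (csum a2) (csum a3) (csum a4) x = dual_pair_sum a1 a2 a3 a4 + dual_pair_sum a3 a4 a1 a2.
Proof.
have c1 := csum_Cnear a1; have c2 := csum_Cnear a2; have c3 := csum_Cnear a3; have c4 := csum_Cnear a4.
have [s1 _] := c1; have [s2 _] := c2; have [s3 _] := c3; have [s4 _] := c4.
have [v [Fv v1 v2 hv]] := cbr_ex SS LM x s1 s2; have [w [Fw w1 w2 hw]] := cbr_ex SS LM x s3 s4.
rewrite /bracket_pair hv; last exact: (lie_vfield okN (Es_v s3) (Es_v s4)).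
rewrite hw; last exact: (lie_vfield okN (Es_v s1) (Es_v s2)).
rewrite -v1 -w1 -v2 -w2 -/(EP v w) (Efib_split Fv Fw) /dual_pair_sum -big_split; apply: eq_bigr => m _ /=.
rewrite (EPC SS (Fc m) Fw) (EPC SS (Fu m) Fw).
rewrite -(cp_val (su m) v1 v2 hv) -(cp_val (sc m) v1 v2 hv).
rewrite -(cp_val (su m) w1 w2 hw) -(cp_val (sc m) w1 w2 hw).
have aux (p p' q q' k k' l l' : R) : p = p' -> q = q' -> k = k' -> l = l' -> p * k + q * l = p' * k' + l' * q'.
  by move=> -> -> -> ->; rewrite [q' * _]mulrC.
exact: (aux _ _ _ _ _ _ _ _ (csum_emb_rot a1 a2 m) (cp_rot c1 c2 (cN m)) (cp_rot c3 c4 (cN m)) (csum_emb_rot a3 a4 m)).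
Qed.

Lemma csum_jacobi a1 a2 a3 a4 : let z := csum in
  (z a1 x).1.1 (cp (z a2) (z a3) (z a4)) - (z a2 x).1.1 (cp (z a1) (z a3) (z a4))
  + (z a3 x).1.1 (cp (z a1) (z a2) (z a4)) - (z a4 x).1.1 (cp (z a1) (z a2) (z a3)) =
  dual_pair_sum a1 a2 a3 a4 + dual_pair_sum a3 a4 a1 a2 - (dual_pair_sum a1 a3 a2 a4 + dual_pair_sum a2 a4 a1 a3) + (dual_pair_sum a1 a4 a2 a3 + dual_pair_sum a2 a3 a1 a4).
Proof.
have [s1 _] := csum_Cnear a1; have [s2 _] := csum_Cnear a2; have [s3 _] := csum_Cnear a3; have [s4 _] := csum_Cnear a4.
by rewrite /= (cp_jacobi SS LM x s1 s2 s3 s4) !bracket_pair_csum.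
Qed.

End OneFrame.

Definition left_field (u : N -> tvec H) : H -> tvec H := fun h => left_ext h (tmap inv (u (s h))).
Local Notation lf u f := (fun j h => - left_field (u j) h f).

(** u^r is related by R to (u, 0) with zero covector, and the pairings of u with frames of C are
    smooth, so [relR_field] applies. *)
Lemma right_field_vf u : is_section u -> is_vfield (right_field u).
Proof.
move=> su; have [au _] := su; have se := emb_Esection SS LM su.
apply: (relR_field SS LM IC (b := fun=> 0) (e1 := fun h => embs (t h) (u (t h))) (e2 := fun=> 0)).
- by move=> h; exact: (relR_right SS LM (au (t h))).
- exact: form1_0.
- move=> h0 r c w [sc _ _ _] j; apply: (smooth_fun_at _ okH).
  by have [_ ht] := smt; exact: (ht _ (EP_smooth SS LM se (sc j))).
move=> h0 r c w [sc _ _ _] j; rewrite (_ : (fun h => _) = fun=> 0); first exact: smooth_at_cst.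
by apply/funext => h; apply: (EP0l (x := s h) SS); have [h' _ _ _] := sc j; exact: h'.
Qed.

Lemma left_field_vf u : is_section u -> is_vfield (left_field u).
Proof.
move=> su; have [au _] := su; have se := emb_Esection SS LM su.
apply: (relR_field SS LM IC (b := fun=> 0) (e2 := fun h => embs (s h) (u (s h))) (e1 := fun=> 0)).
- by move=> h; exact: (relR_left SS LM (au (s h))).
- exact: form1_0.
- move=> h0 r c w [sc _ _ _] j; rewrite (_ : (fun h => _) = fun=> 0); first exact: smooth_at_cst.
  by apply/funext => h; apply: (EP0l (x := t h) SS); have [h' _ _ _] := sc j; exact: h'.
move=> h0 r c w [sc _ _ _] j; apply: (smooth_fun_at _ okH).
by have [_ hs] := sms; exact: (hs _ (EP_smooth SS LM se (sc j))).
Qed.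

(** * The bivector field and its Hamiltonian fields *)

Variables (Uof : H -> fnl (tvec H) -> tvec H) (E1of E2of : H -> fnl (tvec H) -> Ev).
Hypothesis hD : forall h b, cotangent h b ->
  [/\ C (t h) (E1of h b), C (s h) (E2of h b) & relR'' h (Uof h b) b (E1of h b) (E2of h b)].

Definition bivec : mvec2 H := fun h b a => a (Uof h b).
Definition ham (f : H -> R) : H -> tvec H := fun h => Uof h (differential h f).

Let dc (f : H -> R) h : cotangent h (differential h f) := differential_cot h f.

Lemma U_tan h b : cotangent h b -> tangent h (Uof h b).
Proof. by move=> cb; have [_ _ [[]]] := hD cb. Qed.

Lemma U_uniq h b U e1 e2 : C (t h) e1 -> C (s h) e2 -> relR'' h U b e1 e2 -> cotangent h b ->
  [/\ Uof h b = U, E1of h b = e1 & E2of h b = e2].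
Proof.
move=> C1 C2 r cb; have [D1 D2 r'] := hD cb; apply: (relR_uniq SS LM IC r' r).
  by rewrite -scaleN1r addrC; exact: (C_linc IC).
by rewrite -scaleN1r addrC; exact: (C_linc IC).
Qed.

Lemma U_lin h k b b' : cotangent h b -> cotangent h b' -> cotangent h (k *: b + b') ->
  Uof h (k *: b + b') = k *: Uof h b + Uof h b'.
Proof.
move=> cb cb' ck; have [D1 D2 r] := hD cb; have [D1' D2' r'] := hD cb'.
by have [] := U_uniq (C_linc IC k D1 D1') (C_linc IC k D2 D2') (relR'_lin SS LM k r r') ck.
Qed.

Lemma bivec_anti h b b' : cotangent h b -> cotangent h b' -> bivec h b b' = - bivec h b' b.
Proof.
move=> cb cb'; have [D1 D2 r] := hD cb; have [D1' D2' r'] := hD cb'; have [_ _ _ iso] := IC.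
have := relR'_iso SS LM r' r; rewrite (iso _ _ _ D1' D1) (iso _ _ _ D2' D2) subrr => /eqP.
by rewrite addr_eq0 => /eqP.
Qed.

Lemma bivec_alt h : alt2 (cotangent h) (bivec h).
Proof.
split; last by move=> b b' cb cb'; exact: bivec_anti.
move=> a ca k b b' cb cb'; rewrite /bivec (U_lin cb cb' (cot_lin k cb cb')).
by have [l _] := ca; rewrite l //; exact: U_tan.
Qed.

Lemma bivec_graph h U b : graph_sharp bivec h U b <-> relR_comp Omega Phi sigma C h U b.
Proof.
split.
  move=> [tU cb hU]; have [D1 D2 r] := hD cb.
  have -> : U = Uof h b.
    apply: (tan_eq tU (U_tan cb)) => f sf; have := hU _ (dc f h).
    by rewrite /bivec !differentialE //; exact: U_tan.
  by exists (E1of h b), (E2of h b); split => //; apply/(relRP SS LM).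
move=> [e1 [e2 [C1 C2 /(relRP SS LM) r]]]; have [[tU cb _ _] _ _ _ _] := r; split => // a ca.
by rewrite /bivec; have [-> _ _] := U_uniq C1 C2 r cb.
Qed.

Lemma dev2E f g h : dev2 bivec f g h = ham f h g.
Proof. by rewrite /dev2 /bivec differentialE //; exact: U_tan. Qed.

Lemma ham_anti f g h : ham f h g = - ham g h f.
Proof. by rewrite -!dev2E /dev2 (bivec_anti (dc f h) (dc g h)). Qed.

(** The covector is smooth, and the pairings of [E1of] and [E2of] with frames of C vanish near h0;
    so [relR_field] gives smoothness although [Uof] is a pointwise selection. *)
Lemma ham_vf f : smooth_fun f -> is_vfield (ham f).
Proof.
move=> sf; have [_ _ _ iso] := IC.
apply: (relR_field SS LM IC (b := d_ f) (e1 := fun h => E1of h (differential h f)) (e2 := fun h => E2of h (differential h f))).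
- by move=> h; have [] := hD (dc f h).
- exact: differential_form.
- move=> h0 r c u hc j; apply: (@smooth_at_near _ _ okH h0 (fun=> 0)); last exact: smooth_at_cst.
  have [ct _] := smt; have [_ _ _ n] := hc.
  have n' : \forall h \near h0, cpt c u (t h) := ct h0 _ n.
  apply: filterS n' => h [Cc _ _ _]; have [D1 _ _] := hD (dc f h).
  by rewrite (iso _ _ _ D1 (Cc j)).
move=> h0 r c u hc j; apply: (@smooth_at_near _ _ okH h0 (fun=> 0)); last exact: smooth_at_cst.
have [cs _] := sms; have [_ _ _ n] := hc.
have n' : \forall h \near h0, cpt c u (s h) := cs h0 _ n.
apply: filterS n' => h [Cc _ _ _]; have [_ D2 _] := hD (dc f h).
by rewrite (iso _ _ _ D2 (Cc j)).
Qed.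

Lemma ham_smooth f g : smooth_fun f -> smooth_fun g -> smooth_fun (dev2 bivec f g).
Proof.
move=> sf sg; rewrite (_ : dev2 bivec f g = (fun h => ham f h g)); first exact: vf_smooth (ham_vf sf) sg.
by apply/funext => h; exact: dev2E.
Qed.

Lemma bivec_bivector : is_bivector_field bivec.
Proof. by split; [exact: bivec_alt | exact: ham_smooth]. Qed.

(** If (a1, b1, g1) annihilates the graph of m, then by [relR_mul] and uniqueness the vectors of a1
    and b1 are composable and their product is the vector of - g1. Evaluating (a2, b2, g2) on this
    pair gives the claim. *)
Lemma bivec_multiplicative : @Defs.multiplicative R G bivec.
Proof.
move=> q a1 a2 b1 b2 g1 g2 ca1 cb1 cg1 ca2 cb2 cg2 h1 h2.
set g := cpr1 q in ca1 ca2 *; set k := cpr2 q in cb1 cb2 *; set m := gm q in cg1 cg2 *.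
have E : s g = t k := comp_st GD q.
have [A1 A2 ra] := hD ca1; have [B1 B2 rb] := hD cb1.
have tE v w : tangent g v -> tangent k w -> tmap s v = tmap t w ->
    exists x, [/\ tangent q x, tmap (@cpr1 R G) x = v, tmap (@cpr2 R G) x = w & tmap (@gm R G) x = tmul g k v w].
  move=> tv tw ev; have [q' [z [e1 e2 tz [f1 f2 f3]]]] := tmul_ex GD E tv tw ev.
  have eq : q' = q by apply: (cm_inj (gd_cpb GD)); rewrite ?e1 ?e2.
  by rewrite eq in tz; exists z.
have [|eU r] := relR_mul SS LM IC E ra rb A2 B1 cg1.
- move=> v w tv tw ev; have [x [tx e1 e2 e3]] := tE _ _ tv tw ev.
  by have := h1 _ tx; rewrite e1 e2 e3 => h; apply/eqP; rewrite -addr_eq0 addrC; apply/eqP.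
have [[tUa _ _ _] _ _ _ _] := ra; have [[tUb _ _ _] _ _ _ _] := rb.
have [x [tx e1 e2 e3]] := tE _ _ tUa tUb eU; have := h2 _ tx; rewrite e1 e2 e3.
have cm : cotangent m (- g1) by have [[_ + _ _] _ _ _ _] := r.
have C1 : C (t m) (E1of g a1) by rewrite /m /gm (gd_tgt_mul GD E).
have C2 : C (s m) (E2of k b1) by rewrite /m /gm (gd_src_mul GD E).
have [Um _ _] := U_uniq C1 C2 r cm.
have := U_lin (k := -1) cg1 (cot0 m) (cot_lin _ cg1 (cot0 m)); rewrite addr0 scaleN1r Um.
have U0 : Uof m 0 = 0.
  have := U_lin (k := 1) (cot0 m) (cot0 m) (cot_lin _ (cot0 m) (cot0 m)); rewrite scaler0 addr0 scale1r => /eqP.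
  by rewrite -subr_eq0 opprD addNKr oppr_eq0 => /eqP.
rewrite U0 addr0 scaleN1r => Ug; rewrite /bivec -/g -/k -/m => h.
have [lg _] := cg2; have -> : g2 (Uof m g1) = - g2 (tmul g k (Uof g a1) (Uof k b1)).
  by rewrite Ug -[- Uof m g1]scaleN1r (linear_onZ (-1) lg (tan0 m) (U_tan cg1)) mulN1r opprK.
lra.
Qed.

Lemma pair_right f u h : is_section u -> EP (E1of h (differential h f)) (embs (t h) (u (t h))) = right_field u h f.
Proof.
move=> su; have [au _] := su; have [_ _ r] := hD (dc f h).
by rewrite -(relR_pair_right SS LM r (au (t h))) differentialE //; exact: (vf_tan h (right_field_vf su)).
Qed.
Lemma pair_left f u h : is_section u -> EP (E2of h (differential h f)) (embs (s h) (u (s h))) = - left_field u h f.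
Proof.
move=> su; have [au _] := su; have [_ _ r] := hD (dc f h).
have := relR_pair_left SS LM r (au (s h)); rewrite differentialE; last exact: (vf_tan h (left_field_vf su)).
by rewrite /left_field => ->; rewrite opprK.
Qed.

(** The coordinates of e1 in c are its pairings with u_j, which by isotropy of R equal df(u_j^r);
    likewise at s with i(u'_j)^l, where a sign enters. *)
Lemma ham_relR_lift f h0 r c u r' c' u' : smooth_fun f -> cfr (t h0) (r := r) c u -> cfr (s h0) (r := r') c' u' ->
  relR_lift Omega Phi sigma c c' h0 (ham f) (d_ f) (fun j h => right_field (u j) h f) (fun j h => - left_field (u' j) h f).
Proof.
move=> sf [_ su _ n1] [_ su' _ n2]; split.
- exact: ham_vf.
- exact: differential_form.
- by move=> j; exact: vf_smooth (right_field_vf (su j)) sf.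
- by move=> j; apply: (smooth_opp okH); exact: vf_smooth (left_field_vf (su' j)) sf.
have [ct _] := smt; have [cs _] := sms.
have m1 : \forall h \near h0, cpt c u (t h) := ct h0 _ n1.
have m2 : \forall h \near h0, cpt c' u' (s h) := cs h0 _ n2.
apply: filterS2 m1 m2 => h [_ _ ex1 _] [_ _ ex2 _]; have [D1 D2 r0] := hD (dc f h).
rewrite (eq_bigr (fun j => EP (E1of h (differential h f)) (embs (t h) (u j (t h))) *: c j (t h))); last by move=> j _; rewrite pair_right.
rewrite (eq_bigr (fun j => EP (E2of h (differential h f)) (embs (s h) (u' j (s h))) *: c' j (s h))); last by move=> j _; rewrite pair_left.
by rewrite -(ex1 _ D1) -(ex2 _ D2).
Qed.

Local Notation B := (dev2 bivec).

Let hv f (sf : smooth_fun f) : is_vfield (ham f) := ham_vf sf.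
Let BE f g h : B f g h = ham f h g := dev2E f g h.
Let sB f g (sf : smooth_fun f) (sg : smooth_fun g) : smooth_fun (B f g) := ham_smooth sf sg.
Let BA f g h : B f g h = - B g f h. Proof. by rewrite !BE (ham_anti). Qed.
Let BAf f g : B f g = fun h => - B g f h. Proof. by apply/funext => h; exact: BA. Qed.

Lemma ev1_ham f g : smooth_fun g -> ev1 (d_ f) (ham g) = B g f.
Proof. by move=> sg; apply/funext => h; rewrite /ev1 differentialE ?BE //; exact: (vf_tan h (hv sg)). Qed.

Lemma ham_BN f g k h : smooth_fun f -> smooth_fun g -> smooth_fun k -> ham f h (B g k) = - ham f h (B k g).
Proof. by move=> sf sg sk; rewrite (BAf g k) (tan_opp okH (vf_tan h (hv sf))) //; exact: sB. Qed.

Lemma frame_G0 phi (h0 : H) r (c : 'I_r -> N -> Ev) u j k : cfr (phi h0) c u -> Gc Omega phi c h0 j k = 0.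
Proof. by move=> /cframe_cpoint [Cc _ _ _]; have [_ _ _ iso] := IC; exact: (iso _ _ _ (Cc j) (Cc k)). Qed.

(** Both sides reduce to the cyclic sum of {f, {g, k}}. In [koszul2] each term occurs twice, once as
    an action and once as a bracket, which the factor 1/2 compensates. *)
Lemma schouten_tex f g k h0 : smooth_fun f -> smooth_fun g -> smooth_fun k ->
  2^-1 * schouten22 bivec f g k h0 = tex (ham f) (d_ f) (ham g) (d_ g) (ham k) (d_ k) h0.
Proof.
move=> sf sg sk; rewrite /tex !ev1_ham // !differentialE; try exact: (lie_tangent okH _ (hv _) (hv _)).
have V x y : vact (ham x) y = B x y by apply/funext => h; rewrite BE.
rewrite /lie !V /schouten22 /koszul2 (BA (B f g) k) (BA (B f k) g) (BA (B g k) f) !BE.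
rewrite (ham_BN h0 sf sk sg) (ham_BN h0 sg sk sf) (ham_BN h0 sk sg sf) (ham_BN h0 sg sf sk).
have hk : ham k h0 (B g f) = - ham k h0 (B f g) by exact: ham_BN.
set p := ham f h0 (B g k); set q := ham g h0 (B f k); set w := ham k h0 (B f g).
have := hk; rewrite -/w; lra.
Qed.

(** The frames lie in C, so the pairings that weight the Leibniz terms of [side] vanish; only the
    trilinear terms at t and at s remain. *)
Lemma bivec_jacobi f g k h0 r c u r' c' u' : smooth_fun f -> smooth_fun g -> smooth_fun k ->
  cfr (t h0) (r := r) c u -> cfr (s h0) (r := r') c' u' ->
  2^-1 * schouten22 bivec f g k h0 =
  tsum ((rf u f)^~ h0) ((rf u g)^~ h0) ((rf u k)^~ h0) (fun i j l => cp (c i) (c j) (c l) (t h0))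
  - tsum ((lf u' f)^~ h0) ((lf u' g)^~ h0) ((lf u' k)^~ h0) (fun i j l => cp (c' i) (c' j) (c' l) (s h0)).
Proof.
move=> sf sg sk hc hc'; rewrite schouten_tex //.
have [sc _ _ _] := hc; have [sc' _ _ _] := hc'.
have M f1 (sf1 : smooth_fun f1) := ham_relR_lift sf1 hc hc'.
rewrite (tex_relR SS LM sc sc' (M _ sf) (M _ sg) (M _ sk)) /side.
have Z1 x y : bsum x y (Gc Omega t c h0) = 0 by apply: bsum0g => j l; exact: (frame_G0 j l hc).
have Z2 x y : bsum x y (Gc Omega s c' h0) = 0 by apply: bsum0g => j l; exact: (frame_G0 j l hc').
by rewrite !Z1 !Z2; congr (_ - _); rewrite subrr !add0r.
Qed.

Lemma lie_tex w f g h0 : is_section w -> smooth_fun f -> smooth_fun g ->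
  lie_bivector (right_field w) bivec f g h0 = tex (right_field w) (fun=> 0) (ham f) (d_ f) (ham g) (d_ g) h0.
Proof.
move=> sw sf sg; have vw := right_field_vf sw.
have srw x : smooth_fun x -> smooth_fun (vact (right_field w) x) by exact: vf_smooth.
rewrite /tex !ev1_ham // !differentialE; try exact: (lie_tangent okH _ vw (hv _)).
have E0 (X : H -> tvec H) : ev1 (fun=> 0) X = fun=> 0 by [].
rewrite !E0 (tan_cst okH _ (vf_tan h0 (hv sf))) (tan_cst okH _ (vf_tan h0 (hv sg))).
have V x y : vact (ham x) y = B x y by apply/funext => h; rewrite BE.
have F0 Z : (0 : fnl (tvec H)) Z = 0 by [].
rewrite F0 /lie !V /lie_bivector (BA _ g) !BE /vact -/(vact (right_field w) f) -/(vact (right_field w) g); ring.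
Qed.

Lemma right_bivec w f g h0 r c u : is_section w -> smooth_fun f -> smooth_fun g -> cfr (t h0) (r := r) c u ->
  lie_bivector (right_field w) bivec f g h0 =
  bsum ((rf u f)^~ h0) ((rf u g)^~ h0) (fun j l => cp (embu w) (c j) (c l) (t h0)).
Proof.
move=> sw sf sg hc; rewrite lie_tex //.
have [r' [c' [u' hc']]] := dual_frame SS LM IC (s h0).
have [sc _ _ _] := hc; have [sc' _ _ _] := hc'.
(* The family at t is enlarged by the section w: w^r has coefficient 1 on it, and the Hamiltonian
   fields have coefficient 0. *)
pose co (x : 'I_1 + 'I_r) : N -> Ev := match x with inl _ => embu w | inr j => c j end.
have sco x : is_Esection (co x) by case: x => [i|j]; [exact: (emb_Esection SS LM) | exact: sc].
have M f1 (sf1 : smooth_fun f1) : relR_lift Omega Phi sigma co c' h0 (ham f1) (d_ f1)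
    (fun x h => match x with inl _ => 0 | inr j => right_field (u j) h f1 end) (lf u' f1).
  have [v1 v2 v3 v4 n] := ham_relR_lift sf1 hc hc'; split => //.
    by case=> [i|j]; [exact: smooth_cst | exact: v3].
  by apply: filterS n => h; rewrite big_sumType /= big_ord1 scale0r add0r.
have M0 : relR_lift Omega Phi sigma co c' h0 (right_field w) (fun=> 0)
    (fun x h => match x with inl _ => 1 | inr j => 0 end) (fun _ _ => 0).
  split.
  - exact: (right_field_vf).
  - exact: form1_0.
  - by case=> [i|j]; exact: smooth_cst.
  - by move=> j; exact: smooth_cst.
  near=> h; rewrite big_sumType /= big_ord1 scale1r big1 ?addr0; last by move=> j _; rewrite scale0r.
  rewrite big1; last by move=> j _; rewrite scale0r.
  by have [aw _] := sw; exact: (relR_right SS LM (aw (t h))).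
rewrite (tex_relR SS LM sco sc' M0 (M _ sf) (M _ sg)) /side.
have tf := vf_tan h0 (hv sf); have tg := vf_tan h0 (hv sg).
have Z2 x y : bsum x y (Gc Omega s c' h0) = 0 by apply: bsum0g => j l; exact: (frame_G0 j l hc').
have T0 (y z : 'I_r' -> R) T : tsum (fun=> 0) y z T = 0.
  by rewrite /tsum big1 // => i _; rewrite big1 // => j _; rewrite big1 // => l _; rewrite !mul0r.
rewrite !Z2 T0 subrr !addr0 subr0.
have cst0 (v : tvec H) (x : 'I_1 + 'I_r) : tangent h0 v -> v (fun h => match x with inl _ => 1 | inr j => 0 end) = 0.
  by move=> tv; case: x => [i|j]; exact: (tan_cst okH _ tv).
have Z0 (x y : 'I_1 + 'I_r -> R) : (forall j, x j = 0) -> bsum x y (Gc Omega t co h0) = 0.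
  by move=> x0; rewrite /bsum big1 // => j _; rewrite big1 // => l _; rewrite x0 !mul0r.
rewrite (Z0 (fun j => ham f h0 _)); last by move=> j; exact: cst0.
rewrite (Z0 (fun j => ham g h0 _)); last by move=> j; exact: cst0.
rewrite [X in X - 0](_ : _ = 0); last first.
  have tw := vf_tan h0 (right_field_vf sw).
  rewrite /bsum big1 // => -[i|j] _; rewrite big1 // => -[i'|l] _; rewrite ?(tan_cst okH _ tw) ?mul0r ?mulr0 ?mul0r //.
  by rewrite [Gc _ _ _ _ _ _](_ : _ = 0) ?mulr0 //; exact: (frame_G0 j l hc).
rewrite subr0 !add0r /tsum sum_inlr big_ord1 [X in _ + X]big1 ?addr0; last first.
  by move=> j _; rewrite big1 // => k _; rewrite big1 // => l _; rewrite !mul0r.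
rewrite sum_inlr big_ord1 [X in X + _]big1 ?add0r; last by move=> l _; rewrite mulr0 !mul0r.
apply: eq_bigr => j _; rewrite sum_inlr big_ord1 !mulr0 mul0r add0r; apply: eq_bigr => l _.
by rewrite mul1r.
Unshelve. all: by end_near.
Qed.

Variable rr : nat.
Variables (cc : N -> 'I_rr -> N -> Ev) (uu : N -> 'I_rr -> N -> tvec H).
Hypothesis hF : forall x, cfr x (cc x) (uu x).

(** At x the frame chosen at x is used. By [chi3_frame] any dual frame near x gives the same value,
    whence smoothness. *)
Definition chi3 : amv3 G := fun x f1 f2 f3 =>
  tsum (fun i => f1 (uu x i x)) (fun i => f2 (uu x i x)) (fun i => f3 (uu x i x))
    (fun i j k => cp (cc x i) (cc x j) (cc x k) x).

(** The bivector - <[[w, .]], .> on C: the defining formula of d_* takes this form when [cp_anti12]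
    and [cp_anti23] rotate the bracket, see [dsec_flat]. *)
Definition dsec (w : N -> tvec H) : amv2 G := fun x f1 f2 =>
  - bsum (fun i => f1 (uu x i x)) (fun i => f2 (uu x i x)) (fun i j => cp (embu w) (cc x i) (cc x j) x).

Lemma chi3_frame x r (c : 'I_r -> N -> Ev) u f1 f2 f3 : cfr x c u ->
  dual (algd x) f1 -> dual (algd x) f2 -> dual (algd x) f3 ->
  chi3 x f1 f2 f3 = tsum (fun i => f1 (u i x)) (fun i => f2 (u i x)) (fun i => f3 (u i x))
    (fun i j k => cp (c i) (c j) (c k) x).
Proof.
move=> hc d1 d2 d3; rewrite /chi3.
rewrite (eq_tsum _ _ _ (fun i j k => cp_expand123 hc (cframe_Cnear (hF x) i) (cframe_Cnear (hF x) j) (cframe_Cnear (hF x) k))).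
rewrite tsum_tsum; congr (tsum _ _ _ _); apply/funext => j; exact: (dual_coor hc _ _ (hF x)).
Qed.

Lemma dsec_frame w x r (c : 'I_r -> N -> Ev) u f1 f2 : is_section w -> cfr x c u ->
  dual (algd x) f1 -> dual (algd x) f2 ->
  dsec w x f1 f2 = - bsum (fun i => f1 (u i x)) (fun i => f2 (u i x)) (fun i j => cp (embu w) (c i) (c j) x).
Proof.
move=> sw hc d1 d2; rewrite /dsec; congr (- _); have se := emb_Esection SS LM sw.
rewrite (eq_bsum (fun=> erefl) (fun=> erefl) (fun i j => cp_expand23 hc se (cframe_Cnear (hF x) i) (cframe_Cnear (hF x) j))).
rewrite bsum_bsum; congr (bsum _ _ _); apply/funext => j; exact: (dual_coor hc _ _ (hF x)).
Qed.

Lemma right_tr_dual h b : cotangent h b -> dual (algd (t h)) (right_tr h b).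
Proof.
move=> [lb _]; split; last by move=> v nv; rewrite /right_tr /restr asboolF.
move=> k u v au av; rewrite /right_tr /restr !asboolT //; last exact: algd_linc.
rewrite (right_ext_lin GD) // lb //; first by have [] := right_ext_tan GD au.
by have [] := right_ext_tan GD av.
Qed.

Lemma right_trE f u h : is_section u -> right_tr h (differential h f) (u (t h)) = right_field u h f.
Proof.
move=> su; have [au _] := su; rewrite /right_tr /restr asboolT // differentialE //.
exact: (vf_tan h (right_field_vf su)).
Qed.

Local Notation W := (dev3 (@right3 R G chi3)).

Lemma right_chi h r (c : 'I_r -> N -> Ev) u f g k : cfr (t h) c u ->
  W f g k h = tsum ((rf u f)^~ h) ((rf u g)^~ h) ((rf u k)^~ h) (fun i j l => cp (c i) (c j) (c l) (t h)).
Proof.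
move=> hc; have [_ su _ _] := hc.
have dd f' := right_tr_dual (differential_cot h f').
rewrite /dev3 /right3 (chi3_frame hc) //.
by congr (tsum _ _ _ _); apply/funext => j; exact: right_trE.
Qed.

Let tsum_smooth r (x y z : 'I_r -> H -> R) (T : 'I_r -> 'I_r -> 'I_r -> H -> R) :
  (forall i, smooth_fun (x i)) -> (forall i, smooth_fun (y i)) -> (forall i, smooth_fun (z i)) ->
  (forall i j k, smooth_fun (T i j k)) ->
  smooth_fun (fun h => tsum (x^~ h) (y^~ h) (z^~ h) (fun i j k => T i j k h)).
Proof.
move=> sx sy sz sT; do 3 (apply: (smooth_sum okH) => ?); apply: (smooth_mul okH) => //.
by apply: (smooth_mul okH) => //; exact: smooth_mul.
Qed.

Let rf_smooth r (c : 'I_r -> N -> Ev) u x f : cfr x c u -> smooth_fun f -> forall j, smooth_fun (rf u f j).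
Proof. by move=> [_ su _ _] sf j; exact: vf_smooth (right_field_vf (su j)) sf. Qed.

Let cp_smooth_t r (c : 'I_r -> N -> Ev) u x : cfr x c u -> forall i j k, smooth_fun (fun h => cp (c i) (c j) (c k) (t h)).
Proof.
move=> [sc _ _ _] i j k; have [_ ht] := smt; apply: (ht (cp (c i) (c j) (c k))).
exact: (cp_smooth SS LM).
Qed.

Lemma right_chi_near h0 r (c : 'I_r -> N -> Ev) u f g k : cfr (t h0) c u -> \forall h \near h0,
  W f g k h = tsum ((rf u f)^~ h) ((rf u g)^~ h) ((rf u k)^~ h) (fun i j l => cp (c i) (c j) (c l) (t h)).
Proof.
move=> /cframe_near n; have [ct _] := smt.
have n' : \forall h \near h0, cfr (t h) c u := ct h0 _ n.
by apply: filterS n' => h; exact: right_chi.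
Qed.

Lemma right_chi_smooth f g k : smooth_fun f -> smooth_fun g -> smooth_fun k -> smooth_fun (W f g k).
Proof.
move=> sf sg sk; apply/(smooth_funP okH) => h0.
have hc := hF (t h0).
apply: (@smooth_at_near _ _ okH h0 (fun h => tsum ((rf (uu (t h0)) f)^~ h) ((rf (uu (t h0)) g)^~ h) ((rf (uu (t h0)) k)^~ h)
   (fun i j l => cp (cc (t h0) i) (cc (t h0) j) (cc (t h0) l) (t h)))).
  by apply: filterS (right_chi_near f g k hc) => h ->.
apply: (smooth_fun_at _ okH); apply: tsum_smooth; try exact: (rf_smooth hc).
exact: (cp_smooth_t hc).
Qed.

Section AtPoint.
Variables (h0 : H) (r : nat) (c : 'I_r -> N -> Ev) (u : 'I_r -> N -> tvec H).
Hypothesis hc : cfr (t h0) c u.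
Local Notation x0 := (t h0).
Let chi i j k := cp (c i) (c j) (c k) x0.
Let A f : 'I_r -> R := (rf u f)^~ h0.
Let z f := csum c (A f).
Let sc j : is_Esection (c j). Proof. by have [h _ _ _] := hc; exact: h. Qed.
Let su j : is_section (u j). Proof. by have [_ h _ _] := hc; exact: h. Qed.
Let cN j : Cnear x0 (c j). Proof. exact: (cframe_Cnear hc). Qed.
Let zN f : Cnear x0 (z f). Proof. exact: (csum_Cnear hc). Qed.

(** The product rule for chi^r in a frame. The derivative of the structure functions is rewritten as
    that of the Courant pairing of sections with coefficients frozen at h0, the form in which
    [csum_jacobi] uses it. *)
Lemma ham_right_chi f g k l : smooth_fun f -> smooth_fun g -> smooth_fun k -> smooth_fun l ->
  ham f h0 (W g k l) =
   tsum (fun i => ham f h0 (rf u g i)) (A k) (A l) chi + tsum (A g) (fun i => ham f h0 (rf u k i)) (A l) chi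
   + tsum (A g) (A k) (fun i => ham f h0 (rf u l i)) chi + (z f x0).1.1 (cp (z g) (z k) (z l)).
Proof.
move=> sf sg sk sl; have tU := vf_tan h0 (hv sf).
have sA f' : smooth_fun f' -> forall j, smooth_fun (rf u f' j) := rf_smooth hc.
have sch := cp_smooth_t hc.
have p2 i j : smooth_fun (fun h => rf u g i h * rf u k j h) by apply: (smooth_mul okH); exact: sA.
have p3 i j m : smooth_fun (fun h => rf u g i h * rf u k j h * rf u l m h) by apply: (smooth_mul okH) => //; exact: sA.
have p4 i j m : smooth_fun (fun h => rf u g i h * rf u k j h * rf u l m h * cp (c i) (c j) (c m) (t h)) by exact: smooth_mul.
rewrite (tan_local okH tU (right_chi_smooth sg sk sl) (tsum_smooth (sA _ sg) (sA _ sk) (sA _ sl) sch) (right_chi_near _ _ _ hc)).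
have [_ /nbhs_singleton E] : True /\ \forall h \near h0, tmap t (ham f h) = (\sum_j rf u f j h *: c j (t h)).1.1.
  split => //; have [r' [c' [u' hc']]] := dual_frame SS LM IC (s h0).
  by have [_ _ _ _] := ham_relR_lift sf hc hc'; apply: filterS => h [_ <- _ _ _].
have -> : (z f x0).1.1 (cp (z g) (z k) (z l)) = tsum (A g) (A k) (A l) (fun i j m => ham f h0 (fun h => cp (c i) (c j) (c m) (t h))).
  have scp i j m : smooth_fun (cp (c i) (c j) (c m)) by exact: (cp_smooth SS LM).
  have tz : tangent x0 ((z f x0).1.1) by have [/Es_v v _] := zN f; exact: (vf_tan x0 v).
  have q4 i j m : smooth_fun (fun x => A g i * A k j * A l m * cp (c i) (c j) (c m) x).
    by apply: (smooth_mul okN) => //; exact: smooth_cst.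
  have [sg' _] := zN g; have [sk' _] := zN k; have [sl' _] := zN l.
  rewrite (@tan_local _ _ okN x0 _ _ (fun x => tsum (A g) (A k) (A l) (fun i j m => cp (c i) (c j) (c m) x)) tz (cp_smooth SS LM sg' sk' sl')); last 2 first.
  - by do 3 (apply: (smooth_sum okN) => ?).
  - apply: filterS (cframe_near hc) => x hx.
    by rewrite (cp_expand123 hx (csum_Cnear hx _) (csum_Cnear hx _) (csum_Cnear hx _)) !(csum_coor hx).
  rewrite (tan_sum okN _ tz); last by move=> i; do 2 (apply: (smooth_sum okN) => ?).
  apply: eq_bigr => i _; rewrite (tan_sum okN _ tz); last by move=> j; apply: (smooth_sum okN).
  apply: eq_bigr => j _; rewrite (tan_sum okN _ tz) //; apply: eq_bigr => m _.
  rewrite (tan_scale okN _ tz (scp i j m)); congr (_ * _).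
  by rewrite /z /csum -E (tmapE t _ (scp i j m)).
rewrite /tsum (tan_sum okH _ tU); last by move=> i; do 2 (apply: (smooth_sum okH) => ?).
rewrite -!big_split; apply: eq_bigr => i _ /=; rewrite (tan_sum okH _ tU); last by move=> j; apply: (smooth_sum okH).
rewrite -!big_split; apply: eq_bigr => j _ /=; rewrite (tan_sum okH _ tU) //.
rewrite -!big_split; apply: eq_bigr => m _ /=.
rewrite (tan_mul tU (p3 i j m) (sch i j m)) (tan_mul tU (p2 i j) (sA _ sl m)) (tan_mul tU (sA _ sg i) (sA _ sk j)).
rewrite /A /chi; ring.
Qed.

(** [right_bivec] for u_m computes u_m^r {f, g}: besides derivatives of coefficients it leaves
    <[[u_m, z f]], z g>, and the sum over m is [dual_pair_sum]. *)
Lemma right_chi_bracket f g k l : smooth_fun f -> smooth_fun g ->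
  W (B f g) k l h0 = tsum (fun i => ham f h0 (rf u g i)) (A k) (A l) chi - tsum (fun i => ham g h0 (rf u f i)) (A k) (A l) chi
    + dual_pair_sum x0 c u (A f) (A g) (A k) (A l).
Proof.
move=> sf sg; rewrite (right_chi _ _ _ hc).
have E m : rf u (B f g) m h0 = ham f h0 (rf u g m) - ham g h0 (rf u f m) + cp (embu (u m)) (z f) (z g) x0.
  have := right_bivec (su m) sf sg hc; rewrite /lie_bivector !BE (ham_anti _ g).
  rewrite (cp_expand23 hc (emb_Esection SS LM (su m)) (zN f) (zN g)) !(csum_coor hc) => <-.
  rewrite /vact; ring.
rewrite /dual_pair_sum /tsum -sumrB -big_split; apply: eq_bigr => m _ /=.
rewrite (cp_expand23 hc (sc m) (zN k) (zN l)) !(csum_coor hc) /bsum mulr_sumr -sumrB -big_split.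
apply: eq_bigr => j _ /=; rewrite mulr_sumr -sumrB -big_split; apply: eq_bigr => n _ /=.
rewrite E /A /chi -/(z f) -/(z g); ring.
Qed.

Let anti12 x y w : tsum x y w chi = - tsum y x w chi.
Proof.
rewrite tsum_213 tsumN; apply: eq_tsum => i j k.
exact: (cp_Canti12 (cN j) (cN i) (sc k)).
Qed.
Let anti23 x y w : tsum x y w chi = - tsum x w y chi.
Proof.
rewrite tsum_132 tsumN; apply: eq_tsum => i j k.
exact: (cp_Canti23 (sc i) (cN k) (cN j)).
Qed.

(** Once antisymmetry has put them in a common slot, the derivatives of coefficients cancel; the
    rest is [csum_jacobi] with the coefficients of the four differentials. *)
Lemma right_chi_closed f1 f2 f3 f4 : smooth_fun f1 -> smooth_fun f2 -> smooth_fun f3 -> smooth_fun f4 ->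
  schouten23 bivec (@right3 R G chi3) f1 f2 f3 f4 h0 = 0.
Proof.
move=> s1 s2 s3 s4; rewrite /schouten23 /koszul3 !BE !ham_right_chi // !right_chi_bracket //.
have := csum_jacobi hc (A f1) (A f2) (A f3) (A f4); rewrite /= -!/(z _).
have aux (x y w : 'I_r -> R) : tsum x y w chi = - tsum y x w chi /\ tsum x y w chi = tsum w x y chi.
  by split; [exact: anti12 | rewrite anti23 anti12 opprK].
rewrite (aux (A f2) (fun i => ham f1 h0 (rf u f3 i)) _).1 (aux (A f2) (A f3) (fun i => ham f1 h0 (rf u f4 i))).2.
rewrite (aux (A f1) (fun i => ham f2 h0 (rf u f3 i)) _).1 (aux (A f1) (A f3) (fun i => ham f2 h0 (rf u f4 i))).2.
rewrite (aux (A f1) (fun i => ham f3 h0 (rf u f2 i)) _).1 (aux (A f1) (A f2) (fun i => ham f3 h0 (rf u f4 i))).2.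
rewrite (aux (A f1) (fun i => ham f4 h0 (rf u f2 i)) _).1 (aux (A f1) (A f2) (fun i => ham f4 h0 (rf u f3 i))).2.
(* V stands for derivatives of structure functions, Q for the two-term brackets in dual bases, aij
   for the terms where [ham fi] acts on the coefficients of fj. *)
have key (V1 V2 V3 V4 Q12 Q13 Q14 Q23 Q24 Q34 a12 a13 a14 a21 a23 a24 a31 a32 a34 a41 a42 a43 : R) :
    V1 - V2 + V3 - V4 = Q12 + Q34 - (Q13 + Q24) + (Q14 + Q23) ->
    (a12 - a13 + a14 + V1) - (a21 - a23 + a24 + V2) + (a31 - a32 + a34 + V3) - (a41 - a42 + a43 + V4)
    - (a12 - a21 + Q12) + (a13 - a31 + Q13) - (a14 - a41 + Q14)
    - (a23 - a32 + Q23) + (a24 - a42 + Q24) - (a34 - a43 + Q34) = 0 by lra.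
exact: key.
Qed.

End AtPoint.
Lemma algd_diff_dual x (f : H -> R) : dual (algd (G := G) x) (algd_diff x f).
Proof.
split; last by move=> v nv; rewrite /algd_diff /restr asboolF.
by move=> k u v au av; rewrite /algd_diff /restr !asboolT //; exact: algd_linc.
Qed.

Lemma algd_diffE x (f : H -> R) u : is_section u -> algd_diff (G := G) x f (u x) = u x f.
Proof. by move=> [au _]; rewrite /algd_diff /restr asboolT. Qed.

Lemma flatE x xi v : algd x v -> flat Omega Phi sigma x xi v = EP xi (embs x v).
Proof. by move=> av; rewrite /flat /restr asboolT. Qed.

Lemma chi_section : is_section3 chi3.
Proof.
split.
  move=> x; have cN i := cframe_Cnear (hF x) i; have [sc _ _ _] := hF x; split.
    move=> f2 f3 d2 d3 k f1 f1' d1 d1'; rewrite /chi3 /tsum mulr_sumr -big_split; apply: eq_bigr => i _.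
    rewrite mulr_sumr -big_split; apply: eq_bigr => j _; rewrite mulr_sumr -big_split; apply: eq_bigr => l _ /=.
    rewrite (_ : (k *: f1 + f1') _ = k * f1 (uu x i x) + f1' (uu x i x)) //; ring.
  move=> f1 f2 f3 d1 d2 d3; split; rewrite /chi3 tsumN.
    rewrite -[RHS]tsum_213; apply: eq_tsum => i j l.
    by rewrite (cp_Canti12 (cN i) (cN j) (sc l)).
  rewrite -[RHS]tsum_132; apply: eq_tsum => i j l.
  by rewrite (cp_Canti23 (sc i) (cN j) (cN l)).
move=> f g k sf sg sk; apply/(smooth_funP okN) => x0; have hc := hF x0; have [sc su _ _] := hc.
apply: (@smooth_at_near _ _ okN x0 (fun x => tsum (fun i => uu x0 i x f) (fun i => uu x0 i x g) (fun i => uu x0 i x k)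
  (fun i j l => cp (cc x0 i) (cc x0 j) (cc x0 l) x))).
  apply: filterS (cframe_near hc) => x hx; rewrite (chi3_frame hx) //; try exact: algd_diff_dual.
  by congr (tsum _ _ _ _); apply/funext => i; rewrite algd_diffE.
apply: (smooth_fun_at _ okN); do 3 (apply: (smooth_sum okN) => ?); apply: (smooth_mul okN); last exact: (cp_smooth SS LM).
have ss i f' : smooth_fun f' -> smooth_fun (fun x => uu x0 i x f') by have [_ h] := su i; exact: h.
by apply: (smooth_mul okN); [apply: (smooth_mul okN) | ]; exact: ss.
Qed.

Lemma dsec_section u : is_section u -> is_section2 (dsec u).
Proof.
move=> su0; have se := emb_Esection SS LM su0; split.
  move=> x; have cN i := cframe_Cnear (hF x) i; split.
    move=> f2 d2 k f1 f1' d1 d1'; rewrite /dsec mulrN -opprD; congr (- _).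
    rewrite /bsum mulr_sumr -big_split; apply: eq_bigr => i _.
    rewrite mulr_sumr -big_split; apply: eq_bigr => j _ /=.
    rewrite (_ : (k *: f1 + f1') _ = k * f1 (uu x i x) + f1' (uu x i x)) //; ring.
  move=> f1 f2 d1 d2; rewrite /dsec; congr (- _); rewrite bsumC /bsum -sumrN; apply: eq_bigr => i _.
  rewrite -sumrN; apply: eq_bigr => j _; rewrite (cp_Canti23 se (cN i) (cN j)); ring.
move=> f g sf sg; apply/(smooth_funP okN) => x0; have hc := hF x0; have [sc su _ _] := hc.
apply: (@smooth_at_near _ _ okN x0 (fun x => - bsum (fun i => uu x0 i x f) (fun i => uu x0 i x g)
  (fun i j => cp (embu u) (cc x0 i) (cc x0 j) x))).
  apply: filterS (cframe_near hc) => x hx; rewrite (dsec_frame su0 hx) //; try exact: algd_diff_dual.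
  by congr (- bsum _ _ _); apply/funext => i; rewrite algd_diffE.
apply: (smooth_fun_at _ okN); apply: (smooth_opp okN).
do 2 (apply: (smooth_sum okN) => ?); apply: (smooth_mul okN); last exact: (cp_smooth SS LM).
have ss i f' : smooth_fun f' -> smooth_fun (fun x => uu x0 i x f') by have [_ h] := su i; exact: h.
by apply: (smooth_mul okN); exact: ss.
Qed.

Lemma Csec_Cnear xi x : is_Csection C xi -> Cnear x xi.
Proof. by move=> [sx cx]; split => //; near=> y; exact: cx. Unshelve. all: by end_near. Qed.

Lemma chi_flat xi1 xi2 xi3 x : is_Csection C xi1 -> is_Csection C xi2 -> is_Csection C xi3 ->
  chi3 x (flat Omega Phi sigma x (xi1 x)) (flat Omega Phi sigma x (xi2 x)) (flat Omega Phi sigma x (xi3 x)) = cp xi1 xi2 xi3 x.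
Proof.
move=> c1 c2 c3; have [_ su _ _] := hF x.
rewrite (cp_expand123 (hF x) (Csec_Cnear x c1) (Csec_Cnear x c2) (Csec_Cnear x c3)) /chi3.
by congr (tsum _ _ _ _); apply/funext => i; rewrite flatE //; have [h _] := su i; exact: h.
Qed.

Lemma dsec_flat u xi1 xi2 x : is_section u -> is_Csection C xi1 -> is_Csection C xi2 ->
  dsec u x (flat Omega Phi sigma x (xi1 x)) (flat Omega Phi sigma x (xi2 x)) =
      vact (fun y => (xi1 y).1.1) (fun y => flat Omega Phi sigma y (xi2 y) (u y)) x
      - vact (fun y => (xi2 y).1.1) (fun y => flat Omega Phi sigma y (xi1 y) (u y)) x
      - cp xi1 xi2 (embu u) x.
Proof.
move=> su0 c1 c2; have [_ su _ _] := hF x; have se := emb_Esection SS LM su0.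
have [s1 _] := c1; have [s2 _] := c2; have [au _] := su0.
have -> : dsec u x (flat Omega Phi sigma x (xi1 x)) (flat Omega Phi sigma x (xi2 x)) = - cp (embu u) xi1 xi2 x.
  rewrite (cp_expand23 (hF x) se (Csec_Cnear x c1) (Csec_Cnear x c2)) /dsec.
  by congr (- bsum _ _ _); apply/funext => i; rewrite flatE //; have [h _] := su i; exact: h.
have E xi : (fun y => flat Omega Phi sigma y (xi y) (u y)) = (fun y => EP (xi y) (embs y (u y))).
  by apply/funext => y; rewrite flatE.
rewrite !E /vact -(cp_anti23 SS LM x s1 s2 se) -(cp_anti12 SS LM x s1 se s2); ring.
Qed.

(** The transpose of the anchor: the pairing with c_j is the derivative of f along the anchor of
    c_j. *)
Definition dfun (f : N -> R) (x : N) : tvec H := \sum_j ((cc x j x).1.1 f : R) *: uu x j x.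

Lemma dfun_algd f x : algd x (dfun f x).
Proof.
have [_ su _ _] := hF x; apply: (sum_in _ (algd_subspace x)) => j; by have [h _] := su j; exact: h.
Qed.

Lemma dfun_pair f x xi : C x xi -> EP xi (embs x (dfun f x)) = xi.1.1 f.
Proof.
move=> Cx; have [_ su _ _] := hF x; have [Cc _ ex _] := cframe_cpoint (hF x).
have Fx := C_fib IC Cx.
have la : linear_on (algd x) (fun a => EP xi (embs x a)).
  by move=> k a b aa ab; rewrite (emb_lin LM) // (EP_linr SS Fx) //; exact: (emb_fib SS LM).
rewrite /dfun (sum_on _ la (algd_subspace x)); last by move=> j; have [h _] := su j; exact: h.
rewrite [in RHS](ex _ Cx) Ev_sum1 tvec_sumE; apply: eq_bigr => j _; rewrite tvecZ; exact: mulrC.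
Qed.

Lemma dfun_section f : smooth_fun f -> is_section (dfun f).
Proof.
move=> sf; split; first exact: dfun_algd.
move=> g sg; apply/(smooth_funP okN) => x0; have hc := hF x0; have [sc su _ _] := hc.
apply: (@smooth_at_near _ _ okN x0 (fun x => \sum_j (cc x0 j x).1.1 f * uu x0 j x g)).
  apply: filterS (cframe_near hc) => x hx; have [Cc _ _ exA] := cframe_cpoint hx.
  rewrite [in RHS](exA _ (dfun_algd f x)) tvec_sumE; apply: eq_bigr => j _.
  by rewrite tvecZ dfun_pair.
apply: (smooth_fun_at _ okN); apply: (smooth_sum okN) => j; apply: (smooth_mul okN).
  by have := Es_v (sc j) => vc; exact: (vf_smooth vc).
by have [_ h] := su j; exact: h.
Qed.

(** (0, df, 0) at t is related to t^* df with zero vector. Subtracting the lift of d_* f keeps the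
    covector and makes the component at t orthogonal to C, hence an element of C. *)
Lemma dfun_relR f h : smooth_fun f ->
  relR_comp Omega Phi sigma C h (- right_ext h (dfun f (t h))) (differential h (f \o t)).
Proof.
move=> sf; have au := dfun_algd f (t h); set u := dfun f (t h) in au *.
pose e1 : Ev := (0, differential (t h) f, 0).
have F1 : Efib (t h) e1 by split; [exact: tan0 | exact: differential_cot | exact: tan0].
have Fu := emb_fib SS LM au.
have r1 : relR' Omega Phi sigma h 0 (differential h (f \o t)) e1 0.
  split.
  - by split; [exact: tan0 | exact: differential_cot | exact: F1 | exact: Efib0].
  - by rewrite tmap0.
  - by rewrite tmap0.
  - by rewrite !tmap0 subr0.
  move=> V tV; have tPV := tan_TP SS LM tV.
  rewrite /= (mu0 SS tPV) (nu0 SS tPV) (sg0l LM tV) !addr0 !subr0 !differentialE //; last exact: (tan_Tt LM).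
  by rewrite tmapE.
have := relR'_lin SS LM (-1) (relR_right SS LM au) r1; rewrite !scaler0 !addr0 !add0r !scaleN1r => r2.
exists (- embs (t h) u + e1), 0; split; [ | exact: (C0 IC) | exact/(relRP SS LM)].
have [Cc _ _ _] := cframe_cpoint (hF (t h)).
apply: (cpoint_C SS LM IC (cframe_cpoint (hF (t h)))); first by rewrite -scaleN1r; exact: Efib_lin.
move=> j; have Fc := C_fib IC (Cc j).
rewrite -scaleN1r (EP_lin SS Fc (-1) Fu F1) (EPC SS Fu Fc) (dfun_pair f (Cc j)) /e1 /Epair /=.
have [tc _ lc] := Fc; rewrite differentialE //.
rewrite (linear_on0 (kpair_lin SS lc) (tan0 _)).
have [_ [lz _] _] := Fc; rewrite (linear_on0 lz (tan0 _)); ring.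
Qed.

End Complement.

Theorem corollary4p6 (R : realType)
    (K : lie_group_data R) (Omega : form2 (prod_mfd K K)) (Theta : form3 K)
    (G : groupoid_data R) (Phi : arr G -> K) (sigma : form2 (arr G))
    (eta : form3 (obj G)) (C : obj G -> set (Evec K G)) :
  shifted_symplectic Omega Theta ->
  lagrangian_morphism Omega Theta Phi sigma eta ->
  isotropic_complement Omega Phi sigma C ->
  exists (P : mvec2 (arr G))
         (d0 : (obj G -> R) -> obj G -> tvec (arr G))
         (d1 : (obj G -> tvec (arr G)) -> amv2 G)
         (chi : amv3 G),
    (forall (h : arr G) (U : tvec (arr G)) (b : fnl (tvec (arr G))),
       graph_sharp P h U b <-> relR_comp Omega Phi sigma C h U b) /\
    quasi_bialgebroid_of Omega Phi sigma eta C d0 d1 chi /\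
    quasi_poisson P chi /\
    integrates P d0 d1.
Proof.
move=> SS LM IC; pose H := arr G; pose N := obj G; pose Ev := Evec K G.
(* Choice needs a value at every pair; for functionals that are not covectors at h it is
   arbitrary. *)
have exD (hb : H * fnl (tvec H)) : exists D : tvec H * Ev * Ev, cotangent hb.1 hb.2 ->
    [/\ C (tgt hb.1) D.1.2, C (src hb.1) D.2 & relR' Omega Phi sigma hb.1 D.1.1 hb.2 D.1.2 D.2].
  case: hb => h b; case: (pselect (cotangent h b)) => cb; last by exists (0, 0, 0).
  by have [U [e1 [e2 [C1 C2 r]]]] := graph_ex SS LM IC cb; exists (U, e1, e2).
have [D hD0] := choice exD.
pose Uof h b := (D (h, b)).1.1; pose E1of h b := (D (h, b)).1.2; pose E2of h b := (D (h, b)).2.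
have hD h b : cotangent h b -> [/\ C (tgt h) (E1of h b), C (src h) (E2of h b) &
    relR' Omega Phi sigma h (Uof h b) b (E1of h b) (E2of h b)] by exact: (hD0 (h, b)).
(* The rank equation fixes the length of every dual frame, so one index type serves all points. *)
pose rr := ((2 * mdim N + mdim K)./2)%N.
have exF (x : N) : exists F : ('I_rr -> N -> Ev) * ('I_rr -> N -> tvec H), cframe Omega Phi sigma C x F.1 F.2.
  have [r [c [u hc]]] := dual_frame SS LM IC x.
  have er : r = rr by have [_ _ e _] := hc; rewrite /rr -e mul2n doubleK.
  by case: _ / er in c u hc *; exists (c, u).
have [F hF0] := choice exF.
pose cc x := (F x).1; pose uu x := (F x).2.
have hF x : cframe Omega Phi sigma C x (cc x) (uu x) := hF0 x.
exists (bivec Uof), (dfun cc uu), (dsec Omega Phi sigma eta cc uu), (chi3 Omega eta cc uu).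
split; first by move=> h U b; exact: (bivec_graph SS LM IC hD).
split.
  split.
  - by move=> f sf; exact: (dfun_section SS LM IC hF).
  - by move=> f sf x xi Cx; rewrite flatE ?(dfun_pair SS LM IC hF) //; exact: (dfun_algd hF).
  - by move=> u su; exact: (dsec_section SS LM IC hF).
  - by move=> u su xi1 xi2 c1 c2 x; exact: (dsec_flat SS LM IC hF).
  - exact: (chi_section SS LM IC hF).
  - by move=> xi1 xi2 xi3 c1 c2 c3 x; exact: (chi_flat SS LM IC hF).
split.
  split.
  - exact: (bivec_bivector SS LM IC hD).
  - exact: (bivec_multiplicative SS LM IC hD).
  - exact: (chi_section SS LM IC hF).
  - move=> f g k sf sg sk h; rewrite (bivec_jacobi SS LM IC hD sf sg sk (hF (tgt h)) (hF (src h))).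
    rewrite (right_chi SS LM IC hF _ _ _ (hF (tgt h))); congr (_ + _).
    have [_ su _ _] := hF (src h).
    have lE i f' : left_inv_tr h (differential h f') (uu (src h) i (src h)) = left_field (uu (src h) i) h f'.
      have [au _] := su i; rewrite /left_inv_tr /restr asboolT // differentialE //.
      exact: (vf_tan h (left_field_vf SS LM IC (su i))).
    (* The three signs of the coefficients at s turn the difference of [bivec_jacobi] into the sum
       chi^r + i(chi)^l. *)
    rewrite /dev3 /left_inv3 /chi3 tsumN /tsum; apply: eq_bigr => i _; apply: eq_bigr => j _; apply: eq_bigr => l _.
    rewrite !lE; ring.
  - by move=> f g k l sf sg sk sl h; exact: (right_chi_closed SS LM IC hD hF (hF (tgt h))).
split.
  move=> u su f g sf sg h; rewrite (right_bivec SS LM IC hD su sf sg (hF (tgt h))).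
  rewrite /dev2 /right2 /dsec opprK; have [_ su' _ _] := hF (tgt h).
  by congr (bsum _ _ _); apply/funext => i; rewrite (right_trE SS LM IC).
move=> f sf h b cb; have [e1 [e2 [C1 C2 r]]] := dfun_relR SS LM IC hF h sf.
have [U0 _ _] := U_uniq SS LM IC hD C1 C2 ((relRP SS LM _ _ _ _ _).1 r) (differential_cot h (f \o tgt (g:=G))).
rewrite /bivec U0 /right_field; have [lb _] := cb.
have tr : tangent h (right_ext h (dfun cc uu f (tgt h))).
  by have [] := right_ext_tan (lm_groupoid LM) (dfun_algd hF f (tgt h)).
by rewrite -scaleN1r (linear_onZ (-1) lb (tan0 h) tr) mulN1r.
Qed.
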